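(* Let $n\ge 1$ and let $\Omega$ be a bounded domain with smooth boundary $\Sigma=\partial\Omega$ in hyperbolic space $\mathbb{H}^{n+1}$. Fix a point $o\in\mathbb{H}^{n+1}$ and let $V(x)=\cosh r(x)$, where $r(x)=d(o,x)$ is the hyperbolic distance to $o$. Assume that the mean curvature $H$ of $\Sigma$ (with respect to the unit outward normal $\nu$) satisfies $H>n$ everywhere on $\Sigma$. Then $$\int_{\Sigma}\frac{V-V_{,\nu}}{H-n}\,d\mu\;\ge\;\frac{n+1}{n}\int_{\Omega}V\,d\mathrm{vol},$$ where $V_{,\nu}=\langle\overline{\nabla}V,\nu\rangle=\langle\sinh r\,\partial_r,\nu\rangle$. Moreover, equality holds if and only if $\Sigma$ is umbilic.
   Context: $\mathbb{H}^{n+1}$ is the simply connected complete Riemannian manifold of constant sectional curvature $-1$, with metric $\overline g=\langle\cdot,\cdot\rangle$ and Levi-Civita connection $\overline\nabla$. In geodesic polar coordinates about $o$, $\overline g=dr^2+\sinh^2 r\,g_{\mathbb{S}^n}$. For the hypersurface $\Sigma$ with unit outward normal $\nu$ and a local orthonormal tangent frame $e_1,\dots,e_n$, the second fundamental form is $h_{ij}=\langle\overline\nabla_{e_i}\nu,e_j\rangle$, the principal curvatures $\kappa_1,\dots,\kappa_n$ are the eigenvalues of the Weingarten map $(h_i^j)$, and the mean curvature is the (unnormalized) sum $H=\sum_{i=1}^n\kappa_i$; thus a geodesic sphere of radius $\rho$ with its outward normal has all $\kappa_i=\coth\rho$. $d\mu$ is the area measure on $\Sigma$ and $d\mathrm{vol}$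 the hyperbolic volume measure. Umbilic means $\kappa_1=\dots=\kappa_n$ at every point.
   Formalization: For n = 1 the condition that all principal curvatures agree at each point is void and the equality clause fails (e.g. small non-circular ellipses); there ''umbilic'' is taken to mean that Σ has constant curvature. For n ≥ 2 nothing is changed. *)

(* Defs.v *)
From HB Require Import structures.
From mathcomp Require Import all_boot all_order all_algebra.
From mathcomp Require Import all_classical all_reals all_analysis.
From mathcomp Require Import measurable_realfun.

Set Implicit Arguments.
Unset Strict Implicit.
Unset Printing Implicit Defensive.
Import Order.TTheory GRing.Theory Num.Theory.
Import numFieldNormedType.Exports.

Local Open Scope classical_set_scope.
Local Open Scope ring_scope.

Notation borel_rV R n := (g_sigma_algebraType (@open 'rV[R%type]_n)).

Section borel_rV.
Context {R : realType} {n : nat}.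
Let mR := measurableTypeR R.

Lemma measurable_coord (i : 'I_n) :
  measurable_fun setT (fun x : borel_rV R n => (x : 'rV[R]_n) 0 i : mR).
Proof.
apply: (measurability _ (RGenOInfty.measurableE R)) => _ [_ [a ->] <-].
rewrite setTI; apply: sub_sigma_algebra.
apply: open_comp; last exact: rray_open.
by move=> x _; exact: coord_continuous.
Qed.

Lemma measurable_rVP d (T : measurableType d) (f : T -> borel_rV R n) :
  (forall i, measurable_fun setT (fun t => (f t : 'rV[R]_n) 0 i : mR)) ->
  measurable_fun setT f.
Proof.
move=> mf; apply: (@measurability _ _ _ (borel_rV R n) _ _ (@open 'rV[R]_n) erefl) => _ [A oA <-].
rewrite setTI.
pose box (q : 'rV[rat]_n * nat) : set 'rV[R]_n :=
  [set x | forall i, `|x 0 i - ratr (q.1 0 i)| < q.2.+1%:R^-1].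
have -> : A = \bigcup_q (if `[< box q `<=` A >] then box q else set0).
  apply/seteqP; split=> [x Ax|x [q _]]; last first.
    by case: asboolP => // + bx; exact.
  have /nbhs_ballP[e /= e0 eA] : nbhs x A by exact: open_nbhs_nbhs.
  pose j := Num.truncn (e / 2)^-1.
  have je : j.+1%:R^-1 < e / 2.
    by rewrite -[ltRHS]invrK ltf_pV2 ?posrE ?invr_gt0 ?divr_gt0// truncnS_gt.
  have /choice[q hq] : forall i, exists q : rat,
      `|x 0 i - ratr q| < j.+1%:R^-1.
    move=> i.
    have : x 0 i - j.+1%:R^-1 < x 0 i + j.+1%:R^-1.
      by rewrite ltrD2l gtrN ?invr_gt0.
    move=> /rat_in_itvoo[q] /[!in_itv]/= /andP[q1 q2]; exists q.
    by rewrite distrC ltr_distl q1 q2.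
  exists (\row_i q i, j) => //=; rewrite asboolT.
    by move=> i; rewrite mxE.
  move=> y hy; apply: eA; split=> // k i; rewrite !ord1 -ball_normE /=.
  rewrite -(subrK (ratr (q i)) (x 0 i)) -addrA (le_lt_trans (ler_normD _ _))//.
  rewrite [ltRHS]splitr ltrD// ?(lt_trans _ je)//.
  by have := hy i; rewrite mxE distrC.
rewrite preimage_bigcup; apply: countable_bigcupT_measurable; first exact: countableP.
move=> q.
case: asboolP => _; last by rewrite preimage_set0.
have -> : f @^-1` box q = \bigcap_(i in [set: 'I_n])
   ((fun t => (f t : 'rV[R]_n) 0 i : mR) @^-1`
     (ball (ratr (q.1 0 i) : R) q.2.+1%:R^-1)).
  apply/seteqP; split=> t; rewrite /box/=.
    by move=> h i _; have := h i; rewrite -ball_normE /= distrC.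
  by move=> h i; have := h i I; rewrite -ball_normE /= distrC.
apply: fin_bigcap_measurable => // i _.
rewrite -[X in measurable X]setTI; apply: mf => //.
exact: measurable_ball.
Qed.

End borel_rV.

Lemma sigma_finite_product d1 d2 (T1 : measurableType d1)
    (T2 : measurableType d2) (R : realType)
    (m1 : {sigma_finite_measure set T1 -> \bar R})
    (m2 : {sigma_finite_measure set T2 -> \bar R}) :
  sigma_finite setT (m1 \x m2)%E.
Proof.
have /sigma_finiteP[F [TF ndF Foo]] := sigma_finiteT m1.
have /sigma_finiteP[G [TG ndG Goo]] := sigma_finiteT m2.
exists (fun k => F k `*` G k).
  rewrite -setXTT TF TG; apply/seteqP; split=> -[x y]/=; last first.
    by move=> [k _ []/= ? ?]; split; exists k.
  move=> [/= [i _ Fix] [j _ Gjy]]; exists (maxn i j) => //; split.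
  - by move: x Fix; exact/subsetPset/ndF/leq_maxl.
  - by move: y Gjy; exact/subsetPset/ndG/leq_maxr.
move=> k; have [? ?] := Foo k; have [? ?] := Goo k.
split; first exact: measurableX.
by rewrite product_measure1E// lte_mul_pinfty// ge0_fin_numE.
Qed.

Section lebesgue_rV.
Context {R : realType}.
Let mR := measurableTypeR R.

Definition cons_rV n (p : mR * borel_rV R n) : borel_rV R n.+1 :=
  row_mx (const_mx p.1 : 'rV[R]_1) (p.2 : 'rV[R]_n).

Definition uncons_rV n (x : borel_rV R n.+1) : mR * borel_rV R n :=
  ((x : 'rV[R]_n.+1) 0 0, rsubmx (x : 'rV[R]_(1 + n))).

Lemma cons_rVK n : cancel (@cons_rV n) (@uncons_rV n).
Proof.
move=> [a x]; rewrite /cons_rV /uncons_rV/=; congr pair.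
  have := row_mxEl (const_mx a : 'rV[R]_1) (x : 'rV[R]_n) 0 0.
  rewrite [in X in _ = X -> _]mxE => e; rewrite -[RHS]e; congr (row_mx _ _ _ _).
  exact/val_inj.
exact: row_mxKr.
Qed.

Lemma measurable_cons_rV n : measurable_fun setT (@cons_rV n).
Proof.
apply: measurable_rVP => i.
case: (split_ordP (i : 'I_(1 + n))) => j ->.
  rewrite (_ : (fun _ => _) = fst); first exact: measurable_fst.
  apply/funext => p; apply: etrans (row_mxEl _ _ _ _) _.
  by rewrite mxE.
rewrite (_ : (fun _ => _) = (fun x : borel_rV R n => (x : 'rV[R]_n) 0 j : mR) \o snd).
  by apply: measurableT_comp; [exact: measurable_coord|exact: measurable_snd].
by apply/funext => p; exact: row_mxEr.
Qed.

Lemma measurable_uncons_rV n : measurable_fun setT (@uncons_rV n).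
Proof.
apply: measurable_fun_pair; first exact: measurable_coord.
apply: measurable_rVP => i.
rewrite (_ : (fun _ => _) = (fun x : borel_rV R n.+1 => (x : 'rV[R]_n.+1) 0 (rshift 1 i) : mR)).
  exact: measurable_coord.
by apply/funext => x; rewrite mxE.
Qed.

Section lebesgue_cons.
Variables (n : nat) (m : {sigma_finite_measure set (borel_rV R n) -> \bar R}).

Definition lebesgue_cons : set (borel_rV R n.+1) -> \bar R :=
  pushforward (@lebesgue_measure R \x m)%E (@cons_rV n).

Let measurable_preimage_cons A :
  measurable A -> measurable (@cons_rV n @^-1` A).
Proof.
by move=> mA; rewrite -[X in measurable X]setTI; exact: measurable_cons_rV.
Qed.

Let lebesgue_cons0 : lebesgue_cons set0 = 0%E.
Proof. by rewrite /lebesgue_cons /pushforward preimage_set0 measure0. Qed.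

Let lebesgue_cons_ge0 A : (0 <= lebesgue_cons A)%E.
Proof. by rewrite /lebesgue_cons /pushforward measure_ge0. Qed.

Let lebesgue_cons_sigma_additive : semi_sigma_additive lebesgue_cons.
Proof.
move=> F mF tF mUF; rewrite /lebesgue_cons /pushforward preimage_bigcup.
apply: measure_semi_sigma_additive.
- by move=> k; exact: measurable_preimage_cons.
- apply/trivIsetP => /= i j _ _ ij; rewrite -preimage_setI.
  by move/trivIsetP : tF => /(_ _ _ _ _ ij) ->//; rewrite preimage_set0.
- by rewrite -preimage_bigcup; exact: measurable_preimage_cons.
Qed.

HB.instance Definition _ := isMeasure.Build _ _ _ lebesgue_cons
  lebesgue_cons0 lebesgue_cons_ge0 lebesgue_cons_sigma_additive.

Let lebesgue_cons_sigma_finite : sigma_finite setT lebesgue_cons.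
Proof.
have [F FT mF] := sigma_finite_product (@lebesgue_measure R) m.
exists (fun k => @uncons_rV n @^-1` F k).
  by rewrite -preimage_bigcup -FT preimage_setT.
move=> k; have [mFk Fk] := mF k; split.
  by rewrite -[X in measurable X]setTI; exact: measurable_uncons_rV.
rewrite /lebesgue_cons /pushforward -comp_preimage.
rewrite (_ : _ \o _ = id)//; apply/funext => p; exact: cons_rVK.
Qed.

HB.instance Definition _ := Measure_isSigmaFinite.Build _ _ _ lebesgue_cons
  lebesgue_cons_sigma_finite.

End lebesgue_cons.

Fixpoint lebesgue_rV n : {sigma_finite_measure set (borel_rV R n) -> \bar R} :=
  if n is n'.+1 then lebesgue_cons (lebesgue_rV n')
  else @dirac _ (borel_rV R 0) (0 : 'rV[R]_0) R.

End lebesgue_rV.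

Section smooth.
Context {R : realType} {V W : normedModType R}.

(* C^oo on the open set D: every iterated directional derivative of f is
   differentiable at every point of D *)
Definition smooth_on (D : set V) (f : V -> W) :=
  forall (s : seq V) x, D x ->
    differentiable (foldr (fun v (h : V -> W) => 'D_v h) f s) x.

End smooth.

(* Riemannian geometry in a single global chart: the manifold is R^m, and
   g x is the Gram matrix of the metric at x in the coordinate frame *)
Section riemannian.
Context {R : realType} {m : nat}.
Local Notation E := 'rV[R]_m.
Variable g : E -> 'M[R]_m.

Definition inner (x u v : E) : R := (u *m g x *m v^T) 0 0.

Definition christoffel (x : E) (k i j : 'I_m) : R :=
  2^-1 * \sum_l invmx (g x) k l *
    ('D_(delta_mx 0 i) (fun y => g y j l) x
     + 'D_(delta_mx 0 j) (fun y => g y i l) x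
     - 'D_(delta_mx 0 l) (fun y => g y i j) x).

Definition gradient (f : E -> R) (x : E) : E :=
  \row_k \sum_l invmx (g x) k l * 'D_(delta_mx 0 l) f x.

Definition curve_length (c : R -> E) : R :=
  \int[lebesgue_measure]_(t in `[0, 1])
     Num.sqrt (inner (c t) (derive1 c t) (derive1 c t)).

Definition riem_dist (x y : E) : R :=
  inf [set curve_length c | c in [set c : R -> E |
    [/\ forall t, derivable c t 1, continuous (derive1 c), c 0 = x & c 1 = y]]].

Definition vol_density (x : E) : R := Num.sqrt (\det (g x)).

Definition bounded_domain (O : set E) :=
  [/\ O !=set0, open O, connected O &
      exists C, forall x y, O x -> O y -> riem_dist x y <= C].

Definition boundary (O : set E) := closure O `\` O^°.

(* Near each of its boundary points O is a strict sublevel set of a smooth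
   function without critical point there *)
Definition smooth_boundary (O : set E) :=
  forall p, boundary O p ->
    exists (U : set E) (f : E -> R),
      [/\ open U, U p, smooth_on U f, exists v, 'd f p v != 0 &
          forall x, U x -> (O x <-> f x < 0)].

Section hypersurface.
Context {n : nat}.
Local Notation P := 'rV[R]_n.

(* (U, F) is a regular local parametrization of the hypersurface S; the rows
   of 'J F u are the coordinate tangent vectors d_i F(u) *)
Definition local_param (S : set E) (U : set P) (F : P -> E) :=
  [/\ open U, smooth_on U F, {in U &, injective F},
      forall u, U u -> S (F u) & forall u, U u -> row_free ('J F u)].

(* Levi-Civita derivative in direction d_i F of a vector field X along F *)
Definition covariant (F X : P -> E) (u : P) (i : 'I_n) : E :=
  'D_(delta_mx 0 i) X u +
  \row_k \sum_a \sum_b christoffel (F u) k a b * 'J F u i a * X u 0 b.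

Definition first_form (F : P -> E) (u : P) : 'M[R]_n :=
  'J F u *m g (F u) *m ('J F u)^T.

Definition second_form (F : P -> E) (nu : E -> E) (u : P) : 'M[R]_n :=
  \matrix_(i, j) inner (F u) (covariant F (nu \o F) u i) (row j ('J F u)).

Definition weingarten (F : P -> E) (nu : E -> E) (u : P) : 'M[R]_n :=
  second_form F nu u *m invmx (first_form F u).

Definition outward_unit_normal (O : set E) (nu : E -> E) :=
  (forall p, boundary O p ->
     inner p (nu p) (nu p) = 1 /\
     (\forall t \near 0^'+, ~ O (p + t *: nu p))) /\
  (forall (U : set P) F, local_param (boundary O) U F ->
     forall u i, U u -> inner (F u) (nu (F u)) (row i ('J F u)) = 0).

(* kappa p lists the eigenvalues, with multiplicity, of the Weingarten map
   at p *)
Definition principal_curvatures (S : set E) (nu : E -> E)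
    (kappa : E -> 'I_n -> R) :=
  forall (U : set P) F, local_param S U F -> forall u, U u ->
    char_poly (weingarten F nu u) = \prod_i ('X - (kappa (F u) i)%:P).

(* In local coordinates the area element is sqrt (det g_ij) du; as the
   images of parametrizations cover S, this determines mu *)
Definition area_measure (S : set E)
    (mu : {measure set (borel_rV R m) -> \bar R}) :=
  mu (~` S) = 0%E /\
  forall (U : set P) F, local_param S U F ->
    forall B : set E, (@measurable _ (borel_rV R m)) B -> B `<=` F @` U ->
      mu B = (\int[lebesgue_rV n]_(u in U `&` F @^-1` B)
                (Num.sqrt (\det (first_form F u)))%:E)%E.

Definition mean_curvature (kappa : E -> 'I_n -> R) (p : E) : R :=
  \sum_i kappa p i.

(* For n = 1 the equality of the principal curvatures at a point is void and
   does not single out circles; an umbilic curve is then one of constant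
   curvature.  For n >= 2 the second clause is vacuous *)
Definition umbilic (S : set E) (kappa : E -> 'I_n -> R) :=
  (forall p, S p -> forall i j, kappa p i = kappa p j) /\
  (n = 1%N -> forall p q, S p -> S q -> forall i, kappa p i = kappa q i).

End hypersurface.
End riemannian.

Section hyperbolic.
Context {R : realType} {m : nat}.

(* H^m as the hyperboloid {(x, s) | s = sqrt (1 + |x|^2)} in Minkowski space,
   charted by x in R^m: the induced metric |dx|^2 - ds^2 is
   |dx|^2 - (x . dx)^2 / (1 + |x|^2).  With x = sinh r . theta, |theta| = 1,
   it reads dr^2 + sinh^2 r g_S *)
Definition hyp_metric (x : 'rV[R]_m) : 'M[R]_m :=
  1%:M - (1 + (x *m x^T) 0 0)^-1 *: (x^T *m x).

Definition cosh (t : R) : R := (expR t + expR (- t)) / 2.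

Definition cosh_dist (o x : 'rV[R]_m) : R := cosh (riem_dist hyp_metric o x).

End hyperbolic.

(* Main.v *)
(* Lift p, nu p, o to vectors X, N, O of Minkowski space, so that V - V_nu = - <X - N, O>.
   The normal flow sends (p, s), s > 0, to the point of the hyperboloid of the form
   X + s (X - N) - t O.  Every point of Omega is the image of a contact pair (p, s), that is,
   one with - <X + s (X - N), X_q> >= 1 + s for every q in Sigma.  At a contact pair the second
   order condition at q = p reads 1 + s - s kappa_i >= 0, so AM-GM bounds the Jacobian of
   the flow, with respect to V dvol and dmu ds, by (V - V_nu) (1 - (H/n - 1) s)^n, and
   integrating over s gives the inequality.

   In the equality case every (p, s) with (H/n - 1) s < 1 is a contact pair, since an open set
   of other pairs could be left out of the integral.  Letting s tend to 1 / (H/n - 1) gives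
   kappa_i <= H/n, hence equality of the kappa_i, and shows that H is locally constant.

   If Sigma is umbilic, H is locally constant (by hypothesis when n = 1), hence so is the vector
   (H/n) X - N; therefore Sigma is a geodesic sphere about some c and Omega is the ball.  For
   o = c the flow has an explicit inverse, and the area inequality for this inverse is the
   reverse inequality.  For general o both sides are linear in O, and reflecting o through c gives
   o' with O + O' a multiple of C, so the inequalities for o and o' are equalities. *)
Require Import Defs.
From HB Require Import structures.
From mathcomp Require Import all_boot all_order all_algebra perm.
From mathcomp Require Import all_classical all_reals all_analysis.
From mathcomp Require Import measurable_realfun ring lra.

Set Implicit Arguments.
Unset Strict Implicit.
Unset Printing Implicit Defensive.
Import Order.TTheory GRing.Theory Num.Theory.
Import numFieldNormedType.Exports.

Local Open Scope classical_set_scope.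
Local Open Scope ring_scope.

(** * Lebesgue measure on row vectors *)

Section rV_basics.
Context {R : realType}.
Implicit Types (n m : nat).

(** Why V and why this flow: projecting the hyperboloid along O carries V dvol to Lebesgue measure,
    and modulo O the flow is X + s (X - N), a straight line in a null direction. So the Jacobian is
    prod_i (1 + s - s kappa_i) times V - V_nu, and the coefficient t, which has no convenient
    derivative, cancels from it. Contact is geometric: Y = X + s (X - N) has - <Y, Y> = 1 + 2 s, so
    Y normalized is the centre of a geodesic sphere through p, tangent to Sigma, of curvature (1 +
    s) / s; a contact pair is such a sphere whose open ball misses Sigma. That curvature equals H/n
    at s = 1 / (H/n - 1), where the AM-GM bound reaches zero. Two obstacles shape the measure
    theory. The images of the flow are not known to be measurable, nor the flow injective, so the
    area inequality yields a measurable set that contains the image, with a bound on its measure.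
    And mu is prescribed in charts only, so every bound is proved on small open sets and glued along
    half-open cubes, over which measures add up exactly. *)

Lemma rV_normP n (x : 'rV[R]_n) (e : R) : 0 <= e ->
  reflect (forall i, `|x 0 i| <= e) (`|x| <= e).
Proof.
move=> e0; apply: (iffP idP) => [h i|h].
  apply: le_trans h; rewrite [leRHS]/Num.Def.normr/= mx_normrE.
  exact: (le_bigmax _ (fun ij => `|x ij.1 ij.2|) (0, i)).
rewrite /Num.Def.normr/= mx_normrE; apply: bigmax_le => // -[i j] _ /=.
by rewrite ord1.
Qed.

Lemma ler_coord_norm n (x : 'rV[R]_n) i : `|x 0 i| <= `|x|.
Proof. by apply/rV_normP. Qed.

Lemma rV_norm_ltP n (x : 'rV[R]_n) (e : R) : 0 < e ->
  reflect (forall i, `|x 0 i| < e) (`|x| < e).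
Proof.
move=> e0; apply: (iffP idP) => [h i|h].
  exact: le_lt_trans (ler_coord_norm x i) h.
rewrite /Num.Def.normr/= mx_normrE; apply: bigmax_lt => // -[i j] _ /=.
by rewrite ord1.
Qed.

Lemma continuous_rVP (T : topologicalType) n (f : T -> 'rV[R]_n) (x : T) :
  (forall i, {for x, continuous (fun t => f t 0 i)}) -> {for x, continuous f}.
Proof.
move=> h; apply/cvgrPdist_lt => /= e e0.
near=> t; apply/rV_norm_ltP => // i; rewrite !mxE.
move: i; near: t; apply: filter_forall => i.
by move/cvgrPdist_lt : (h i) => /(_ _ e0).
Unshelve. all: by end_near. Qed.

Lemma continuous_coordP (T : topologicalType) n (f : T -> 'rV[R]_n) (x : T) i :
  {for x, continuous f} -> {for x, continuous (fun t => f t 0 i)}.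
Proof.
move=> h; apply: (@continuous_comp _ _ _ f (fun M : 'rV[R]_n => M 0 i)) => //.
exact: coord_continuous.
Qed.

(** These restatements of the limit rules are phrased for functions written pointwise, so that the
    continuity of a formula can be proved by following its syntax. *)
Lemma contM (T : topologicalType) (f g : T -> R) (x : T) :
  {for x, continuous f} -> {for x, continuous g} ->
  {for x, continuous (fun t => f t * g t)}.
Proof. exact: cvgM. Qed.

Lemma contD (T : topologicalType) (V : normedModType R) (f g : T -> V) (x : T) :
  {for x, continuous f} -> {for x, continuous g} ->
  {for x, continuous (fun t => f t + g t)}.
Proof. exact: cvgD. Qed.

Lemma contB (T : topologicalType) (V : normedModType R) (f g : T -> V) (x : T) :
  {for x, continuous f} -> {for x, continuous g} ->
  {for x, continuous (fun t => f t - g t)}.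
Proof. exact: cvgB. Qed.

Lemma contN (T : topologicalType) (V : normedModType R) (f : T -> V) (x : T) :
  {for x, continuous f} -> {for x, continuous (fun t => - f t)}.
Proof. exact: cvgN. Qed.

Lemma contZ (T : topologicalType) (V : normedModType R) (f : T -> R) (g : T -> V) (x : T) :
  {for x, continuous f} -> {for x, continuous g} ->
  {for x, continuous (fun t => f t *: g t)}.
Proof. exact: cvgZ. Qed.

Lemma contV (T : topologicalType) (f : T -> R) (x : T) : f x != 0 ->
  {for x, continuous f} -> {for x, continuous (fun t => (f t)^-1)}.
Proof. by move=> *; exact: cvgV. Qed.

Lemma contX (T : topologicalType) (f : T -> R) k (x : T) :
  {for x, continuous f} -> {for x, continuous (fun t => f t ^+ k)}.
Proof.
move=> cf; apply: (@continuous_comp _ _ _ f (fun t => t ^+ k)) => //.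
exact: exprn_continuous.
Qed.

Lemma contC (T U : topologicalType) (c : U) (x : T) :
  {for x, continuous (fun=> c)}.
Proof. exact: cvg_cst. Qed.

Lemma cont_sqrt (T : topologicalType) (f : T -> R) (x : T) :
  {for x, continuous f} -> {for x, continuous (fun t => Num.sqrt (f t))}.
Proof.
move=> cf; apply: (@continuous_comp _ _ _ f Num.sqrt) => //.
exact: sqrt_continuous.
Qed.

Lemma continuous_sumr (T : topologicalType) I (r : seq I) (P : pred I)
    (F : I -> T -> R) (x : T) : (forall i, P i -> {for x, continuous (F i)}) ->
  {for x, continuous (fun t => \sum_(i <- r | P i) F i t)}.
Proof.
move=> h; elim: r => [|i r IH].
  by rewrite (_ : (fun _ => _) = cst 0); [exact: cvg_cst|apply/funext => t; rewrite big_nil].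
case: (boolP (P i)) => Pi; last first.
  rewrite (_ : (fun _ => _) = fun t => \sum_(i <- r | P i) F i t)//.
  by apply/funext => t; rewrite big_cons (negbTE Pi).
rewrite (_ : (fun _ => _) = F i + fun t => \sum_(i <- r | P i) F i t).
  by apply: cvgD => //; exact: h.
by apply/funext => t; rewrite big_cons Pi.
Qed.

Lemma continuous_mulmxr n m (M : 'M[R]_(n, m)) :
  continuous (fun x : 'rV[R]_n => x *m M).
Proof.
move=> x; apply: continuous_rVP => i.
rewrite (_ : (fun _ => _) = fun t : 'rV[R]_n => \sum_j t 0 j * M j i); last first.
  by apply/funext => t; rewrite mxE.
apply: continuous_sumr => j _; apply: contM; last exact: contC.
exact: coord_continuous.
Qed.

Lemma measurable_open_rV n (A : set 'rV[R]_n) : open A ->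
  measurable (A : set (borel_rV R n)).
Proof. exact: sub_sigma_algebra. Qed.

Lemma measurable_closed_rV n (A : set 'rV[R]_n) : closed A ->
  measurable (A : set (borel_rV R n)).
Proof.
move=> cA; rewrite -[A]setCK; apply: measurableC.
by apply: measurable_open_rV; exact/closed_openC.
Qed.

Lemma continuous_open_preimage (T U : topologicalType) (f : T -> U) (D : set T)
  (A : set U) : open D -> (forall x, D x -> {for x, continuous f}) -> open A ->
  open (D `&` f @^-1` A).
Proof.
move=> oD cf oA; rewrite openE => x [Dx fA]; rewrite /interior.
apply: filterI; first exact: open_nbhs_nbhs.
by apply: cf => //; exact: open_nbhs_nbhs.
Qed.

Lemma measurable_fun_continuous_rV n m (D : set 'rV[R]_n) (f : 'rV[R]_n -> 'rV[R]_m) :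
  open D -> (forall x, D x -> {for x, continuous f}) ->
  @measurable_fun _ _ (borel_rV R n) (borel_rV R m) D f.
Proof.
move=> oD cf.
apply: (@measurability _ _ (borel_rV R n) (borel_rV R m) D f (@open 'rV[R]_m) erefl) => _ [A oA <-].
by apply: measurable_open_rV; exact: continuous_open_preimage.
Qed.

Lemma measurable_fun_continuous_rV1 n (D : set 'rV[R]_n) (f : 'rV[R]_n -> R) :
  open D -> (forall x, D x -> {for x, continuous f}) ->
  @measurable_fun _ _ (borel_rV R n) (measurableTypeR R) D f.
Proof.
move=> oD cf.
apply: (measurability _ (RGenOInfty.measurableE R)) => _ [_ [a ->] <-].
apply: measurable_open_rV; apply: continuous_open_preimage => //; exact: rray_open.
Qed.

Definition cbox n (a b : 'rV[R]_n) : set 'rV[R]_n :=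
  [set x | forall i, a 0 i <= x 0 i <= b 0 i].

Lemma closed_cbox n (a b : 'rV[R]_n) : closed (cbox a b).
Proof.
have -> : cbox a b = \bigcap_(i in [set: 'I_n])
   (fun x : 'rV[R]_n => x 0 i) @^-1` [set` `[a 0 i, b 0 i]].
  apply/seteqP; split=> x.
    by move=> h i _ /=; rewrite in_itv; exact: h.
  by move=> h i; have := h i I; rewrite /= in_itv.
apply: closed_bigI => i _; apply: preimage_closed.
  by move=> x _; exact: coord_continuous.
exact: interval_closed.
Qed.

Lemma measurable_cbox n (a b : 'rV[R]_n) :
  measurable (cbox a b : set (borel_rV R n)).
Proof. by apply: measurable_closed_rV; exact: closed_cbox. Qed.

Lemma lebesgue_rVS n A : lebesgue_rV n.+1 A =
  (@lebesgue_measure R \x lebesgue_rV n)%E (@cons_rV R n @^-1` A).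
Proof. by []. Qed.

Lemma cons_rV0 n (p : measurableTypeR R * borel_rV R n) :
  (cons_rV p : 'rV[R]_n.+1) 0 0 = p.1.
Proof. by have := congr1 fst (cons_rVK p). Qed.

Lemma cons_rV_lift n (p : measurableTypeR R * borel_rV R n) (i : 'I_n) :
  (cons_rV p : 'rV[R]_n.+1) 0 (lift ord0 i) = (p.2 : 'rV[R]_n) 0 i.
Proof.
have -> : lift ord0 i = rshift 1 i by exact/val_inj.
exact: (row_mxEr (const_mx p.1 : 'rV[R]_1) (p.2 : 'rV[R]_n)).
Qed.

Lemma lebesgue_cbox n (a b : 'rV[R]_n) :
  lebesgue_rV n (cbox a b) = (\prod_i Num.max 0 (b 0 i - a 0 i))%:E.
Proof.
elim: n a b => [|n IH] a b.
  rewrite /= big_ord0 diracE mem_set// => i; by case: i.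
rewrite lebesgue_rVS.
have -> : @cons_rV R n @^-1` cbox a b =
    `[a 0 0, b 0 0] `*` cbox (\row_i a 0 (lift ord0 i)) (\row_i b 0 (lift ord0 i)).
  apply/seteqP; split=> p.
    move=> h; split=> [|i]; first by have := h 0; rewrite cons_rV0 /= in_itv.
    by have := h (lift ord0 i); rewrite cons_rV_lift !mxE.
  move=> [h1 h2] i; case: (unliftP ord0 i) => [j|] ->.
    by have := h2 j; rewrite cons_rV_lift !mxE.
  by move: h1; rewrite cons_rV0 /= in_itv.
rewrite product_measure1E//; last exact: measurable_cbox.
rewrite IH /= [X in (X * _)%E]lebesgue_measure_itv big_ord_recl /= lte_fin.
rewrite (eq_bigr (fun i : 'I_n => Num.max 0 (b 0 (lift ord0 i) - a 0 (lift ord0 i)))).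
  case: ltP => ab; first by rewrite EFinM max_r ?subr_ge0 ?ltW.
  by rewrite max_l ?subr_le0// mul0r mul0e.
by move=> i _; rewrite !mxE.
Qed.

Lemma setI_cbox n (a b c d : 'rV[R]_n) : cbox a b `&` cbox c d =
  cbox (\row_i Num.max (a 0 i) (c 0 i)) (\row_i Num.min (b 0 i) (d 0 i)).
Proof.
apply/seteqP; split=> x.
  by move=> [h k] i; rewrite !mxE ge_max le_min; have /andP[-> ->] := h i; have /andP[-> ->] := k i.
by move=> h; split=> i; have := h i; rewrite !mxE ge_max le_min => /andP[/andP[? ?] /andP[? ?]]; apply/andP.
Qed.

Lemma cbox_ball n (x : 'rV[R]_n) (e : R) : 0 < e -> cbox (x - const_mx (e / 2)) (x + const_mx (e / 2)) `<=` ball x e.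
Proof.
move=> e0 y h; rewrite -ball_normE /=.
apply: (@le_lt_trans _ _ (e / 2)); last by rewrite gtr_pMr// invf_lt1 ?ltr1n.
apply/rV_normP; first by rewrite divr_ge0// ltW.
move=> i; have := h i; rewrite !mxE ler_norml; lra.
Qed.

(** Rational corners keep the union countable; pairs whose box leaves [A] contribute the empty
    set. *)
Lemma open_bigcup_cbox n (A : set 'rV[R]_n) : open A ->
  A = \bigcup_q (if `[< cbox (map_mx ratr q.1) (map_mx ratr q.2) `<=` A >]
     then cbox (map_mx (@ratr R) q.1) (map_mx ratr q.2) else set0
     : set 'rV[R]_n) :> set 'rV[R]_n.
Proof.
move=> oA; apply/seteqP; split=> [x Ax|x [q _]]; last first.
  by case: asboolP => // + bx; exact.
have /nbhs_ballP[e /= e0 eA] : nbhs x A by exact: open_nbhs_nbhs.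
have e40 : 0 < e / 2 by rewrite divr_gt0.
have /choice[q hq] i : exists q : rat, x 0 i - e / 2 < ratr q < x 0 i.
  have : x 0 i - e / 2 < x 0 i by rewrite gtrBl.
  by move=> /rat_in_itvoo[q] /[!in_itv]/= ?; exists q.
have /choice[r hr] i : exists q : rat, x 0 i < ratr q < x 0 i + e / 2.
  have : x 0 i < x 0 i + e / 2 by rewrite ltrDl.
  by move=> /rat_in_itvoo[r] /[!in_itv]/= ?; exists r.
exists (\row_i q i, \row_i r i) => //=; rewrite asboolT.
  move=> i; rewrite !mxE; have /andP[_ /ltW ->] := hq i.
  by have /andP[/ltW -> _] := hr i.
apply: subset_trans eA; apply: subset_trans (cbox_ball e0) => y hy i.
have := hy i; rewrite !mxE => /andP[h1 h2].
have /andP[h3 _] := hq i; have /andP[_ h4] := hr i.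
by rewrite (le_trans (ltW h3) h1) (le_trans h2 (ltW h4)).
Qed.

Lemma measurable_cboxE n : @measurable _ (borel_rV R n) =
  <<s [set A | exists a b : 'rV[R]_n, A = cbox a b] >>.
Proof.
apply/seteqP; split.
  apply: smallest_sub; first exact: smallest_sigma_algebra.
  move=> A oA; rewrite (open_bigcup_cbox oA).
  apply: (@countable_bigcupT_measurable _ (g_sigma_algebraType
    [set A | exists a b : 'rV[R]_n, A = cbox a b])); first exact: countableP.
  move=> q; case: asboolP => _; last exact: measurable0.
  by apply: sub_sigma_algebra; do 2 eexists.
apply: smallest_sub; first exact: sigma_algebra_measurable.
by move=> _ [a [b ->]]; exact: measurable_cbox.
Qed.

Lemma bigcup_cbox n : \bigcup_k cbox (const_mx (- k%:R) : 'rV[R]_n) (const_mx k%:R) = setT.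
Proof.
apply/seteqP; split=> // x _; exists (Num.truncn `|x|).+1 => //= i.
rewrite !mxE -ler_norml (le_trans (ler_coord_norm x i))// ltW//.
exact: truncnS_gt.
Qed.

(** Closed boxes are stable under intersection, generate the Borel sets and exhaust the space with
    finite measure, so two measures that agree on them are equal. The factor [c] makes room for the
    determinant of a linear map. *)
Lemma lebesgue_rV_unique n (f : borel_rV R n -> borel_rV R n) (c : R) :
  0 <= c -> measurable_fun setT f ->
  (forall a b : 'rV[R]_n, (c%:E * lebesgue_rV n (f @^-1` cbox a b))%E =
      lebesgue_rV n (cbox a b)) ->
  forall A, measurable A -> (c%:E * lebesgue_rV n (f @^-1` A))%E = lebesgue_rV n A.
Proof.
move=> c0 mf h A mA; apply/esym.
pose pf : {measure set (borel_rV R n) -> \bar R} :=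
  @measure_function_pushforward__canonical__measure_function_Measure _ _ _ _ R (lebesgue_rV n) f mf.
have := @measure_unique _ R (borel_rV R n) [set A | exists a b : 'rV[R]_n, A = cbox a b]
   (fun k => cbox (const_mx (- k%:R) : 'rV[R]_n) (const_mx k%:R))
   _ _ _ _ (lebesgue_rV n) (mscale (NngNum c0) pf).
apply => //.
- exact: measurable_cboxE.
- by move=> _ _ [a [b ->]] [d [e ->]]; rewrite setI_cbox; do 2 eexists.
- by move=> k; do 2 eexists.
- exact: bigcup_cbox.
- by move=> _ [a [b ->]]; exact/esym/h.
- move=> k; apply: (@eq_ind_r _ _ (fun x => (x < +oo)%E) _ _ (lebesgue_cbox _ _)).
  exact: ltry.
Qed.

Lemma lebesgue_rV_add n (v : 'rV[R]_n) A : measurable (A : set (borel_rV R n)) ->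
  lebesgue_rV n ((fun x : 'rV[R]_n => x + v) @^-1` A) = lebesgue_rV n A.
Proof.
move=> mA; rewrite -(mul1e (lebesgue_rV n (_ @^-1` _))).
apply: (@lebesgue_rV_unique n (fun x : 'rV[R]_n => x + v) 1) => //.
  apply: (@measurable_fun_continuous_rV n n setT); first exact: openT.
  by move=> x _; apply: (@contD _ _ id (fun=> v)); [exact: cvg_id|exact: contC].
move=> a b; rewrite mul1e.
rewrite (_ : _ @^-1` _ = cbox (a - v) (b - v)).
  by rewrite !lebesgue_cbox; congr EFin; apply: eq_bigr => i _; rewrite !mxE; congr Num.max; ring.
apply/seteqP; split=> x h i; have := h i; rewrite !mxE; lra.
Qed.

(** The property passes to products, which reduces the linear change of variables to permutation,
    diagonal and unitriangular matrices. *)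
Definition leb_linear n (M : 'M[R]_n) := M \in unitmx /\
  forall A, measurable (A : set (borel_rV R n)) ->
    (`|\det M|%:E * lebesgue_rV n ((fun x : 'rV[R]_n => x *m M) @^-1` A))%E = lebesgue_rV n A.

Lemma measurable_preimage_mulmxr n (M : 'M[R]_n) A :
  measurable (A : set (borel_rV R n)) ->
  measurable ((fun x : 'rV[R]_n => x *m M) @^-1` A : set (borel_rV R n)).
Proof.
move=> mA; rewrite -[X in measurable X]setTI.
apply: (@measurable_fun_continuous_rV n n setT); [exact: openT| |exact: measurableT|exact: mA].
by move=> x _; exact: continuous_mulmxr.
Qed.

Lemma leb_linearM n (M N : 'M[R]_n) : leb_linear M -> leb_linear N ->
  leb_linear (M *m N).
Proof.
move=> [uM hM] [uN hN]; split; first by rewrite unitmx_mul uM.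
move=> A mA; rewrite det_mulmx normrM EFinM -[RHS]hN//.
rewrite -(hM ((fun x : 'rV[R]_n => x *m N) @^-1` A)); last exact: measurable_preimage_mulmxr.
rewrite muleCA -muleA; congr (_ * (_ * lebesgue_rV n _))%E.
by apply/seteqP; split=> x /=; rewrite mulmxA.
Qed.

Lemma leb_linear_perm n (s : 'S_n) : leb_linear (perm_mx s).
Proof.
split; first exact: unitmx_perm.
move=> A mA; rewrite det_perm normrX normrN1 expr1n.
apply: (@lebesgue_rV_unique n (fun x : 'rV[R]_n => x *m perm_mx s) 1) => //.
  apply: (@measurable_fun_continuous_rV n n setT); first exact: openT.
  by move=> x _; exact: continuous_mulmxr.
have E (x : 'rV[R]_n) i : (x *m perm_mx s) 0 (s i) = x 0 i.
  by rewrite -{1}(invgK s) -col_permE mxE permK.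
move=> a b; rewrite mul1e (_ : _ @^-1` _ = cbox (\row_i a 0 (s i)) (\row_i b 0 (s i))).
  rewrite !lebesgue_cbox [in RHS](reindex_inj (@perm_inj _ s))/=; congr EFin.
  by apply: eq_bigr => i _; rewrite !mxE.
apply/seteqP; split=> x h i.
  by have := h (s i); rewrite E !mxE.
by rewrite -(permKV s i) E; have := h (s^-1 i)%g; rewrite !mxE.
Qed.

Lemma leb_linear_diag n (d : 'rV[R]_n) : (forall i, d 0 i != 0) ->
  leb_linear (diag_mx d).
Proof.
move=> d0; have u : \det (diag_mx d) != 0.
  by rewrite det_diag; apply/prodf_neq0 => i _.
split; first by rewrite unitmxE unitfE.
move=> A mA.
apply: (@lebesgue_rV_unique n (fun x : 'rV[R]_n => x *m diag_mx d)) => //.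
  apply: (@measurable_fun_continuous_rV n n setT); first exact: openT.
  by move=> x _; exact: continuous_mulmxr.
move=> a b.
pose l i := if 0 < d 0 i then a 0 i / d 0 i else b 0 i / d 0 i.
pose r i := if 0 < d 0 i then b 0 i / d 0 i else a 0 i / d 0 i.
rewrite (_ : _ @^-1` _ = cbox (\row_i l i) (\row_i r i)).
  rewrite !lebesgue_cbox -EFinM det_diag normr_prod -big_split/=; congr EFin.
  apply: eq_bigr => i _; rewrite !mxE /l /r maxr_pMr// mulr0; congr Num.max.
  case: ltP => di; first by rewrite gtr0_norm// -mulrBl mulrC divfK ?gt_eqF.
  by rewrite ler0_norm// -mulrBl mulNr mulrC divfK// opprB.
have E (x : 'rV[R]_n) i : (x *m diag_mx d) 0 i = x 0 i * d 0 i.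
  by rewrite mul_mx_diag mxE.
have EE (x : 'rV[R]_n) i : (a 0 i <= x 0 i * d 0 i <= b 0 i) = (l i <= x 0 i <= r i).
  rewrite /l /r; case: ltP => di; first by rewrite ler_pdivrMr// ler_pdivlMr.
  have di' : d 0 i < 0 by rewrite lt_neqAle d0.
  by rewrite ler_ndivrMr// ler_ndivlMr// andbC.
apply/seteqP; split=> x h i; have := h i; rewrite E !mxE.
  by rewrite EE.
by rewrite EE.
Qed.

Definition upper_unitri n (M : 'M[R]_n) := forall i j : 'I_n, (j <= i)%N -> M i j = (i == j)%:R.

(** Fubini over the first coordinate, which the map fixes: on the slice at [t] it acts as a
    unitriangular map of size [n] followed by the translation by [t *: rw]. *)
Lemma leb_linear_upper n (M : 'M[R]_n) : upper_unitri M -> leb_linear M.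
Proof.
move=> hM.
have d1 : \det M = 1.
  rewrite -det_tr det_trig.
    by rewrite big1// => i _; rewrite mxE hM// eqxx.
  by apply/is_trig_mxP => i j ij; rewrite mxE hM ?(ltnW ij)// -val_eqE /= gtn_eqF.
split; first by rewrite unitmxE d1 unitr1.
rewrite d1 normr1 => A mA; rewrite mul1e.
elim: n M hM {d1} A mA => [|n IH] M hM A mA.
  by congr (lebesgue_rV 0 _); apply/seteqP; split=> x /=; rewrite (thinmx0 M) mulmx0 (thinmx0 x).
pose M' : 'M[R]_(1 + n) := M.
pose rw := ursubmx M'; pose B := drsubmx M'.
have hB : upper_unitri B.
  by move=> i j ij; rewrite !mxE hM//= ?(inj_eq (@lift_inj _ ord0)) -?rshift1 ?leq_add2l// (inj_eq (@rshift_inj _ _)).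
have key (p : measurableTypeR R * borel_rV R n) :
   (cons_rV p : 'rV[R]_n.+1) *m M = cons_rV (p.1, (p.2 : 'rV[R]_n) *m B + p.1 *: rw).
  transitivity (row_mx (const_mx p.1 : 'M[R]_1) (p.2 : 'rV[R]_n) *m
      block_mx (ulsubmx M') (ursubmx M') (dlsubmx M') (drsubmx M')).
    by rewrite submxK.
  rewrite mul_row_block.
  have -> : const_mx p.1 = (p.1)%:M :> 'M[R]_1.
    by apply/matrixP => i j; rewrite !mxE !ord1 eqxx.
  have -> : ulsubmx M' = 1%:M.
    by apply/matrixP => i j; rewrite !ord1 !mxE hM// eqxx.
  have -> : dlsubmx M' = 0.
    by apply/matrixP => i j; rewrite !ord1 !mxE hM.
  rewrite mulmx1 mulmx0 addr0 !mul_scalar_mx addrC.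
  rewrite (_ : (p.1)%:M = const_mx p.1)//.
  by apply/matrixP => i j; rewrite !mxE !ord1 eqxx.
rewrite !lebesgue_rVS /product_measure1 /=.
apply: eq_integral => t _ /=.
have mA' : measurable (xsection (@cons_rV R n @^-1` A) t).
  apply: measurable_xsection; rewrite -[X in measurable X]setTI.
  exact: measurable_cons_rV.
rewrite -(lebesgue_rV_add (t *: rw) mA') -(IH B hB); last first.
  rewrite -[X in measurable X]setTI.
  apply: (@measurable_fun_continuous_rV n n setT (fun x => x + t *: rw));
    [exact: openT| |exact: measurableT|exact: mA'].
  by move=> x _; apply: (@contD _ _ id (fun=> t *: rw)); [exact: cvg_id|exact: contC].
congr (lebesgue_rV n _); apply/seteqP; split=> x; rewrite /xsection /= !inE /=.
  by rewrite (key (t, x)).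
by rewrite (key (t, x)).
Qed.

(** Conjugation by the reversal of the coordinates exchanges lower and upper triangular matrices. *)
Lemma leb_linear_lower n (M : 'M[R]_n) :
  (forall i j : 'I_n, (i <= j)%N -> M i j = (i == j)%:R) -> leb_linear M.
Proof.
move=> hM; pose s : {perm 'I_n} := perm (@rev_ord_inj n).
have sK i : s (s i) = i by rewrite !permE rev_ordK.
have -> : M = perm_mx s *m (perm_mx s *m M *m perm_mx s) *m perm_mx s.
  rewrite !mulmxA -perm_mxM (_ : (s * s)%g = 1%g) ?perm_mx1 ?mul1mx.
    by rewrite -mulmxA -perm_mxM (_ : (s * s)%g = 1%g) ?perm_mx1 ?mulmx1//; apply/permP => i; rewrite permM sK perm1.
  by apply/permP => i; rewrite permM sK perm1.
apply: leb_linearM; last exact: leb_linear_perm.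
apply: leb_linearM; first exact: leb_linear_perm.
apply: leb_linear_upper => i j ij.
have sV : s = (s^-1)%g by apply/permP => k; apply: (@perm_inj _ s); rewrite permKV sK.
rewrite -row_permE {2}sV -col_permE !mxE hM ?(inj_eq perm_inj)//.
by rewrite !permE /= leq_sub2l.
Qed.

(** The LUP decomposition, with the diagonal of [U] split off so that the remaining upper factor is
    unitriangular. *)
Lemma leb_linear_unit n (M : 'M[R]_n) : M \in unitmx -> leb_linear M.
Proof.
case: n M => [|n] M uM.
  rewrite (_ : M = 1%:M); last by apply/matrixP => -[].
  by apply: leb_linear_upper => -[].
have := cormen_lup_correct M; have := cormen_lup_perm M.
have := @cormen_lup_lower _ _ M; have := @cormen_lup_upper _ _ M.
case: (cormen_lup M) => [[P L] U] /= hU hL /is_perm_mxP[s Ps] /esym LU.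
have LL : leb_linear L by exact: leb_linear_lower.
have uU : U \in unitmx.
  have : L *m U \in unitmx by rewrite [_ *m _]LU unitmx_mul uM Ps unitmx_perm.
  by rewrite unitmx_mul => /andP[].
have dU : forall i, U i i != 0.
  move: uU; rewrite unitmxE unitfE -det_tr det_trig.
    by move=> /prodf_neq0 h i; have := h i isT; rewrite mxE.
  by apply/is_trig_mxP => i j ij; rewrite mxE hU.
have -> : M = perm_mx s^-1 *m (L *m (diag_mx (\row_i U i i) *m (diag_mx (\row_i (U i i)^-1) *m U))).
  rewrite (mulmxA (diag_mx _)) mulmx_diag.
  rewrite (_ : diag_mx _ = 1%:M) ?mul1mx.
    rewrite [L *m U]LU Ps -[X in _ = _ *m X]/(perm_mx s *m M) mulmxA -perm_mxM.
    by rewrite mulVg perm_mx1 mul1mx.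
  by apply/matrixP => i j; rewrite !mxE divff.
apply: leb_linearM; first exact: leb_linear_perm.
apply: leb_linearM => //.
apply: leb_linearM; first by apply: leb_linear_diag => i; rewrite mxE.
apply: leb_linear_upper => i j; rewrite leq_eqVlt => /predU1P[/val_inj ->|ij].
  by rewrite mul_diag_mx mxE !mxE eqxx mulVf.
by rewrite mul_diag_mx mxE hU// mulr0 -val_eqE /= gtn_eqF.
Qed.

End rV_basics.

(** * Half-open cubes and measurable covers *)

Section cubes.
Context {R : realType}.
Implicit Types (n : nat).

(** Half-open, so that the halved cubes partition the cube and a measure of it is exactly the sum
    over the pieces. *)
Definition hcube n (a : 'rV[R]_n) (r : R) : set 'rV[R]_n :=
  [set x | forall i, a 0 i <= x 0 i < a 0 i + r].

Definition subcorner n (a : 'rV[R]_n) (r : R) (e : {ffun 'I_n -> bool}) : 'rV[R]_n :=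
  \row_i (a 0 i + (e i)%:R * (r / 2)).

Lemma hcube_split n (a : 'rV[R]_n) (r : R) : 0 < r ->
  hcube a r = \bigcup_e hcube (subcorner a r e) (r / 2).
Proof.
move=> r0; apply/seteqP; split=> x.
  move=> h; exists [ffun i => a 0 i + r / 2 <= x 0 i] => // i.
  rewrite mxE ffunE; have := h i; case: (leP (a 0 i + r / 2) (x 0 i)) => /= hh; rewrite ?mulr1n ?mulr0n ?mul1r ?mul0r ?addr0; lra.
move=> [e _ h] i; have := h i; rewrite mxE; case: (e i); rewrite /= ?mulr1n ?mulr0n ?mul1r ?mul0r; lra.
Qed.

Lemma trivIset_subcube n (a : 'rV[R]_n) (r : R) : 0 < r ->
  trivIset setT (fun e => hcube (subcorner a r e) (r / 2)).
Proof.
move=> r0; apply/trivIsetP => e f _ _ /eqP ef.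
apply/seteqP; split=> // x [he hf]; exfalso; apply: ef.
apply/ffunP => i; have := he i; have := hf i; rewrite !mxE.
by case: (e i); case: (f i) => //=; rewrite ?mulr1n ?mulr0n ?mul1r ?mul0r; lra.
Qed.

Lemma measurable_hcube n (a : 'rV[R]_n) (r : R) : measurable (hcube a r : set (borel_rV R n)).
Proof.
have -> : hcube a r = \bigcap_(i in [set: 'I_n])
   (fun x : 'rV[R]_n => x 0 i) @^-1` [set` `[a 0 i, a 0 i + r[].
  apply/seteqP; split=> x.
    by move=> h i _ /=; rewrite in_itv; exact: h.
  by move=> h i; have := h i I; rewrite /= in_itv.
apply: fin_bigcap_measurable => // i _.
rewrite -[X in measurable X]setTI; apply: measurable_coord => //.
Qed.

(** Cousin's lemma by bisection. If [P] failed on the cube, it would fail on a nested sequence of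
    halved cubes; these shrink to a point [x], where the local hypothesis is contradicted. The limit
    may lie on a missing face, hence the closed inequalities on [x]. *)
Lemma hcube_ind n (P : 'rV[R]_n -> R -> Prop) (a : 'rV[R]_n) (r : R) : 0 < r ->
  (forall b (s : R), 0 < s -> (forall e, P (subcorner b s e) (s / 2)) -> P b s) ->
  (forall x : 'rV[R]_n, (forall i, a 0 i <= x 0 i <= a 0 i + r) ->
    exists2 d : R, 0 < d & forall b (s : R), 0 < s < d -> hcube b s `<=` hcube a r ->
     (forall i, b 0 i <= x 0 i <= b 0 i + s) -> P b s) ->
  P a r.
Proof.
move=> r0 Psub Ploc; apply: contrapT => nP.
have /choice[e he] (p : 'rV[R]_n * R) : exists e, 0 < p.2 -> ~ P p.1 p.2 ->
    ~ P (subcorner p.1 p.2 e) (p.2 / 2).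
  have [|/existsNP[e he]] := pselect (forall e, P (subcorner p.1 p.2 e) (p.2 / 2)).
    by move=> p1; exists [ffun=> false] => p0 np; have := np (Psub p.1 p.2 p0 p1).
  by exists e.
pose F p := (subcorner p.1 p.2 (e p), p.2 / 2).
pose s := fix s k := if k is k'.+1 then F (s k') else (a, r).
have s0 k : 0 < (s k).2 by elim: k => //= k ?; rewrite divr_gt0.
have sP k : ~ P (s k).1 (s k).2 by elim: k => //= k ?; exact: he.
have s2 k : (s k).2 = r / 2 ^+ k.
  by elim: k => [|k /= ->]; rewrite ?expr0 ?divr1// exprS invfM mulrA mulrAC.
have mono k i : ((s k).1 0 i <= (s k.+1).1 0 i) && ((s k.+1).1 0 i + (s k.+1).2 <= (s k).1 0 i + (s k).2).
  rewrite /= mxE; have := s0 k; case: (e _ i); rewrite /= ?mulr1n ?mulr0n ?mul1r ?mul0r; lra.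
have mono' k l i : (k <= l)%N -> (s k).1 0 i <= (s l).1 0 i /\ (s l).1 0 i + (s l).2 <= (s k).1 0 i + (s k).2.
  elim: l => [|l IH]; first by rewrite leqn0 => /eqP ->.
  rewrite leq_eqVlt => /predU1P[->//|/IH[h1 h2]].
  have := mono l i; split; lra.
have hub i k : ubound (range (fun k => (s k).1 0 i)) ((s k).1 0 i + (s k).2).
  move=> _ [l _ <-]; have [kl|/ltnW lk] := leqP k l.
    have := mono' _ _ i kl; have := s0 l; lra.
  have := mono' _ _ i lk; have := s0 k; lra.
pose x : 'rV[R]_n := \row_i sup (range (fun k => (s k).1 0 i)).
have hx k i : (s k).1 0 i <= x 0 i <= (s k).1 0 i + (s k).2.
  rewrite mxE; apply/andP; split.
    apply: ub_le_sup; last by exists k.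
    by eexists; exact: (hub i 0%N).
  apply: ge_sup; last exact: hub.
  by exists ((s 0%N).1 0 i), 0%N.
have [d d0 hd] := Ploc x (hx 0%N).
have [k hk] : exists k, r / 2 ^+ k < d.
  exists (Num.truncn (r / d)).+1; rewrite ltr_pdivrMr ?exprn_gt0// -ltr_pdivrMl// mulrC.
  apply: (lt_le_trans (truncnS_gt _)); rewrite -natrX ler_nat ltnW//.
  exact: ltn_expl.
apply: (sP k); apply: hd => [|y hy i|]; last exact: hx.
  by rewrite s0 s2.
have := mono' _ _ i (leq0n k); have /= := hy i; lra.
Qed.

(** The union of the covers of the subcubes is a cover: [tau] is subadditive and [nu] additive on
    the disjoint subcubes. A relation in place of a map allows one boundary point to have many
    images under the flow, and a cover [B] in place of an image avoids asking whether the image is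
    measurable. *)
Lemma cover_hcube n (nu : {measure set (borel_rV R n) -> \bar R})
    d (T : measurableType d) (tau : {measure set T -> \bar R})
    (rel : 'rV[R]_n -> set T) (a : 'rV[R]_n) (r : R) : 0 < r ->
  (forall x : 'rV[R]_n, (forall i, a 0 i <= x 0 i <= a 0 i + r) ->
    exists2 d : R, 0 < d & forall b (s : R), 0 < s < d -> hcube b s `<=` hcube a r ->
     (forall i, b 0 i <= x 0 i <= b 0 i + s) ->
     exists B, [/\ measurable B, forall y, hcube b s y -> rel y `<=` B &
       (tau B <= nu (hcube b s))%E]) ->
  exists B, [/\ measurable B, forall y, hcube a r y -> rel y `<=` B &
       (tau B <= nu (hcube a r))%E].
Proof.
move=> r0 hloc; apply: (@hcube_ind n (fun a r => exists B, [/\ measurable B,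
   forall y, hcube a r y -> rel y `<=` B & (tau B <= nu (hcube a r))%E])) => //.
move=> b s s_gt0 /choice[B hB].
have fin : finite_set [set: {ffun 'I_n -> bool}] by exact: finite_finset.
exists (\bigcup_e B e); split.
- by apply: countable_bigcupT_measurable => // e; have [] := hB e.
- move=> y; rewrite hcube_split// => -[e _ ye]; have [_ h _] := hB e.
  by move=> z /(h _ ye) ?; exists e.
rewrite hcube_split// [leRHS]measure_fin_bigcup//; last 2 first.
- exact: trivIset_subcube.
- by move=> e _; exact: measurable_hcube.
apply: (@le_trans _ _ (\sum_(e \in setT) tau (B e))%E).
  apply: content_sub_fsum => //.
    by move=> e _; have [] := hB e.
  by apply: countable_bigcupT_measurable => // e; have [] := hB e.
by apply: lee_fsum => // e _; have [] := hB e.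
Qed.

(** Turns covers with vanishing errors into one with the exact bound: their lower limit, the union
    over [k] of the intersections of all [B l] with [l >= k]. As [S] increases, [S k] lies in every
    later [B l]; each such intersection has measure at most [c], and continuity from below
    concludes. *)
Lemma cover_liminf d (T : measurableType d) (tau : {measure set T -> \bar R})
    (S B : nat -> set T) (c : \bar R) (e : nat -> R) :
  (forall k, measurable (B k)) -> (forall k, S k `<=` B k) ->
  (forall k l, (k <= l)%N -> S k `<=` S l) ->
  (forall k, (tau (B k) <= c + (e k)%:E)%E) -> e @ \oo --> 0 ->
  exists A, [/\ measurable A, \bigcup_k S k `<=` A & (tau A <= c)%E].
Proof.
move=> mB SB mS hB e0.
pose C k := \bigcap_(l in [set l | (k <= l)%N]) B l.
have mC k : measurable (C k) by apply: bigcap_measurable => // ; exists k => /=.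
exists (\bigcup_k C k); split; first exact: bigcupT_measurable.
  by move=> z [k _ Sz]; exists k => // l /= kl; exact/SB/(mS k l).
have cvC : tau (C k) @[k --> \oo] --> tau (\bigcup_k C k).
  apply: nondecreasing_cvg_mu => //; first exact: bigcupT_measurable.
  by move=> k l kl; apply/subsetPset => z Cz i /= li; apply: Cz => /=; exact: leq_trans li.
have hC k : (tau (C k) <= c)%E.
  apply/lee_addgt0Pr => eps eps0.
  have [l kl el] : exists2 l, (k <= l)%N & e l < eps.
    move/cvgrPdist_lt : e0 => /(_ _ eps0)[N _ hN].
    exists (maxn k N); first exact: leq_maxl.
    have /= := hN (maxn k N) (leq_maxr _ _); rewrite sub0r normrN.
    exact/le_lt_trans/ler_norm.
  apply: (@le_trans _ _ (tau (B l))).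
    by apply: le_measure; rewrite ?inE// => z Cz; exact: Cz.
  by apply: (le_trans (hB l)); rewrite leeD2l// lee_fin ltW.
rewrite -(cvg_lim _ cvC)//; apply: lime_le; first by apply/cvg_ex; eexists; exact: cvC.
by apply: nearW.
Qed.

Section density.
Context d (T : measurableType d) (mu : {measure set T -> \bar R}) (f : T -> \bar R).
Hypotheses (mf : measurable_fun setT f) (f0 : forall x, (0 <= f x)%E).

(** Measurability and positivity are arguments of the function so that a measure structure, which
    depends on them, can be attached to it. *)
Definition density of measurable_fun setT f & (forall x, (0 <= f x)%E) : set T -> \bar R :=
  fun A => (\int[mu]_(x in A) f x)%E.

Let density0 : density mf f0 set0 = 0%E.
Proof. exact: integral_set0. Qed.

Let density_ge0 A : (0 <= density mf f0 A)%E.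
Proof. by apply: integral_ge0. Qed.

Let density_sigma_additive : semi_sigma_additive (density mf f0).
Proof.
move=> F mF tF mUF; rewrite /density.
apply: cvg_toP.
  by apply: is_cvg_ereal_nneg_natsum => k _; exact: integral_ge0.
by rewrite ge0_integral_bigcup//; exact: measurable_funS mf.
Qed.

HB.instance Definition _ := isMeasure.Build _ _ _ (density mf f0)
  density0 density_ge0 density_sigma_additive.

End density.

End cubes.

(** * The area inequality *)

Section area.
Context {R : realType}.
Implicit Types (n : nat).

Lemma mulmxr_bound n m (M : 'M[R]_(n, m)) : exists2 K : R, 0 <= K &
  forall (e : 'rV[R]_n) (c : R), (forall i, `|e 0 i| <= c) -> forall i, `|(e *m M) 0 i| <= c * K.
Proof.
exists (\sum_i \sum_j `|M i j|); first by apply: sumr_ge0 => i _; apply: sumr_ge0.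
move=> e c ec i; rewrite mxE; apply: (le_trans (ler_norm_sum _ _ _)).
rewrite mulr_sumr; apply: ler_sum => j _; rewrite normrM.
apply: ler_pM => //.
by rewrite (bigD1 i)//= lerDl sumr_ge0.
Qed.

Lemma lebesgue_preimage_unit n (M : 'M[R]_n) (a b : 'rV[R]_n) : M \in unitmx ->
  lebesgue_rV n ((fun x : 'rV[R]_n => x *m M) @^-1` cbox a b) =
  (`|\det M|^-1 * \prod_i Num.max 0 (b 0 i - a 0 i))%:E.
Proof.
move=> uM; have [_ /(_ _ (measurable_cbox a b))] := leb_linear_unit uM.
rewrite lebesgue_cbox => h; rewrite EFinM -h muleA -EFinM mulVf ?mul1e//.
by rewrite normr_eq0 -unitfE -unitmxE.
Qed.

(** For invertible [L], pull back by [L]: the perturbed image lies in the image of a slightly larger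
    cube. For singular [L] the image of the cube is flat, and the perturbation thickens it by a
    multiple of [eta * r] only, so its volume is a small multiple of [r ^+ n]. *)
Lemma linear_cube n (L : 'M[R]_n) (eps : R) : 0 < eps ->
  exists2 eta : R, 0 < eta & forall (b : 'rV[R]_n) (r : R), 0 < r ->
    (forall i, `|b 0 i| <= r) -> exists B : set (borel_rV R n),
    [/\ measurable B,
      forall v e : 'rV[R]_n, (forall i, b 0 i <= v 0 i <= b 0 i + r) ->
        (forall i, `|e 0 i| <= eta * r) -> B (v *m L + e) &
      (lebesgue_rV n B <= ((`|\det L| + eps) * r ^+ n)%:E)%E].
Proof.
move=> eps0; have [uL|nuL] := boolP (L \in unitmx).
  have [K K0 hK] := mulmxr_bound (invmx L).
  (* The enlarged cube has side [r * (1 + 2 * (t * K))] with [t] the relative size of the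
     perturbation, and the volume tends to the exact one as [t] tends to zero. *)
  have c : {for 0, continuous (fun t : R => `|\det L| * (1 + 2 * (t * K)) ^+ n)}.
    apply: contM; first exact: contC.
    apply: contX; apply: contD; first exact: contC.
    apply: contM; first exact: contC.
    by apply: contM; [exact: cvg_id|exact: contC].
  have /cvgrPdist_lt/(_ _ eps0)/nbhs_ballP[d /= d0 hd] := c.
  exists (d / 2) => [|b r r0 br]; first by rewrite divr_gt0.
  pose c1 := r * (d / 2 * K).
  exists ((fun x : 'rV[R]_n => x *m invmx L) @^-1`
     cbox (b - const_mx c1) (b + const_mx (r + c1))); split.
  - by apply: measurable_preimage_mulmxr; exact: measurable_cbox.
  - move=> v e hv he i; rewrite mulmxDl mulmxK//.
    have := hK _ _ he i; rewrite ler_norml !mxE.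
    rewrite (_ : d / 2 * r * K = c1); last by rewrite /c1; ring.
    by have := hv i; lra.
  - rewrite lebesgue_preimage_unit ?unitmx_inv// lee_fin det_inv normrV -?unitmxE// invrK.
    rewrite (eq_bigr (fun=> r * (1 + 2 * (d / 2 * K)))); last first.
      move=> i _; rewrite !mxE max_r; first by rewrite /c1; ring.
      have : 0 <= c1 by rewrite /c1 mulr_ge0 ?(ltW r0)// mulr_ge0// ltW// divr_gt0.
      lra.
    rewrite prodr_const card_ord exprMn mulrCA [leRHS]mulrC ler_pM2l ?exprn_gt0//.
    have := hd (d / 2); rewrite /= mul0r mulr0 addr0 expr1n mulr1 -ball_normE /= sub0r normrN.
    rewrite gtr0_norm ?divr_gt0// gtr_pMr// invf_lt1// ltr1n => /(_ isT).
    by rewrite ltr_norml => /andP[h1 h2]; lra.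
have rL : (\rank L < n)%N.
  by rewrite ltn_neqAle rank_leq_row andbT; move: nuL; rewrite -row_full_unit.
(* After the change of basis [M] the coordinate of index [\rank L] vanishes on the whole image; this
   is the thin direction. *)
pose i0 := Ordinal rL.
pose M := invmx (row_ebase L).
have uM : M \in unitmx by rewrite unitmx_inv row_ebase_unit.
have LM : L *m M = col_ebase L *m pid_mx (\rank L).
  by rewrite -{1}(mulmx_ebase L) mulmxK// row_ebase_unit.
have LM0 (v : 'rV[R]_n) : (v *m (L *m M)) 0 i0 = 0.
  rewrite LM mulmxA mxE big1// => j _; rewrite !mxE /= .
  by case: eqP => [->|]; rewrite ?ltnn ?andbF ?mulr0 ?mulr0.
have [K1 K10 hK1] := mulmxr_bound (L *m M).
have [K2 K20 hK2] := mulmxr_bound M.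
pose K := K1 + K2 + 1.
have K0 : 0 < K by rewrite /K; lra.
(* The box has half-width [eta * K * r] in the thin direction and [3 * K * r] in the others, so its
   preimage has volume [eta * P * r ^+ n]. *)
pose P := `|\det M|^-1 * \prod_(i < n | i != i0) (6 * K) * (2 * K).
have P0 : 0 <= P.
  rewrite !mulr_ge0 ?invr_ge0 ?(ltW K0)//; apply: prodr_ge0 => i _.
  by rewrite mulr_ge0 ?(ltW K0).
pose eta := Num.min 1 (eps / (P + 1)).
have eta0 : 0 < eta by rewrite lt_min ltr01 divr_gt0//; lra.
have eta1 : eta <= 1 by rewrite ge_min lexx.
have etaP : eta * P <= eps.
  apply: (@le_trans _ _ (eps / (P + 1) * P)); first by rewrite ler_wpM2r// ge_min lexx orbT.
  by rewrite mulrAC ler_pdivrMr ?ler_pM2l//; lra.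
exists eta => // b r r0 br.
pose k (i : 'I_n) := if i == i0 then eta * K * r else 3 * K * r.
exists ((fun x : 'rV[R]_n => x *m M) @^-1` cbox (\row_i (- k i)) (\row_i k i)); split.
- by apply: measurable_preimage_mulmxr; exact: measurable_cbox.
- move=> v e hv he i; rewrite [X in X <= _ <= _]mxE [X in _ <= _ <= X]mxE -ler_norml /= mulmxDl -mulmxA mxE.
  have h1 : `|(v *m (L *m M)) 0 i| <= 2 * r * K1.
    apply: hK1 => j; rewrite ler_norml; have := hv j; have := br j; rewrite ler_norml; lra.
  have h2 := hK2 _ _ he i.
  apply: (le_trans (ler_normD _ _)); rewrite /k.
  have KK1 : K1 * r <= K * r by rewrite ler_pM2r// /K; lra.
  have KK2 : K2 * r <= K * r by rewrite ler_pM2r// /K; lra.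
  have KK3 : eta * (K2 * r) <= eta * (K * r) by rewrite ler_pM2l.
  have KK4 : eta * (K * r) <= K * r by rewrite ler_piMl// mulr_ge0 ?ltW.
  case: eqP => [ii|_]; last by lra.
  by rewrite ii LM0 normr0 add0r -ii; lra.
- rewrite lebesgue_preimage_unit// lee_fin.
  rewrite (eq_bigr (fun i => r * (if i == i0 then eta * (2 * K) else 6 * K))); last first.
    move=> i _; rewrite !mxE /k max_r; first by case: eqP => _; ring.
    by case: eqP => _; rewrite opprK addr_ge0 ?mulr_ge0 ?(ltW eta0) ?(ltW K0) ?(ltW r0).
  rewrite big_split/= prodr_const card_ord (bigD1 i0)//= eqxx.
  rewrite (eq_bigr (fun=> 6 * K)); last by move=> i /negPf ->.
  rewrite [leLHS](_ : _ = r ^+ n * (eta * P)); last by rewrite /P; ring.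
  rewrite [leRHS]mulrC ler_pM2l ?exprn_gt0//.
  by rewrite (le_trans etaP)// lerDr.
Qed.

Lemma diff_approx (V W : normedModType R) (f : V -> W) (x : V) (eta : R) :
  differentiable f x -> 0 < eta -> exists2 d : R, 0 < d & forall y, `|y - x| < d ->
    `|f y - f x - 'd f x (y - x)| <= eta * `|y - x|.
Proof.
move=> df eta0; have := diff_locally df; set o := (X in _ = _ + X) => h.
have : o =o_ 0 (@id V) by rewrite /o; exact: littleo_eqo.
move/eqoP => /(_ _ eta0)/nbhs_ballP[d /= d0 hd].
exists d => // y yx; have /= := hd (y - x).
rewrite -ball_normE /= sub0r normrN => /(_ yx).
have := congr1 (fun g => g (y - x)) h; rewrite /= !fctE subrK => ->.
by rewrite -[X in X - _ - _]addrA [f x + _]addrC addrK addrAC subrr add0r.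
Qed.

Lemma diff_intro (V W : normedModType R) (f : V -> W) (L : {linear V -> W}) (x : V) :
  continuous L -> (forall eta : R, 0 < eta -> exists2 d : R, 0 < d &
    forall y, `|y - x| < d -> `|f y - f x - L (y - x)| <= eta * `|y - x|) ->
  differentiable f x /\ 'd f x = L :> (V -> W).
Proof.
move=> cL h.
have E : f \o shift x = cst (f x) + L +o_ 0 id.
  apply/eqaddoP => eta eta0; have [d d0 hd] := h _ eta0.
  apply/nbhs_ballP; exists d => // y; rewrite -ball_normE /= sub0r normrN => yd.
  have := hd (y + x); rewrite addrK => /(_ yd).
  by rewrite !fctE /= opprD addrA.
have dE := diff_unique cL E; split=> //.
by apply/diff_locallyP; rewrite dE.
Qed.

Lemma diff_cube n (Psi : 'rV[R]_n -> 'rV[R]_n) (x : 'rV[R]_n) (eps e0 : R) :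
  differentiable Psi x -> 0 < eps -> 0 < e0 ->
  exists2 d : R, 0 < d & forall (b : 'rV[R]_n) (r : R), 0 < r < d ->
    (forall i, b 0 i <= x 0 i <= b 0 i + r) -> exists B : set (borel_rV R n),
    [/\ measurable B,
      forall y : 'rV[R]_n, (forall i, b 0 i <= y 0 i <= b 0 i + r) -> B (Psi y),
      B `<=` ball (Psi x) e0 &
      (lebesgue_rV n B <= ((`|\det ('J Psi x)| + eps) * r ^+ n)%:E)%E].
Proof.
move=> dP eps0 e0_gt0; have [eta eta0 heta] := linear_cube ('J Psi x) eps0.
have [d1 d10 hd1] : exists2 d : R, 0 < d & forall y, `|y - x| < d -> ball (Psi x) e0 (Psi y).
  have /differentiable_continuous/cvgrPdist_lt/(_ _ e0_gt0)/nbhs_ballP[d /= d0 hd] := dP.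
  exists d => // y yx; rewrite -ball_normE /=; apply: hd.
  by rewrite -ball_normE /= distrC.
have [d2 d20 hd2] : exists2 d : R, 0 < d & forall y, `|y - x| < d ->
    `|Psi y - Psi x - (y - x) *m 'J Psi x| <= eta * `|y - x|.
  have [d d0 hd] := diff_approx dP eta0; exists d => // y /hd.
  by rewrite mul_rV_lin1.
exists (Num.min d1 d2); first by rewrite lt_min d10.
move=> b r /andP[r0]; rewrite lt_min => /andP[rd1 rd2] bx.
have [||B [mB hB lB]] := heta (b - x) r => //.
  by move=> i; rewrite !mxE ler_norml; have := bx i; lra.
have nyx (y : 'rV[R]_n) : (forall i, b 0 i <= y 0 i <= b 0 i + r) -> `|y - x| <= r.
  move=> hy; apply/rV_normP; first exact: ltW.
  by move=> i; rewrite !mxE ler_norml; have := bx i; have := hy i; lra.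
pose B' : set (borel_rV R n) := (fun z : 'rV[R]_n => z - Psi x) @^-1` B.
have mB' : measurable B'.
  rewrite -[X in measurable X]setTI.
  apply: (@measurable_fun_continuous_rV R n n setT (fun z => z - Psi x));
    [exact: openT| |exact: measurableT|exact: mB].
  by move=> z _; apply: (@contB R _ _ id (fun=> Psi x)); [exact: cvg_id|exact: contC].
have mball : measurable (ball (Psi x) e0 : set (borel_rV R n)).
  by apply: measurable_open_rV; exact: ball_open.
exists (B' `&` ball (Psi x) e0); split.
- exact: measurableI.
- move=> y hy; split; last first.
    by apply/hd1; apply: le_lt_trans (nyx _ hy) _.
  rewrite /B' /= -(subrK ((y - x) *m 'J Psi x) (Psi y - Psi x)) addrC.
  apply: hB => i; first by rewrite !mxE; have := hy i; lra.
  apply: (le_trans (ler_coord_norm _ _)); apply: (le_trans (hd2 _ _)).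
    exact: le_lt_trans (nyx _ hy) _.
  by rewrite ler_pM2l// nyx.
- by move=> z [].
apply: le_trans lB; rewrite -(lebesgue_rV_add (- Psi x) mB).
by apply: le_measure; rewrite ?inE//; exact: measurableI.
Qed.

Lemma lebesgue_hcube n (a : 'rV[R]_n) (r : R) : 0 < r ->
  lebesgue_rV n (hcube a r) = (r ^+ n)%:E.
Proof.
move=> r0; elim: n a => [|n IH] a.
  by rewrite /= diracE mem_set// => i; case: i.
rewrite lebesgue_rVS.
have -> : @cons_rV R n @^-1` hcube a r =
    `[a 0 0, a 0 0 + r[ `*` hcube (\row_i a 0 (lift ord0 i)) r.
  apply/seteqP; split=> p.
    move=> h; split=> [|i]; first by have := h 0; rewrite cons_rV0 /= in_itv.
    by have := h (lift ord0 i); rewrite cons_rV_lift !mxE.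
  move=> [h1 h2] i; case: (unliftP ord0 i) => [j|] ->.
    by have := h2 j; rewrite cons_rV_lift !mxE.
  by move: h1; rewrite cons_rV0 /= in_itv.
rewrite product_measure1E//; last exact: measurable_hcube.
rewrite IH /= [X in (X * _)%E]lebesgue_measure_itv /= lte_fin ltrDl r0.
by rewrite -EFinB addrAC subrr add0r -EFinM exprS.
Qed.

Lemma hcube_near n (b x y : 'rV[R]_n) (s d : R) : 0 < s < d ->
  (forall i, b 0 i <= x 0 i <= b 0 i + s) -> hcube b s y -> `|y - x| < d.
Proof.
move=> /andP[s0 sd] hx hy; apply: le_lt_trans sd; apply/rV_normP; first exact: ltW.
by move=> i; rewrite !mxE ler_norml; have := hx i; have := hy i; lra.
Qed.

(** A limit point of subcubes that is outside [K], or in [K] but outside [A], has a neighbourhood in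
    which nothing has to be covered. The remaining ones lie in [O], where [Psi] can be linearized
    and [theta] is continuous; this is why [K] is closed and contained in [O]. *)
Lemma area_le_cube n (O A K : set 'rV[R]_n) (Psi : 'rV[R]_n -> 'rV[R]_n)
    (w theta : 'rV[R]_n -> R) (a : 'rV[R]_n) (r eps : R)
    (mw : @measurable_fun _ _ (borel_rV R n) _ setT (EFin \o w))
    (w0 : forall y, (0 <= (EFin \o w) y)%E)
    (mt : @measurable_fun _ _ (borel_rV R n) _ setT (EFin \o (theta \_ O)))
    (t0 : forall y, (0 <= (EFin \o (theta \_ O)) y)%E) :
  open O -> closed K -> K `<=` O ->
  (forall x, O x -> ~ A x -> \forall y \near x, ~ A y) ->
  (forall x, O x -> A x -> [/\ differentiable Psi x, {for Psi x, continuous w} &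
     w (Psi x) * `|\det ('J Psi x)| <= theta x]) ->
  (forall x, O x -> {for x, continuous theta}) -> 0 < r -> 0 < eps ->
  exists B : set (borel_rV R n), [/\ measurable B, forall y, hcube a r y -> K y -> A y -> B (Psi y) &
    (density (lebesgue_rV n) mw w0 B <=
      density (lebesgue_rV n) mt t0 (hcube a r) + (eps * r ^+ n)%:E)%E].
Proof.
move=> oO cK KO cA hA ct r0 eps0.
(* The error term is made part of the measure, so that it adds up under subdivision like the main
   term. *)
pose nu : {measure set (borel_rV R n) -> \bar R} :=
  measure_add (density (lebesgue_rV n) mt t0) (mscale (NngNum (ltW eps0)) (lebesgue_rV n)).
have nuE b s : 0 < s -> nu (hcube b s) = (density (lebesgue_rV n) mt t0 (hcube b s) + (eps * s ^+ n)%:E)%E.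
  by move=> s0; rewrite [LHS]measure_addE; congr (_ + _)%E; rewrite EFinM -(lebesgue_hcube b s0).
pose rel (y : 'rV[R]_n) : set (borel_rV R n) := [set z | K y /\ A y /\ z = Psi y].
suff : exists B : set (borel_rV R n), [/\ measurable B, forall y, hcube a r y -> rel y `<=` B &
       (density (lebesgue_rV n) mw w0 B <= nu (hcube a r))%E].
  move=> [B [mB hB lB]]; exists B; split => //; last by rewrite -nuE.
  by move=> y hy Ky Ay; apply: (hB y hy).
apply: cover_hcube => // x hx.
have [[Kx Ax]|nKA] := pselect (K x /\ A x); last first.
  have : \forall y \near x, ~ (K y /\ A y).
    have [Kx|nKx] := pselect (K x).
      have nAx : ~ A x by move=> ?; apply: nKA.
      by apply: filterS (cA _ (KO _ Kx) nAx) => y ? [].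
    have : nbhs x (~` K) by apply: open_nbhs_nbhs; split => //; exact: closed_openC.
    by apply: filterS => y /= ? [].
  move=> /nbhs_ballP[d /= d0 hd]; exists d => // b s sd _ hbx.
  exists set0; split; [exact: measurable0| |by rewrite measure0 measure_ge0].
  move=> y hy z [Ky [Ay _]]; apply: (hd y) => //.
  by rewrite -ball_normE /= distrC; exact: hcube_near hy.
have Ox := KO _ Kx; have [dP cw hle] := hA x Ox Ax.
set W := w (Psi x) in hle *; set J := `|_| in hle.
have W0 : 0 <= W by have := w0 (Psi x); rewrite /= lee_fin.
have J0 : 0 <= J by exact: normr_ge0.
(* Chosen so that enlarging both the weight and the determinant by [e1] costs at most [eps / 2]; the
   other half of [eps] pays for the variation of [theta] over the cube. *)
pose e1 := Num.min 1 (eps / 2 / (W + J + 1)).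
have e10 : 0 < e1 by rewrite lt_min ltr01 !divr_gt0//; lra.
have e1P : (W + e1) * (J + e1) <= theta x + eps / 2.
  have h1 : e1 <= 1 by rewrite ge_min lexx.
  have h2 : e1 * (W + J + 1) <= eps / 2.
    by rewrite -ler_pdivlMr ?ge_min ?lexx ?orbT//; lra.
  have h3 : e1 * e1 <= e1 * 1 by rewrite ler_pM2l.
  have -> : (W + e1) * (J + e1) = W * J + (e1 * (W + J) + e1 * e1) by ring.
  by move: h2 h3 hle; rewrite !mulrDr !mulr1; lra.
have [e0 e00 he0] : exists2 e0 : R, 0 < e0 & forall z, ball (Psi x) e0 z -> w z <= W + e1.
  have /cvgrPdist_lt/(_ _ e10)/nbhs_ballP[d /= d0 hd] := cw.
  by exists d => // z /hd/=; rewrite ltr_norml /W => /andP[]; lra.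
have [d1 d10 hd1] := diff_cube dP e10 e00.
have [d2 d20 hd2] : exists2 d : R, 0 < d & forall y, ball x d y -> O y /\ theta x - eps / 2 <= theta y.
  have eps20 : 0 < eps / 2 by rewrite divr_gt0.
  have /cvgrPdist_lt/(_ _ eps20) h1 := ct _ Ox.
  have h2 : nbhs x O by exact: open_nbhs_nbhs.
  have /nbhs_ballP[d /= d0 hd] : nbhs x (O `&` [set t | `|theta x - theta t| < eps / 2]) by exact: filterI.
  by exists d => // y /hd/= [Oy]; rewrite ltr_norml => /andP[]; split => //; lra.
exists (Num.min d1 d2); first by rewrite lt_min d10.
move=> b s /andP[s0]; rewrite lt_min => /andP[sd1 sd2] _ hbx.
have [|B [mB hB Bb lB]] := hd1 b s _ hbx; first by rewrite s0.
exists B; split => //.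
  move=> y hy z [_ [_ ->]]; apply: hB => i; have := hy i; lra.
rewrite nuE//.
apply: (@le_trans _ _ (((W + e1) * (J + e1)) * s ^+ n)%:E).
  apply: (@le_trans _ _ (\int[lebesgue_rV n]_(z in B) (W + e1)%:E)%E).
    apply: ge0_le_integral => //.
    - exact: measurable_funS mw.
    - by move=> z Bz; rewrite lee_fin; exact/he0/Bb.
  rewrite integral_cst// -mulrA EFinM lee_pmul2l//; first by rewrite lte_fin; lra.
(* The truncation at 0 keeps the constant integrand nonnegative when [theta x < eps / 2]. *)
apply: (@le_trans _ _ ((Num.max 0 (theta x - eps / 2) * s ^+ n)%:E + (eps * s ^+ n)%:E)%E).
  rewrite -EFinD lee_fin -mulrDl ler_wpM2r ?exprn_ge0 ?(ltW s0)//.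
  apply: (le_trans e1P); have := le_max (theta x - eps / 2) 0 (theta x - eps / 2).
  rewrite lexx orbT; lra.
rewrite leeD2r//.
apply: (@le_trans _ _ (\int[lebesgue_rV n]_(z in hcube b s) (Num.max 0 (theta x - eps / 2))%:E)%E).
  rewrite integral_cst; last exact: measurable_hcube.
  by rewrite EFinM -(lebesgue_hcube b s0); exact: lexx.
apply: ge0_le_integral => //.
- exact: measurable_hcube.
- by move=> z _; rewrite lee_fin le_max lexx.
- by apply: (measurable_funS _ _ mt).
- move=> z hz /=; have [|Oz tz] := hd2 z.
    by rewrite -ball_normE /= distrC; apply: (hcube_near _ hbx hz); rewrite s0.
  rewrite lee_fin patchE mem_set// ge_max tz andbT.
  by have := t0 z; rewrite /= lee_fin patchE mem_set.
Qed.

(* Subdivide O into small cubes, on which Psi is close to its linearization. *)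
Lemma area_le n (O A : set 'rV[R]_n) (Psi : 'rV[R]_n -> 'rV[R]_n)
    (w theta : 'rV[R]_n -> R) :
  open O -> (forall x, O x -> ~ A x -> \forall y \near x, ~ A y) ->
  @measurable_fun _ _ (borel_rV R n) _ setT (EFin \o w) -> (forall y, 0 <= w y) ->
  (forall x, O x -> A x -> [/\ differentiable Psi x, {for Psi x, continuous w} &
     w (Psi x) * `|\det ('J Psi x)| <= theta x]) ->
  (forall x, O x -> 0 <= theta x /\ {for x, continuous theta}) ->
  exists B : set (borel_rV R n), [/\ measurable B, forall y, O y -> A y -> B (Psi y) &
    (\int[lebesgue_rV n]_(z in B) (w z)%:E <= \int[lebesgue_rV n]_(z in O) (theta z)%:E)%E].
Proof.
move=> oO cA mw w0 hA ht.
have mO : measurable (O : set (borel_rV R n)) by exact: measurable_open_rV.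
have w0' y : (0 <= (EFin \o w) y)%E by rewrite lee_fin.
have mt : @measurable_fun _ _ (borel_rV R n) _ setT (EFin \o (theta \_ O)).
  apply/measurable_EFinP; apply/(measurable_restrictT _ _).1 => //.
  by apply: measurable_fun_continuous_rV1 => // x /ht[].
have t0 y : (0 <= (EFin \o (theta \_ O)) y)%E.
  by rewrite /= lee_fin patchE; case: ifPn => // /set_mem/ht[].
pose c := (\int[lebesgue_rV n]_(z in O) (theta z)%:E)%E.
have cE : c = density (lebesgue_rV n) mt t0 setT.
  rewrite /c integral_mkcond; apply: eq_integral => x _.
  by rewrite /= !patchE; case: ifP.
(* Exhaustion of [O] by the closed sets of points at distance at least [1 / (k + 1)] from its
   complement. *)
pose K k : set 'rV[R]_n := ~` \bigcup_(y in ~` O) ball y k.+1%:R^-1.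
have cK k : closed (K k).
  by apply: open_closedC; apply: bigcup_open => y _; exact: ball_open.
have KO k : K k `<=` O.
  move=> x Kx; apply: contrapT => nO; apply: Kx; exists x => //.
  by apply: ballxx; rewrite invr_gt0.
have Kmono k l : (k <= l)%N -> K k `<=` K l.
  move=> kl x Kx [y Oy yx]; apply: Kx; exists y => //.
  by apply: le_ball yx; rewrite lef_pV2 ?posrE// ler_nat.
have KU x : O x -> exists k, K k x.
  move=> Ox; have /nbhs_ballP[e /= e0 he] : nbhs x O by exact: open_nbhs_nbhs.
  exists (Num.truncn e^-1) => -[y nOy] /ball_sym yx; apply: nOy.
  apply: he; apply: le_ball yx; rewrite -[leRHS]invrK lef_pV2 ?posrE ?invr_gt0//.
  by rewrite ltW// truncnS_gt.
pose r k : R := 2 * k.+1%:R.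
have r0 k : 0 < r k by rewrite /r mulr_gt0.
pose a k : 'rV[R]_n := const_mx (- k.+1%:R).
pose e k : R := k.+1%:R^-1.
(* Divided by the volume of the [k]-th cube, so that the total error over that cube is [e k], which
   tends to zero. *)
have e0 k : 0 < e k / r k ^+ n by rewrite divr_gt0 ?invr_gt0// exprn_gt0.
have /choice[B hB] k := @area_le_cube n O A (K k) Psi w theta (a k) (r k) _ mw w0' mt t0
  oO (cK k) (@KO k) cA hA (fun x Ox => (ht x Ox).2) (r0 k) (e0 k).
pose S k : set (borel_rV R n) := [set z | exists y, [/\ hcube (a k) (r k) y, K k y, A y & z = Psi y]].
have [|||||D [mD SD lD]] := @cover_liminf R _ _ (density (lebesgue_rV n) mw w0') S B c e.
- by move=> k; have [] := hB k.
- by move=> k z [y [h1 h2 h3 ->]]; have [_ h _] := hB k; exact: h.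
- move=> k l kl z [y [h1 h2 h3 ->]]; exists y; split => //; last exact: Kmono h2.
  move=> i; have := h1 i; rewrite !mxE /r.
  have : (k.+1%:R : R) <= l.+1%:R by rewrite ler_nat.
  lra.
- move=> k; have [_ _] := hB k; rewrite divfK ?gt_eqF ?exprn_gt0// => h.
  apply: (le_trans h); rewrite leeD2r// cE; apply: le_measure; rewrite ?inE//.
  exact: measurable_hcube.
- exact: cvg_harmonic.
exists D; split => // y Oy Ay; apply: SD.
have [k1 hk1] := KU y Oy.
pose k := maxn k1 (Num.truncn `|y|).
exists k => //; exists y; split => //; last exact: (Kmono _ _ (leq_maxl _ _)).
move=> i; rewrite mxE /r.
have : `|y 0 i| < k.+1%:R.
  apply: (le_lt_trans (ler_coord_norm _ _)); apply: (lt_le_trans (truncnS_gt _)).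
  by rewrite ler_nat ltnS leq_maxr.
rewrite ltr_norml; lra.
Qed.

End area.

(** * Directional derivatives *)

Section hasD.
Context {R : realType} {V : normedModType R}.
Implicit Types f g : V -> R.

(** Bundles differentiability with a formula for all directional derivatives, so that the
    differential of a long expression is assembled by applying one rule per operation. *)
Definition hasD (W : normedModType R) (f : V -> W) (x : V) (L : V -> W) :=
  differentiable f x /\ forall v, 'D_v f x = L v.

Lemma hasD_diff (W : normedModType R) (f : V -> W) x : differentiable f x ->
  hasD f x (fun v => 'D_v f x).
Proof. by []. Qed.

Lemma hasD_eq (W : normedModType R) (f : V -> W) x (L M : V -> W) : hasD f x L -> (forall v, L v = M v) ->
  hasD f x M.
Proof. by move=> [df h] LM; split=> // v; rewrite h. Qed.

Lemma hasD_cst (W : normedModType R) (c : W) x : hasD (fun=> c) x (fun=> 0).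
Proof. by split=> [|v]; [exact: differentiable_cst|exact: derive_cst]. Qed.

Lemma hasD_D (W : normedModType R) (f g : V -> W) x L M : hasD f x L -> hasD g x M ->
  hasD (fun y => f y + g y) x (fun v => L v + M v).
Proof.
move=> [df hf] [dg hg]; split=> [|v]; first exact: differentiableD.
by rewrite (@deriveD _ _ _ f g) ?hf ?hg//; exact: diff_derivable.
Qed.

Lemma hasD_N (W : normedModType R) (f : V -> W) x L : hasD f x L -> hasD (fun y => - f y) x (fun v => - L v).
Proof.
move=> [df hf]; split=> [|v]; first exact: differentiableN.
by rewrite (@deriveN _ _ _ f) ?hf//; exact: diff_derivable.
Qed.

Lemma hasD_B (W : normedModType R) (f g : V -> W) x L M : hasD f x L -> hasD g x M ->
  hasD (fun y => f y - g y) x (fun v => L v - M v).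
Proof. by move=> hf hg; apply: hasD_D => //; exact: hasD_N. Qed.

Lemma hasD_M f g x L M : hasD f x L -> hasD g x M ->
  hasD (fun y => f y * g y) x (fun v => L v * g x + f x * M v).
Proof.
move=> [df hf] [dg hg]; split=> [|v]; first exact: differentiableM.
rewrite (@deriveM _ _ f g) ?hf ?hg; [|exact: diff_derivable..].
by rewrite addrC /GRing.scale/= [g x * _]mulrC.
Qed.

Lemma hasD_V f x L : f x != 0 -> hasD f x L ->
  hasD (fun y => (f y)^-1) x (fun v => - L v / f x ^+ 2).
Proof.
move=> f0 [df hf]; split=> [|v]; first exact: differentiableV.
by rewrite deriveV ?hf//; [rewrite /GRing.scale/= !mulNr mulrC|exact: diff_derivable].
Qed.

Lemma hasD_comp1 f x L (h : R -> R) (c : R) : is_derive (f x) 1 h c -> hasD f x L ->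
  hasD (fun y => h (f y)) x (fun v => c * L v).
Proof.
move=> hc [df hf]; have dh : differentiable h (f x) by apply/derivable1_diffP; exact: ex_derive.
have dc : differentiable (h \o f) x by exact: differentiable_comp.
split=> [|v]; first exact: dc.
rewrite (deriveE _ dc) diff_comp//= -(deriveE _ df) hf.
rewrite -[L v]mulr1 -[L v * 1]/(L v *: 1) linearZ /= -(deriveE _ dh) (@derive_val _ _ _ _ _ _ _ hc).
by rewrite /GRing.scale /= mulr1 mulrC.
Qed.

Lemma hasD_sqrt f x L : 0 < f x -> hasD f x L ->
  hasD (fun y => Num.sqrt (f y)) x (fun v => L v / (2 * Num.sqrt (f x))).
Proof.
move=> f0 hf; apply: (hasD_eq (hasD_comp1 (is_derive1_sqrt f0) hf)) => v.
by rewrite mulrC.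
Qed.

Lemma hasD_sum I (r : seq I) (P : pred I) (F : I -> V -> R) x L :
  (forall i, P i -> hasD (F i) x (L i)) ->
  hasD (fun y => \sum_(i <- r | P i) F i y) x (fun v => \sum_(i <- r | P i) L i v).
Proof.
move=> h; elim: r => [|i r IH].
  rewrite (_ : (fun _ => _) = fun=> 0); last by apply/funext => y; rewrite big_nil.
  by apply: (hasD_eq (hasD_cst _ _)) => v; rewrite big_nil.
have E (T : Type) (G : I -> T -> R) : (fun y => \sum_(j <- i :: r | P j) G j y) =
   fun y => (if P i then G i y else 0) + \sum_(j <- r | P j) G j y.
  by apply/funext => y; rewrite big_cons; case: ifP => //; rewrite add0r.
rewrite !E; apply: hasD_D => //.
by case: (boolP (P i)) => Pi; [exact: h|exact: hasD_cst].
Qed.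

Lemma hasD_near (W : normedModType R) (f g : V -> W) x L : (\forall y \near x, f y = g y) ->
  hasD f x L -> hasD g x L.
Proof.
move=> fg [df hf]; split; last first.
  by move=> v; rewrite -hf; apply/esym/near_eq_derive.
have fgx : f x = g x by exact: (nbhs_singleton fg).
apply: (proj1 (@diff_intro _ _ _ g ('d f x) x _ _)); first exact: diff_continuous.
move=> eta eta0; have [d d0 hd] := diff_approx df eta0.
have /nbhs_ballP[e /= e0 he] := fg.
exists (Num.min d e); first by rewrite lt_min d0.
move=> y; rewrite lt_min => /andP[yd ye].
rewrite -fgx -(he y); last by rewrite /= -ball_normE /= distrC.
exact: hd.
Qed.

End hasD.

Section hasD_rV.
Context {R : realType}.

Lemma hasD_id (V : normedModType R) (x : V) : hasD (fun y : V => y) x (fun v => v).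
Proof. by split=> // v; rewrite derive_id. Qed.

Lemma hasD_coord n (x : 'rV[R]_n) i :
  hasD (fun y : 'rV[R]_n => y 0 i) x (fun v => v 0 i).
Proof.
have [L LE] : exists L : {linear 'rV[R]_n -> R}, forall v, L v = v 0 i.
  have @f : {linear 'rV[R]_n -> R}.
    by exists (fun N : 'rV[R]_n => N 0 i); do 2![eexists]; do ?[constructor];
     rewrite ?mxE// => ? *; rewrite ?mxE//; move=> ?; rewrite !mxE.
  by exists f.
have LE' : (fun y : 'rV[R]_n => y 0 i) = L by apply/funext => v; rewrite LE.
split; first exact: differentiable_coord.
move=> v; rewrite deriveE; last exact: differentiable_coord.
rewrite LE' diff_lin -?LE'//; exact: coord_continuous.
Qed.

Lemma hasD_rVP (V : normedModType R) n (f : V -> 'rV[R]_n) x (L : V -> 'rV[R]_n) :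
  (forall i, hasD (fun y => f y 0 i) x (fun v => L v 0 i)) -> hasD f x L.
Proof.
move=> h; have df : differentiable f x.
  have -> : f = \sum_(i < n) (fun y => f y 0 i *: delta_mx 0 i : 'rV[R]_n).
    apply/funext => y; rewrite fct_sumE; apply/rowP => j; rewrite summxE (bigD1 j)//= big1.
      by rewrite !mxE !eqxx mulr1 addr0.
    by move=> i ij; rewrite !mxE eq_sym (negbTE ij) andbF mulr0.
  apply: differentiable_sum => i; apply: differentiableZl; exact: (h i).1.
split=> // v; rewrite derive_mx; last exact: diff_derivable.
by apply/matrixP => i j; rewrite mxE ord1 (h j).2.
Qed.

Lemma hasD_rV_coord (V : normedModType R) n (f : V -> 'rV[R]_n) x (L : V -> 'rV[R]_n) i :
  hasD f x L -> hasD (fun y => f y 0 i) x (fun v => L v 0 i).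
Proof.
move=> [df hf]; split.
  apply: (@differentiable_comp _ _ _ _ f (fun y : 'rV[R]_n => y 0 i)) => //.
  exact: differentiable_coord.
move=> v; have := derive_mx (@diff_derivable _ _ _ f x v df); rewrite hf => ->; by rewrite mxE.
Qed.

Lemma hasD_Z (V : normedModType R) n (f : V -> R) (g : V -> 'rV[R]_n) x L M :
  hasD f x L -> hasD g x M ->
  hasD (fun y => f y *: g y) x (fun v => L v *: g x + f x *: M v).
Proof.
move=> hf hg; apply: hasD_rVP => i.
have := hasD_M hf (hasD_rV_coord i hg).
rewrite (_ : (fun y => f y * g y 0 i) = fun y => (f y *: g y) 0 i); last first.
  by apply/funext => y; rewrite mxE.
by move/hasD_eq; apply => v; rewrite !mxE.
Qed.

Lemma hasD_comp (V : normedModType R) n (f : V -> 'rV[R]_n) (W : normedModType R)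
    (g : 'rV[R]_n -> W) x L M :
  hasD f x L -> hasD g (f x) M -> hasD (fun y => g (f y)) x (fun v => M (L v)).
Proof.
move=> [df hf] [dg hg]; have dc : differentiable (g \o f) x by exact: differentiable_comp.
split=> // v; rewrite (deriveE v dc) diff_comp//= -(deriveE v df) hf.
by rewrite -deriveE.
Qed.

End hasD_rV.

(** * The hyperboloid model *)

Section minkowski.
Context {R : realType}.

Definition dot m (x y : 'rV[R]_m) : R := (x *m y^T) 0 0.
Definition wt m (x : 'rV[R]_m) : R := Num.sqrt (1 + dot x x).

Section dot.
Context {m : nat}.
Implicit Types (x y z : 'rV[R]_m).

Lemma dotE x y : dot x y = \sum_i x 0 i * y 0 i.
Proof. by rewrite /dot mxE; apply: eq_bigr => i _; rewrite mxE. Qed.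

Lemma dotC x y : dot x y = dot y x.
Proof. by rewrite !dotE; apply: eq_bigr => i _; rewrite mulrC. Qed.

Lemma dotDl x y z : dot (x + y) z = dot x z + dot y z.
Proof. by rewrite /dot mulmxDl mxE. Qed.

Lemma dotDr x y z : dot z (x + y) = dot z x + dot z y.
Proof. by rewrite dotC dotDl !(dotC _ z). Qed.

Lemma dotZl a x y : dot (a *: x) y = a * dot x y.
Proof. by rewrite /dot -scalemxAl mxE. Qed.

Lemma dotZr a x y : dot x (a *: y) = a * dot x y.
Proof. by rewrite dotC dotZl dotC. Qed.

Lemma dotNl x y : dot (- x) y = - dot x y.
Proof. by rewrite -scaleN1r dotZl mulN1r. Qed.

Lemma dotNr x y : dot x (- y) = - dot x y.
Proof. by rewrite dotC dotNl dotC. Qed.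

Lemma dotBl x y z : dot (x - y) z = dot x z - dot y z.
Proof. by rewrite dotDl dotNl. Qed.

Lemma dotBr x y z : dot z (x - y) = dot z x - dot z y.
Proof. by rewrite dotDr dotNr. Qed.

Definition dotrw := (dotDl, dotDr, dotBl, dotBr, dotZl, dotZr, dotNl, dotNr).

Lemma dot_delta x i : dot x (delta_mx 0 i) = x 0 i.
Proof.
rewrite dotE (bigD1 i)//= big1.
  by rewrite mxE !eqxx mulr1 addr0.
by move=> j ji; rewrite mxE (negbTE ji) andbF mulr0.
Qed.

Lemma dot_ge0 x : 0 <= dot x x.
Proof. by rewrite dotE sumr_ge0// => i _; rewrite -expr2 sqr_ge0. Qed.

Lemma dot_eq0 x : (dot x x == 0) = (x == 0).
Proof.
apply/idP/idP => [|/eqP ->]; last by rewrite /dot mul0mx mxE.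
rewrite dotE psumr_eq0; last by move=> i _; rewrite -expr2 sqr_ge0.
move=> /allP h; apply/eqP/rowP => i; rewrite mxE.
by have := h i (mem_index_enum _); rewrite /= mulf_eq0 orbb => /eqP.
Qed.

Lemma dot_cauchy x y : dot x y ^+ 2 <= dot x x * dot y y.
Proof.
have [/eqP|yy] := eqVneq (dot y y) 0.
  by rewrite dot_eq0 => /eqP ->; rewrite /dot trmx0 mulmx0 mul0mx !mxE expr0n mulr0.
have yy0 : 0 < dot y y by rewrite lt_neqAle eq_sym yy dot_ge0.
have := dot_ge0 (dot y y *: x - dot x y *: y).
rewrite !dotrw !(dotC y x) => h.
rewrite -subr_ge0 -(pmulr_rge0 _ yy0).
apply: le_trans h _; rewrite le_eqVlt; apply/orP; left; apply/eqP; ring.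
Qed.

Lemma wt2 x : wt x ^+ 2 = 1 + dot x x.
Proof. by rewrite sqr_sqrtr// addr_ge0// dot_ge0. Qed.

Lemma wt_gt0 x : 0 < wt x.
Proof. by rewrite sqrtr_gt0 ltr_wpDr// dot_ge0. Qed.

Lemma wt_neq0 x : wt x != 0. Proof. by rewrite gt_eqF// wt_gt0. Qed.

Lemma dotxx x : dot x x = wt x ^+ 2 - 1.
Proof. by rewrite wt2 addrC addKr. Qed.

Lemma wt_ge1 x : 1 <= wt x.
Proof.
have := dot_ge0 x; rewrite dotxx; have := wt_gt0 x; nra.
Qed.

Lemma hyp_metricE x i j : hyp_metric x i j = (i == j)%:R - x 0 i * x 0 j / wt x ^+ 2.
Proof.
by rewrite /hyp_metric -/(dot x x) -wt2; set c := wt x ^- 2; rewrite !mxE big_ord1 !mxE mulrC.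
Qed.

Lemma innerE x u v : inner hyp_metric x u v = dot u v - dot x u * dot x v / wt x ^+ 2.
Proof.
rewrite /inner /hyp_metric -/(dot x x) -wt2; set c := wt x ^- 2.
have -> : u *m (1%:M - c *: (x^T *m x)) *m v^T = u *m v^T - c *: ((u *m x^T) *m (x *m v^T)).
  by rewrite mulmxBr mulmx1 mulmxBl -scalemxAr -scalemxAl !mulmxA.
set T := (u *m x^T) *m (x *m v^T).
have TE : T 0 0 = dot u x * dot x v by rewrite /T mxE big_ord1.
by rewrite mxE -/(dot u v) [X in _ + X]mxE [X in _ - X]mxE TE (dotC u x) mulrC.
Qed.

(** The bordered matrix [M] factors into triangular blocks in two ways, and the determinants of the
    two factorizations are compared. *)
Lemma det_rank1 (u v : 'rV[R]_m) : \det (1%:M + u^T *m v) = 1 + dot v u.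
Proof.
pose M := block_mx 1%:M v (- u^T) 1%:M : 'M[R]_(1 + m).
have E1 : M = block_mx 1%:M 0 (- u^T) 1%:M *m block_mx 1%:M v 0 (1%:M + u^T *m v).
  by rewrite mulmx_block !mul1mx !mul0mx !mulmx1 !addr0 ?mulmx0 ?addr0 mulNmx addrCA addNr addr0 .
have E2 : M = block_mx (1%:M + v *m u^T) v 0 1%:M *m block_mx 1%:M 0 (- u^T) 1%:M.
  by rewrite mulmx_block !mulmx1 !mul0mx !mulmx0 !mul1mx !add0r mulmxN addrK.
have := congr1 determinant E1; rewrite E2 !det_mulmx !det_ublock !det_lblock !det1 !mul1r !mulr1.
by move=> <-; rewrite det_mx11 mxE mxE eqxx.
Qed.

Lemma det_hyp_metric x : \det (hyp_metric x) = wt x ^- 2.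
Proof.
have -> : hyp_metric x = 1%:M + (- wt x ^- 2 *: x)^T *m x.
  rewrite /hyp_metric -/(dot x x) -wt2.
  have -> : (- wt x ^- 2 *: x)^T = - wt x ^- 2 *: x^T by apply/matrixP => i j; rewrite !mxE.
  by rewrite -scalemxAl scaleNr.
rewrite det_rank1 dotZr dotxx; field; exact: wt_neq0.
Qed.

Lemma vol_density_hyp x : vol_density hyp_metric x = (wt x)^-1.
Proof.
by rewrite /vol_density det_hyp_metric -exprVn sqrtr_sqr ger0_norm// invr_ge0 ltW// wt_gt0.
Qed.

Lemma hyp_metricV x : hyp_metric x *m (1%:M + x^T *m x) = 1%:M.
Proof.
rewrite /hyp_metric -/(dot x x) -wt2 mulmxDr mulmx1 mulmxBl mul1mx -scalemxAl.
rewrite mulmxA -(mulmxA _ x) [x *m x^T]mx11_scalar -/(dot x x) mul_mx_scalar -scalemxAl scalerA.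
rewrite -addrA -[RHS]addr0; congr (_ + _).
rewrite -{2}[x^T *m x]scale1r -scaleNr -scalerBl -scalerDl dotxx.
rewrite (_ : _ + _ = 0) ?scale0r//; field; exact: wt_neq0.
Qed.

Lemma hyp_metric_unit x : hyp_metric x \in unitmx.
Proof. by have /mulmx1_unit[] := hyp_metricV x. Qed.

Lemma invmx_hyp_metric x : invmx (hyp_metric x) = 1%:M + x^T *m x.
Proof. by rewrite -[RHS](mulKmx (hyp_metric_unit x)) hyp_metricV mulmx1. Qed.

Lemma invmx_hyp_metricE x i j : invmx (hyp_metric x) i j = (i == j)%:R + x 0 i * x 0 j.
Proof. by rewrite invmx_hyp_metric !mxE big_ord1 !mxE. Qed.

Lemma hasD_dot (V : normedModType R) (f g : V -> 'rV[R]_m) (x : V) L M :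
  hasD f x L -> hasD g x M ->
  hasD (fun y : V => dot (f y) (g y)) x (fun v => dot (L v) (g x) + dot (f x) (M v)).
Proof.
move=> hf hg; rewrite (_ : (fun _ => _) = fun y : V => \sum_i f y 0 i * g y 0 i); last first.
  by apply/funext => y; rewrite dotE.
apply: hasD_eq.
  by apply: hasD_sum => i _; apply: hasD_M; apply: hasD_rV_coord; [exact: hf|exact: hg].
by move=> v /=; rewrite !dotE -big_split.
Qed.

Lemma hasD_wt (V : normedModType R) (f : V -> 'rV[R]_m) (x : V) L : hasD f x L ->
  hasD (fun y : V => wt (f y)) x (fun v => dot (f x) (L v) / wt (f x)).
Proof.
move=> hf; apply: hasD_eq.
  apply: hasD_sqrt; last by apply: hasD_D; [exact: hasD_cst|exact: (hasD_dot hf hf)].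
  by rewrite ltr_wpDr// dot_ge0.
move=> v /=; rewrite add0r (dotC (L v)) -/(wt (f x)); field; exact: wt_neq0.
Qed.

(** In Minkowski space the second derivatives of the lift are vertical, since its space part is the
    chart itself. By the Gauss formula they are the covariant derivative plus [g_ij] times the
    position vector; the space part of this identity reads [0 = Gamma^k_ij + g_ij x^k]. *)
Lemma christoffelE x k i j : christoffel hyp_metric x k i j = - x 0 k * hyp_metric x i j.
Proof.
have D a b c : 'D_(delta_mx 0 c) (fun y : 'rV[R]_m => hyp_metric y a b) x =
   - ((a == c)%:R * x 0 b + x 0 a * (b == c)%:R) / wt x ^+ 2 + 2 * x 0 a * x 0 b * x 0 c / wt x ^+ 4.
  rewrite (_ : (fun _ => _) = fun y => (a == b)%:R - y 0 a * y 0 b * (1 + dot y y)^-1); last first.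
    by apply/funext => y; rewrite hyp_metricE wt2.
  have : hasD (fun y : 'rV[R]_m => (a == b)%:R - y 0 a * y 0 b * (1 + dot y y)^-1) x
     (fun v => 0 - ((v 0 a * x 0 b + x 0 a * v 0 b) * (1 + dot x x)^-1 +
        x 0 a * x 0 b * (- (0 + (dot v x + dot x v)) / (1 + dot x x) ^+ 2))).
    apply: hasD_B; first exact: hasD_cst.
    apply: hasD_M; first by apply: hasD_M; exact: hasD_coord.
    apply: hasD_V; first by rewrite -wt2 expf_neq0// wt_neq0.
    by apply: hasD_D; [exact: hasD_cst|apply: hasD_dot; exact: hasD_id].
  move=> [_ ->]; rewrite (dotC (delta_mx _ _)) dot_delta !mxE !eqxx /= -wt2.
  by field; exact: wt_neq0.
rewrite /christoffel.
rewrite (eq_bigr (fun l => (- 2 / wt x ^+ 2 * hyp_metric x i j) *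
    ((k == l)%:R * x 0 l + x 0 k * (x 0 l * x 0 l)))); last first.
  move=> l _; rewrite invmx_hyp_metricE !D hyp_metricE (eq_sym j i) (eq_sym l i) (eq_sym l j).
  by field; exact: wt_neq0.
rewrite -mulr_sumr.
rewrite big_split/= -mulr_sumr -dotE dotxx (bigD1 k)//= eqxx big1 ?addr0; last first.
  by move=> l; rewrite eq_sym => /negbTE ->; rewrite mul0r.
rewrite /= mulr1n; by field; exact: wt_neq0.
Qed.

End dot.
End minkowski.

Section coshd.
Context {R : realType} {m : nat}.
Implicit Types (x y z u v o : 'rV[R]_m).

(** Minus the Minkowski product of the lifts of [o] and [x]; [cosh_distE] identifies it with the
    hyperbolic cosine of their distance. *)
Definition coshd o x : R := wt o * wt x - dot o x.

Lemma coshdxx x : coshd x x = 1.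
Proof. by rewrite /coshd dotxx; ring. Qed.

Lemma dot0l x : dot 0 x = 0 :> R.
Proof. by rewrite -(scale0r 0) dotZl mul0r. Qed.

Lemma innerC x u v : inner hyp_metric x u v = inner hyp_metric x v u.
Proof. by rewrite !innerE dotC [dot x u * _]mulrC. Qed.

Lemma innerDl x u v z : inner hyp_metric x (u + v) z = inner hyp_metric x u z + inner hyp_metric x v z.
Proof. by rewrite !innerE !dotrw; ring. Qed.

Lemma innerZl x a u z : inner hyp_metric x (a *: u) z = a * inner hyp_metric x u z.
Proof. by rewrite !innerE !dotrw; ring. Qed.

Lemma innerDr x u v z : inner hyp_metric x z (u + v) = inner hyp_metric x z u + inner hyp_metric x z v.
Proof. by rewrite !(innerC x z) innerDl. Qed.

Lemma innerZr x a u z : inner hyp_metric x z (a *: u) = a * inner hyp_metric x z u.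
Proof. by rewrite !(innerC x z) innerZl. Qed.

Lemma innerNl x u z : inner hyp_metric x (- u) z = - inner hyp_metric x u z.
Proof. by rewrite -scaleN1r innerZl mulN1r. Qed.

Lemma innerNr x u z : inner hyp_metric x z (- u) = - inner hyp_metric x z u.
Proof. by rewrite !(innerC x z) innerNl. Qed.

Definition innerrw := (innerDl, innerDr, innerNl, innerNr, innerZl, innerZr).

Lemma inner_ge x v : dot v v <= wt x ^+ 2 * inner hyp_metric x v v.
Proof.
rewrite innerE mulrBr mulrCA mulfV ?expf_neq0 ?wt_neq0// mulr1.
have := dot_cauchy x v; rewrite dotxx; lra.
Qed.

Lemma inner_ge0 x v : 0 <= inner hyp_metric x v v.
Proof.
have w0 : 0 < wt x ^+ 2 by rewrite exprn_gt0// wt_gt0.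
by rewrite -(pmulr_rge0 _ w0); exact: le_trans (dot_ge0 _) (inner_ge x v).
Qed.

Lemma inner_eq0 x v : inner hyp_metric x v v = 0 -> v = 0.
Proof.
move=> h; have := inner_ge x v; rewrite h mulr0 => h2.
by apply/eqP; rewrite -dot_eq0 eq_le h2 dot_ge0.
Qed.

Lemma inner_cauchy x u v : inner hyp_metric x u v ^+ 2 <=
  inner hyp_metric x u u * inner hyp_metric x v v.
Proof.
have [/inner_eq0 ->|vv] := eqVneq (inner hyp_metric x v v) 0.
  by rewrite -(scale0r (0 : 'rV[R]_m)) !innerZr !mul0r expr0n mulr0.
have vv0 : 0 < inner hyp_metric x v v by rewrite lt_neqAle eq_sym vv inner_ge0.
have := inner_ge0 x (inner hyp_metric x v v *: u - inner hyp_metric x u v *: v).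
rewrite !innerrw !(innerC x v u) => h.
rewrite -subr_ge0 -(pmulr_rge0 _ vv0).
apply: le_trans h _; rewrite le_eqVlt; apply/orP; left; apply/eqP; ring.
Qed.

(** The left side is the squared product of the Minkowski vector [(xi, xi0)] with the lift of the
    tangent vector [v]. Adding [f] times the position vector makes [(xi, xi0)] tangent without
    changing this product, and [inner_cauchy] applies. *)
Lemma minkowski_cauchy (xi : 'rV[R]_m) (xi0 : R) y v :
  (dot xi v - xi0 * (dot y v / wt y)) ^+ 2 <=
  (dot xi xi - xi0 ^+ 2 + (dot xi y - xi0 * wt y) ^+ 2) * inner hyp_metric y v v.
Proof.
pose f := dot xi y - xi0 * wt y.
have yu : dot y (xi + f *: y) = wt y * (xi0 + f * wt y).
  by rewrite !dotrw dotxx (dotC y xi) /f; ring.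
apply: le_trans (le_trans (inner_cauchy y (xi + f *: y) v) _).
  rewrite innerE yu !dotrw le_eqVlt; apply/orP; left; apply/eqP; congr (_ ^+ 2).
  rewrite dotC /f; field; exact: wt_neq0.
rewrite le_eqVlt; apply/orP; left; apply/eqP; congr (_ * _).
rewrite innerE yu !dotrw (dotxx y) (dotC y xi) /f; field; exact: wt_neq0.
Qed.

Lemma ler_of_sqr (a b : R) : 0 <= b -> a ^+ 2 <= b ^+ 2 -> a <= b.
Proof. by move=> b0 h; rewrite leNgt; apply/negP => ab; nra. Qed.

Lemma coshd_ge1 o x : 1 <= coshd o x.
Proof.
suff : dot o x <= wt o * wt x - 1 by rewrite /coshd; lra.
have := dot_cauchy o x; rewrite !dotxx.
have := wt_ge1 o; have := wt_ge1 x.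
set a := wt o; set b := wt x; set d := dot o x => h1 h2 h3.
apply: ler_of_sqr; first by nra.
apply: le_trans h3 _; rewrite -subr_ge0.
rewrite (_ : _ - _ = (a - b) ^+ 2); first exact: sqr_ge0.
ring.
Qed.

Lemma hasD_coshd (V : normedModType R) (f : V -> 'rV[R]_m) (x : V) L o : hasD f x L ->
  hasD (fun y : V => coshd o (f y)) x (fun v : V => wt o * (dot (f x) (L v) / wt (f x)) - dot o (L v)).
Proof.
move=> hf; apply: hasD_eq.
  apply: hasD_B; last by apply: hasD_dot; [exact: hasD_cst|exact: hf].
  by apply: hasD_M; [exact: hasD_cst|exact: hasD_wt hf].
by move=> v /=; rewrite dot0l; ring.
Qed.

End coshd.

(** * Geodesics and the distance formula *)

Section geodesics.
Context {R : realType} {m : nat}.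

Definition sinh (t : R) : R := (expR t - expR (- t)) / 2.

Lemma cosh2_sinh2 t : cosh t ^+ 2 - sinh t ^+ 2 = 1.
Proof.
rewrite /cosh /sinh; have := expRxMexpNx_1 t; set a := expR t; set b := expR _ => h.
rewrite (_ : _ - _ = a * b); first by rewrite h. by field.
Qed.

Lemma hasD_expR (V : normedModType R) (f : V -> R) (x : V) L : hasD f x L ->
  hasD (fun y => expR (f y)) x (fun v => expR (f x) * L v).
Proof. by move=> hf; apply: hasD_comp1 hf; exact: is_derive_expR. Qed.

Lemma hasD_cosh (V : normedModType R) (f : V -> R) (x : V) L : hasD f x L ->
  hasD (fun y => cosh (f y)) x (fun v => sinh (f x) * L v).
Proof.
move=> hf; apply: (@hasD_eq _ _ _ (fun y => (expR (f y) + expR (- f y)) * 2^-1)).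
  apply: hasD_M; last exact: hasD_cst.
  apply: hasD_D; first exact: hasD_expR hf.
  by apply: hasD_expR; exact: hasD_N hf.
by move=> v; rewrite /= /sinh; field.
Qed.

Lemma hasD_sinh (V : normedModType R) (f : V -> R) (x : V) L : hasD f x L ->
  hasD (fun y => sinh (f y)) x (fun v => cosh (f x) * L v).
Proof.
move=> hf; apply: (@hasD_eq _ _ _ (fun y => (expR (f y) - expR (- f y)) * 2^-1)).
  apply: hasD_M; last exact: hasD_cst.
  apply: hasD_B; first exact: hasD_expR hf.
  by apply: hasD_expR; exact: hasD_N hf.
by move=> v; rewrite /= /cosh; field.
Qed.

Lemma hasD_cont (V W : normedModType R) (f : V -> W) (x : V) L : hasD f x L -> {for x, continuous f}.
Proof. by move=> [/differentiable_continuous]. Qed.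

Lemma hasD_derive1 (W : normedModType R) (f : R -> W) (x : R) L : hasD f x L ->
  derivable f x 1 /\ derive1 f x = L 1.
Proof.
move=> [df h]; split; first exact: diff_derivable.
by rewrite derive1E h.
Qed.

Definition arsinh (a : R) := ln (a + Num.sqrt (1 + a ^+ 2)).

Lemma arsinh_pos (a : R) : 0 < a + Num.sqrt (1 + a ^+ 2).
Proof.
have h : 0 < 1 + a ^+ 2 by rewrite ltr_wpDr// sqr_ge0.
have s0 : 0 < Num.sqrt (1 + a ^+ 2) by rewrite sqrtr_gt0.
have s2 := sqr_sqrtr (ltW h); move: s0 s2; set s := Num.sqrt _ => s0 s2.
by rewrite ltNge; apply/negP => sa; nra.
Qed.

Lemma hasD_arsinh (V : normedModType R) (f : V -> R) (x : V) L : hasD f x L ->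
  hasD (fun y => arsinh (f y)) x (fun v => L v / Num.sqrt (1 + f x ^+ 2)).
Proof.
move=> hf; have h : 0 < 1 + f x ^+ 2 by rewrite ltr_wpDr// sqr_ge0.
have hs : hasD (fun y => f y + Num.sqrt (1 + f y * f y)) x
   (fun v => L v + (0 + (L v * f x + f x * L v)) / (2 * Num.sqrt (1 + f x * f x))).
  apply: hasD_D => //; apply: hasD_sqrt; first by rewrite -expr2.
  by apply: hasD_D; [exact: hasD_cst|exact: hasD_M].
have pos := arsinh_pos (f x); rewrite expr2 in pos.
have := @hasD_comp1 _ _ (fun y => f y + Num.sqrt (1 + f y * f y)) _ _ _ _ (is_derive1_ln pos) hs.
rewrite (_ : (fun y => ln (f y + Num.sqrt (1 + f y * f y))) = fun y => arsinh (f y)); last first.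
  by apply/funext => y; rewrite /arsinh expr2.
move/hasD_eq; apply => v; rewrite -expr2 in pos *; field.
by rewrite !gt_eqF// sqrtr_gt0.
Qed.

(** For a spacelike unit vector, [arsinh] of the product with it is the signed distance to a totally
    geodesic hyperplane. The left side is its derivative along [v], and the bound says that it is
    1-Lipschitz. *)
Lemma speed_bound (xi : 'rV[R]_m) (xi0 : R) y v : dot xi xi - xi0 ^+ 2 = 1 ->
  (dot xi v - xi0 * (dot y v / wt y)) / Num.sqrt (1 + (dot xi y - xi0 * wt y) ^+ 2) <=
  Num.sqrt (inner hyp_metric y v v).
Proof.
move=> h; have := minkowski_cauchy xi xi0 y v; rewrite h.
set a := (X in X ^+ 2 <= _); set b := (X in 1 + X ^+ 2); set c := inner _ _ _ _ => hh.
have p : 0 < 1 + b ^+ 2 by rewrite ltr_wpDr// sqr_ge0.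
rewrite ler_pdivrMr ?sqrtr_gt0// -sqrtrM ?inner_ge0//.
have c0 : 0 <= c by exact: inner_ge0.
by apply: ler_of_sqr; rewrite ?sqrtr_ge0// sqr_sqrtr ?mulr_ge0 ?(ltW p)// [leRHS]mulrC.
Qed.

Lemma cont_dot (T : topologicalType) (f g : T -> 'rV[R]_m) (t : T) :
  {for t, continuous f} -> {for t, continuous g} -> {for t, continuous (fun s => dot (f s) (g s))}.
Proof.
move=> cf cg; rewrite (_ : (fun _ => _) = fun s => \sum_i f s 0 i * g s 0 i); last first.
  by apply/funext => s; rewrite dotE.
by apply: continuous_sumr => i _; apply: contM; apply: continuous_coordP.
Qed.

Lemma cont_wt (T : topologicalType) (f : T -> 'rV[R]_m) (t : T) :
  {for t, continuous f} -> {for t, continuous (fun s => wt (f s))}.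
Proof.
by move=> cf; apply: cont_sqrt; apply: contD; [exact: contC|exact: cont_dot].
Qed.

Lemma cont_inner (T : topologicalType) (f g h : T -> 'rV[R]_m) (t : T) :
  {for t, continuous f} -> {for t, continuous g} -> {for t, continuous h} ->
  {for t, continuous (fun s => inner hyp_metric (f s) (g s) (h s))}.
Proof.
move=> cf cg ch; rewrite (_ : (fun _ => _) = fun s => dot (g s) (h s) - dot (f s) (g s) * dot (f s) (h s) / wt (f s) ^+ 2); last first.
  by apply/funext => s; rewrite innerE.
apply: contB; first exact: cont_dot.
apply: contM; first by apply: contM; exact: cont_dot.
by apply: contV; [rewrite expf_neq0// wt_neq0|apply: contX; exact: cont_wt].
Qed.

Lemma integrable_cont01 (f : R -> R) : continuous f ->
  lebesgue_measure.-integrable (`[0, 1]%classic : set (measurableTypeR R)) (EFin \o f).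
Proof.
move=> cf; apply: continuous_compact_integrable; first exact: segment_compact.
exact: continuous_subspaceT.
Qed.

Lemma curve_length_ge (xi : 'rV[R]_m) (xi0 : R) (c : R -> 'rV[R]_m) :
  dot xi xi - xi0 ^+ 2 = 1 ->
  (forall t, derivable c t 1) -> continuous (derive1 c) ->
  arsinh (dot xi (c 1) - xi0 * wt (c 1)) - arsinh (dot xi (c 0) - xi0 * wt (c 0)) <=
  curve_length hyp_metric c.
Proof.
move=> h dc cc'.
have hc t : hasD c t (fun s => s *: derive1 c t).
  have df : differentiable c t by apply/derivable1_diffP.
  split=> // v; rewrite (deriveE v df) derive1E (@deriveE _ _ _ c t 1 df).
  by rewrite -{1}[v]mulr1 -[v * 1]/(v *: 1) linearZ.
have cc : continuous c by move=> t; exact: hasD_cont (hc t).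
pose F t := arsinh (dot xi (c t) - xi0 * wt (c t)).
pose f t := (dot xi (derive1 c t) - xi0 * (dot (c t) (derive1 c t) / wt (c t))) /
   Num.sqrt (1 + (dot xi (c t) - xi0 * wt (c t)) ^+ 2).
have hF t : hasD F t (fun s => s * f t).
  apply: hasD_eq.
    apply: hasD_arsinh; apply: hasD_B.
      by apply: hasD_dot; [exact: hasD_cst|exact: hc].
    by apply: hasD_M; [exact: hasD_cst|exact: hasD_wt (hc t)].
  by move=> v /=; rewrite /f dot0l !dotrw; ring.
have cF : continuous F by move=> t; exact: hasD_cont (hF t).
have cf : continuous f.
  suff : forall t, {for t, continuous f} by [].
  move=> t; rewrite /f; apply: contM.
    apply: contB; first by apply: cont_dot; [exact: contC|exact: cc'].
    apply: contM; first exact: contC.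
    apply: contM; first by apply: cont_dot; [exact: cc|exact: cc'].
    by apply: contV; [exact: wt_neq0|apply: cont_wt; exact: cc].
  apply: contV; first by rewrite gt_eqF// sqrtr_gt0 ltr_wpDr// sqr_ge0.
  apply: cont_sqrt; apply: contD; first exact: contC.
  apply: contX; apply: contB; first by apply: cont_dot; [exact: contC|exact: cc].
  by apply: contM; [exact: contC|apply: cont_wt; exact: cc].
have FTC : (\int[lebesgue_measure]_(t in `[0%R, 1%R]) (f t)%:E = (F 1)%:E - (F 0)%:E)%E.
  apply: continuous_FTC2 => //.
  - exact: continuous_subspaceT.
  - split; first by move=> t _; have [] := hasD_derive1 (hF t).
      exact/cvg_at_right_filter/cF.
    exact/cvg_at_left_filter/cF.
  - by move=> t _; have [_ ->] := hasD_derive1 (hF t); rewrite mul1r.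
rewrite -/(F 1) -/(F 0) (_ : F 1 - F 0 = \int[lebesgue_measure]_(t in `[0, 1]) f t); last first.
  by rewrite /Rintegral FTC.
apply: le_Rintegral => //.
- exact: integrable_cont01.
- have cs t : {for t, continuous (fun t => Num.sqrt (inner hyp_metric (c t) (derive1 c t) (derive1 c t)))}.
    by apply: cont_sqrt; apply: cont_inner; [exact: cc|exact: cc'|exact: cc'].
  exact: integrable_cont01.
- by move=> t _; exact: speed_bound.
Qed.

Lemma arsinh_coshd o (x : 'rV[R]_m) :
  cosh (arsinh (Num.sqrt (coshd o x ^+ 2 - 1))) = coshd o x.
Proof.
have c1 := coshd_ge1 o x; have p := arsinh_pos (Num.sqrt (coshd o x ^+ 2 - 1)).
have c0 : 0 <= coshd o x ^+ 2 - 1 by nra.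
rewrite /cosh expRN lnK ?posrE// in p *.
have E : 1 + Num.sqrt (coshd o x ^+ 2 - 1) ^+ 2 = coshd o x ^+ 2 by rewrite sqr_sqrtr//; ring.
rewrite E sqrtr_sqr ger0_norm in p *; last lra.
have := sqr_sqrtr c0; move: p; set s := Num.sqrt _ => p s2.
have -> : (s + coshd o x)^-1 = coshd o x - s.
  by apply: (mulfI (lt0r_neq0 p)); rewrite divff ?gt_eqF//; move: s2; set c := coshd o x => s2; nra.
by field.
Qed.

(** The explicit geodesic [c] has length [d], and the signed distance to the hyperplane orthogonal
    to it at [o] grows from 0 to [d], so that no competing curve is shorter. *)
Lemma riem_dist_hyp o (x : 'rV[R]_m) :
  riem_dist hyp_metric o x = arsinh (Num.sqrt (coshd o x ^+ 2 - 1)).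
Proof.
have c1 := coshd_ge1 o x.
set d := arsinh _.
have d0 : 0 <= d.
  have h1 : 1 <= Num.sqrt (1 + Num.sqrt (coshd o x ^+ 2 - 1) ^+ 2).
    by rewrite -{1}sqrtr1 ler_sqrt ?lerDl ?sqr_ge0// ltr_wpDr// sqr_ge0.
  by rewrite /d /arsinh ln_ge0// ler_wpDl// sqrtr_ge0.
have lb0 (c : R -> 'rV[R]_m) : 0 <= curve_length hyp_metric c by apply: Rintegral_ge0 => t _; exact: sqrtr_ge0.
have hlb : has_lbound [set curve_length hyp_metric c | c in [set c : R -> 'rV[R]_m |
    [/\ forall t, derivable c t 1, continuous (derive1 c), c 0 = o & c 1 = x]]].
  by exists 0 => _ [c _ <-].
(* Coincident points are treated apart, since there is no initial direction to normalize. *)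
have [cE|cN] := eqVneq (coshd o x) 1.
  have dE : d = 0 by rewrite /d cE expr1n subrr sqrtr0 /arsinh expr0n /= addr0 sqrtr1 add0r ln1.
  have xo : o = x.
    have : dot (wt x *: o - wt o *: x) (wt x *: o - wt o *: x) = - (wt x - wt o) ^+ 2.
      move: cE; rewrite /coshd !dotrw (dotC x o) !dotxx => cE.
      have -> : dot o x = wt o * wt x - 1 by lra.
      by ring.
    have := dot_ge0 (wt x *: o - wt o *: x) => h1 h2.
    have h3 : (wt x - wt o) ^+ 2 = 0.
      by apply/eqP; rewrite eq_le sqr_ge0 andbT -oppr_ge0 -h2.
    have ww : wt x = wt o by move/eqP: h3; rewrite sqrf_eq0 subr_eq0 => /eqP.
    move/eqP: h2; rewrite h3 oppr0 dot_eq0 ww -scalerBr scaler_eq0 (negbTE (wt_neq0 o)) /= subr_eq0.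
    by move/eqP.
  apply/eqP; rewrite eq_le dE; apply/andP; split; last first.
    apply: lb_le_inf; last by move=> _ [c _ <-].
    exists (curve_length hyp_metric (fun=> o)), (fun=> o) => //; split => //.
      by move=> t; rewrite (_ : derive1 _ = fun=> 0); [exact: cst_continuous|apply/funext => s; rewrite derive1_cst].
  apply: (le_trans (ge_inf hlb _)).
    exists (fun=> o) => //; split => //.
    by move=> t; rewrite (_ : derive1 _ = fun=> 0); [exact: cst_continuous|apply/funext => s; rewrite derive1_cst].
  rewrite /curve_length (_ : (fun _ => _) = fun=> 0); last first.
    apply/funext => t; rewrite derive1_cst -(scale0r (0 : 'rV[R]_m)) innerZr mul0r sqrtr0//.
  by rewrite Rintegral_cst// mul0r.
have s0 : 0 < coshd o x ^+ 2 - 1 by move/eqP: cN; nra.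
pose s := Num.sqrt (coshd o x ^+ 2 - 1).
have sp : 0 < s by rewrite sqrtr_gt0.
have s2 : s ^+ 2 = coshd o x ^+ 2 - 1 by rewrite sqr_sqrtr// ltW.
(* [(xi, xi0)] is the unit initial velocity at [o] of the geodesic to [x]: the component of the lift
   of [x] orthogonal to that of [o], divided by the hyperbolic sine of the distance. *)
pose xi := s^-1 *: (x - coshd o x *: o).
pose xi0 := s^-1 * (wt x - coshd o x * wt o).
have sN : s != 0 by rewrite gt_eqF.
have dox : dot o x = wt o * wt x - coshd o x by rewrite /coshd; ring.
have xixi : dot xi xi - xi0 ^+ 2 = 1.
  rewrite /xi /xi0 !dotrw (dotC x o) !dotxx dox.
  apply: (mulIf (expf_neq0 2 sN)); rewrite mul1r {2}s2; field; exact: sN.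
have f0 : dot xi o - xi0 * wt o = 0.
  by rewrite /xi /xi0 !dotrw (dotC x o) !dotxx dox; ring.
have f1 : dot xi x - xi0 * wt x = s.
  apply: (mulIf sN); rewrite -expr2 s2 /xi /xi0 !dotrw dotxx dox; field; exact: sN.
have xE : coshd o x *: o + s *: xi = x.
  by rewrite /xi scalerA mulfV// scale1r addrC subrK.
clearbody xi xi0.
have chd : cosh d = coshd o x by exact: arsinh_coshd.
have shd : sinh d = s.
  have h1 : sinh d ^+ 2 = s ^+ 2 by rewrite s2 -chd -(cosh2_sinh2 d); ring.
  have h2 : 0 <= sinh d.
    rewrite /sinh divr_ge0// subr_ge0 ler_expR; lra.
  by apply/eqP; rewrite -(eqrXn2 (n := 2))// ?ltW// h1.
pose c (t : R) := cosh (t * d) *: o + sinh (t * d) *: xi.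
pose c' (t : R) := d *: (sinh (t * d) *: o + cosh (t * d) *: xi).
have htd (t : R) : hasD (fun t : R => t * d) t (fun v => v * d + t * 0).
  by apply: hasD_M; [exact: hasD_id|exact: hasD_cst].
have hc t : hasD c t (fun v => v *: c' t).
  apply: hasD_eq.
    apply: hasD_D; apply: hasD_Z; try exact: hasD_cst.
      by apply: hasD_cosh; exact: htd.
    by apply: hasD_sinh; exact: htd.
  move=> v /=; rewrite /c' !scaler0 !addr0 mulr0 addr0 !scalerDr !scalerA.
  by congr (_ *: _ + _ *: _); ring.
have dc t : derive1 c t = c' t by have [_ ->] := hasD_derive1 (hc t); rewrite scale1r.
have wc t : 1 + dot (c t) (c t) = (cosh (t * d) * wt o + sinh (t * d) * xi0) ^+ 2.
  have := cosh2_sinh2 (t * d); rewrite /c !dotrw (dotC o xi) dotxx => h.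
  have -> : dot xi o = xi0 * wt o by lra.
  have -> : dot xi xi = 1 + xi0 ^+ 2 by lra.
  set a := cosh _ in h *; set b := sinh _ in h *.
  rewrite -[X in X + _ = _]h; ring.
have speed t : inner hyp_metric (c t) (derive1 c t) (derive1 c t) = d ^+ 2.
  rewrite dc innerE wt2 wc.
  have h := cosh2_sinh2 (t * d).
  have := dot_ge0 (c t); rewrite -(lerD2l 1) addr0 wc => Q1.
  have dxo : dot xi o = xi0 * wt o by lra.
  have dxx : dot xi xi = 1 + xi0 ^+ 2 by lra.
  have cc : dot (c t) (c' t) = d * ((cosh (t * d) * wt o + sinh (t * d) * xi0) * (sinh (t * d) * wt o + cosh (t * d) * xi0)).
    by rewrite /c /c' !dotrw (dotC o xi) dotxx dxo dxx; ring.
  have c'c' : dot (c' t) (c' t) = d ^+ 2 * ((sinh (t * d) * wt o + cosh (t * d) * xi0) ^+ 2 + (cosh (t * d) ^+ 2 - sinh (t * d) ^+ 2)).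
    by rewrite /c' !dotrw (dotC o xi) dotxx dxo dxx; ring.
  rewrite cc c'c' h; set Q := (cosh _ * wt o + _) in Q1 *.
  have Q0 : Q != 0 by apply/eqP => Q0; move: Q1; rewrite Q0 expr0n ler10.
  by field.
have lenc : curve_length hyp_metric c = d.
  rewrite /curve_length (_ : (fun _ => _) = fun=> d); last first.
    by apply/funext => t; rewrite speed sqrtr_sqr ger0_norm.
  by rewrite Rintegral_cst//= lebesgue_measure_itv /= lte_fin ltr01 /= ?oppr0 ?adde0 ?subr0 ?addr0 ?mulr1.
have cP : [/\ forall t, derivable c t 1, continuous (derive1 c), c 0 = o & c 1 = x].
  split.
  - by move=> t; have [] := hasD_derive1 (hc t).
  - move=> t; rewrite (_ : derive1 c = c'); last by apply/funext => u; exact: dc.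
    apply: (@hasD_cont _ _ _ _ _ _); apply: hasD_Z; first exact: hasD_cst.
    by apply: hasD_D; apply: hasD_Z; try exact: hasD_cst; [apply: hasD_sinh; exact: htd|apply: hasD_cosh; exact: htd].
  - by rewrite /c mul0r /cosh /sinh oppr0 expR0 subrr mul0r scale0r addr0 (_ : _ / 2 = 1) ?scale1r//; field.
  - by rewrite /c mul1r chd shd.
apply/eqP; rewrite eq_le; apply/andP; split.
  by rewrite -lenc; apply: ge_inf => //; exists c.
apply: lb_le_inf; first by exists (curve_length hyp_metric c), c.
move=> _ [k [k1 k2 k3 k4] <-].
apply: le_trans (curve_length_ge xixi k1 k2).
by rewrite k3 k4 f0 f1 /d /arsinh -/s expr0n /= !addr0 sqrtr1 add0r ln1 subr0.
Qed.

Lemma cosh_distE (o x : 'rV[R]_m) : cosh_dist o x = coshd o x.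
Proof. by rewrite /cosh_dist riem_dist_hyp arsinh_coshd. Qed.

Lemma coshd_le_dist (C : R) (o x : 'rV[R]_m) : riem_dist hyp_metric o x <= C ->
  coshd o x <= expR C.
Proof.
move=> h; rewrite -cosh_distE /cosh_dist /cosh.
have d0 : 0 <= riem_dist hyp_metric o x.
  rewrite riem_dist_hyp /arsinh ln_ge0// ler_wpDl ?sqrtr_ge0//.
  by rewrite -{1}sqrtr1 ler_sqrt ?lerDl ?sqr_ge0// ltr_wpDr// sqr_ge0.
have h1 : expR (riem_dist hyp_metric o x) <= expR C by rewrite ler_expR.
have h2 : expR (- riem_dist hyp_metric o x) <= expR C by rewrite ler_expR; lra.
lra.
Qed.

Lemma inner_gradient (f : 'rV[R]_m -> R) x v L : hasD f x L ->
  inner hyp_metric x (gradient hyp_metric f x) v = L v.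
Proof.
move=> [df hf].
have -> : gradient hyp_metric f x = (\row_l 'D_(delta_mx 0 l) f x) *m invmx (hyp_metric x).
  apply/rowP => k; rewrite !mxE; apply: eq_bigr => l _.
  by rewrite !invmx_hyp_metricE mxE (eq_sym k l) mulrC [x 0 k * _]mulrC.
rewrite /inner mulmxKV ?hyp_metric_unit// -/(dot _ _) -hf (deriveE _ df).
rewrite [in RHS](row_sum_delta v) linear_sum dotE; apply: eq_bigr => i _.
by rewrite linearZ mxE -(deriveE _ df) mulrC.
Qed.

Lemma normal_derivative_coshd (o x v : 'rV[R]_m) :
  inner hyp_metric x (gradient hyp_metric (cosh_dist o) x) v =
  wt o * (dot x v / wt x) - dot o v.
Proof.
rewrite (_ : cosh_dist o = coshd o); last by apply/funext => y; exact: cosh_distE.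
exact: (inner_gradient v (hasD_coshd o (hasD_id x))).
Qed.

End geodesics.

(** * Smooth functions and boundary charts *)

Section smooth_class.
Context {R : realType}.

(** Replaces inductions over iterated derivatives by a class stable under one derivative. A
    derivative has to agree with a member of the class on [D] only; as [D] is open, this survives
    further differentiation. *)
Lemma smooth_class (V W : normedModType R) (D : set V) (C : (V -> W) -> Prop) :
  open D -> (forall h, C h -> forall x, D x -> differentiable h x) ->
  (forall h v, C h -> exists2 h', C h' & forall x, D x -> 'D_v h x = h' x) ->
  forall h, C h -> smooth_on D h.
Proof.
move=> oD Cd CD.
have key (s : seq V) h : C h -> exists2 h', C h' &
    forall x, D x -> foldr (fun v (h : V -> W) => 'D_v h) h s x = h' x.
  elim: s h => [|v s IH] h Ch /=; first by exists h.
  have [h1 Ch1 h1E] := IH h Ch; have [h2 Ch2 h2E] := CD h1 v Ch1.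
  exists h2 => // x Dx; rewrite -h2E//; apply: near_eq_derive.
  by apply: filterS (open_nbhs_nbhs (conj oD Dx)) => y /h1E.
move=> h Ch s x Dx; have [h' Ch' h'E] := key s h Ch.
have [] // := @hasD_near _ _ _ h' (foldr (fun v (h : V -> W) => 'D_v h) h s) x _ _ (hasD_diff (Cd _ Ch' x Dx)).
by apply: filterS (open_nbhs_nbhs (conj oD Dx)) => y /h'E.
Qed.

Lemma smooth_on_diff (V W : normedModType R) (D : set V) (h : V -> W) x :
  smooth_on D h -> D x -> differentiable h x.
Proof. by move=> /(_ [::]); exact. Qed.

Lemma smooth_on_derive (V W : normedModType R) (D : set V) (h : V -> W) v :
  smooth_on D h -> smooth_on D ('D_v h).
Proof. by move=> sh s x Dx; have := sh (rcons s v) x Dx; rewrite foldr_rcons. Qed.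

Lemma smooth_on_sub (V W : normedModType R) (D D' : set V) (h : V -> W) :
  D' `<=` D -> smooth_on D h -> smooth_on D' h.
Proof. by move=> DD sh s x /DD; exact: sh. Qed.

(** A class given by formation rules, so that stability under directional derivatives
    ([elem_derive]) is a structural induction. It is large enough for the derivatives of implicit
    functions and for the normalized gradient. *)
Inductive elem (V : normedModType R) (D : set V) : (V -> R) -> Prop :=
| elem_smooth h : smooth_on D h -> elem D h
| elem_add h k : elem D h -> elem D k -> elem D (fun x => h x + k x)
| elem_mul h k : elem D h -> elem D k -> elem D (fun x => h x * k x)
| elem_inv h : elem D h -> (forall x, D x -> h x != 0) -> elem D (fun x => (h x)^-1)
| elem_sqrt h : elem D h -> (forall x, D x -> 0 < h x) -> elem D (fun x => Num.sqrt (h x)).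

Lemma smooth_on_cst (V W : normedModType R) (D : set V) (c : W) : open D -> smooth_on D (fun=> c).
Proof.
move=> oD; apply: (@smooth_class _ _ D (fun h => exists c : W, h = fun=> c)) => //; last by exists c.
  by move=> _ [a ->] x _; exact: differentiable_cst.
move=> _ v [a ->]; exists (fun=> 0); first by exists 0.
by move=> x _; exact: derive_cst.
Qed.

Lemma elem_cst (V : normedModType R) (D : set V) (c : R) : open D -> elem D (fun=> c).
Proof. by move=> oD; apply: elem_smooth; exact: smooth_on_cst. Qed.

Lemma elem_opp (V : normedModType R) (D : set V) h : open D -> elem D h -> elem D (fun x => - h x).
Proof.
move=> oD eh; rewrite (_ : (fun _ => _) = fun x => -1 * h x).
  by apply: elem_mul => //; exact: elem_cst.
by apply/funext => x; rewrite mulN1r.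
Qed.

Lemma elem_sum (V : normedModType R) (D : set V) I (r : seq I) (F : I -> V -> R) : open D ->
  (forall i, elem D (F i)) -> elem D (fun x => \sum_(i <- r) F i x).
Proof.
move=> oD eF; elim: r => [|i r IH].
  rewrite (_ : (fun _ => _) = fun=> 0); first exact: elem_cst.
  by apply/funext => x; rewrite big_nil.
rewrite (_ : (fun _ => _) = fun x => F i x + \sum_(i <- r) F i x).
  exact: elem_add.
by apply/funext => x; rewrite big_cons.
Qed.

Lemma elem_coord n (D : set 'rV[R]_n) i : open D -> elem D (fun x => x 0 i).
Proof.
move=> oD; apply: elem_smooth.
apply: (@smooth_class _ _ D (fun h => h = (fun x => x 0 i) \/ exists c, h = fun=> c)) => //; last by left.
  move=> h [->|[c ->]] x _; first exact: (hasD_coord x i).1.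
  exact: differentiable_cst.
move=> h v [->|[c ->]].
  exists (fun=> v 0 i); first by right; exists (v 0 i).
  by move=> x _; exact: (hasD_coord x i).2.
by exists (fun=> 0); [right; exists 0|move=> x _; exact: derive_cst].
Qed.

Lemma elem_diff (V : normedModType R) (D : set V) h : elem D h -> forall x, D x -> differentiable h x.
Proof.
elim => {h} [h sh|h k _ IHh _ IHk|h k _ IHh _ IHk|h _ IHh h0|h _ IHh h0] x Dx.
- exact: smooth_on_diff sh Dx.
- by have [] := hasD_D (hasD_diff (IHh x Dx)) (hasD_diff (IHk x Dx)).
- by have [] := hasD_M (hasD_diff (IHh x Dx)) (hasD_diff (IHk x Dx)).
- by have [] := hasD_V (h0 x Dx) (hasD_diff (IHh x Dx)).
- by have [] := hasD_sqrt (h0 x Dx) (hasD_diff (IHh x Dx)).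
Qed.

Lemma elem_derive (V : normedModType R) (D : set V) h v : open D -> elem D h ->
  exists2 h', elem D h' & forall x, D x -> 'D_v h x = h' x.
Proof.
move=> oD; elim => {h} [h sh|h k eh [h' eh' hE] ek [k' ek' kE]|h k eh [h' eh' hE] ek [k' ek' kE]|
   h eh [h' eh' hE] h0|h eh [h' eh' hE] h0].
- by exists ('D_v h) => //; apply: elem_smooth; exact: smooth_on_derive.
- exists (fun x => h' x + k' x); first exact: elem_add.
  move=> x Dx; have [_ ->] := hasD_D (hasD_diff (elem_diff eh Dx)) (hasD_diff (elem_diff ek Dx)).
  by rewrite hE// kE.
- exists (fun x => h' x * k x + h x * k' x).
    by apply: elem_add; apply: elem_mul.
  move=> x Dx; have [_ ->] := hasD_M (hasD_diff (elem_diff eh Dx)) (hasD_diff (elem_diff ek Dx)).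
  by rewrite hE// kE.
- exists (fun x => - h' x * (h x * h x)^-1).
    apply: elem_mul; first exact: elem_opp.
    apply: elem_inv; first exact: elem_mul.
    by move=> x Dx; rewrite mulf_neq0 ?h0.
  move=> x Dx; have [_ ->] := hasD_V (h0 x Dx) (hasD_diff (elem_diff eh Dx)).
  by rewrite hE// -expr2.
- have s0 x : D x -> 2 * Num.sqrt (h x) != 0.
    by move=> Dx; rewrite mulf_neq0 ?pnatr_eq0// gt_eqF// sqrtr_gt0 h0.
  exists (fun x => h' x * (2 * Num.sqrt (h x))^-1).
    apply: elem_mul => //; apply: elem_inv => //.
    by apply: elem_mul; [exact: elem_cst|exact: elem_sqrt].
  move=> x Dx; have [_ ->] := hasD_sqrt (h0 x Dx) (hasD_diff (elem_diff eh Dx)).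
  by rewrite hE.
Qed.

Lemma row_sum_derive n (f : 'rV[R]_n -> R) x v : differentiable f x ->
  'D_v f x = \sum_i v 0 i * 'D_(delta_mx 0 i) f x.
Proof.
move=> df; rewrite (deriveE _ df) {1}(row_sum_delta v) linear_sum.
by apply: eq_bigr => i _; rewrite linearZ -deriveE.
Qed.

(** The hypothesis on ['D_v F] is an autonomous differential equation with elementary right side. By
    the chain rule the derivative of an elementary function of [F u] is again one, and
    [smooth_class] applies. *)
Lemma smooth_on_graph n m k (U : set 'rV[R]_n) (D : set 'rV[R]_m) (F : 'rV[R]_n -> 'rV[R]_m)
    (G : 'rV[R]_n -> 'rV[R]_k) :
  open U -> open D -> (forall u, U u -> D (F u)) ->
  (forall u, U u -> differentiable F u) ->
  (forall v i, exists2 h, elem D h & forall u, U u -> ('D_v F u) 0 i = h (F u)) ->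
  (forall i, exists2 h, elem D h & forall u, U u -> G u 0 i = h (F u)) ->
  smooth_on U G.
Proof.
move=> oU oD UD dF FD; move: G.
pose C (G : 'rV[R]_n -> 'rV[R]_k) := forall i : 'I_k, exists2 h, elem D h & forall u, U u -> G u 0 i = h (F u).
have CGd G : C G -> forall u, U u -> differentiable G u.
  move=> CG u Uu.
  have hG i : hasD (fun u => G u 0 i) u (fun v => 'D_v (fun u => G u 0 i) u).
    have [h eh hE] := CG i; split => //.
    apply: (hasD_near _ (hasD_comp (hasD_diff (dF u Uu)) (hasD_diff (elem_diff eh (UD u Uu))))).1.
    by apply: filterS (open_nbhs_nbhs (conj oU Uu)) => y /hE.
  have := @hasD_rVP _ _ k G u (fun v => \row_i 'D_v (fun u => G u 0 i) u).
  by case=> // i; apply: hasD_eq (hG i) _ => v; rewrite mxE.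
apply: (@smooth_class _ _ U C) => //.
move=> G v CG.
have /choice[h hh] i : exists h, elem D h /\ forall u, U u -> ('D_v G u) 0 i = h (F u).
  have [g eg gE] := CG i.
  have /choice[a ha] j : exists a, elem D a /\ forall u, U u -> ('D_v F u) 0 j = a (F u).
    by have [a ea aE] := FD v j; exists a.
  have /choice[b hb] j : exists b, elem D b /\ forall x, D x -> 'D_(delta_mx 0 j) g x = b x.
    by have [b eb bE] := elem_derive (delta_mx 0 j) oD eg; exists b.
  exists (fun x => \sum_j a j x * b j x); split.
    by apply: elem_sum => // j; apply: elem_mul; [exact: (ha j).1|exact: (hb j).1].
  move=> u Uu.
  have hc := hasD_comp (hasD_diff (dF u Uu)) (hasD_diff (elem_diff eg (UD u Uu))).
  have hGi : hasD (fun u => G u 0 i) u (fun v => 'D_('D_v F u) g (F u)).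
    apply: hasD_near hc.
    by apply: filterS (open_nbhs_nbhs (conj oU Uu)) => y /gE.
  have dG : derivable G u v.
    by apply: diff_derivable; exact: CGd.
  rewrite (derive_mx dG) mxE hGi.2 row_sum_derive; last exact: elem_diff (UD u Uu).
  by apply: eq_bigr => j _; rewrite (ha j).2// (hb j).2//; exact: UD.
exists (fun u => \row_i h i (F u)).
  by move=> i; exists (h i); [exact: (hh i).1|move=> u _; rewrite mxE].
by move=> u Uu; apply/rowP => i; rewrite mxE (hh i).2.
Qed.

End smooth_class.

Lemma near_lt (R : realType) (T : topologicalType) (f : T -> R) x c :
  {for x, continuous f} -> f x < c -> \forall y \near x, f y < c.
Proof. by move=> cf fc; exact: (@cvgr_lt _ _ _ _ f (f x) cf c fc). Qed.

Lemma near_gt (R : realType) (T : topologicalType) (f : T -> R) x c :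
  {for x, continuous f} -> c < f x -> \forall y \near x, c < f y.
Proof. by move=> cf fc; exact: (@cvgr_gt _ _ _ _ f (f x) cf c fc). Qed.

Lemma near_norm (R : realType) (V : normedModType R) (x : V) (P : V -> Prop) :
  (\forall y \near x, P y) -> exists2 d : R, 0 < d & forall y, `|y - x| < d -> P y.
Proof.
move=> /nbhs_ballP[d /= d0 hd]; exists d => // y yx; apply: (hd y).
by rewrite -ball_normE /= distrC.
Qed.

Lemma norm_near (R : realType) (V : normedModType R) (x : V) (d : R) :
  0 < d -> \forall y \near x, `|y - x| < d.
Proof. by move=> d0; apply/nbhs_ballP; exists d => // u; rewrite -ball_normE /= distrC. Qed.

Lemma near_dist (R : realType) (T : topologicalType) (V : normedModType R) (f : T -> V) x c (r : R) :
  {for x, continuous f} -> `|f x - c| < r -> \forall y \near x, `|f y - c| < r.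
Proof.
move=> cf h; apply: (@near_lt _ _ (fun y => `|f y - c|)) h; have cc := contB cf (@contC T V c x).
by apply: (continuous_comp cc); exact: norm_continuous.
Qed.

Lemma cont_dist (R : realType) (T : topologicalType) (V : normedModType R) (f : T -> V) x :
  (forall e : R, 0 < e -> \forall y \near x, `|f y - f x| < e) -> {for x, continuous f}.
Proof.
move=> h; apply/cvgrPdist_lt => e /h; apply: filterS => y; by rewrite distrC.
Qed.

(** * Implicit functions as graphs *)

Section graph.
Context {R : realType} {n : nat}.
Implicit Types (k : 'I_n.+1) (u v : 'rV[R]_n) (x p : 'rV[R]_n.+1).

Definition ins k u (t : R) : 'rV[R]_n.+1 := \row_j (if unlift k j is Some i then u 0 i else t).
Definition del k x : 'rV[R]_n := \row_i x 0 (lift k i).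

Lemma ins_lift k u t i : ins k u t 0 (lift k i) = u 0 i.
Proof. by rewrite mxE liftK. Qed.

Lemma ins_k k u t : ins k u t 0 k = t.
Proof. by rewrite mxE unlift_none. Qed.

Lemma del_ins k u t : del k (ins k u t) = u.
Proof. by apply/rowP => i; rewrite mxE ins_lift. Qed.

Lemma ins_del k x : ins k (del k x) (x 0 k) = x.
Proof.
by apply/rowP => j; case: (unliftP k j) => [i|] ->; rewrite ?ins_lift ?ins_k ?mxE.
Qed.

Lemma insB k u v s t : ins k (u - v) (s - t) = ins k u s - ins k v t.
Proof.
apply/rowP => j; rewrite [RHS]mxE [X in _ = _ + X]mxE.
by case: (unliftP k j) => [i|] ->; rewrite ?ins_lift ?ins_k// !mxE.
Qed.

Lemma ins_norm k u t : `|ins k u t| <= `|u| + `|t|.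
Proof.
apply/rV_normP; first by rewrite addr_ge0.
move=> j; case: (unliftP k j) => [i|] ->; rewrite ?ins_lift ?ins_k.
  by rewrite (le_trans (ler_coord_norm u i))// lerDl.
by rewrite lerDr.
Qed.

Lemma del_norm k x : `|del k x| <= `|x|.
Proof. by apply/rV_normP => // i; rewrite mxE ler_coord_norm. Qed.

Lemma delB k x y : del k (x - y) = del k x - del k y.
Proof. by apply/rowP => i; rewrite !mxE. Qed.

Lemma hasD_ins (V : normedModType R) k (f : V -> 'rV[R]_n) (t : V -> R) z L T :
  hasD f z L -> hasD t z T -> hasD (fun y : V => ins k (f y) (t y)) z (fun v : V => ins k (L v) (T v)).
Proof.
move=> hf ht; apply: hasD_rVP => j; case: (unliftP k j) => [i|] ->.
  rewrite (_ : (fun y : V => _) = fun y : V => f y 0 i); last by apply/funext => y; rewrite ins_lift.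
  by apply: hasD_eq (hasD_rV_coord i hf) _ => v; rewrite ins_lift.
rewrite (_ : (fun y : V => _) = t); last by apply/funext => y; rewrite ins_k.
by apply: hasD_eq ht _ => v; rewrite ins_k.
Qed.

Lemma hasD_del k x : hasD (del k) x (del k).
Proof.
apply: hasD_rVP => i.
rewrite (_ : (fun y => _) = fun y : 'rV[R]_n.+1 => y 0 (lift k i)); last by apply/funext => y; rewrite mxE.
by apply: hasD_eq (hasD_coord x (lift k i)) _ => v /=; rewrite ?mxE.
Qed.

(* Monotonicity in the k-th coordinate gives existence and uniqueness of phi. *)
Lemma implicit_box k (f : 'rV[R]_n.+1 -> R) (D : set 'rV[R]_n.+1) p :
  open D -> D p -> (forall x, D x -> differentiable f x) ->
  {for p, continuous ('D_(delta_mx 0 k) f)} ->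
  f p = 0 -> 0 < 'D_(delta_mx 0 k) f p ->
  exists r1 r2 : R, exists phi : 'rV[R]_n -> R,
   [/\ 0 < r1, 0 < r2,
     forall x, `|del k x - del k p| < r2 -> `|x 0 k - p 0 k| <= r1 ->
        D x /\ 0 < 'D_(delta_mx 0 k) f x,
     forall u, `|u - del k p| < r2 -> `|phi u - p 0 k| < r1 /\ f (ins k u (phi u)) = 0 &
     forall u s t, `|u - del k p| < r2 -> `|s - p 0 k| <= r1 -> `|t - p 0 k| <= r1 ->
        s < t -> f (ins k u s) < f (ins k u t)].
Proof.
move=> oD Dp df cg fp gp.
have [r r0 hr] : exists2 r : R, 0 < r & forall x, `|x - p| < r -> D x /\ 0 < 'D_(delta_mx 0 k) f x.
  have h1 : nbhs p D by exact: open_nbhs_nbhs.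
  have h2 : \forall x \near p, 0 < 'D_(delta_mx 0 k) f x by exact: near_gt cg gp.
  by have [r r0 hr] := near_norm (filterI h1 h2); exists r.
pose r1 := r / 4.
have r10 : 0 < r1 by rewrite divr_gt0.
have inD u s : `|u - del k p| < r1 -> `|s - p 0 k| <= r1 -> D (ins k u s) /\ 0 < 'D_(delta_mx 0 k) f (ins k u s).
  move=> h1 h2; apply: hr; rewrite -[X in _ - X](ins_del k) -insB.
  by apply: (le_lt_trans (ins_norm _ _ _)); rewrite /r1 in h1 h2; lra.
have hv u s : hasD (fun t : R => ins k u t) s (fun v : R => v *: delta_mx 0 k).
  apply: hasD_eq (hasD_ins k (hasD_cst u s) (hasD_id s)) _ => v.
  apply/rowP => j; case: (unliftP k j) => [i|] ->; rewrite ?ins_lift ?ins_k !mxE eqxx /=.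
    by rewrite eq_sym (negbTE (neq_lift _ _)) mulr0.
  by rewrite eqxx mulr1.
have hfv u s : `|u - del k p| < r1 -> `|s - p 0 k| <= r1 ->
   hasD (fun t : R => f (ins k u t)) s (fun v : R => v * 'D_(delta_mx 0 k) f (ins k u s)).
  move=> h1 h2; have [h3 h4] := inD u s h1 h2.
  apply: hasD_eq (hasD_comp (hv u s) (hasD_diff (df _ h3))) _ => v.
  by rewrite (deriveE _ (df _ h3)) linearZ /= -(deriveE _ (df _ h3)).
have mono u s t : `|u - del k p| < r1 -> `|s - p 0 k| <= r1 -> `|t - p 0 k| <= r1 ->
        s < t -> f (ins k u s) < f (ins k u t).
  move=> h1 h2 h3 st.
  have H z : z \in `[s, t]%R -> `|z - p 0 k| <= r1.
    by rewrite in_itv /= !ler_norml in h2 h3 * => /andP[? ?]; lra.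
  have H' z : z \in `]s, t[%R -> `|z - p 0 k| <= r1.
    by move=> zst; apply: H; exact: subset_itv_oo_cc zst.
  apply: (@gtr0_derive1_lt_cc _ (fun t => f (ins k u t)) s t); last exact: st.
  - by move=> z /H' /(hfv _ _ h1)/hasD_derive1[].
  - move=> z zst; have [_ ->] := hasD_derive1 (hfv _ _ h1 (H' _ zst)).
    by rewrite mul1r; have [] := inD u z h1 (H' _ zst).
  - apply: continuous_in_subspaceT => z /set_mem/H/(hfv _ _ h1) hz; exact: hasD_cont hz.
  - by rewrite in_itv /= lexx ltW.
  - by rewrite in_itv /= lexx andbT ltW.
have upp : `|del k p - del k p| < r1 by rewrite subrr normr0.
have lo : f (ins k (del k p) (p 0 k - r1)) < 0.
  rewrite -fp -[in ltRHS](ins_del k p); apply: mono => //; last by lra.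
    by rewrite addrAC subrr sub0r normrN ger0_norm// ltW.
  by rewrite subrr normr0 ltW.
have hi : 0 < f (ins k (del k p) (p 0 k + r1)).
  rewrite -fp -[in ltLHS](ins_del k p); apply: mono => //; last by lra.
    by rewrite subrr normr0 ltW.
  by rewrite addrAC subrr add0r ger0_norm// ltW.
have hu s u : `|u - del k p| < r1 -> `|s - p 0 k| <= r1 -> {for u, continuous (fun u => f (ins k u s))}.
  move=> h1 h2; have [h3 _] := inD u s h1 h2.
  exact: hasD_cont (hasD_comp (hasD_ins k (hasD_id u) (hasD_cst s u)) (hasD_diff (df _ h3))).
have [r2 r20 hr2] : exists2 r2 : R, 0 < r2 & forall u, `|u - del k p| < r2 ->
   [/\ `|u - del k p| < r1, f (ins k u (p 0 k - r1)) < 0 & 0 < f (ins k u (p 0 k + r1))].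
  have h1 : \forall u \near del k p, f (ins k u (p 0 k - r1)) < 0.
    apply: near_lt lo; apply: (hu (p 0 k - r1)) => //.
    by rewrite addrAC subrr sub0r normrN ger0_norm// ltW.
  have h2 : \forall u \near del k p, 0 < f (ins k u (p 0 k + r1)).
    apply: near_gt hi; apply: (hu (p 0 k + r1)) => //.
    by rewrite addrAC subrr add0r ger0_norm// ltW.
  have h3 : \forall u \near del k p, `|u - del k p| < r1.
    exact: norm_near.
  have [d d0 hd] := near_norm (filterI h3 (filterI h1 h2)).
  by exists d => // u /hd[? [? ?]].
have /choice[phi hphi] u : exists t, `|u - del k p| < r2 -> `|t - p 0 k| < r1 /\ f (ins k u t) = 0.
  have [ud|] := pselect (`|u - del k p| < r2); last by exists 0.
  have [h1 h2 h3] := hr2 u ud.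
  have H z : z \in `[p 0 k - r1, p 0 k + r1]%R -> `|z - p 0 k| <= r1.
    by rewrite in_itv /= ler_norml => /andP[? ?]; lra.
  have [|||c] := @IVT _ (fun t => f (ins k u t)) (p 0 k - r1) (p 0 k + r1) 0.
  - by lra.
  - apply: continuous_in_subspaceT => z /set_mem/H/(hfv _ _ h1) hz; exact: hasD_cont hz.
  - by rewrite ge_min le_max (ltW h2) (ltW h3) orbT.
  move=> cI fc; exists c => _; split => //; have := H _ cI; rewrite le_eqVlt => /orP[/eqP|//].
  move=> cE; exfalso; have [cc|cc] := eqVneq (c - p 0 k) r1.
    by have := h3; rewrite (_ : p 0 k + r1 = c) ?fc ?ltxx//; lra.
  have cc' : c = p 0 k - r1.
    move: cE cc; case: (leP 0 (c - p 0 k)) => c0; first by rewrite ger0_norm// => ->; rewrite eqxx.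
    by rewrite ltr0_norm// => ? _; lra.
  by have := h2; rewrite -cc' fc ltxx.
exists r1, r2, phi; split => //.
- move=> x h1 h2; rewrite -(ins_del k x); apply: inD => //.
  by have [] := hr2 _ h1.
- by move=> u s t /hr2[h1 _ _]; exact: mono.
Qed.

Lemma dot_bound m (c : 'rV[R]_m) : exists2 K : R, 0 <= K & forall v : 'rV[R]_m, `|dot v c| <= K * `|v|.
Proof.
have [K K0 hK] := mulmxr_bound c^T; exists K => // v; rewrite mulrC.
by apply: hK => i; exact: ler_coord_norm.
Qed.

Lemma hasD_intro m (f : 'rV[R]_m -> R) (c x : 'rV[R]_m) :
  (forall eta : R, 0 < eta -> exists2 d : R, 0 < d &
    forall y, `|y - x| < d -> `|f y - f x - dot (y - x) c| <= eta * `|y - x|) ->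
  hasD f x (fun v : 'rV[R]_m => dot v c).
Proof.
move=> h.
have [L LE] : exists L : {linear 'rV[R]_m -> R}, forall v : 'rV[R]_m, L v = dot v c.
  have @g : {linear 'rV[R]_m -> R}.
    by exists (fun v : 'rV[R]_m => dot v c); do 2![eexists]; do ?[constructor];
     rewrite ?dot0l// => ? *; rewrite ?dotDl ?dotZl//; move=> ?; rewrite ?dotDl ?dotZl.
  by exists g.
have LE' : (fun v : 'rV[R]_m => dot v c) = L by apply/funext => v; rewrite LE.
have cL : continuous L.
  by rewrite -LE' => v; apply: cont_dot; [exact: cvg_id|exact: contC].
have [|df dE] := @diff_intro _ _ _ f L x cL.
  by move=> eta /h[d d0 hd]; exists d => // y /hd; rewrite LE.
by split=> // v; rewrite (deriveE _ df) dE LE.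
Qed.

Lemma implicit_pos k (f : 'rV[R]_n.+1 -> R) (D : set 'rV[R]_n.+1) p :
  open D -> D p -> (forall x, D x -> differentiable f x) ->
  {for p, continuous ('D_(delta_mx 0 k) f)} ->
  f p = 0 -> 0 < 'D_(delta_mx 0 k) f p ->
  exists (N : set 'rV[R]_n.+1) (r : R) (F : 'rV[R]_n -> 'rV[R]_n.+1),
   [/\ open N /\ N p, 0 < r,
     forall x, N x -> D x /\ 'D_(delta_mx 0 k) f x != 0,
     forall u, `|u - del k p| < r -> [/\ N (F u), f (F u) = 0, del k (F u) = u &
        hasD F u (fun v => ins k v (- 'D_(ins k v 0) f (F u) / 'D_(delta_mx 0 k) f (F u)))] &
     forall x, N x -> f x = 0 -> `|del k x - del k p| < r /\ F (del k x) = x].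
Proof.
move=> oD Dp df cg fp gp.
have [r1 [r2 [phi [r10 r20 hbox hphi mono]]]] := implicit_box oD Dp df cg fp gp.
pose N := [set x : 'rV[R]_n.+1 | `|del k x - del k p| < r2 /\ `|x 0 k - p 0 k| < r1].
have coordk (x : 'rV[R]_n.+1) : {for x, continuous (fun y : 'rV[R]_n.+1 => y 0 k)}.
  exact: (hasD_cont (hasD_coord x k)).
have contdel (x : 'rV[R]_n.+1) : {for x, continuous (del k)} by exact: hasD_cont (hasD_del k x).
have oN : open N.
  rewrite openE => x [h1 h2].
  exact: filterI (near_dist (contdel x) h1) (near_dist (coordk x) h2).
have Np : N p by split; rewrite subrr normr0.
have phiN u : `|u - del k p| < r2 -> N (ins k u (phi u)).
  by move=> ur; have [? ?] := hphi u ur; split; rewrite ?del_ins ?ins_k.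
have uniq u t : `|u - del k p| < r2 -> `|t - p 0 k| <= r1 -> f (ins k u t) = 0 -> t = phi u.
  move=> ur tr ft; have [h1 h2] := hphi u ur.
  case: (ltgtP t (phi u)) => // lt.
    by have := mono u _ _ ur tr (ltW h1) lt; rewrite ft h2 ltxx.
  by have := mono u _ _ ur (ltW h1) tr lt; rewrite ft h2 ltxx.
have cphi u : `|u - del k p| < r2 -> {for u, continuous phi}.
  move=> ur; have [h1 h2] := hphi u ur.
  apply: cont_dist => e e0.
  (* Small enough that [phi u - e1] and [phi u + e1] stay in the box where [f] is monotone; [f] has
     opposite signs there, also for nearby [y], and this traps [phi y]. *)
  pose e1 := Num.min (e / 2) ((r1 - `|phi u - p 0 k|) / 2).
  have e10 : 0 < e1 by rewrite lt_min !divr_gt0// subr_gt0.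
  have e1e : e1 < e by rewrite gt_min; apply/orP; left; lra.
  have e1r : e1 <= (r1 - `|phi u - p 0 k|) / 2 by rewrite ge_min lexx orbT.
  clearbody e1.
  have a1 : `|(phi u - e1) - p 0 k| <= r1.
    have := ler_normB (phi u - p 0 k) e1; rewrite (ger0_norm (ltW e10)) addrAC; lra.
  have a2 : `|(phi u + e1) - p 0 k| <= r1.
    have := ler_normD (phi u - p 0 k) e1; rewrite (ger0_norm (ltW e10)) addrAC; lra.
  have l1 : f (ins k u (phi u - e1)) < 0 by rewrite -h2; apply: mono => //; [exact: ltW|lra].
  have l2 : 0 < f (ins k u (phi u + e1)) by rewrite -h2; apply: mono => //; [exact: ltW|lra].
  have hu s : `|s - p 0 k| <= r1 -> {for u, continuous (fun u => f (ins k u s))}.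
    move=> h3; have [h4 _] : D (ins k u s) /\ 0 < 'D_(delta_mx 0 k) f (ins k u s).
      by apply: hbox; rewrite ?del_ins ?ins_k.
    exact: hasD_cont (hasD_comp (hasD_ins k (hasD_id u) (hasD_cst s u)) (hasD_diff (df _ h4))).
  have n1 := near_lt (hu _ a1) l1.
  have n2 := near_gt (hu _ a2) l2.
  have n3 : \forall y \near u, `|y - del k p| < r2.
    by apply: near_dist ur; exact: cvg_id.
  near=> y.
  have y1 : f (ins k y (phi u - e1)) < 0 by near: y.
  have y2 : 0 < f (ins k y (phi u + e1)) by near: y.
  have y3 : `|y - del k p| < r2 by near: y.
  have [g1 g2] := hphi y y3.
  have b1 : phi u - e1 < phi y.
    rewrite ltNge le_eqVlt; apply/negP => /orP[/eqP b|b]; first by move: y1; rewrite -b g2 ltxx.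
    by have := mono y _ _ y3 (ltW g1) a1 b; rewrite g2; lra.
  have b2 : phi y < phi u + e1.
    rewrite ltNge le_eqVlt; apply/negP => /orP[/eqP b|b]; first by move: y2; rewrite b g2 ltxx.
    by have := mono y _ _ y3 a2 (ltW g1) b; rewrite g2; lra.
  by rewrite ltr_norml; lra.
pose F u := ins k u (phi u).
exists N, r2, F; split => //.
- by move=> x [h1 h2]; have [? ?] := hbox x h1 (ltW h2); split=> //; rewrite gt_eqF.
- move=> u ur; have [h1 h2] := hphi u ur; split => //; [exact: phiN|exact: del_ins|].
  have [DF gF] : D (F u) /\ 0 < 'D_(delta_mx 0 k) f (F u).
    by apply: hbox; rewrite ?del_ins ?ins_k// ltW.
  set g := 'D_(delta_mx 0 k) f (F u) in gF *.
  pose c : 'rV[R]_n := \row_i (- 'D_(delta_mx 0 (lift k i)) f (F u) / g).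
  have dfE (v : 'rV[R]_n) (t : R) : 'd f (F u) (ins k v t) = g * (t - dot v c).
    rewrite -(deriveE _ (df _ DF)) row_sum_derive; last exact: df.
    rewrite (bigD1_ord k)//= ins_k mulrBr mulrC; congr (_ + _).
    rewrite dotE mulr_sumr -sumrN; apply: eq_bigr => i _; rewrite ins_lift !mxE.
    by field; rewrite gt_eqF.
  suff hphiD : hasD phi u (fun v => dot v c).
    apply: hasD_eq (hasD_ins k (hasD_id u) hphiD) _ => v; congr (ins _ _ _).
    by rewrite (deriveE _ (df _ DF)) dfE sub0r; field; rewrite gt_eqF.
  have [K K0 hK] := dot_bound c.
  apply: hasD_intro => eta eta0.
  (* With [z <= 2^-1] the error term in the unknown increment of [phi] is absorbed, which bounds
     that increment by [2 * K + 1] times the one of the argument; the other bound then turns the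
     error into [eta]. *)
  pose z := Num.min 2^-1 (eta / (2 * K + 2)).
  have z0 : 0 < z by rewrite lt_min invr_gt0 divr_gt0//; lra.
  have z1 : z <= 2^-1 by rewrite ge_min lexx.
  have z2 : z * (2 * K + 2) <= eta.
    by rewrite -ler_pdivlMr; [rewrite ge_min lexx orbT|lra].
  clearbody z.
  have [d d0 hd] := diff_approx (df _ DF) (mulr_gt0 gF z0).
  have cF : {for u, continuous F}.
    apply/continuous_rVP => j; rewrite /F; case: (unliftP k j) => [i|] ->.
      rewrite (_ : (fun _ => _) = fun y : 'rV[R]_n => y 0 i); last by apply/funext => y; rewrite ins_lift.
      exact: hasD_cont (hasD_coord u i).
    rewrite (_ : (fun _ => _) = phi); last by apply/funext => y; rewrite ins_k.
    exact: cphi.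
  have n1 : \forall y \near u, `|F y - F u| < d.
    by apply: near_dist => //; rewrite subrr normr0.
  have n3 : \forall y \near u, `|y - del k p| < r2.
    by apply: near_dist ur; exact: cvg_id.
  have [d' d'0 hd'] := near_norm (filterI n1 n3).
  exists d' => // y /hd'[y1 y2].
  have [g1 g2] := hphi y y2.
  have := hd _ y1; rewrite /F g2 h2 -insB subrr sub0r normrN dfE normrM (gtr0_norm gF) -mulrA ler_pM2l//.
  move: (dot _ _) (hK (y - u)) (ins_norm k (y - u) (phi y - phi u)) => q hq hn le.
  have le' : `|phi y - phi u - q| <= z * (`|y - u| + `|phi y - phi u|).
    by apply: (le_trans le); rewrite ler_pM2l.
  have tri : `|phi y - phi u| <= `|phi y - phi u - q| + `|q|.
    by rewrite -[X in `|X| <= _](subrK q) ler_normD.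
  move: (normr_ge0 (phi y - phi u)) (normr_ge0 (y - u)) le' tri hq z1 z2.
  move: `|_ - _ - _| `|_ - _| `|_ - _| `|q| => A B C Q B0 C0 le' tri hq z1 z2.
  have : z * B <= 2^-1 * B by rewrite ler_wpM2r.
  have : z * C <= 2^-1 * C by rewrite ler_wpM2r.
  move=> i1 i2.
  have i3 : C <= (2 * K + 1) * B by lra.
  apply: (le_trans le'); apply: (@le_trans _ _ (z * (2 * K + 2) * B)); last by rewrite ler_wpM2r.
  by rewrite -mulrA ler_pM2l//; lra.
- move=> x [h1 h2] fx; split => //; rewrite /F -[RHS](ins_del k); congr ins.
  by apply/esym/uniq => //; rewrite ?ins_del// ltW.
Unshelve. all: by end_near.
Qed.

Lemma derive_opp k (f : 'rV[R]_n.+1 -> R) (v x : 'rV[R]_n.+1) : differentiable f x ->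
  'D_v (fun y => - f y) x = - 'D_v f x.
Proof. by move=> df; have [_ ->] := hasD_N (hasD_diff df). Qed.

Lemma implicit_graph k (f : 'rV[R]_n.+1 -> R) (D : set 'rV[R]_n.+1) p :
  open D -> D p -> smooth_on D f -> f p = 0 -> 'D_(delta_mx 0 k) f p != 0 ->
  exists (N : set 'rV[R]_n.+1) (r : R) (F : 'rV[R]_n -> 'rV[R]_n.+1),
   [/\ open N /\ N p, 0 < r,
     forall x, N x -> D x /\ 'D_(delta_mx 0 k) f x != 0,
     forall u, `|u - del k p| < r -> [/\ N (F u), f (F u) = 0, del k (F u) = u &
        hasD F u (fun v => ins k v (- 'D_(ins k v 0) f (F u) / 'D_(delta_mx 0 k) f (F u)))] &
     forall x, N x -> f x = 0 -> `|del k x - del k p| < r /\ F (del k x) = x].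
Proof.
move=> oD Dp sf fp gp.
have df x : D x -> differentiable f x by exact: smooth_on_diff sf.
have cg : {for p, continuous ('D_(delta_mx 0 k) f)}.
  exact/differentiable_continuous/(smooth_on_diff (smooth_on_derive _ sf)).
case: (ltgtP ('D_(delta_mx 0 k) f p) 0) gp => // lt _; last exact: implicit_pos lt.
have dfN x (v : 'rV[R]_n.+1) : D x -> 'D_v (fun y => - f y) x = - 'D_v f x.
  by move=> Dx; apply: derive_opp => //; exact: df.
have [N [r [F [h1 h2 h3 h4 h5]]]] : exists (N : set 'rV[R]_n.+1) (r : R) (F : 'rV[R]_n -> 'rV[R]_n.+1),
   [/\ open N /\ N p, 0 < r,
     forall x, N x -> D x /\ 'D_(delta_mx 0 k) (fun y => - f y) x != 0,
     forall u, `|u - del k p| < r -> [/\ N (F u), - f (F u) = 0, del k (F u) = u &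
        hasD F u (fun v => ins k v (- 'D_(ins k v 0) (fun y => - f y) (F u) / 'D_(delta_mx 0 k) (fun y => - f y) (F u)))] &
     forall x, N x -> - f x = 0 -> `|del k x - del k p| < r /\ F (del k x) = x].
  apply: (@implicit_pos k (fun y => - f y) D p oD Dp).
  - by move=> x /df dfx; have [] := hasD_N (hasD_diff dfx).
  - have hk := hasD_N (hasD_diff (smooth_on_diff (smooth_on_derive (delta_mx 0 k) sf) Dp)).
    apply: (hasD_cont (hasD_near _ hk)).
    by apply: filterS (open_nbhs_nbhs (conj oD Dp)) => y Dy; rewrite dfN.
  - by rewrite fp oppr0.
  - by rewrite dfN// oppr_gt0.
exists N, r, F; split => //.
- by move=> x /h3[Dx]; rewrite dfN// oppr_eq0.
- move=> u /h4[NF /eqP fF dF hF]; have [DF _] := h3 _ NF.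
  split => //; first by apply/eqP; rewrite -oppr_eq0.
  by apply: hasD_eq hF _ => v; rewrite !dfN// invrN mulrN mulNr opprK.
- by move=> x /h5 h fx; apply: h; rewrite fx oppr0.
Qed.

Lemma smooth_on_graph_sol k (f : 'rV[R]_n.+1 -> R) (N : set 'rV[R]_n.+1) (U : set 'rV[R]_n) (F : 'rV[R]_n -> 'rV[R]_n.+1)
    m (G : 'rV[R]_n -> 'rV[R]_m) :
  open N -> open U -> smooth_on N f -> (forall x, N x -> 'D_(delta_mx 0 k) f x != 0) ->
  (forall u, U u -> N (F u) /\
     hasD F u (fun v => ins k v (- 'D_(ins k v 0) f (F u) / 'D_(delta_mx 0 k) f (F u)))) ->
  (forall i, exists2 h, elem N h & forall u, U u -> G u 0 i = h (F u)) ->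
  smooth_on U G.
Proof.
move=> oN oU sf f0 hF; apply: (smooth_on_graph oU oN).
- by move=> u /hF[].
- by move=> u /hF[_ []].
- move=> v j; case: (unliftP k j) => [i|] ->.
    by exists (fun=> v 0 i); [exact: elem_cst|move=> u /hF[_ [_ ->]]; rewrite ins_lift].
  exists (fun x => - 'D_(ins k v 0) f x * ('D_(delta_mx 0 k) f x)^-1).
    apply: elem_mul; first by apply: elem_opp => //; apply: elem_smooth; exact: smooth_on_derive.
    by apply: elem_inv => //; apply: elem_smooth; exact: smooth_on_derive.
  by move=> u /hF[_ [_ ->]]; rewrite ins_k.
Qed.

End graph.

Section chart.
Context {R : realType} {n : nat}.
Local Notation V := 'rV[R]_n.+1.
Local Notation ip := (inner hyp_metric).

Lemma derive_neg (W : normedModType R) (f : W -> R) (x v : W) : derivable f x v -> 'D_v f x < 0 ->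
  exists2 d : R, 0 < d & forall t, 0 < t < d -> f (x + t *: v) < f x.
Proof.
move=> df Df.
have cv : h^-1 *: ((f \o shift x) (h *: v) - f x) @[h --> (0:R)^'] --> 'D_v f x by exact: df.
have /nbhs_ballP[d /= d0 hd] : \forall h \near (0:R)^', h^-1 *: ((f \o shift x) (h *: v) - f x) < 0.
  exact: (@cvgr_lt _ _ _ _ _ _ cv 0 Df).
exists d => // t /andP[t0 td].
have := hd t; rewrite -ball_normE /= sub0r normrN gtr0_norm// gt_eqF// => /(_ td erefl).
by rewrite /GRing.scale /= [x + _]addrC pmulr_rlt0 ?invr_gt0// subr_lt0.
Qed.

Lemma derive_pos (W : normedModType R) (f : W -> R) (x v : W) : differentiable f x -> 0 < 'D_v f x ->
  exists2 d : R, 0 < d & forall t, 0 < t < d -> f x < f (x + t *: v).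
Proof.
move=> df Df; have [dg gE] := hasD_N (hasD_diff df).
have [|d d0 hd] := @derive_neg _ (fun y => - f y) x v (diff_derivable dg).
  by rewrite gE oppr_lt0.
by exists d => // t /hd; rewrite ltrN2.
Qed.

Variable O : set V.

(* F parametrizes the zero set of f in N as a graph over the coordinates other than k. *)
Record chart k (f : V -> R) (N : set V) (c : 'rV[R]_n) (r : R) (F : 'rV[R]_n -> V) : Prop := Chart {
  chart_open : open N;
  chart_r : 0 < r;
  chart_smooth : smooth_on N f;
  chart_slope : forall x, N x -> 'D_(delta_mx 0 k) f x != 0;
  chart_dom : forall x, N x -> (O x <-> f x < 0);
  chart_param : forall u, `|u - c| < r -> [/\ N (F u), f (F u) = 0, del k (F u) = u &
     hasD F u (fun v => ins k v (- 'D_(ins k v 0) f (F u) / 'D_(delta_mx 0 k) f (F u)))];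
  chart_inv : forall x, N x -> f x = 0 -> `|del k x - c| < r /\ F (del k x) = x }.

Hypothesis oO : open O.
Hypothesis sO : smooth_boundary O.

Let intO : O° = O. Proof. exact/interior_id. Qed.

Lemma boundaryP x : boundary O x -> closure O x /\ ~ O x.
Proof. by move=> [h1 h2]; split=> // Ox; apply: h2; rewrite intO. Qed.

Lemma boundary_f0 (U : set V) (f : V -> R) x : open U -> {for x, continuous f} ->
  (forall x, U x -> (O x <-> f x < 0)) -> U x -> boundary O x -> f x = 0.
Proof.
move=> oU cf Of Ux /boundaryP[cO nO].
case: (ltgtP (f x) 0) => // fx; first by case: nO; apply/Of.
have h : nbhs x (U `&` [set y | 0 < f y]).
  by apply: filterI; [exact: open_nbhs_nbhs|exact: near_gt cf fx].
have [y [Oy [Uy /= fy]]] := cO _ h.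
by have /(Of _ Uy) := Oy; rewrite ltNge ltW.
Qed.

(** In a direction of negative derivative [f] takes negative values arbitrarily close to [x], so [x]
    is a limit of points of [O]. *)
Lemma f0_boundary (U : set V) (f : V -> R) x v : open U -> differentiable f x -> 'D_v f x != 0 ->
  (forall x, U x -> (O x <-> f x < 0)) -> U x -> f x = 0 -> boundary O x.
Proof.
move=> oU df Df Of Ux fx; split; last first.
  by rewrite intO => /(Of _ Ux); rewrite fx ltxx.
have [w Dw] : exists w, 'D_w f x < 0.
  case: (ltgtP ('D_v f x) 0) Df => // h _; first by exists v.
  by exists (- v); rewrite (deriveE _ df) linearN -(deriveE _ df) oppr_lt0.
have [d d0 hd] := derive_neg (diff_derivable df) Dw.
move=> B /near_norm[e e0 he].
have [e' e'0 he'] := near_norm (open_nbhs_nbhs (conj oU Ux)).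
pose t := Num.min (d / 2) (Num.min (e / 2) (e' / 2) / (`|w| + 1)).
have w1 : 0 < `|w| + 1 by rewrite ltr_wpDl.
have t0 : 0 < t by rewrite lt_min divr_gt0//= divr_gt0// lt_min !divr_gt0.
have td : t < d by rewrite gt_min; apply/orP; left; lra.
have te : t * (`|w| + 1) <= Num.min (e / 2) (e' / 2).
  by rewrite -ler_pdivlMr// ge_min lexx orbT.
have tw : `|x + t *: w - x| <= Num.min (e / 2) (e' / 2).
  by rewrite addrAC subrr add0r normrZ gtr0_norm// (le_trans _ te)// ler_pM2l// lerDl.
exists (x + t *: w); split; last first.
  by apply: he; apply: (le_lt_trans tw); rewrite gt_min; apply/orP; left; lra.
have Ut : U (x + t *: w).
  by apply: he'; apply: (le_lt_trans tw); rewrite gt_min; apply/orP; right; lra.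
by apply/(Of _ Ut); rewrite -fx; apply: hd; rewrite t0.
Qed.

Lemma boundary_chart p : boundary O p -> exists k f N c r F, chart k f N c r F /\ N p.
Proof.
move=> bp; have [U [f [oU Up sf [v dv] Of]]] := sO bp.
have df := smooth_on_diff sf.
have fp : f p = 0.
  by apply: (boundary_f0 oU _ Of Up bp); exact/differentiable_continuous/df.
have [k Dk] : exists k, 'D_(delta_mx 0 k) f p != 0.
  apply/not_existsP => h; move: dv; rewrite -(deriveE _ (df _ Up)) row_sum_derive; last exact: df.
  rewrite big1 ?eqxx// => i _; have /negP := h i; rewrite negbK => /eqP ->; exact: mulr0.
have [N [r [F [[oN Np] r0 NU hF hN]]]] := implicit_graph oU Up sf fp Dk.
exists k, f, N, (del k p), r, F; split => //; split => //.
- by apply: smooth_on_sub sf => x /NU[].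
- by move=> x /NU[].
- by move=> x /NU[Ux _]; exact: Of.
Qed.

Section in_chart.
Variables (k : 'I_n.+1) (f : V -> R) (N : set V) (c : 'rV[R]_n) (r : R) (F : 'rV[R]_n -> V).
Hypothesis ch : chart k f N c r F.
Local Notation U := [set u : 'rV[R]_n | `|u - c| < r].

Let oN := chart_open ch.
Let r0 := chart_r ch.
Let sf := chart_smooth ch.

Lemma chart_U_open : open U.
Proof.
rewrite openE => u /= h; apply: (@near_dist _ _ _ (fun y : 'rV[R]_n => y)) h; exact: cvg_id.
Qed.

Lemma chart_diff x : N x -> differentiable f x. Proof. exact: smooth_on_diff sf. Qed.

Lemma chart_f0 x : N x -> boundary O x -> f x = 0.
Proof.
move=> Nx; apply: (boundary_f0 oN _ (chart_dom ch)) => //.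
exact/differentiable_continuous/chart_diff.
Qed.

Lemma chart_bd x : N x -> f x = 0 -> boundary O x.
Proof.
by move=> Nx; apply: (f0_boundary oN (chart_diff Nx) (chart_slope ch Nx) (chart_dom ch)).
Qed.

Lemma chart_S u : U u -> boundary O (F u).
Proof. by move=> /(chart_param ch)[NF fF _ _]; exact: chart_bd. Qed.

Lemma chart_N u : U u -> N (F u). Proof. by move=> /(chart_param ch)[]. Qed.

Lemma chart_del u : U u -> del k (F u) = u. Proof. by move=> /(chart_param ch)[]. Qed.

Lemma chart_hasD u : U u -> hasD F u (fun v => ins k v (- 'D_(ins k v 0) f (F u) / 'D_(delta_mx 0 k) f (F u))).
Proof. by move=> /(chart_param ch)[]. Qed.

Lemma chart_F x : N x -> boundary O x -> U (del k x) /\ F (del k x) = x.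
Proof. by move=> Nx bx; apply: (chart_inv ch) => //; exact: chart_f0. Qed.

Lemma chart_smooth_on m (G : 'rV[R]_n -> 'rV[R]_m) :
  (forall i, exists2 h, elem N h & forall u, U u -> G u 0 i = h (F u)) -> smooth_on U G.
Proof.
apply: (smooth_on_graph_sol oN chart_U_open sf (chart_slope ch)) => u Uu.
by split; [exact: chart_N|exact: chart_hasD].
Qed.

Lemma chart_smooth_F : smooth_on U F.
Proof. by apply: chart_smooth_on => i; exists (fun x : V => x 0 i) => //; exact: elem_coord. Qed.

Lemma chart_del_J u (v : 'rV[R]_n) : U u -> del k (v *m 'J F u) = v.
Proof.
by move=> /chart_hasD[dF hF]; rewrite -(deriveEjacobian _ dF) hF del_ins.
Qed.

Lemma chart_local_param : local_param (boundary O) U F.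
Proof.
split.
- exact: chart_U_open.
- exact: chart_smooth_F.
- by move=> u v /set_mem Uu /set_mem Uv e; rewrite -(chart_del Uu) e chart_del.
- exact: chart_S.
- move=> u Uu; apply/inj_row_free => v vJ.
  rewrite -(chart_del_J v Uu) vJ; by apply/rowP => i; rewrite !mxE.
Qed.

Variable nu : V -> V.
Hypothesis hnu : outward_unit_normal (n := n) hyp_metric O nu.

Definition grad0 (g : V -> R) (x : V) : V := \row_j 'D_(delta_mx 0 j) g x.
(* The squared length of the hyperbolic gradient of g. *)
Definition steep (g : V -> R) (x : V) : R := dot (grad0 g x) (grad0 g x) + dot x (grad0 g x) ^+ 2.

Lemma dot_grad0 g (x w : V) : differentiable g x -> dot w (grad0 g x) = 'D_w g x.
Proof. by move=> dg; rewrite dotE row_sum_derive//; apply: eq_bigr => i _; rewrite mxE. Qed.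

Lemma steep_gt0 x : N x -> 0 < steep f x.
Proof.
move=> Nx; rewrite /steep ltr_pwDl ?sqr_ge0// lt_def dot_ge0 andbT dot_eq0.
by apply: contraNneq (chart_slope ch Nx) => h; rewrite -dot_grad0 ?h; [rewrite dotC dot0l|exact: chart_diff].
Qed.

Lemma inner_g1 (x a b : V) : ip x (a + dot x a *: x) b = dot a b.
Proof.
rewrite innerE !dotrw dotxx; field; exact: wt_neq0.
Qed.

Lemma inner_nondeg (x a b : V) : (forall w, ip x a w = ip x b w) -> a = b.
Proof.
move=> h; apply/eqP; rewrite -subr_eq0; apply/eqP/(@inner_eq0 _ _ x).
by rewrite {1}/GRing.add /= innerDl innerNl h subrr.
Qed.

(** The normal annihilates the tangent vectors of the graph, so it is a multiple [c0] of the
    hyperbolic gradient of [f]. Unit length gives [c0] up to sign; were [c0] negative, [f] would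
    decrease along [nu x], which would then point into [O]. *)
Lemma normal_chart x : N x -> boundary O x ->
  nu x = (Num.sqrt (steep f x))^-1 *: (grad0 f x + dot x (grad0 f x) *: x).
Proof.
move=> Nx bx; have [Uu Fx] := chart_F Nx bx; set u := del k x in Uu Fx.
have [[nn out] _] := (hnu.1 x bx, tt).
have dfx := chart_diff Nx.
have q0 := steep_gt0 Nx.
have gk := chart_slope ch Nx.
set G := grad0 f x + _.
have orth v : ip x (nu x) (ins k v (- 'D_(ins k v 0) f x / 'D_(delta_mx 0 k) f x)) = 0.
  have [dF hF] := chart_hasD Uu.
  have -> : ins k v (- 'D_(ins k v 0) f x / 'D_(delta_mx 0 k) f x) = 'D_v F u by rewrite hF Fx.
  rewrite (deriveEjacobian _ dF) (row_sum_delta v) mulmx_suml /inner linear_sum.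
  rewrite mulmx_sumr summxE big1// => i _.
  rewrite -scalemxAl linearZ /= -scalemxAr mxE -rowE.
  by have := hnu.2 _ _ chart_local_param u i Uu; rewrite /inner Fx => ->; rewrite mulr0.
pose c0 := ip x (nu x) (delta_mx 0 k) / 'D_(delta_mx 0 k) f x.
have nw (w : V) : ip x (nu x) w = c0 * 'D_w f x.
  have dec (y : V) : y = ins k (del k y) 0 + y 0 k *: delta_mx 0 k.
    apply/rowP => i; rewrite [RHS]mxE [X in _ = _ + X]mxE.
    case: (unliftP k i) => [j|] ->; rewrite ?ins_lift ?ins_k [delta_mx _ _ _ _]mxE eqxx /= ?eqxx.
      by rewrite eq_sym (negbTE (neq_lift _ _)) mulr0 addr0 mxE.
    by rewrite mulr1 add0r.
  have e : 'D_w f x = 'D_(ins k (del k w) 0) f x + w 0 k * 'D_(delta_mx 0 k) f x.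
    rewrite [in LHS](dec w) !(deriveE _ dfx) linearD linearZ; by rewrite /GRing.scale /= ?dec.
  have wE : w = ins k (del k w) (- 'D_(ins k (del k w) 0) f x / 'D_(delta_mx 0 k) f x)
     + ('D_w f x / 'D_(delta_mx 0 k) f x) *: delta_mx 0 k.
    rewrite e [LHS]dec; apply/rowP => j; rewrite [LHS]mxE [RHS]mxE [X in _ + X = _]mxE [X in _ = _ + X]mxE.
    case: (unliftP k j) => [i|] ->; rewrite ?ins_lift ?ins_k [delta_mx _ _ _ _]mxE eqxx /= ?eqxx.
      by rewrite eq_sym (negbTE (neq_lift _ _)) !mulr0.
    by rewrite mulr1n; field.
  by rewrite [in LHS]wE innerDr orth add0r innerZr /c0; ring.
have GE w : ip x G w = 'D_w f x by rewrite /G inner_g1 dotC dot_grad0.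
have nG : nu x = c0 *: G by apply: (@inner_nondeg x) => w; rewrite innerZl GE nw.
have qE : ip x G G = steep f x.
  by rewrite {1}/G inner_g1 /G dotDr dotZr /steep (dotC _ x) expr2.
have c2 : c0 ^+ 2 * steep f x = 1 by rewrite -nn nG innerZl innerZr qE; ring.
have c00 : 0 <= c0.
  rewrite leNgt; apply/negP => cn.
  have [|d d0 hd] := @derive_neg _ f x (nu x) (diff_derivable dfx).
    by rewrite -GE nG innerZr qE nmulr_rlt0.
  have cl : {for 0, continuous (fun t : R => x + t *: nu x)}.
    by apply: contD; [exact: contC|apply: contZ; [exact: cvg_id|exact: contC]].
  have h1 : \forall t \near (0:R), N (x + t *: nu x).
    by apply: cl; rewrite scale0r addr0; exact: open_nbhs_nbhs.
  have [e e0 he] := near_norm h1.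
  have := out; rewrite /prop_near1 /nbhs /= /at_right /within /=.
  move=> /near_norm[e' e'0 he'].
  pose t := Num.min (d / 2) (Num.min (e / 2) (e' / 2)).
  have t0 : 0 < t by rewrite !lt_min !divr_gt0.
  have td : t < d by rewrite gt_min; apply/orP; left; lra.
  have te : t < e by rewrite !gt_min; apply/orP; right; apply/orP; left; lra.
  have te' : t < e' by rewrite !gt_min; apply/orP; right; apply/orP; right; lra.
  have tn : `|t - 0| = t by rewrite subr0 gtr0_norm.
  have Nt : N (x + t *: nu x) by apply: he; rewrite tn.
  apply: (he' t); rewrite ?tn//.
  by apply/(chart_dom ch Nt); rewrite -(chart_f0 Nx bx); apply: hd; rewrite t0.
rewrite nG; congr (_ *: _).
have sq : c0 * Num.sqrt (steep f x) = 1.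
  by rewrite -[c0]ger0_norm// -sqrtr_sqr -sqrtrM ?sqr_ge0// c2 sqrtr1.
by rewrite -[LHS]mulr1 -(mulfV (x := Num.sqrt (steep f x))) ?gt_eqF ?sqrtr_gt0// mulrA sq mul1r.
Qed.

Lemma normal_derive x w : N x -> boundary O x -> 'D_w f x = Num.sqrt (steep f x) * ip x (nu x) w.
Proof.
move=> Nx bx; rewrite normal_chart// innerZl inner_g1 dotC dot_grad0; last exact: chart_diff.
by rewrite mulrA mulfV ?mul1r// gt_eqF// sqrtr_gt0 steep_gt0.
Qed.

Lemma chart_smooth_nu : smooth_on U (nu \o F).
Proof.
have ed (v : V) : elem N ('D_v f) by apply: elem_smooth; exact: smooth_on_derive.
have eg i : elem N (fun x => grad0 f x 0 i).
  by rewrite (_ : (fun _ => _) = 'D_(delta_mx 0 i) f)//; apply/funext => x; rewrite mxE.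
have ex : elem N (fun x => dot x (grad0 f x)).
  rewrite (_ : (fun _ => _) = fun x : V => \sum_i x 0 i * grad0 f x 0 i); last by apply/funext => x; rewrite dotE.
  by apply: elem_sum => // i; apply: elem_mul => //; exact: elem_coord.
have es : elem N (steep f).
  rewrite (_ : steep f = fun x : V => (\sum_i grad0 f x 0 i * grad0 f x 0 i) + dot x (grad0 f x) * dot x (grad0 f x)).
    by apply: elem_add; [apply: elem_sum => // i; exact: elem_mul|exact: elem_mul].
  by apply/funext => x; rewrite -dotE -expr2.
apply: chart_smooth_on => i.
exists (fun x => (Num.sqrt (steep f x))^-1 * (grad0 f x 0 i + dot x (grad0 f x) * x 0 i)).
  apply: elem_mul; last by apply: elem_add => //; apply: elem_mul => //; exact: elem_coord.
  by apply: elem_inv => [|x Nx]; [apply: elem_sqrt => //; exact: steep_gt0|rewrite gt_eqF// sqrtr_gt0 steep_gt0].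
by move=> u Uu; rewrite /= normal_chart; [rewrite !mxE|exact: chart_N|exact: chart_S].
Qed.
End in_chart.
End chart.

(** * The Weingarten map in a chart *)

Section tcomp.
Context {R : realType} {m : nat}.

(* The tangent vector v at x lifts to (v, tcomp x v) on the hyperboloid. *)
Definition tcomp (x v : 'rV[R]_m) : R := dot x v / wt x.

Lemma innerE_tcomp (x u v : 'rV[R]_m) : inner hyp_metric x u v = dot u v - tcomp x u * tcomp x v.
Proof. by rewrite innerE /tcomp; field; exact: wt_neq0. Qed.

Lemma tcompD (x u v : 'rV[R]_m) : tcomp x (u + v) = tcomp x u + tcomp x v.
Proof. by rewrite /tcomp dotDr mulrDl. Qed.

Lemma tcompZ (x : 'rV[R]_m) a v : tcomp x (a *: v) = a * tcomp x v.
Proof. by rewrite /tcomp dotZr mulrA. Qed.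

Lemma hasD_tcomp (V : normedModType R) (f g : V -> 'rV[R]_m) (x : V) L M :
  hasD f x L -> hasD g x M ->
  hasD (fun y : V => tcomp (f y) (g y)) x (fun v : V => (dot (L v) (g x) + dot (f x) (M v)) / wt (f x)
     - dot (f x) (g x) * dot (f x) (L v) / wt (f x) ^+ 3).
Proof.
move=> hf hg; have h := hasD_M (hasD_dot hf hg) (@hasD_V _ _ (fun y : V => wt (f y)) x _ (wt_neq0 _) (hasD_wt hf)).
by apply: hasD_eq h _ => v /=; field; exact: wt_neq0.
Qed.

Lemma hasD_const (V W : normedModType R) (f : V -> W) (x : V) L a v :
  hasD f x L -> (\forall y \near x, f y = a) -> L v = 0.
Proof.
move=> hf fa; have [_ hc] := hasD_cst a x.
have [_ h] : hasD (fun=> a) x L by apply: hasD_near hf.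
by rewrite -h hc.
Qed.

End tcomp.

Section weingarten.
Context {R : realType} {n : nat}.
Local Notation V := 'rV[R]_n.+1.
Local Notation ip := (inner hyp_metric).

Variable O : set V.
Hypothesis oO : open O.
Hypothesis sO : smooth_boundary O.
Variable nu : V -> V.
Hypothesis hnu : outward_unit_normal (n := n) hyp_metric O nu.
Variables (k : 'I_n.+1) (f : V -> R) (N : set V) (c : 'rV[R]_n) (r : R) (F : 'rV[R]_n -> V).
Hypothesis ch : chart O k f N c r F.
Local Notation U := [set u : 'rV[R]_n | `|u - c| < r].

Lemma chart_nearU u : U u -> \forall y \near u, U y.
Proof. by move=> Uu; exact: open_nbhs_nbhs (conj (chart_U_open (c := c) (r := r)) Uu). Qed.

Lemma chart_diff_F u : U u -> differentiable F u.
Proof. by move=> /(chart_hasD ch)[]. Qed.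

Lemma chart_diff_nu u : U u -> differentiable (nu \o F) u.
Proof. exact: smooth_on_diff (chart_smooth_nu oO ch hnu). Qed.

Lemma normal_tan u (v : 'rV[R]_n) : U u -> ip (F u) (nu (F u)) (v *m 'J F u) = 0.
Proof.
move=> Uu; rewrite (row_sum_delta v) mulmx_suml /inner linear_sum mulmx_sumr summxE big1// => i _.
rewrite -scalemxAl linearZ /= -scalemxAr mxE -rowE.
by have := hnu.2 _ _ (chart_local_param oO ch) u i Uu; rewrite /inner => ->; rewrite mulr0.
Qed.

Lemma normal_unit x : boundary O x -> ip x (nu x) (nu x) = 1.
Proof. by move=> /(hnu.1)[]. Qed.

(** The two vectors have the same coordinates other than the [k]-th, so they differ by a multiple of
    the [k]-th basis vector. This difference is orthogonal to the normal, while the basis vector is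
    not, by [chart_slope]. *)
Lemma tan_span u (a : V) : U u -> ip (F u) (nu (F u)) a = 0 -> a = del k a *m 'J F u.
Proof.
move=> Uu ha; have Nu := chart_N ch Uu; have Su := chart_S oO ch Uu.
pose b := a - del k a *m 'J F u.
have bE : b = b 0 k *: delta_mx 0 k.
  have b0 : del k b = 0 by rewrite /b delB (chart_del_J ch _ Uu) subrr.
  rewrite -[LHS](ins_del k) b0; apply/rowP => j; rewrite [RHS]mxE [delta_mx _ _ _ _]mxE eqxx /=.
  case: (unliftP k j) => [i|] ->; rewrite ?ins_lift ?ins_k ?eqxx ?mulr1// mxE.
  by rewrite eq_sym (negbTE (neq_lift _ _)) mulr0.
have : ip (F u) (nu (F u)) b = 0 by rewrite /b innerDr innerNr ha normal_tan// subr0.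
have := normal_derive oO ch hnu (delta_mx 0 k) Nu Su.
rewrite bE innerZr => e /eqP; rewrite mulf_eq0 => /orP[/eqP b0|/eqP i0].
  by move: bE; rewrite b0 scale0r => /eqP; rewrite subr_eq0 => /eqP.
by have /eqP[] := chart_slope ch Nu; rewrite e i0 mulr0.
Qed.

(** Differentiate the unit length of [nu]; the terms from the varying metric cancel because tangent
    vectors are orthogonal to [nu]. *)
Lemma normal_D u (v : 'rV[R]_n) : U u -> ip (F u) (nu (F u)) ('D_v (nu \o F) u) = 0.
Proof.
move=> Uu; have hF := hasD_diff (chart_diff_F Uu); have hN := hasD_diff (chart_diff_nu Uu).
have Su y : U y -> boundary O (F y) by exact: (chart_S oO ch).
have h := hasD_B (hasD_dot hN hN) (hasD_M (hasD_tcomp hF hN) (hasD_tcomp hF hN)).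
have e : \forall y \near u, dot ((nu \o F) y) ((nu \o F) y) -
     tcomp (F y) ((nu \o F) y) * tcomp (F y) ((nu \o F) y) = 1.
  by apply: filterS (chart_nearU Uu) => y /Su b; rewrite -innerE_tcomp normal_unit.
have {e h} := hasD_const (a := 1 : R) v h e.
have := normal_tan v Uu; rewrite -(deriveEjacobian _ (chart_diff_F Uu)) !innerE /tcomp /= => /eqP.
rewrite subr_eq0 => /eqP tan.
rewrite (dotC ('D_v F u)) (dotC ('D_v (nu \o F) u)) tan => e.
apply: (@mulfI _ 2) => //; rewrite mulr0 -e; move: (wt_neq0 (F u)).
by move: (dot _ _) (dot _ _) (dot _ _) (dot _ _) (wt _) => a1 a2 a3 a4 w w0; field.
Qed.

(** With X and N the lifts, [<N, X> = 0] gives [<dN, X> = - <N, dX> = 0]. So dN is tangent to the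
    hyperboloid, and its last coordinate is determined by its space part like that of any lifted
    tangent vector. *)
Lemma tcomp_normal_D u (v : 'rV[R]_n) : U u ->
  hasD (fun y => tcomp (F y) (nu (F y))) u (fun v : 'rV[R]_n => tcomp (F u) ('D_v (nu \o F) u)).
Proof.
move=> Uu; have hF := hasD_diff (chart_diff_F Uu); have hN := hasD_diff (chart_diff_nu Uu).
apply: hasD_eq (hasD_tcomp hF hN) _ => {}v.
have := normal_tan v Uu; rewrite -(deriveEjacobian _ (chart_diff_F Uu)) !innerE /tcomp /= => /eqP.
rewrite subr_eq0 => /eqP tan.
rewrite (dotC ('D_v F u)) tan; move: (wt_neq0 (F u)).
by move: (dot _ _) (dot _ _) (dot _ _) (wt _) => a1 a2 a3 w w0; field.
Qed.

(* The components of a tangent vector in the frame of a graph chart are its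
   coordinates other than the k-th. *)
Definition gweing (u : 'rV[R]_n) : 'M[R]_n := \matrix_i del k ('D_(delta_mx 0 i) (nu \o F) u).

Lemma D_normal u (v : 'rV[R]_n) : U u -> 'D_v (nu \o F) u = v *m gweing u *m 'J F u.
Proof.
move=> Uu; rewrite [LHS](tan_span Uu (normal_D v Uu)); congr (_ *m _).
rewrite (deriveEjacobian _ (chart_diff_nu Uu)).
apply/rowP => j; rewrite !mxE; apply: eq_bigr => i _; rewrite !mxE; congr (_ * _).
by rewrite -(deriveE _ (chart_diff_nu Uu)).
Qed.

Lemma D_chart u (v : 'rV[R]_n) : U u -> 'D_v F u = v *m 'J F u.
Proof. by move=> /chart_diff_F; exact: deriveEjacobian. Qed.

(** By [christoffelE] the connection term is [- F u] times the product of a tangent vector with the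
    normal, hence zero. *)
Lemma covariantE u i : U u -> covariant hyp_metric F (nu \o F) u i = 'D_(delta_mx 0 i) (nu \o F) u.
Proof.
move=> Uu; rewrite /covariant; set s := (X in _ + X); suff -> : s = 0 by rewrite addr0.
apply/rowP => l; rewrite !mxE.
transitivity (- F u 0 l * ip (F u) (row i ('J F u)) (nu (F u))); last first.
  by rewrite innerC rowE normal_tan// mulr0.
rewrite /inner mxE mulr_sumr exchange_big /=; apply: eq_bigr => b _.
rewrite !mxE mulr_suml mulr_sumr; apply: eq_bigr => a _.
by rewrite christoffelE !mxE; ring.
Qed.

Lemma inner_mx m (x : V) (A : 'M[R]_(m, n.+1)) (w : V) i : ip x (row i A) w = (A *m hyp_metric x *m w^T) i 0.
Proof. by rewrite /inner -row_mul -row_mul mxE. Qed.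

Lemma second_formE u : U u -> second_form hyp_metric F nu u = gweing u *m first_form hyp_metric F u.
Proof.
move=> Uu; apply/matrixP => i j; rewrite mxE covariantE// D_normal// /first_form /inner.
rewrite -(mulmxA (delta_mx 0 i)) -rowE -row_mul [LHS]mxE !mulmxA [RHS]mxE.
by apply: eq_bigr => l _; rewrite !mxE.
Qed.

Lemma first_formE u (v w : 'rV[R]_n) : (v *m first_form hyp_metric F u *m w^T) 0 0 =
  ip (F u) (v *m 'J F u) (w *m 'J F u).
Proof. by rewrite /first_form /inner trmx_mul !mulmxA. Qed.

Lemma first_form_unit u : U u -> first_form hyp_metric F u \in unitmx.
Proof.
move=> Uu; rewrite -row_free_unit; apply/inj_row_free => v h.
have : ip (F u) (v *m 'J F u) (v *m 'J F u) = 0 by rewrite -first_formE h mul0mx mxE.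
move=> /inner_eq0 h2; rewrite -(chart_del_J ch v Uu) h2.
by apply/rowP => i; rewrite !mxE.
Qed.

Lemma weingartenE u : U u -> weingarten hyp_metric F nu u = gweing u.
Proof. by move=> Uu; rewrite /weingarten second_formE// mulmxK// first_form_unit. Qed.

Definition frame u : 'M[R]_(1 + n) := col_mx (nu (F u) : 'rV[R]_(1 + n)) ('J F u : 'M[R]_(n, 1 + n)).

Lemma det_frame u : U u -> \det (frame u) ^+ 2 = wt (F u) ^+ 2 * \det (first_form hyp_metric F u).
Proof.
move=> Uu; have Su := chart_S oO ch Uu.
(* The Gram matrix of the frame is block diagonal, and the metric itself contributes [wt ^- 2] to
   its determinant. *)
have E : frame u *m hyp_metric (F u) *m (frame u)^T = block_mx 1%:M 0 0 (first_form hyp_metric F u).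
  rewrite /frame tr_col_mx mul_col_mx mul_col_mx !mul_mx_row.
  rewrite -[LHS]/(block_mx _ _ _ _).
  congr block_mx.
  - by rewrite [LHS]mx11_scalar; congr (_%:M); exact: normal_unit.
  - apply/matrixP => i j; rewrite ord1 [RHS]mxE.
    have := normal_tan (delta_mx 0 j) Uu; rewrite /inner -rowE => <-.
    by rewrite !mxE; apply: eq_bigr => l _; rewrite !mxE.
  - apply/matrixP => i j; rewrite ord1 [RHS]mxE.
    by have := normal_tan (delta_mx 0 i) Uu; rewrite innerC -rowE inner_mx => <-.
have := congr1 determinant E; rewrite !det_mulmx det_tr det_hyp_metric det_ublock det1 mul1r => <-.
by field; exact: wt_neq0.
Qed.

Lemma det_first_form_gt0 u : U u -> 0 < \det (first_form hyp_metric F u).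
Proof.
move=> Uu; have := first_form_unit Uu; rewrite unitmxE unitfE => d0.
rewrite lt_def d0 /=; have w0 : 0 < wt (F u) ^+ 2 by rewrite exprn_gt0// wt_gt0.
by rewrite -(pmulr_rge0 _ w0) -det_frame// sqr_ge0.
Qed.

Lemma norm_det_frame u : U u -> `|\det (frame u)| = wt (F u) * Num.sqrt (\det (first_form hyp_metric F u)).
Proof.
move=> Uu; rewrite -sqrtr_sqr det_frame// sqrtrM ?sqr_ge0// sqrtr_sqr ger0_norm//.
by rewrite ltW// wt_gt0.
Qed.

Variable kappa : V -> 'I_n -> R.
Hypothesis hkappa : principal_curvatures hyp_metric (boundary O) nu kappa.

Lemma char_gweing u : U u -> char_poly (gweing u) = \prod_i ('X - (kappa (F u) i)%:P).
Proof.
by move=> Uu; have := hkappa (chart_local_param oO ch) Uu; rewrite weingartenE.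
Qed.

Lemma tr_gweing u : (0 < n)%N -> U u -> \tr (gweing u) = mean_curvature kappa (F u).
Proof.
move=> n0 Uu; have := char_poly_trace (gweing u) n0; rewrite char_gweing// => h.
apply: oppr_inj; rewrite -h /mean_curvature.
have := @coefPn_prod_XsubC _ (map (kappa (F u)) (index_enum 'I_n)).
rewrite !big_map size_map -[X in size X]enumT size_enum_ord => -> //.
by rewrite -lt0n.
Qed.

Lemma det_gweing u (a s : R) : U u -> \det (a%:M - s *: gweing u) = \prod_i (a - s * kappa (F u) i).
Proof.
move=> Uu; have [->|s0] := eqVneq s 0.
  by rewrite scale0r subr0 det_scalar; under eq_bigr do rewrite mul0r subr0; rewrite prodr_const card_ord.
have -> : a%:M - s *: gweing u = s *: ((a / s)%:M - gweing u).
  by rewrite scalerBr scale_scalar_mx mulrC divfK.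
rewrite detZ.
have -> : \det ((a / s)%:M - gweing u) = (char_poly (gweing u)).[a / s].
  rewrite /char_poly -horner_evalE -det_map_mx; congr determinant.
  apply/matrixP => i j; rewrite !mxE /= /horner_eval hornerD hornerN hornerC hornerMn hornerX; by [].
rewrite char_gweing// horner_prod -[X in s ^+ X]card_ord -prodr_const -big_split /=.
by apply: eq_bigr => i _; rewrite hornerXsubC; field.
Qed.

Lemma kappa_eigen u i : U u -> exists2 v : 'rV[R]_n, v != 0 & v *m gweing u = kappa (F u) i *: v.
Proof.
move=> Uu; have : root (char_poly (gweing u)) (kappa (F u) i).
  rewrite char_gweing// /root horner_prod (bigD1 i)//= hornerXsubC subrr mul0r eqxx//.
rewrite -eigenvalue_root_char => /eigenvalueP[v vE v0]; by exists v.
Qed.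
End weingarten.

(** * The normal flow *)

Section bordered.
Context {R : comRingType}.

Lemma det_bordered m (A : 'M[R]_m) (c : 'cV[R]_m) (o : 'rV[R]_m) (d : R) :
  \det (block_mx A (A *m c) o d%:M) = \det A * (d - (o *m c) 0 0).
Proof.
have -> : block_mx A (A *m c) o d%:M =
    block_mx A 0 o (d%:M - o *m c) *m block_mx 1%:M c 0 1%:M.
  by rewrite mulmx_block !mulmx1 !mulmx0 !addr0 addrC subrK.
rewrite det_mulmx det_lblock det_ublock !det1 !mulr1; congr (_ * _).
by rewrite det_mx11 !mxE eqxx mulr1n.
Qed.

(** The rows of the bordered matrix are vectors of Minkowski space, with the lift of [o] last: [c]
    and [c'] compute last coordinates from space parts. Subtracting multiples [tau] of the last row
    from the others keeps the determinant, so [tau] drops out. This is the projection along O in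
    terms of determinants. *)
Lemma det_bordered_rank1 m (A Q : 'M[R]_m) (c c' tau : 'cV[R]_m) (o : 'rV[R]_m) (d : R) :
  A = Q - tau *m o -> A *m c' = Q *m c - d *: tau ->
  \det A * (d - (o *m c') 0 0) = \det Q * (d - (o *m c) 0 0).
Proof.
move=> AE Ac; rewrite -!det_bordered Ac {1}AE.
have -> : block_mx (Q - tau *m o) (Q *m c - d *: tau) o d%:M =
    block_mx 1%:M (- tau) 0 1%:M *m block_mx Q (Q *m c) o d%:M.
  by rewrite mulmx_block !mul1mx !mul0mx !add0r !mulNmx mul_mx_scalar.
by rewrite det_mulmx det_ublock !det1 !mul1r.
Qed.
End bordered.

Section flow.
Context {R : realType} {n : nat}.
Local Notation V := 'rV[R]_n.+1.
Local Notation ip := (inner hyp_metric).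
Variables (o : V) (nu : V -> V).

(* With X, N, O the lifts of p, nu p, o to Minkowski space,
   height p = - <X - N, O> = V - V_nu and flow s p is the point of the
   hyperboloid of the form X + s (X - N) - t O. *)
Definition height (p : V) : R := coshd o p - (wt o * tcomp p (nu p) - dot o (nu p)).
Definition flow_eta (s : R) (p : V) : R := coshd o p + s * height p.
(** The smaller root of the quadratic equation [flow_tE], which puts [X + s (X - N) - t O] on the
    hyperboloid; this choice of root selects the upper sheet. *)
Definition flow_t (s : R) (p : V) : R := flow_eta s p - Num.sqrt (flow_eta s p ^+ 2 - 2 * s).
Definition flow (s : R) (p : V) : V := p + s *: (p - nu p) - flow_t s p *: o.
(** The last coordinate of [X + s (X - N)] in Minkowski space. *)
Definition flow_Y0 (s : R) (p : V) : R := wt p + s * (wt p - tcomp p (nu p)).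

(** The reversed Cauchy inequality for two future timelike vectors, the lift of [o] and
    [(y, y0)]. *)
Lemma rev_cauchy (y : V) (y0 c : R) : 0 < y0 -> 0 <= c -> y0 ^+ 2 - dot y y = c ->
  Num.sqrt c <= wt o * y0 - dot o y.
Proof.
move=> y0p c0 hc; have := dot_cauchy o y; rewrite dotxx (_ : dot y y = y0 ^+ 2 - c); last by lra.
move=> h; have w1 := wt_ge1 o; set q := Num.sqrt c; have q2 : q ^+ 2 = c by rewrite sqr_sqrtr.
have q0 : 0 <= q by rewrite sqrtr_ge0.
have qy : q <= y0.
  by rewrite -(@ler_pXn2r _ 2) ?nnegrE ?(ltW y0p)// q2 -hc gerBl dot_ge0.
have qwy : q <= wt o * y0 by nra.
rewrite lerBrDr -lerBrDl; apply: ler_of_sqr; first by rewrite subr_ge0.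
rewrite (le_trans h)// -q2 -subr_ge0.
by rewrite (_ : _ - _ = (wt o * q - y0) ^+ 2) ?sqr_ge0//; ring.
Qed.

Section at_point.
Variables (s : R) (p : V).
Hypothesis hs : 0 <= s.
Hypothesis hp : ip p (nu p) (nu p) = 1.

Lemma tcomp_lt : `|tcomp p (nu p)| < wt p.
Proof.
have := hp; rewrite innerE_tcomp => h; have := dot_cauchy p (nu p); rewrite dotxx.
have e : dot p (nu p) = wt p * tcomp p (nu p) by rewrite /tcomp mulrCA mulfV ?mulr1// wt_neq0.
rewrite e (_ : dot (nu p) (nu p) = 1 + tcomp p (nu p) ^+ 2); last by lra.
move: (tcomp p (nu p)) => m h1; have w0 := wt_gt0 p.
rewrite -(@ltr_pXn2r _ 2) ?nnegrE ?(ltW w0)// real_normK ?num_real//; nra.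
Qed.

Lemma flow_Y0_gt0 : 0 < flow_Y0 s p.
Proof.
have := tcomp_lt; rewrite /flow_Y0 ltr_norml => /andP[_ h].
by rewrite ltr_wpDr ?wt_gt0// mulr_ge0// subr_ge0 ltW.
Qed.

(** [X - N] is a null vector and [- <X, X - N> = 1]. *)
Lemma flow_Y2 : flow_Y0 s p ^+ 2 - dot (p + s *: (p - nu p)) (p + s *: (p - nu p)) = 1 + 2 * s.
Proof.
have := hp; rewrite innerE_tcomp => h; rewrite /flow_Y0 !dotrw (dotC (nu p) p) dotxx.
have e : dot p (nu p) = wt p * tcomp p (nu p) by rewrite /tcomp mulrCA mulfV ?mulr1// wt_neq0.
have e2 : dot (nu p) (nu p) = 1 + tcomp p (nu p) * tcomp p (nu p) by lra.
by rewrite e e2; ring.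
Qed.

Lemma flow_etaE : flow_eta s p = wt o * flow_Y0 s p - dot o (p + s *: (p - nu p)).
Proof. by rewrite /flow_eta /height /flow_Y0 /coshd !dotrw; ring. Qed.

Lemma flow_eta_ge : Num.sqrt (1 + 2 * s) <= flow_eta s p.
Proof.
rewrite flow_etaE; apply: rev_cauchy; [exact: flow_Y0_gt0| |exact: flow_Y2].
by move: hs; lra.
Qed.

Lemma flow_disc : 1 <= flow_eta s p ^+ 2 - 2 * s.
Proof.
have h : 0 <= 1 + 2 * s by move: hs; lra.
have e0 : 0 <= flow_eta s p by exact: le_trans (sqrtr_ge0 _) flow_eta_ge.
have h2 : 1 + 2 * s <= flow_eta s p ^+ 2.
  by rewrite -(sqr_sqrtr h) ler_pXn2r ?nnegrE ?sqrtr_ge0// flow_eta_ge.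
lra.
Qed.

Lemma flow_tE : flow_t s p ^+ 2 - 2 * flow_t s p * flow_eta s p + 2 * s = 0.
Proof.
have d0 : 0 <= flow_eta s p ^+ 2 - 2 * s by rewrite (le_trans _ flow_disc).
have := sqr_sqrtr d0; rewrite /flow_t; set q := Num.sqrt _ => h.
by rewrite (_ : _ + 2 * s = q ^+ 2 - (flow_eta s p ^+ 2 - 2 * s)); [rewrite h subrr|ring].
Qed.

Lemma flow_cosh_aux : wt o * (flow_Y0 s p - flow_t s p * wt o) - dot o (flow s p) =
  Num.sqrt (flow_eta s p ^+ 2 - 2 * s).
Proof.
rewrite /flow dotBr dotZr dotxx.
have -> : Num.sqrt (flow_eta s p ^+ 2 - 2 * s) = flow_eta s p - flow_t s p by rewrite /flow_t; ring.
by rewrite {1}flow_etaE; ring.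
Qed.

Lemma wt_flow : wt (flow s p) = flow_Y0 s p - flow_t s p * wt o.
Proof.
set z0 := flow_Y0 s p - _.
have sq : wt (flow s p) ^+ 2 = z0 ^+ 2.
  rewrite wt2 /z0 /flow; have := flow_Y2; have := flow_tE; rewrite flow_etaE.
  move: (p + _) => y; rewrite dotBl !dotBr !dotZl !dotZr (dotC y o) (dotxx o).
  move: (dot _ _) (dot _ _) (flow_t s p) (flow_Y0 s p) => a b t y0 h1 h2; lra.
have w0 := wt_gt0 (flow s p).
(* The equation for [flow_t] determines the last coordinate up to sign; a point of the lower sheet
   would have a product of the wrong sign with O, against [flow_cosh_aux]. *)
suff z0p : 0 <= z0.
  by apply/eqP; rewrite -(@eqrXn2 _ 2) ?sq// ltW.
rewrite leNgt; apply/negP => zn.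
have zE : z0 = - wt (flow s p).
  move/eqP: sq; rewrite eqf_sqr => /orP[/eqP h|/eqP h]; last by rewrite h opprK.
  by move: zn; rewrite -h ltNge ltW.
have := flow_cosh_aux; rewrite -/z0 zE => h.
have d1 : 0 < Num.sqrt (flow_eta s p ^+ 2 - 2 * s) by rewrite sqrtr_gt0 (lt_le_trans _ flow_disc).
have := coshd_ge1 o (- flow s p); rewrite /coshd dotNr /wt dotNl dotNr opprK -/(wt _) -/(wt _); lra.
Qed.

Lemma coshd_flow : coshd o (flow s p) = Num.sqrt (flow_eta s p ^+ 2 - 2 * s).
Proof. by rewrite /coshd wt_flow flow_cosh_aux. Qed.

(** [X - N] is a future null vector with positive last coordinate, by [tcomp_lt], and O is future
    timelike, so their product is strictly negative. *)
Lemma height_gt0 : 0 < height p.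
Proof.
have w1 := wt_ge1 o; have w0 := wt_gt0 p; have := tcomp_lt; rewrite ltr_norml => /andP[_ h].
have := hp; rewrite innerE_tcomp => h2.
have e : dot p (nu p) = wt p * tcomp p (nu p) by rewrite /tcomp mulrCA mulfV ?mulr1// wt_neq0.
have E : height p = wt o * (wt p - tcomp p (nu p)) - dot o (p - nu p).
  by rewrite /height /coshd dotBr; ring.
have c2 := dot_cauchy o (p - nu p).
have D : dot (p - nu p) (p - nu p) = (wt p - tcomp p (nu p)) ^+ 2.
  by rewrite !dotrw (dotC (nu p)) dotxx e (_ : dot (nu p) (nu p) = 1 + tcomp p (nu p) ^+ 2); [ring|lra].
rewrite E subr_gt0; move: c2; rewrite D dotxx; rewrite -subr_gt0 in h.
set k := wt p - _ in h *; set d := dot _ _ => c2.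
have wk : 0 < wt o * k by rewrite mulr_gt0// wt_gt0.
have [d0|d0] := lerP d 0; first exact: le_lt_trans d0 wk.
rewrite -(@ltr_pXn2r _ 2) ?nnegrE ?(ltW d0) ?(ltW wk)//.
by rewrite (le_lt_trans c2)// exprMn ltr_pM2r ?exprn_gt0//; lra.
Qed.

End at_point.
End flow.

Section flow_chart.
Context {R : realType} {n : nat}.
Local Notation V := 'rV[R]_n.+1.
Local Notation ip := (inner hyp_metric).

Variable O : set V.
Hypothesis oO : open O.
Hypothesis sO : smooth_boundary O.
Variable nu : V -> V.
Hypothesis hnu : outward_unit_normal (n := n) hyp_metric O nu.
Variables (k : 'I_n.+1) (f : V -> R) (N : set V) (c : 'rV[R]_n) (r : R) (F : 'rV[R]_n -> V).
Hypothesis ch : chart O k f N c r F.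
Local Notation U := [set u : 'rV[R]_n | `|u - c| < r].
Variable o : V.

Definition flow_map (z : V) : V := flow o nu (z 0 0) (F (del 0 z)).

Lemma hasD_graph u : U u -> hasD F u (fun v : 'rV[R]_n => v *m 'J F u).
Proof. by move=> Uu; split=> [|v]; [exact: (chart_diff_F ch)|exact: (D_chart ch)]. Qed.

Lemma hasD_normal u : U u -> hasD (fun y => nu (F y)) u (fun v : 'rV[R]_n => v *m gweing nu k F u *m 'J F u).
Proof.
move=> Uu; split=> [|v]; first exact: (chart_diff_nu oO hnu ch).
exact: (D_normal oO hnu ch).
Qed.

Lemma hasD_tcomp_normal u : U u ->
  hasD (fun y => tcomp (F y) (nu (F y))) u (fun v : 'rV[R]_n => tcomp (F u) (v *m gweing nu k F u *m 'J F u)).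
Proof.
move=> Uu; apply: hasD_eq (tcomp_normal_D oO hnu ch 0 Uu) _ => v.
by rewrite (D_normal oO hnu ch).
Qed.

(** The differential of [p + s (p - nu p)] in the parameters [(s, u)], factored through the vectors
    [p - nu p] and the tangent vectors; the multiple of [o] in the flow is left aside. *)
Definition flow_lin u s : 'M[R]_(1 + n) :=
  block_mx 1%:M 0 0 ((1 + s)%:M - s *: gweing nu k F u) *m
  col_mx (F u - nu (F u) : 'rV[R]_(1 + n)) ('J F u : 'M[R]_(n, 1 + n)).

Lemma rV_split0 (v : V) : v = row_mx (v 0 0)%:M (del 0 v) :> 'rV[R]_(1 + n).
Proof.
apply/rowP => j; case: (split_ordP (j : 'I_(1 + n))) => i ->.
  by rewrite row_mxEl !ord1 !mxE mulr1n; congr (v _ _); apply/val_inj.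
by rewrite row_mxEr mxE; congr (v _ _); apply/val_inj.
Qed.

Lemma mul_flow_lin u s (v : V) :
  v *m flow_lin u s = v 0 0 *: (F u - nu (F u)) + (1 + s) *: (del 0 v *m 'J F u)
     - s *: (del 0 v *m gweing nu k F u *m 'J F u).
Proof.
have -> : v *m flow_lin u s = row_mx (v 0 0)%:M (del 0 v) *m flow_lin u s by rewrite -rV_split0.
rewrite /flow_lin mulmxA mul_row_block.
rewrite mulmx1 !mulmx0 addr0 add0r mul_row_col mul_scalar_mx -addrA; congr (_ + _).
by rewrite mulmxBr mul_mx_scalar -scalemxAr mulmxBl -!scalemxAl.
Qed.

Lemma det_flow_lin u s : \det (flow_lin u s) = \det ((1 + s)%:M - s *: gweing nu k F u) *
  \det (col_mx (F u - nu (F u) : 'rV[R]_(1 + n)) ('J F u : 'M[R]_(n, 1 + n))).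
Proof. by rewrite /flow_lin det_mulmx det_ublock det1 mul1r. Qed.

Section at_z.
Variable z : V.
Local Notation s := (z 0 0).
Local Notation u := (del 0 z).
Hypothesis s0 : 0 < s.
Hypothesis Uu : U u.

Let hsD : hasD (fun z : V => z 0 0) z (fun v : V => v 0 0). Proof. exact: hasD_coord. Qed.
Let hFD : hasD (fun z : V => F (del 0 z)) z (fun v : V => del 0 v *m 'J F u).
Proof. exact: (hasD_comp (hasD_del 0 z) (hasD_graph Uu)). Qed.
Let hND : hasD (fun z : V => nu (F (del 0 z))) z (fun v : V => del 0 v *m gweing nu k F u *m 'J F u).
Proof. exact: (hasD_comp (hasD_del 0 z) (hasD_normal Uu)). Qed.
Let hTD : hasD (fun z : V => tcomp (F (del 0 z)) (nu (F (del 0 z)))) z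
   (fun v : V => tcomp (F u) (del 0 v *m gweing nu k F u *m 'J F u)).
Proof. exact: (hasD_comp (hasD_del 0 z) (hasD_tcomp_normal Uu)). Qed.
Let hWD : hasD (fun z : V => wt (F (del 0 z))) z (fun v : V => tcomp (F u) (del 0 v *m 'J F u)).
Proof. exact: (hasD_wt hFD). Qed.

Let nn : ip (F u) (nu (F u)) (nu (F u)) = 1.
Proof. by apply: (normal_unit hnu); exact: (chart_S oO ch). Qed.

(** Only the existence of a differential [tau] is recorded, because [det_bordered_rank1] eliminates
    it. *)
Lemma hasD_flow_t : exists tau : V -> R,
  hasD (fun z : V => flow_t o nu (z 0 0) (F (del 0 z))) z tau.
Proof.
have hV := hasD_coshd o hFD.
have hH := hasD_B hV (hasD_B (hasD_M (hasD_cst (wt o) z) hTD) (hasD_dot (hasD_cst o z) hND)).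
have [L1 hE] : exists L, hasD (fun y : V => flow_eta o nu (y 0 0) (F (del 0 y))) z L.
  by eexists; exact: hasD_D hV (hasD_M hsD hH).
have [L2 hQ] : exists L, hasD (fun y : V => flow_eta o nu (y 0 0) (F (del 0 y)) ^+ 2 - 2 * y 0 0) z L.
  by eexists; exact: hasD_B (hasD_M hE hE) (hasD_M (hasD_cst (2 : R) z) hsD).
have d0 : 0 < flow_eta o nu s (F u) ^+ 2 - 2 * s by rewrite (lt_le_trans _ (flow_disc o (ltW s0) nn)).
by eexists; exact: (hasD_B hE (@hasD_sqrt _ _ (fun y : V => flow_eta o nu (y 0 0) (F (del 0 y)) ^+ 2 - 2 * y 0 0) z L2 d0 hQ)).
Qed.

Lemma flow_map_diff : differentiable flow_map z.
Proof.
have [tau hT] := hasD_flow_t.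
by have [] := hasD_B (hasD_D hFD (hasD_Z hsD (hasD_B hFD hND))) (hasD_Z hT (hasD_cst o z)).
Qed.

(** The factor [coshd / wt] on the left is the density of V dvol in the chart, and it arises as the
    cofactor of the border by O. On the right, the null vector X - N paired with O gives the height,
    and the tangent vectors give the area element. *)
Lemma flow_map_det : (0 < n)%N ->
  `|\det ('J flow_map z)| * (coshd o (flow_map z) / wt (flow_map z)) =
  `|\det ((1 + s)%:M - s *: gweing nu k F u)| * (height o nu (F u) * Num.sqrt (\det (first_form hyp_metric F u))).
Proof.
move=> n0; have [tau hT] := hasD_flow_t.
have hP := hasD_B (hasD_D hFD (hasD_Z hsD (hasD_B hFD hND))) (hasD_Z hT (hasD_cst o z)).
have DP (v : V) : v *m 'J flow_map z = v *m flow_lin u s - tau v *: o.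
  rewrite -(deriveEjacobian _ flow_map_diff) mul_flow_lin; have [_ ->] := hP.
  rewrite scaler0 addr0; congr (_ - _).
  rewrite scalerDl scale1r !scalerBr; move: (del 0 v *m 'J F u) (del 0 v *m _ *m 'J F u) => a b.
  by apply/rowP => j; rewrite !mxE; ring.
set x := F u in DP *; set y := flow_map z in DP *.
pose kk := wt x - tcomp x (nu x).
have kk0 : 0 < kk by have := tcomp_lt nn; rewrite ltr_norml /kk subr_gt0 => /andP[].
pose T : 'M[R]_(n, n.+1) := 'J F u.
(* The linear form that returns the last coordinate of a lift from its space part on tangent vectors
   of the hypersurface and on [X - N]. The second term corrects the value on the latter, which is
   not tangent to the hyperboloid. *)
pose cc : 'cV[R]_n.+1 := (wt x)^-1 *: x^T - kk^-1 *: (hyp_metric x *m (nu x)^T).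
pose tc : 'cV[R]_n.+1 := \col_i tau (delta_mx 0 i).
have ipE (a : V) : (a *m (hyp_metric x *m (nu x)^T)) 0 0 = ip x a (nu x) by rewrite mulmxA.
have cE (a : V) : (a *m cc) 0 0 = tcomp x a - ip x a (nu x) / kk.
  have h (A B : 'M[R]_1) (b b' : R) : (b *: A - b' *: B) 0 0 = b * A 0 0 - b' * B 0 0 by rewrite !mxE.
  by rewrite /cc mulmxBr -!scalemxAr h ipE -/(dot a x) (dotC a) /tcomp !(mulrC _^-1).
have tauE (v : V) : v *m tc = (tau v)%:M.
  rewrite [LHS]mx11_scalar mxE; congr (_%:M).
  have [_ h] := hT; have [dh _] := hT; rewrite -h row_sum_derive//.
  by apply: eq_bigr => i _; rewrite mxE h.
have E1 : 'J flow_map z = (flow_lin u s : 'M[R]_n.+1) - tc *m o.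
  apply/row_matrixP => i; have h : delta_mx 0 i *m (tc *m o) = tau (delta_mx 0 i) *: o.
    by rewrite mulmxA tauE mul_scalar_mx.
  by rewrite !rowE DP mulmxBr h.
(* The last coordinate of the flow is [flow_Y0 - flow_t * wt o], by [wt_flow]; its derivative is
   computed in both ways. *)
have wD (v : V) : (v *m 'J flow_map z *m ((wt y)^-1 *: y^T)) 0 0 =
    (v *m flow_lin u s *m cc) 0 0 - tau v * wt o.
  rewrite -(deriveEjacobian _ flow_map_diff).
  have h1 := hasD_wt (hasD_diff flow_map_diff).
  have h2 := hasD_B (hasD_D hWD (hasD_M hsD (hasD_B hWD hTD))) (hasD_M hT (hasD_cst (wt o) z)).
  have e v0 := hasD_const (a := 0 : R) v0 (hasD_B h1 h2).
  have {}e : dot y ('D_v flow_map z) / wt y = (tcomp x (del 0 v *m 'J F u) + (v 0 0 * (wt x - tcomp x (nu x)) +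
    s * (tcomp x (del 0 v *m 'J F u) - tcomp x (del 0 v *m gweing nu k F u *m 'J F u)))) - (tau v * wt o + flow_t o nu s x * 0).
    apply/eqP; rewrite -subr_eq0; apply/eqP; apply: e.
    have n1 : \forall y \near z, 0 < (y : V) 0 0 by apply: (@near_gt _ _ (fun y : V => y 0 0)) s0; exact: coord_continuous.
    have n2 : \forall y \near z, U (del 0 y) by exact: (hasD_cont (hasD_del 0 z)) (chart_nearU Uu).
    apply: filterS (filterI n1 n2) => y' [y1 y2].
    rewrite /flow_map wt_flow ?(ltW y1)//; last by apply: (normal_unit hnu); exact: (chart_S oO ch).
    by rewrite /flow_Y0; ring.
  rewrite -scalemxAr mxE -/(dot _ y) (dotC _ y) mulrC e mulr0 addr0; congr (_ - _).
  have nt (w : 'rV[R]_n) : ip x (w *m 'J F u) (nu x) = 0 by rewrite innerC (normal_tan oO hnu ch).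
  have nt2 := nt (del 0 v *m gweing nu k F u); have nt1 := nt (del 0 v).
  rewrite mul_flow_lin cE -/x; move: nt1 nt2; move: (_ *m 'J F u) (_ *m 'J F u) => a b nt1 nt2.
  have tN w : tcomp x (- w) = - tcomp x w by rewrite -scaleN1r tcompZ mulN1r.
  rewrite !(tcompD, tN, tcompZ) !innerrw nt1 nt2 nn.
  have ipx : ip x x (nu x) = tcomp x (nu x) / wt x.
    by rewrite innerE_tcomp /tcomp dotxx; field; exact: wt_neq0.
  have tx : tcomp x x = (wt x ^+ 2 - 1) / wt x by rewrite /tcomp dotxx.
  rewrite ipx tx; move: kk0 (wt_neq0 x); rewrite /kk.
  move: (tcomp x a) (tcomp x b) (tcomp x (nu x)) (wt x) (v 0 0) s => a1 b1 t1 w1 v1 s1 kk0 w0; field.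
  by rewrite w0 gt_eqF.
have E2 : 'J flow_map z *m ((wt y)^-1 *: y^T) = flow_lin u s *m cc - wt o *: tc.
  have hcol (A : 'cV[R]_n.+1) i : A i 0 = ((delta_mx 0 i : 'rV[R]_n.+1) *m A) 0 0 by rewrite -rowE mxE.
  have hB (A B : 'cV[R]_n.+1) a i : (A - a *: B) i 0 = A i 0 - a * B i 0 by rewrite !mxE.
  apply/colP => i; rewrite hB [tc i 0]mxE [LHS]hcol mulmxA wD (hcol (_ *m cc)) mulmxA.
  by rewrite (mulrC (wt o)).
have := det_bordered_rank1 (d := wt o) E1 E2.
have -> : wt o - (o *m ((wt y)^-1 *: y^T)) 0 0 = coshd o y / wt y.
  by rewrite -scalemxAr mxE -/(dot o y) /coshd; field; exact: wt_neq0.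
rewrite cE => e.
have -> : `|\det ('J flow_map z)| * (coshd o y / wt y) = `|\det ('J flow_map z) * (coshd o y / wt y)|.
  rewrite normrM [X in _ = _ * X]ger0_norm// divr_ge0// ?(ltW (wt_gt0 _))//.
  by rewrite (le_trans _ (coshd_ge1 _ _)).
rewrite e det_flow_lin -mulrA normrM; congr (_ * _).
(* Modulo tangent vectors [x - nu x] equals [- kk / wt x] times the normal, which compares this
   determinant with that of the frame. *)
have dB : \det (col_mx (x - nu x : 'rV[R]_(1 + n)) (T : 'M[R]_(n, 1 + n))) = - kk / wt x * \det (frame nu F u).
  pose a := x - nu x + (kk / wt x) *: nu x.
  have aT : a = del k a *m 'J F u.
    apply: (tan_span oO hnu ch Uu); rewrite /a !innerrw nn.
    have -> : ip (F u) (nu (F u)) x = tcomp x (nu x) / wt x.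
      by rewrite innerC innerE_tcomp /tcomp dotxx; field; exact: wt_neq0.
    by rewrite /kk; field; exact: wt_neq0.
  have -> : col_mx (x - nu x : 'rV[R]_(1 + n)) (T : 'M[R]_(n, 1 + n)) =
     block_mx (- kk / wt x)%:M (del k a) 0 1%:M *m frame nu F u.
    rewrite /frame mul_block_col mul0mx mul1mx add0r -aT mul_scalar_mx; congr col_mx.
    by rewrite /a -/x mulNr scaleNr addrCA addNr addr0.
  by rewrite det_mulmx det_ublock det1 mulr1 det_mx11 mxE eqxx mulr1n.
rewrite dB.
have -> : - kk / wt x * \det (frame nu F u) * (wt o - (tcomp x o - ip x o (nu x) / kk)) =
   - (height o nu x / wt x) * \det (frame nu F u).
  have to : tcomp x o = dot o x / wt x by rewrite /tcomp dotC.
  rewrite /height /coshd innerE_tcomp to; move: kk0 (wt_neq0 x); rewrite /kk.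
  move: (tcomp x (nu x)) (wt x) (dot o x) (dot o (nu x)) => t1 w1 d1 d2 kk0 w0; field.
  by rewrite w0 gt_eqF.
have h0 : 0 <= height o nu x / wt x by rewrite divr_ge0// ltW// ?wt_gt0// height_gt0.
rewrite normrM normrN (ger0_norm h0).
by rewrite (norm_det_frame oO hnu ch)// mulrA divfK// wt_neq0.
Qed.
End at_z.
End flow_chart.

(** * Contact *)

Section contact_tools.
Context {R : realType} {n : nat}.
Local Notation V := 'rV[R]_n.+1.
Local Notation ip := (inner hyp_metric).

Lemma hasD_line m (u v : 'rV[R]_m) (t : R) : hasD (fun s : R => u + s *: v) t (fun s : R => s *: v).
Proof.
apply: hasD_eq (hasD_D (hasD_cst u t) (hasD_Z (hasD_id t) (hasD_cst v t))) _ => s.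
by rewrite add0r scaler0 addr0.
Qed.

(** [H] stands for the derivative of [G] along [v] near [u]. If the derivative of [H] along [v] were
    negative, [G] would strictly decrease along the ray from [u]. *)
Lemma min_second m (G H : 'rV[R]_m -> R) (u v : 'rV[R]_m) L :
  (\forall y \near u, differentiable G y /\ 'D_v G y = H y) ->
  (\forall y \near u, G u <= G y) -> H u = 0 -> hasD H u L -> 0 <= L v.
Proof.
move=> hG hmin Hu hH; rewrite leNgt; apply/negP => Lv.
have [d d0 hd] := near_norm (filterI hG hmin).
have [|e e0 he] := @derive_neg _ _ H u v (diff_derivable hH.1); first by rewrite hH.2.
pose t := Num.min (d / 2 / (`|v| + 1)) (e / 2).
have v1 : 0 < `|v| + 1 by rewrite ltr_wpDl.
have t0 : 0 < t by rewrite lt_min !divr_gt0.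
have te : t < e by rewrite gt_min; apply/orP; right; lra.
have td s : 0 <= s <= t -> `|u + s *: v - u| < d.
  move=> /andP[s0 st]; rewrite addrAC subrr add0r normrZ ger0_norm//.
  have : s * (`|v| + 1) <= d / 2.
    by rewrite -ler_pdivlMr// (le_trans st)// ge_min lexx.
  by have := normr_ge0 v; nra.
have hg s : 0 <= s <= t -> hasD (fun s : R => G (u + s *: v)) s (fun x : R => x * H (u + s *: v)).
  move=> /td/hd[[dG GH] _]; apply: hasD_eq (hasD_comp (hasD_line u v s) (hasD_diff dG)) _ => x.
  by rewrite (deriveE _ dG) linearZ /= -(deriveE _ dG) GH.
have := @ltr0_derive1_lt_cc _ (fun s : R => G (u + s *: v)) 0 t.
have H1 x : x \in `]0, t[%R -> derivable (fun s : R => G (u + s *: v)) x 1.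
  by rewrite in_itv /= => /andP[x0 xt]; have [] := hasD_derive1 (hg x _); rewrite ?(ltW x0) ?(ltW xt).
have H2 x : x \in `]0, t[%R -> derive1 (fun s : R => G (u + s *: v)) x < 0.
  rewrite in_itv /= => /andP[x0 xt]; have [|_ ->] := hasD_derive1 (hg x _); first by rewrite (ltW x0) (ltW xt).
  by rewrite mul1r -Hu; apply: he; rewrite x0 (lt_trans xt).
have H3 : {within `[0, t], continuous (fun s : R => G (u + s *: v))}.
  apply: continuous_in_subspaceT => x /set_mem /=; rewrite in_itv /= => /hg hx; exact: hasD_cont hx.
move=> /(_ H1 H2 H3 t 0); rewrite !in_itv /= !lexx (ltW t0) => /(_ erefl erefl t0).
apply/negP; rewrite -leNgt scale0r addr0.
by have [|_] := hd (u + t *: v); first by apply: td; rewrite lexx ltW.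
Qed.

Lemma min_first m (G : 'rV[R]_m -> R) (u v : 'rV[R]_m) : differentiable G u ->
  (\forall y \near u, G u <= G y) -> 'D_v G u = 0.
Proof.
move=> dG hmin.
have key w : 0 <= 'D_w G u.
  rewrite leNgt; apply/negP => Dw.
  have [d d0 hd] := near_norm hmin.
  have [e e0 he] := derive_neg (diff_derivable dG) Dw.
  have w1 : 0 < `|w| + 1 by rewrite ltr_wpDl.
  pose t := Num.min (d / 2 / (`|w| + 1)) (e / 2).
  have t0 : 0 < t by rewrite lt_min !divr_gt0.
  have te : t < e by rewrite gt_min; apply/orP; right; lra.
  have : t * (`|w| + 1) <= d / 2 by rewrite -ler_pdivlMr// ge_min lexx.
  move=> td; have := he t; rewrite t0 te => /(_ erefl); apply/negP; rewrite -leNgt; apply: hd.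
  by rewrite addrAC subrr add0r normrZ gtr0_norm//; have := normr_ge0 w; nra.
apply/eqP; rewrite eq_le key andbT; have := key (- v).
by rewrite (deriveE _ dG) linearN -(deriveE _ dG) oppr_ge0.
Qed.

Lemma path_in (O : set V) (c : R -> V) (a b : R) : open O -> continuous c -> a <= b -> O (c a) ->
  (forall t, a <= t <= b -> ~ boundary O (c t)) -> O (c b).
Proof.
move=> oO cc ab Oa nb.
have := @segment_connected R a b.
move=> /(_ (`[a, b] `&` c @^-1` O)) h.
have e : `[a, b] `&` c @^-1` O = `[a, b]%classic.
  apply: h.
  - by exists a; split => //=; rewrite in_itv /= lexx.
  - by exists (c @^-1` O) => //; apply: open_comp => // t _; exact: cc.
  - exists (c @^-1` (closure O)).
      by apply: closed_comp; [move=> t _; exact: cc|exact: closed_closure].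
    apply/seteqP; split=> t [t1 t2]; split => //; first exact: subset_closure.
    apply: contrapT => nO; apply: (nb t); first by move: t1; rewrite /= in_itv.
    by split=> //; have /interior_id -> := oO.
have : `[a, b]%classic b by rewrite /= in_itv /= lexx andbT.
by rewrite -e => -[].
Qed.

Lemma coshd_eq1 (x y : V) : coshd x y = 1 -> x = y.
Proof.
rewrite /coshd => h; have := dot_cauchy x y; rewrite !dotxx => c.
have e : dot x y = wt x * wt y - 1 by lra.
have w : wt x = wt y.
  apply/eqP; rewrite -subr_eq0 -[_ == 0](@sqrf_eq0 R) eq_le sqr_ge0 andbT; rewrite e in c; lra.
apply/eqP; rewrite -subr_eq0 -dot_eq0 !dotrw (dotC y) !dotxx e w; apply/eqP; ring.
Qed.

Lemma wt_convex (x y : V) : tcomp x (y - x) <= wt y - wt x.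
Proof.
have := coshd_ge1 x y; rewrite /coshd /tcomp dotBr dotxx => h.
by rewrite ler_pdivrMr ?wt_gt0//; lra.
Qed.

Lemma wt_seg (x y : V) (l : R) : 0 <= l <= 1 -> wt (x + l *: (y - x)) <= wt x + l * (wt y - wt x).
Proof.
move=> /andP[l0 l1]; set z := x + _.
have h1 := wt_convex z x; have h2 := wt_convex z y.
have e1 : x - z = - l *: (y - x) by rewrite /z opprD addrA subrr add0r scaleNr.
have e2 : y - z = (1 - l) *: (y - x) by rewrite /z opprD addrA scalerBl scale1r.
rewrite e1 tcompZ in h1; rewrite e2 tcompZ in h2.
move: (tcomp _ _) h1 h2 => T h1 h2.
have := ler_wpM2l l0 h2; have l1' : 0 <= 1 - l by lra.
have := ler_wpM2l l1' h1; lra.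
Qed.

Lemma coshd_bounded (z : V) (M : R) : exists K : R, forall x, coshd z x <= M -> `|x| <= K.
Proof.
(* [k] is [wt z] minus the Euclidean length of [z]; by Cauchy [coshd z x] is at least [k * wt x]. *)
pose k := wt z - Num.sqrt (wt z ^+ 2 - 1).
have w1 := wt_ge1 z; have w2 : 0 <= wt z ^+ 2 - 1 by rewrite subr_ge0 expr_ge1// ?(le_trans _ w1).
have k0 : 0 < k.
  have q2 := sqr_sqrtr w2; have q0 := sqrtr_ge0 (wt z ^+ 2 - 1).
  rewrite /k subr_gt0 ltNge; apply/negP => wq; move: (Num.sqrt _) q2 q0 wq => q q2 q0 wq; nra.
exists (M / k) => x hx; have w := wt_gt0 x.
have h1 : wt x * k <= M.
  apply: le_trans hx; rewrite /coshd /k mulrBr (mulrC (wt x)) lerB//.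
  apply: ler_of_sqr; first by rewrite mulr_ge0// ?sqrtr_ge0// ltW.
  have h := dot_cauchy z x; rewrite !dotxx in h; rewrite exprMn (sqr_sqrtr w2).
  by apply: (le_trans h); rewrite mulrC ler_wpM2r//; lra.
rewrite ler_pdivlMr// (le_trans _ h1)// ler_wpM2r ?(ltW k0)//.
apply/rV_normP; first exact: ltW.
move=> i; apply: ler_of_sqr; first exact: ltW.
rewrite real_normK ?num_real// wt2 dotE (bigD1 i)//= -expr2 addrCA ler_wpDr// addr_ge0// sumr_ge0// => j _.
by rewrite -expr2 sqr_ge0.
Qed.

End contact_tools.

Section contact.
Context {R : realType} {n : nat}.
Local Notation V := 'rV[R]_n.+1.
Local Notation ip := (inner hyp_metric).

Variable O : set V.
Hypothesis oO : open O.
Hypothesis sO : smooth_boundary O.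
Hypothesis bO : exists C, forall x y, O x -> O y -> riem_dist hyp_metric x y <= C.
Variable nu : V -> V.
Hypothesis hnu : outward_unit_normal (n := n) hyp_metric O nu.

Lemma closed_boundary : closed (boundary O).
Proof. by rewrite /boundary setDE; apply: closedI; [exact: closed_closure|rewrite closedC; exact: open_interior]. Qed.

Lemma cont_coshd (z x : V) : {for x, continuous (coshd z)}.
Proof. exact: hasD_cont (hasD_coshd z (hasD_id x)). Qed.

Lemma closure_bounded (z : V) : O z -> exists K : R, forall x, closure O x -> `|x| <= K.
Proof.
move=> Oz; have [C hC] := bO; have [K hK] := coshd_bounded z (expR C).
exists K => x cx; apply: hK; rewrite leNgt; apply/negP => h.
have nb := near_gt (cont_coshd (z := z) (x := x)) h.
have [y [Oy]] := cx _ nb; apply/negP; rewrite -leNgt.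
by apply: coshd_le_dist; exact: hC.
Qed.

Lemma compact_boundary (z : V) : O z -> compact (boundary O).
Proof.
move=> Oz; apply: bounded_closed_compact; last exact: closed_boundary.
have [K hK] := closure_bounded Oz; exists K; split; first exact: num_real.
by move=> M KM x [cx _]; exact: le_trans (hK _ cx) (ltW KM).
Qed.

Lemma cont_line (u v : V) : continuous (fun t : R => u + t *: v).
Proof. by move=> t; exact: hasD_cont (hasD_line u v t). Qed.

Lemma boundary_nonempty (z : V) : O z -> boundary O !=set0.
Proof.
move=> Oz; apply/set0P/negP => /eqP e; have [K hK] := closure_bounded Oz.
pose w : V := delta_mx 0 0; have w0 : w 0 0 = 1 by rewrite mxE eqxx.
pose T := `|K| + `|z| + 1.
have T0 : 0 <= T by rewrite !addr_ge0.
have O1 : O (z + T *: w).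
  apply: (path_in (c := fun t : R => z + t *: w) (a := 0) oO _ T0).
  - exact: cont_line.
  - by rewrite scale0r addr0.
  - by move=> t _; rewrite e.
have := hK _ (subset_closure O1); apply/negP; rewrite -ltNge.
have := ler_coord_norm (z + T *: w) 0; rewrite mxE [X in _ + X]mxE w0 mulr1.
have := ler_coord_norm z 0; rewrite ler_norml => /andP[h1 h2] h3.
have := ler_norm (z 0 0 + T); have := ler_norm K; rewrite /T in h3 *; lra.
Qed.

(** With [Y = X + s (X - N)], [- <Y, Y> = 1 + 2 s] and [- <Y, X> = 1 + s]: the boundary avoids the
    open geodesic ball that is centred at Y normalized and has [p] on its sphere. The curvature of
    that sphere is [(1 + s) / s]. *)
Definition contact (s : R) (p : V) := forall q, boundary O q -> 1 + s <= flow_eta q nu s p.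

Lemma flow_eta_self s p : ip p (nu p) (nu p) = 1 -> flow_eta p nu s p = 1 + s.
Proof. by move=> _; rewrite /flow_eta /height coshdxx /tcomp mulrCA mulfV ?wt_neq0// mulr1 subrr subr0 mulr1. Qed.

Section in_chart.
Variables (k : 'I_n.+1) (f : V -> R) (N : set V) (c : 'rV[R]_n) (r : R) (F : 'rV[R]_n -> V).
Hypothesis ch : chart O k f N c r F.
Local Notation U := [set u : 'rV[R]_n | `|u - c| < r].

Lemma hasD_support (y : V) (y0 : R) u : U u ->
  hasD (fun u => y0 * wt (F u) - dot y (F u)) u
    (fun v : 'rV[R]_n => y0 * tcomp (F u) (v *m 'J F u) - dot y (v *m 'J F u)).
Proof.
move=> Uu; have hF := hasD_graph ch Uu.
apply: hasD_eq (hasD_B (hasD_M (hasD_cst y0 u) (hasD_wt hF)) (hasD_dot (hasD_cst y u) hF)) _ => v.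
by rewrite mul0r add0r dot0l add0r.
Qed.

Lemma contact_psd s u (v : 'rV[R]_n) : 0 <= s -> U u -> contact s (F u) ->
  0 <= ip (F u) ((1 + s) *: (v *m 'J F u) - s *: (v *m gweing nu k F u *m 'J F u)) (v *m 'J F u).
Proof.
move=> s0 Uu hc; have Su x : U x -> boundary O (F x) by exact: (chart_S oO ch).
pose yy (x : 'rV[R]_n) := F x + s *: (F x - nu (F x)).
pose Y0 (x : 'rV[R]_n) := wt (F x) + s * (wt (F x) - tcomp (F x) (nu (F x))).
pose G (x : 'rV[R]_n) := Y0 u * wt (F x) - dot (yy u) (F x).
(* Since the lift of [yy x] is orthogonal to the hypersurface at [F x], it may be inserted in the
   derivative of [G]. The resulting first factors vanish at [u], so the second derivatives of [F] do
   not survive when [H] is differentiated there. *)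
pose H (x : 'rV[R]_n) := dot (yy x - yy u) ('D_v F x) - (Y0 x - Y0 u) * tcomp (F x) ('D_v F x).
have hF := hasD_graph ch Uu; have hN := hasD_normal oO hnu ch Uu.
have hT := hasD_tcomp_normal oO hnu ch Uu.
have hDF : hasD ('D_v F) u (fun w => 'D_w ('D_v F) u).
  apply: hasD_diff; apply: smooth_on_diff Uu.
  by apply: smooth_on_derive; exact: (chart_smooth_F ch).
have hyy : hasD yy u (fun w : 'rV[R]_n => w *m 'J F u + s *: (w *m 'J F u - w *m gweing nu k F u *m 'J F u)).
  apply: hasD_eq (hasD_D hF (hasD_Z (hasD_cst s u) (hasD_B hF hN))) _ => w.
  by rewrite scale0r add0r.
have hY0 : hasD Y0 u (fun w : 'rV[R]_n => tcomp (F u) (w *m 'J F u) + s * (tcomp (F u) (w *m 'J F u) - tcomp (F u) (w *m gweing nu k F u *m 'J F u))).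
  apply: hasD_eq (hasD_D (hasD_wt hF) (hasD_M (hasD_cst s u) (hasD_B (hasD_wt hF) hT))) _ => w.
  by rewrite mul0r add0r.
have hH := hasD_B (hasD_dot (hasD_B hyy (hasD_cst (yy u) u)) hDF)
   (hasD_M (hasD_B hY0 (hasD_cst (Y0 u) u)) (hasD_tcomp hF hDF)).
have := @min_second _ _ G H u v _ _ _ _ hH.
rewrite !subrr dot0l addr0 mul0r addr0 !subr0 (D_chart ch)// => h.
rewrite innerE_tcomp -scaleN1r !tcompD !tcompZ mulN1r.
have e : (1 + s) *: (v *m 'J F u) + -1 *: (s *: (v *m gweing nu k F u *m 'J F u)) =
   v *m 'J F u + s *: (v *m 'J F u - v *m gweing nu k F u *m 'J F u).
  move: (v *m 'J F u) (v *m gweing nu k F u *m 'J F u) => a b.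
  by apply/rowP => j; rewrite !mxE; ring.
rewrite e; have -> : (1 + s) * tcomp (F u) (v *m 'J F u) - s * tcomp (F u) (v *m gweing nu k F u *m 'J F u) =
   tcomp (F u) (v *m 'J F u) + s * (tcomp (F u) (v *m 'J F u) - tcomp (F u) (v *m gweing nu k F u *m 'J F u)) by ring.
apply: h.
- apply: filterS (chart_nearU Uu) => x Ux; have [dG ->] := hasD_support (yy u) (Y0 u) Ux.
  split=> //; rewrite /H (D_chart ch)// dotBl mulrBl.
  set T := v *m 'J F x; have h1 : wt (F x) * tcomp (F x) T = dot (F x) T.
    by rewrite /tcomp mulrCA mulfV ?mulr1// wt_neq0.
  have := normal_tan oO hnu ch v Ux; rewrite -/T innerE_tcomp => h2.
  have -> : dot (yy x) T = Y0 x * tcomp (F x) T.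
    rewrite /yy /Y0 dotDl dotZl dotBl mulrDl -mulrA mulrBl h1.
    by congr (_ + _ * (_ - _)); lra.
  ring.
- apply: filterS (chart_nearU Uu) => x Ux; rewrite /G.
  have := hc _ (Su _ Ux); rewrite flow_etaE.
  have e1 := flow_eta_self s (normal_unit hnu (Su _ Uu)); rewrite flow_etaE in e1.
  by rewrite -e1 !(mulrC (wt _) (flow_Y0 _ _ _)) (dotC (F u) (F u + _)) (dotC (F x)).
- by rewrite /H !subrr dot0l mul0r subr0.
Qed.

Variable kappa : V -> 'I_n -> R.
Hypothesis hkappa : principal_curvatures hyp_metric (boundary O) nu kappa.

Lemma contact_kappa s u i : 0 <= s -> U u -> contact s (F u) -> s * kappa (F u) i <= 1 + s.
Proof.
move=> s0 Uu hc; have [v v0 vW] := kappa_eigen oO hnu ch hkappa i Uu.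
have := contact_psd v s0 Uu hc; rewrite vW -scalemxAl scalerA -scalerBl innerZl.
rewrite pmulr_lge0; first by rewrite subr_ge0.
rewrite lt_def inner_ge0 andbT; apply: contraNneq v0 => /inner_eq0 h.
by rewrite -(chart_del_J ch v Uu) h; apply/eqP/rowP => j; rewrite !mxE.
Qed.

Lemma normal_line u (a : V) : U u -> (forall v : 'rV[R]_n, ip (F u) a (v *m 'J F u) = 0) ->
  a = ip (F u) (nu (F u)) a *: nu (F u).
Proof.
move=> Uu ha; set b := ip _ _ a; have nn := normal_unit hnu (chart_S oO ch Uu).
have h : ip (F u) (nu (F u)) (a - b *: nu (F u)) = 0 by rewrite innerDr innerNr innerZr nn /b mulr1 subrr.
have := tan_span oO hnu ch Uu h; set w := del k _ => e.
apply/eqP; rewrite -subr_eq0; apply/eqP/(@inner_eq0 _ _ (F u)).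
rewrite {2}e innerDl innerNl ha innerZl (normal_tan oO hnu ch)//; ring.
Qed.

End in_chart.

(* Let Z, O, X, N lift z, o, p, nu p.  Choose t minimal such that, for some p in the
   boundary, - <Z + t O, X> = 1 + s where 1 + 2 s = - <Z + t O, Z + t O>.  Minimality is the
   contact inequality and makes Z + t O - (1 + s) X = - s N up to sign; the sign is
   fixed by the segment from z to p, which stays inside the domain. *)
Lemma flow_surj (o z : V) : O z -> exists p s, [/\ boundary O p, 0 < s, contact s p & flow o nu s p = z].
Proof.
move=> Oz; have nOS q : boundary O q -> ~ O q by case/(boundaryP oO).
pose b q := coshd o q - coshd o z.
(* The nonnegative root [t] of [coshd z q + t * coshd o q = 1 + t * coshd o z + t ^+ 2 / 2], the
   condition that [q] lie on the sphere belonging to [Z + t O]. *)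
pose G q := b q + Num.sqrt (b q ^+ 2 + 2 * (coshd z q - 1)).
have a0 q : 0 <= coshd z q - 1 by rewrite subr_ge0 coshd_ge1.
have sq q : 0 <= b q ^+ 2 + 2 * (coshd z q - 1) by rewrite addr_ge0 ?sqr_ge0// mulr_ge0.
have cG (q : V) : {for q, continuous G}.
  have cb : {for q, continuous b} by apply: contB; [exact: cont_coshd|exact: contC].
  apply: contD => //; apply: cont_sqrt; apply: contD; first exact: contX.
  by apply: contM; [exact: contC|apply: contB; [exact: cont_coshd|exact: contC]].
have [|p /set_mem Sp hp] := @EVT_min_rV _ _ G (boundary O) (boundary_nonempty Oz) (compact_boundary Oz).
  by apply: continuous_subspaceT => q; exact: cG.
pose t := G p; have tle q : boundary O q -> t <= G q by move=> Sq; apply: hp; exact/mem_set.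
have t0 : 0 < t.
  have : 0 < coshd z p - 1.
    rewrite lt_def a0 andbT subr_eq0; apply: contra_notN (nOS _ Sp) => /eqP/coshd_eq1 <-; exact: Oz.
  move=> h; rewrite /t /G; set q := Num.sqrt _; have := sqrtr_ge0 (b p ^+ 2 + 2 * (coshd z p - 1)).
  have := sqr_sqrtr (sq p); rewrite -/q => q2 q0.
  by rewrite ltNge; apply/negP => qb; nra.
pose Vz := coshd o z; have Vz1 : 1 <= Vz by exact: coshd_ge1.
(* From [1 + 2 s = - <Z + t O, Z + t O> = 1 + 2 t Vz + t ^ 2]. *)
pose s := t * Vz + t ^+ 2 / 2.
have s0 : 0 < s by rewrite /s addr_gt0 ?divr_gt0 ?exprn_gt0// mulr_gt0// (lt_le_trans _ Vz1).
pose y := z + t *: o; pose y0 := wt z + t * wt o.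
have y00 : 0 < y0 by rewrite addr_gt0 ?mulr_gt0 ?wt_gt0.
pose K q := y0 * wt q - dot y q.
have KE q : K q = coshd z q + t * coshd o q by rewrite /K /y /y0 /coshd dotDl dotZl; ring.
have Kge q : boundary O q -> 1 + s <= K q.
  move=> /tle; rewrite KE /s /G -/Vz => tq.
  have := sqr_sqrtr (sq q); have := sqrtr_ge0 (b q ^+ 2 + 2 * (coshd z q - 1)).
  move: (Num.sqrt _) tq; rewrite /b -/Vz => w tq w0 w2.
  have h1 : 0 <= w - (coshd o q - Vz) by have := a0 q; nra.
  have : 0 <= (w - t + (coshd o q - Vz)) * (w - (coshd o q - Vz) + t) by rewrite mulr_ge0//; lra.
  lra.
have Kp : K p = 1 + s.
  rewrite KE /s; have : t - b p = Num.sqrt (b p ^+ 2 + 2 * (coshd z p - 1)) by rewrite /t /G; ring.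
  move=> /(congr1 (fun x => x ^+ 2)); rewrite sqr_sqrtr// /b -/Vz => h; lra.
have [k [f [N [c [r [F [ch Np]]]]]]] := boundary_chart oO sO Sp.
have [Uu Fu] := chart_F oO ch Np Sp; set u := del k p in Uu Fu.
have tan (v : 'rV[R]_n) : y0 * tcomp p (v *m 'J F u) - dot y (v *m 'J F u) = 0.
  have hK := hasD_support ch y y0 Uu; rewrite -[in LHS]Fu; rewrite -(hK.2 v).
  apply: min_first hK.1 _; apply: filterS (chart_nearU Uu) => x Ux.
  by rewrite Fu -/(K p) -/(K (F x)) Kp; apply: Kge; exact: (chart_S oO ch).
pose a := y - (1 + s) *: p.
have yp : dot y p = y0 * wt p - (1 + s) by move: Kp; rewrite /K; lra.
have ta : tcomp p a = y0 - (1 + s) * wt p.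
  by rewrite /tcomp /a dotBr dotZr dotxx dotC yp; field; exact: wt_neq0.
have ipa w : ip p a w = dot y w - y0 * tcomp p w.
  rewrite innerE_tcomp ta /a dotBl dotZl.
  by have : dot p w = wt p * tcomp p w by [rewrite /tcomp mulrCA mulfV ?mulr1// wt_neq0]; move=> ->; ring.
have aE : a = ip p (nu p) a *: nu p.
  have := normal_line ch (u := u) (a := a) Uu; rewrite Fu; apply => v.
  by rewrite ipa; have := tan v; lra.
set be := ip p (nu p) a in aE.
have nn := normal_unit hnu Sp.
have be2 : be ^+ 2 = s ^+ 2.
  transitivity (ip p a a); first by rewrite [in RHS]aE innerZl innerZr nn; ring.
  rewrite ipa ta {1}/a dotBr dotZr yp; rewrite /y0.
  have -> : dot y y = y0 ^+ 2 - 1 - 2 * s.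
    by rewrite /y /y0 /s /Vz /coshd !dotrw (dotC o z) !dotxx; field.
  by rewrite /y0; ring.
have Kz : K z = 1 + s - t ^+ 2 / 2 by rewrite KE coshdxx /s -/Vz; field.
have ben : be < 0.
  (* [K] is convex along segments of the chart, with [K z < 1 + s = K p]. So it stays below [1 + s]
     on the segment before [p], where by [Kge] there is no boundary point. *)
  have inO l : 0 < l <= 1 -> O (p + l *: (z - p)).
    move=> /andP[l0 l1].
    have := @path_in _ _ O (fun m : R => z + m *: (p - z)) 0 (1 - l) oO (@cont_line _ _) _ _ _.
    have -> : z + (1 - l) *: (p - z) = p + l *: (z - p).
      by apply/rowP => j; rewrite !mxE; ring.
    apply; rewrite ?scale0r ?addr0 ?subr_ge0//.
    move=> m /andP[m0 ml] Sm; have := Kge _ Sm; apply/negP; rewrite -ltNge.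
    have m1 : 0 <= m <= 1 by rewrite m0; lra.
    have hw := wt_seg z p m1.
    rewrite /K dotDr dotZr dotBr.
    have : y0 * wt (z + m *: (p - z)) <= y0 * (wt z + m * (wt p - wt z)) by rewrite ler_pM2l.
    move: Kz Kp; rewrite /K => h1 h2 h3; have : 0 < (1 - m) * (t ^+ 2 / 2).
      by rewrite mulr_gt0 ?divr_gt0 ?exprn_gt0//; lra.
    have := congr1 (fun x => m * x) h2; have := congr1 (fun x => (1 - m) * x) h1 => /= e1 e2; lra.
  have nw : ip p (nu p) (z - p) <= 0.
    rewrite leNgt; apply/negP => h.
    have hN := normal_derive oO ch hnu (z - p) Np Sp.
    have df := chart_diff ch Np.
    have [|d d0 hd] := derive_pos df (v := z - p).
      by rewrite hN mulr_gt0// sqrtr_gt0 (steep_gt0 ch).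
    have nN : \forall l \near (0 : R), N (p + l *: (z - p)).
      have := @cont_line p (z - p) 0; apply; rewrite scale0r addr0.
      exact: open_nbhs_nbhs (conj (chart_open ch) Np).
    have [e e0 he] := near_norm nN.
    pose l := Num.min (Num.min (d / 2) (e / 2)) 1.
    have l0 : 0 < l by rewrite !lt_min !divr_gt0/=.
    have ld : l < d by rewrite !gt_min; apply/orP; left; apply/orP; left; lra.
    have le : l < e by rewrite !gt_min; apply/orP; left; apply/orP; right; lra.
    have l1 : l <= 1 by rewrite ge_min lexx orbT.
    have Nl : N (p + l *: (z - p)) by apply: he; rewrite subr0 gtr0_norm.
    have := (chart_dom ch Nl).1 (inO l _); rewrite l0 l1 => /(_ erefl); apply/negP; rewrite -leNgt.
    by rewrite -(chart_f0 oO ch Np Sp) ltW// hd// l0.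
  have : 0 < be * ip p (nu p) (z - p).
    have -> : be * ip p (nu p) (z - p) = ip p a (z - p) by rewrite [in RHS]aE innerZl.
    rewrite ipa; have := wt_convex p z => hw.
    have : y0 * tcomp p (z - p) <= y0 * (wt z - wt p) by rewrite ler_pM2l.
    have : 0 < t ^+ 2 / 2 by rewrite divr_gt0// exprn_gt0.
    move: Kz Kp; rewrite /K dotBr; lra.
  by rewrite ltNge => h; rewrite ltNge; apply: contraNN h => be0; rewrite mulr_ge0_le0.
have beE : be = - s.
  by move/eqP: be2; rewrite eqf_sqr => /orP[/eqP h|/eqP//]; move: ben; rewrite h ltNge (ltW s0).
have yE : p + s *: (p - nu p) = y.
  have : y = a + (1 + s) *: p by rewrite /a subrK.
  by move=> ->; rewrite aE beE; apply/rowP => j; rewrite !mxE; ring.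
have Y0E : flow_Y0 nu s p = y0.
  move: ta; rewrite aE beE tcompZ /flow_Y0; lra.
exists p, s; split => //.
- by move=> q /Kge; rewrite flow_etaE yE Y0E /K mulrC (dotC q).
- rewrite /flow yE /flow_t flow_etaE yE Y0E.
  have -> : wt o * y0 - dot o y = Vz + t by rewrite /y /y0 /Vz /coshd dotDr dotZr dotxx; ring.
  have -> : (Vz + t) ^+ 2 - 2 * s = Vz ^+ 2 by rewrite /s; field.
  rewrite sqrtr_sqr ger0_norm; last by rewrite (le_trans _ Vz1).
  by rewrite (_ : Vz + t - Vz = t) ?/y ?addrK//; ring.
Qed.

End contact.

(** * The volume bound *)

Section integral_tools.
Context {R : realType}.
Import HBNNSimple.

(** Both sides commute with increasing limits of simple functions, and for indicator functions the
    identity is the definition of [density]. *)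
Lemma integral_density d (T : measurableType d) (mu : {measure set T -> \bar R}) (p : T -> R)
    (mp : measurable_fun setT (EFin \o p)) (p0 : forall x, (0 <= (EFin \o p) x)%E)
    (f : T -> \bar R) (E : set T) :
  (forall x, E x -> (0 <= f x)%E) -> measurable E -> measurable_fun E f ->
  (\int[density mu mp p0]_(x in E) f x = \int[mu]_(x in E) (f x * (p x)%:E))%E.
Proof.
move=> f0 mE mf; pose h := nnsfun_approx mE mf; pose g := EFin \o p.
set nu := density mu mp p0.
have -> : (\int[nu]_(x in E) f x =
    lim (\int[nu]_(x in E) (EFin \o h n) x @[n --> \oo]))%E.
  have fE x : E x -> f x = lim ((EFin \o h n) x @[n --> \oo]).
    by move=> Ex; apply/esym/cvg_lim => //; exact: cvg_nnsfun_approx.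
  under eq_integral => x /[!inE] /fE -> //.
  apply: monotone_convergence => //.
  - move=> n; apply/measurable_EFinP.
    by apply: (measurable_funS measurableT) => //; exact/measurable_funP.
  - by move=> n x Ex //=; rewrite lee_fin.
  - by move=> x Ex a b ab; rewrite lee_fin; exact/lefP/nd_nnsfun_approx.
have -> : (\int[mu]_(x in E) (f x * (p x)%:E) =
    lim (\int[mu]_(x in E) ((EFin \o h n) x * g x) @[n --> \oo]))%E.
  have fg x : E x -> (f x * (p x)%:E)%E = lim (((EFin \o h n) x * g x)%E @[n --> \oo]).
    by move=> Ex; apply/esym/cvg_lim => //; apply: cvgeZr => //; exact: cvg_nnsfun_approx.
  under eq_integral => x /[!inE] /fg -> //.
  apply: monotone_convergence => [//| | |].
  - move=> n; apply/emeasurable_funM; apply/measurable_funTS.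
      exact/measurable_EFinP.
    exact: mp.
  - by move=> n x Ex /=; rewrite mule_ge0 ?lee_fin//; exact: p0.
  - by move=> x Ex a b ab/=; rewrite lee_wpmul2r ?lee_fin//; [exact: p0|exact/lefP/nd_nnsfun_approx].
suff suf n : (\int[mu]_(x in E) ((EFin \o h n) x * g x) =
    \int[nu]_(x in E) (EFin \o h n) x)%E.
  by congr (limn _); apply/funext => n; rewrite suf.
transitivity (\int[nu]_(x in E)
   (\sum_(y \in range (h n)) (y * \1_(h n @^-1` [set y]) x)%:E))%E; last first.
  by apply: eq_integral => t tE; rewrite /= fimfunE -fsumEFin.
have indich m r : measurable_fun E (fun x => (r * \1_(h m @^-1` [set r]) x)%:E).
  by apply: (measurable_comp measurableT) => //; exact: measurable_funM.
rewrite ge0_integral_fsum//; last by move=> m y Ey; exact: nnfun_muleindic_ge0.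
transitivity (\int[mu]_(x in E) (\sum_(y \in range (h n))
    (y * \1_(h n @^-1` [set y]) x)%:E * g x))%E.
  under [RHS]eq_integral => x xE.
    rewrite -ge0_mule_fsuml => [|y]; last exact: nnfun_muleindic_ge0.
    rewrite fsumEFin // -(fimfunE _ x); over.
  by [].
rewrite ge0_integral_fsum//; last 2 first.
  - by move=> y; apply: emeasurable_funM => //; exact: measurable_funTS mp.
  - by move=> m y Ey; rewrite mule_ge0 ?nnfun_muleindic_ge0//; exact: p0.
apply: eq_fsbigr => r rhn.
under [RHS]eq_integral do rewrite EFinM.
rewrite integralZl_indic_nnsfun => //.
under eq_integral do rewrite EFinM -muleA.
rewrite ge0_integralZl//.
- under eq_integral do rewrite muleC.
  rewrite (eq_integral (g \_ (h n @^-1` [set r]))); last first.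
    by move=> x xE; rewrite epatch_indic.
  by rewrite -integral_mkcondr integral_indic// setIC.
- apply: emeasurable_funM; first exact/measurable_EFinP.
  exact: measurable_funTS mp.
- by move=> t Et; rewrite mule_ge0 ?lee_fin//; exact: p0.
- by move: rhn; rewrite inE => -[t _ <-]; rewrite lee_fin.
Qed.

Lemma integral_cons n (f : 'rV[R]_n.+1 -> \bar R) :
  @measurable_fun _ _ (borel_rV R n.+1) _ setT f -> (forall x, (0 <= f x)%E) ->
  (\int[lebesgue_rV n.+1]_x f x = \int[lebesgue_rV n]_u \int[lebesgue_measure]_s f (@cons_rV R n (s, u)))%E.
Proof.
move=> mf f0.
have mc := @measurable_cons_rV R n.
transitivity (\int[(@lebesgue_measure R \x lebesgue_rV n)%E]_x f (cons_rV x))%E.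
  have := @ge0_integral_pushforward _ _ _ _ R _ mc (@lebesgue_measure R \x lebesgue_rV n)%E setT f measurableT mf.
  rewrite preimage_setT => <- //.
have mfc : measurable_fun setT (fun x => f (@cons_rV R n x)) by exact: measurableT_comp mf mc.
by rewrite fubini_tonelli2.
Qed.

Lemma is_derive_ramp n (c s : R) : c != 0 ->
  is_derive s 1 (fun s : R => - (1 - c * s) ^+ n.+1 / (n.+1%:R * c)) ((1 - c * s) ^+ n).
Proof.
move=> c0.
have hG : hasD (fun s : R => 1 - c * s) s (fun v => - (c * v)).
  apply: hasD_eq (hasD_B (hasD_cst (1 : R) s) (hasD_M (hasD_cst c s) (hasD_id s))) _ => v.
  by rewrite mul0r add0r add0r.
have hX m : hasD (fun s : R => (1 - c * s) ^+ m.+1) s (fun v => - (m.+1%:R * c * v * (1 - c * s) ^+ m)).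
  elim: m => [|m IH].
    rewrite (_ : (fun _ => _) = fun s => 1 - c * s); last by apply/funext => t; rewrite expr1.
    by apply: hasD_eq hG _ => v; rewrite mul1r expr0 mulr1.
  rewrite (_ : (fun _ => _) = fun s => (1 - c * s) * (1 - c * s) ^+ m.+1); last by apply/funext => t; rewrite exprS.
  apply: hasD_eq (hasD_M hG IH) _ => v.
  by rewrite -(natr1 m.+1) exprS; ring.
have hF := hasD_M (hasD_N (hX n)) (hasD_cst (n.+1%:R * c)^-1 s).
have [d1 e1] := hasD_derive1 hF.
apply: DeriveDef => //; rewrite -derive1E e1.
have N0 : n.+1%:R != 0 :> R by rewrite pnatr_eq0.
rewrite mulr0 addr0 opprK mulr1; move: (n.+1%:R) N0 (_ ^+ n) => N N0 q; field.
by rewrite c0 N0.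
Qed.

(** The origin of the constant of the inequality: for [c = H/n - 1] the value is
    [n / ((n + 1) (H - n))]. *)
Lemma integral_ramp n (c : R) : (0 < n)%N -> 0 < c ->
  (\int[lebesgue_measure]_(s in `]0%R, +oo[) (Num.max 0 (1 - c * s) ^+ n)%:E = (n.+1%:R * c)^-1%:E)%E.
Proof.
move=> n0 c0; pose b := c^-1; have b0 : 0 < b by rewrite invr_gt0.
have f0 s : (0 <= (Num.max 0 (1 - c * s) ^+ n)%:E)%E by rewrite lee_fin exprn_ge0// le_max lexx.
have cl : continuous (fun s : R => 1 - c * s).
  by move=> s; apply: contB; [exact: contC|apply: contM; [exact: contC|exact: cvg_id]].
have mf D : measurable_fun D (fun s : R => (Num.max 0 (1 - c * s) ^+ n)%:E).
  apply/measurable_EFinP; apply: (measurable_funS measurableT) => //.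
  apply: measurable_funX; apply: measurable_maxr => //.
  exact: continuous_measurable_fun.
have -> : `]0%R, +oo[%classic = `]0%R, b] `|` `]b, +oo[ :> set R.
  by rewrite -(@itv_bndbnd_setU _ _ (BRight 0) (BRight b) +oo%O)// bnd_simp ltW.
rewrite ge0_integral_setU//; last 2 first.
- exact: mf.
- by rewrite disj_set2E; apply/eqP/seteqP; split=> // s [] /=; rewrite !in_itv /= andbT => /andP[_ sb] bs; have := le_lt_trans sb bs; rewrite ltxx.
rewrite [X in (_ + X)%E](integral0_eq _) ?adde0; last first.
  move=> s; rewrite /= in_itv /= andbT => bs; rewrite max_l ?expr0n ?gtn_eqF//.
  by rewrite subr_le0 -ler_pdivrMl// mulr1 ltW.
rewrite integral_itv_obnd_cbnd; last exact: measurable_funS (mf setT).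
transitivity (\int[lebesgue_measure]_(s in `[0%R, b]) ((1 - c * s) ^+ n)%:E)%E.
  apply: eq_integral => s /set_mem; rewrite /= in_itv /= => /andP[s0 sb]; rewrite max_r//.
  by rewrite subr_ge0 -ler_pdivlMl// mulr1.
have cX : continuous (fun s : R => (1 - c * s) ^+ n) by move=> s; apply: (@contX _ _ (fun s : R => 1 - c * s)); exact: cl.
have cF s := @is_derive_ramp n c s (lt0r_neq0 c0).
have dF s : derivable (fun s : R => - (1 - c * s) ^+ n.+1 / (n.+1%:R * c)) s 1 by have [] := cF s.
have ccF s : {for s, continuous (fun s : R => - (1 - c * s) ^+ n.+1 / (n.+1%:R * c))}.
  by apply: differentiable_continuous; apply/derivable1_diffP.
rewrite (@continuous_FTC2 _ _ (fun s : R => - (1 - c * s) ^+ n.+1 / (n.+1%:R * c)) _ _ b0).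
- rewrite -EFinB; congr (_%:E); rewrite /b mulfV ?gt_eqF// subrr mulr0 subr0 expr1n.
  by rewrite expr0n /= oppr0 mul0r sub0r mulNr opprK mul1r.
- exact: continuous_subspaceT cX.
- split; first by move=> s _.
    exact: cvg_at_right_filter (ccF 0).
  exact: cvg_at_left_filter (ccF b).
- by move=> s _; rewrite derive1E; have [] := cF s.
Qed.

(** Superlevel sets are relatively open in [D]. This suits functions whose behaviour is controlled
    only along the boundary. *)
Lemma measurable_fun_lsc n (D : set 'rV[R]_n) (f : 'rV[R]_n -> R) :
  measurable (D : set (borel_rV R n)) ->
  (forall x a, D x -> a < f x -> exists W : set 'rV[R]_n, [/\ open W, W x & forall y, W y -> D y -> a < f y]) ->
  @measurable_fun _ _ (borel_rV R n) (measurableTypeR R) D f.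
Proof.
move=> mD hf.
apply: (measurability _ (RGenOInfty.measurableE R)) => _ [_ [a ->] <-].
pose W := \bigcup_(W in [set W : set 'rV[R]_n | open W /\ forall y, W y -> D y -> a < f y]) W.
have -> : D `&` f @^-1` `]a, +oo[%classic = D `&` W.
  apply/seteqP; split=> x [Dx].
    rewrite /= in_itv /= andbT => /(hf x a Dx)[W' [oW Wx hW]]; split=> //; by exists W'.
  by move=> [W' [oW hW] Wx]; split=> //=; rewrite in_itv /= andbT; exact: hW.
apply: measurableI => //; apply: measurable_open_rV; by apply: bigcup_open => W' [].
Qed.

End integral_tools.

Section cont_det.
Context {R : realType}.

Lemma cont_prodr (T : topologicalType) I (r : seq I) (P : pred I) (f : I -> T -> R) (x : T) :
  (forall i, {for x, continuous (f i)}) -> {for x, continuous (fun y => \prod_(i <- r | P i) f i y)}.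
Proof.
move=> cf; elim: r => [|i r IH].
  rewrite (_ : (fun _ => _) = fun=> 1); first exact: contC.
  by apply/funext => y; rewrite big_nil.
case: (boolP (P i)) => Pi.
  rewrite (_ : (fun _ => _) = fun y => f i y * \prod_(j <- r | P j) f j y); first exact: contM.
  by apply/funext => y; rewrite big_cons Pi.
rewrite (_ : (fun _ => _) = fun y => \prod_(j <- r | P j) f j y)//.
by apply/funext => y; rewrite big_cons (negbTE Pi).
Qed.

Lemma cont_det (T : topologicalType) m (M : T -> 'M[R]_m) (x : T) :
  (forall i j, {for x, continuous (fun y => M y i j)}) -> {for x, continuous (fun y => \det (M y))}.
Proof.
move=> cM; apply: continuous_sumr => s _; apply: contM; first exact: contC.
by apply: cont_prodr => i; exact: cM.
Qed.

Lemma cont_near (T U : topologicalType) (f g : T -> U) (x : T) :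
  (\forall y \near x, f y = g y) -> {for x, continuous f} -> {for x, continuous g}.
Proof.
move=> fg cf; have fgx := nbhs_singleton fg.
move=> A; rewrite -fgx => /cf h; apply: filterS (filterI fg h) => y [e].
by rewrite /= e.
Qed.

Lemma cont_maxr0 (T : topologicalType) (f : T -> R) (x : T) :
  {for x, continuous f} -> {for x, continuous (fun y => Num.max 0 (f y))}.
Proof.
move=> cf; rewrite (_ : (fun _ => _) = fun y => (f y + `|f y|) / 2); last first.
  apply/funext => y; case: (lerP 0 (f y)) => h; first by rewrite ger0_norm//; field.
  by rewrite ltr0_norm// subrr mul0r.
apply: contM; last exact: contC.
apply: contD => //; apply: (continuous_comp cf); exact: norm_continuous.
Qed.

End cont_det.

Section local_bound.
Context {R : realType} {n : nat}.
Local Notation V := 'rV[R]_n.+1.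
Local Notation ip := (inner hyp_metric).
Hypothesis n0 : (0 < n)%N.

Variable O : set V.
Hypothesis oO : open O.
Hypothesis sO : smooth_boundary O.
Variable nu : V -> V.
Hypothesis hnu : outward_unit_normal (n := n) hyp_metric O nu.
Variable kappa : V -> 'I_n -> R.
Hypothesis hkappa : principal_curvatures hyp_metric (boundary O) nu kappa.
Hypothesis hH : forall p, boundary O p -> n%:R < mean_curvature kappa p.
Variable o : V.

Local Notation H := (mean_curvature kappa).
(* By AM-GM, ramp s p bounds prod_i (1 + s - s kappa_i) at a contact pair (p, s). *)
Definition slope p := H p / n%:R - 1.
Definition ramp s p := Num.max 0 (1 - slope p * s) ^+ n.

Lemma slope_gt0 p : boundary O p -> 0 < slope p.
Proof. by move=> /hH h; rewrite /slope subr_gt0 ltr_pdivlMr ?ltr0n// mul1r. Qed.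

Section in_chart.
Variables (k : 'I_n.+1) (f : V -> R) (N : set V) (c : 'rV[R]_n) (r : R) (F : 'rV[R]_n -> V).
Hypothesis ch : chart O k f N c r F.
Local Notation U := [set u : 'rV[R]_n | `|u - c| < r].

Lemma cont_chart_F u : U u -> {for u, continuous F}.
Proof. by move=> Uu; exact: differentiable_continuous (chart_diff_F ch Uu). Qed.

Lemma cont_chart_nu u : U u -> {for u, continuous (fun u => nu (F u))}.
Proof. by move=> Uu; exact: differentiable_continuous (chart_diff_nu oO hnu ch Uu). Qed.

Lemma cont_slope u : U u -> {for u, continuous (fun u => slope (F u))}.
Proof.
move=> Uu; have ct : {for u, continuous (fun u => \tr (gweing nu k F u) / n%:R - 1)}.
  apply: contB; last exact: contC.
  apply: contM; last exact: contC.
  apply: continuous_sumr => i _.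
  rewrite (_ : (fun _ => _) = fun u => ('D_(delta_mx 0 i) (nu \o F) u) 0 (lift k i)); last first.
    by apply/funext => y; rewrite !mxE.
  apply: continuous_coordP; apply: differentiable_continuous.
  by apply: smooth_on_diff Uu; apply: smooth_on_derive; exact: (chart_smooth_nu oO ch hnu).
refine (cont_near _ ct); apply: filterS (chart_nearU Uu) => y Uy.
by rewrite (tr_gweing oO hnu ch hkappa).
Qed.

Definition area (u : 'rV[R]_n) : R := Num.sqrt (\det (first_form hyp_metric F u)).

Lemma cont_area u : U u -> {for u, continuous area}.
Proof.
move=> Uu; apply: cont_sqrt; apply: cont_det => i j.
have e y : U y -> ip (F y) ('D_(delta_mx 0 i) F y) ('D_(delta_mx 0 j) F y) = first_form hyp_metric F y i j.
  move=> Uy; rewrite !(D_chart ch)// -first_formE -rowE -/(dot _ _).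
  by rewrite dot_delta mxE.
have cD l : {for u, continuous ('D_(delta_mx 0 l) F)}.
  apply: differentiable_continuous; apply: smooth_on_diff Uu.
  by apply: smooth_on_derive; exact: (chart_smooth_F ch).
apply: (@cont_near _ _ (fun y => ip (F y) ('D_(delta_mx 0 i) F y) ('D_(delta_mx 0 j) F y))).
  by apply: filterS (chart_nearU Uu) => y; exact: e.
by apply: cont_inner => //; exact: cont_chart_F.
Qed.

Lemma cont_height q u : U u -> {for u, continuous (fun u => height q nu (F u))}.
Proof.
move=> Uu; have cF := cont_chart_F Uu; have cN := cont_chart_nu Uu.
have cw := cont_wt cF.
apply: contB; first by apply: contB; [apply: contM; [exact: contC|exact: cw]|apply: cont_dot; [exact: contC|exact: cF]].
apply: contB; last by apply: cont_dot; [exact: contC|exact: cN].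
apply: contM; first exact: contC.
apply: contM; first exact: cont_dot.
by apply: contV => //; exact: wt_neq0.
Qed.

Lemma cont_del0 (z : V) (W : topologicalType) (g : 'rV[R]_n -> W) : {for del 0 z, continuous g} ->
  {for z, continuous (fun z : V => g (del 0 z))}.
Proof. by move=> cg; apply: continuous_comp cg; exact: hasD_cont (hasD_del 0 z). Qed.

Lemma cont_coord0 (z : V) : {for z, continuous (fun z : V => z 0 0)}.
Proof. exact: coord_continuous. Qed.

Definition theta (z : V) : R :=
  height o nu (F (del 0 z)) * area (del 0 z) * ramp (z 0 0) (F (del 0 z)).

Lemma cont_theta (z : V) : U (del 0 z) -> {for z, continuous theta}.
Proof.
move=> Uu; apply: contM; first apply: contM.
- by apply: (@cont_del0 z _ (fun u => height o nu (F u))); exact: cont_height.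
- by apply: (@cont_del0 z _ area); exact: cont_area.
apply: contX; apply: cont_maxr0; apply: contB; first exact: contC.
apply: contM; last exact: cont_coord0.
by apply: (@cont_del0 z _ (fun u => slope (F u))); exact: cont_slope.
Qed.

Lemma chart_height_gt0 q u : U u -> 0 < height q nu (F u).
Proof. by move=> Uu; apply: height_gt0; apply: (normal_unit hnu); exact: (chart_S oO ch). Qed.

Lemma theta_ge0 (z : V) : U (del 0 z) -> 0 <= theta z.
Proof.
move=> Uu; rewrite mulr_ge0// ?mulr_ge0// ?sqrtr_ge0 ?exprn_ge0 ?le_max ?lexx//.
by rewrite ltW// chart_height_gt0.
Qed.

Lemma flow_theta (z : V) : 0 < z 0 0 -> U (del 0 z) -> contact O nu (z 0 0) (F (del 0 z)) ->
  coshd o (flow_map nu F o z) / wt (flow_map nu F o z) * `|\det ('J (flow_map nu F o) z)| <= theta z.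
Proof.
move=> s0 Uu hc; rewrite mulrC (flow_map_det oO hnu ch o s0 Uu n0).
rewrite /theta /area [leRHS]mulrC ler_wpM2r//.
  by rewrite mulr_ge0// ?sqrtr_ge0// ltW// chart_height_gt0.
rewrite (det_gweing oO hnu ch hkappa)//.
set s := z 0 0; set p := F (del 0 z).
have kge i : 0 <= 1 + s - s * kappa p i.
  by rewrite subr_ge0; apply: (contact_kappa oO hnu ch hkappa) => //; exact: ltW.
rewrite ger0_norm; last by apply: prodr_ge0.
have h : \prod_i (1 + s - s * kappa p i) <= ((\sum_i (1 + s - s * kappa p i)) / n%:R) ^+ n.
  have [h _] := @leif_AGM R _ [set: 'I_n]%SET (fun i => 1 + s - s * kappa p i) (fun i _ => kge i).
  move: h; rewrite cardsT card_ord (eq_bigl xpredT); last by move=> i; rewrite inE.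
  by rewrite [X in X / _](eq_bigl xpredT)// => i; rewrite inE.
apply: (le_trans h); rewrite /ramp.
have e : (\sum_i (1 + s - s * kappa p i)) / n%:R = 1 - slope p * s.
  rewrite sumrB -mulr_sumr sumr_const card_ord /slope /mean_curvature -[(1 + s) *+ n]mulr_natr.
  by field; rewrite pnatr_eq0 -lt0n.
have h0 : 0 <= 1 - slope p * s by rewrite -e divr_ge0// sumr_ge0.
by rewrite e max_r.
Qed.

Section cut.
Variables (K1 : set V) (s1 s2 eps : R).
Hypothesis cK : closed K1.
Hypothesis s12 : 0 < s1 < s2.
Hypothesis eps0 : 0 <= eps.
Hypothesis hK : forall q, boundary O q -> K1 q -> forall s, s1 <= s <= s2 ->
  ~ contact O nu s q /\ eps <= (s2 - s1) * (height o nu q * ramp s q).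

(* Over K1 the parameters s in [s1, s2] are not reached by contact pairs, which
   saves at least eps in the integral over s. *)
Definition dens p : R := height o nu p / (n.+1%:R * slope p) - eps * \1_K1 p.

Lemma measurable_ramp D q : measurable_fun D (fun s : R => (ramp s q)%:E).
Proof.
have cr : continuous (fun s : R => ramp s q).
  move=> s; apply: (@contX _ _ (fun s : R => Num.max 0 (1 - slope q * s))); apply: cont_maxr0; apply: contB; first exact: contC.
  by apply: contM; [exact: contC|exact: cvg_id].
apply/measurable_EFinP; apply: (measurable_funS measurableT) => //.
exact: continuous_measurable_fun cr.
Qed.

Lemma measurable_rampM D (a : R) q : measurable_fun D (fun s : R => (a * ramp s q)%:E).
Proof.
under eq_fun do rewrite EFinM.
by apply: measurable_funeM; exact: measurable_ramp.
Qed.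

Definition slice q : set R := [set s : R | 0 < s /\ ~ (s1 <= s <= s2 /\ K1 q)].

Lemma dens_bound q : boundary O q -> 0 < height o nu q ->
  (\int[lebesgue_measure]_(s in slice q) (height o nu q * ramp s q)%:E
   <= (dens q)%:E)%E.
Proof.
move=> Sq h0; have c0 := slope_gt0 Sq; set a := height o nu q in h0 *.
have f0 s : (0 <= (a * ramp s q)%:E)%E by rewrite lee_fin mulr_ge0 ?(ltW h0)// exprn_ge0// le_max lexx.
have tot : (\int[lebesgue_measure]_(s in `]0%R, +oo[) (a * ramp s q)%:E = (a / (n.+1%:R * slope q))%:E)%E.
  under eq_integral do rewrite EFinM.
  rewrite ge0_integralZl//; last 3 first.
  - exact: measurable_ramp.
  - by move=> s _; rewrite lee_fin exprn_ge0// le_max lexx.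
  - by rewrite lee_fin ltW.
  by rewrite integral_ramp// EFinM.
have [Kq|nKq] := pselect (K1 q); last first.
  have -> : slice q = `]0%R, +oo[%classic.
    apply/seteqP; split=> s /=; rewrite in_itv /= andbT; first by case.
    by move=> ?; split=> // -[].
  rewrite tot /dens indicE memNset// mulr0 subr0; exact: lexx.
have -> : slice q = `]0%R, +oo[%classic `\` `[s1, s2]%classic.
  apply/seteqP; split=> s /=; rewrite !in_itv /= andbT.
    by move=> [? h]; split=> // h'; apply: h.
  by move=> [? h]; split=> // -[h' _]; apply: h.
have U12 : `]0%R, +oo[%classic = (`]0%R, +oo[%classic `\` `[s1, s2]%classic) `|` `[s1, s2]%classic :> set R.
  rewrite setDKU// => s /=; rewrite !in_itv /= andbT => /andP[h _].
  by have /andP[h1 _] := s12; exact: lt_le_trans h1 h.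
have := tot; rewrite {1}U12 ge0_integral_setU//; last 2 first.
- exact: measurable_rampM.
- by rewrite /disj_set setDKI.
move=> e.
have lo : (eps%:E <= \int[lebesgue_measure]_(s in `[s1, s2]) (a * ramp s q)%:E)%E.
  have /andP[_ s12'] := s12; have d0 : 0 < s2 - s1 by rewrite subr_gt0.
  apply: (@le_trans _ _ (\int[lebesgue_measure]_(s in `[s1, s2]) (eps / (s2 - s1))%:E)%E).
    rewrite integral_cst//= lebesgue_measure_itv /= lte_fin s12' -EFinD -EFinM lee_fin divfK ?gt_eqF//.
  apply: ge0_le_integral => //.
  - by move=> s _; rewrite lee_fin divr_ge0// ltW.
  - exact: measurable_rampM.
  - move=> s /=; rewrite in_itv /= => hs; rewrite lee_fin ler_pdivrMr// mulrC.
    by have [] := hK Sq Kq hs.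
move: e; rewrite /dens indicE mem_set// mulr1 EFinB.
move: (integral _ _ _) lo (integral _ _ _) => J2 lo J1 e.
by rewrite leeBrDr// -e leeD2l.
exact: measurableD.
Qed.

(** [area_le] for the flow in the parameters [(s, u)], then Fubini with the integral over [s]
    innermost. By [hK] the parameters that are cut out contain no contact pair, so the image of the
    contact pairs is still covered. *)
Lemma local_bound (G : set V) : open G -> G `<=` N ->
  exists B : set V, [/\ @measurable _ (borel_rV R n.+1) B,
   forall p s, G p -> boundary O p -> 0 < s -> contact O nu s p -> B (flow o nu s p) &
   (\int[lebesgue_rV n.+1]_(z in B) (coshd o z / wt z)%:E <=
    \int[lebesgue_rV n]_(u in U `&` F @^-1` G) (dens (F u) * area u)%:E)%E].
Proof.
move=> oG GN.
pose bad (z : V) := s1 <= z 0 0 <= s2 /\ K1 (F (del 0 z)).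
pose O' := [set z : V | [/\ 0 < z 0 0, U (del 0 z), G (F (del 0 z)) & ~ bad z]].
pose A := [set z : V | contact O nu (z 0 0) (F (del 0 z))].
have cF (z : V) : U (del 0 z) -> {for z, continuous (fun z : V => F (del 0 z))}.
  by move=> Uz; apply: (@cont_del0 z _ F); exact: cont_chart_F.
have nearUz (z : V) : U (del 0 z) -> \forall y \near z, U (del 0 y).
  by move=> Uz; exact: (hasD_cont (hasD_del 0 z)) (chart_nearU Uz).
have oO' : open O'.
  rewrite openE => z [z0 Uz Gz nbz].
  have n1 : \forall y \near z, 0 < (y : V) 0 0 by apply: near_gt z0; exact: cont_coord0.
  have n2 := nearUz z Uz.
  have n3 : \forall y \near z, G (F (del 0 y)) by exact: cF _ Uz _ (open_nbhs_nbhs (conj oG Gz)).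
  have n4 : \forall y \near z, ~ bad y.
    have [nK|Kz] := pselect (K1 (F (del 0 z))); last first.
      have oK : open (~` K1) by exact: closed_openC.
      have n5 : \forall y \near z, (~` K1) (F (del 0 y)) by exact: cF _ Uz _ (open_nbhs_nbhs (conj oK Kz)).
      by apply: filterS n5 => y h [].
    have [h|h] := ltP (z 0 0) s1.
      apply: filterS (near_lt (@cont_coord0 z) h) => y h' [/andP[h'' _] _].
      by move: h'; rewrite ltNge h''.
    have [h2|h2] := ltP s2 (z 0 0); last by case: nbz; split=> //; rewrite h h2.
    apply: filterS (near_gt (@cont_coord0 z) h2) => y h' [/andP[_ h''] _].
    by move: h'; rewrite ltNge h''.
  by apply: filterS (filterI (filterI n1 n2) (filterI n3 n4)) => y [[? ?] [? ?]]; split.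
(* Failure of contact is witnessed by a single [q] and a strict inequality, hence is an open
   condition. *)
have nA z : O' z -> ~ A z -> \forall y \near z, ~ A y.
  move=> [z0 Uz Gz nbz] /existsNP[q /not_implyP[Sq /negP]]; rewrite -ltNge => h.
  have ce : {for z, continuous (fun z : V => flow_eta q nu (z 0 0) (F (del 0 z)) - (1 + z 0 0))}.
    apply: contB; last by apply: contD; [exact: contC|exact: cont_coord0].
    apply: contD.
      apply: (@cont_del0 z _ (fun u => coshd q (F u))).
      by apply: continuous_comp; [exact: cont_chart_F|exact: cont_coshd].
    apply: contM; first exact: cont_coord0.
    by apply: (@cont_del0 z _ (fun u => height q nu (F u))); exact: cont_height.
  have h' : flow_eta q nu (z 0 0) (F (del 0 z)) - (1 + z 0 0) < 0 by rewrite subr_lt0.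
  apply: filterS (near_lt ce h') => y; rewrite subr_lt0 => hy /(_ q Sq).
  by apply/negP; rewrite -ltNge.
have cw (y : V) : {for y, continuous (fun y : V => coshd o y / wt y)}.
  apply: contM; first exact: cont_coshd.
  by apply: contV; [exact: wt_neq0|apply: cont_wt; exact: cvg_id].
have [] := @area_le _ _ O' A (flow_map nu F o) (fun y => coshd o y / wt y) theta oO' nA.
- apply/measurable_EFinP; apply: measurable_fun_continuous_rV1; first exact: openT.
  by move=> y _; exact: cw.
- by move=> y; rewrite divr_ge0// ?(ltW (wt_gt0 _))// (le_trans _ (coshd_ge1 _ _)).
- move=> z [z0 Uz Gz nbz] Az; split; [exact: (flow_map_diff oO hnu ch)|exact: cw|exact: flow_theta].
- by move=> z [z0 Uz Gz nbz]; split; [exact: theta_ge0|exact: cont_theta].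
move=> B [mB hB leB]; exists B; split => //.
  move=> p s Gp Sp s0 hc; have Np := GN _ Gp.
  have [Up Fp] := chart_F oO ch Np Sp.
  have := hB (ins 0 (del k p) s); rewrite /flow_map ins_k del_ins Fp; apply.
    split; rewrite ?ins_k ?del_ins ?Fp// => -[]; rewrite ins_k del_ins Fp => hs Kp.
    by have [] := hK Sp Kp hs.
  by rewrite /A /= ins_k del_ins Fp.
apply: (le_trans leB).
have mO' : measurable (O' : set (borel_rV R n.+1)) by exact: measurable_open_rV.
pose T : V -> \bar R := (EFin \o theta) \_ O'.
have mT : @measurable_fun _ _ (borel_rV R n.+1) _ setT T.
  apply/(measurable_restrictT _ _).1 => //; apply/measurable_EFinP.
  by apply: measurable_fun_continuous_rV1 => // z [_ Uz _ _]; exact: cont_theta.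
have T0 z : (0 <= T z)%E.
  by rewrite /T patchE; case: ifPn => // /set_mem[_ Uz _ _]; rewrite lee_fin theta_ge0.
rewrite integral_mkcond (integral_cons mT T0) [leRHS]integral_mkcond.
pose U' := U `&` F @^-1` G.
have oU' : open U'.
  by apply: continuous_open_preimage => //; [exact: chart_U_open|exact: cont_chart_F].
have mU' : measurable (U' : set (borel_rV R n)) by exact: measurable_open_rV.
have mdens : @measurable_fun _ _ (borel_rV R n) _ U' (fun u => (dens (F u) * area u)%:E).
  apply/measurable_EFinP; apply: measurable_funM; last first.
    by apply: measurable_fun_continuous_rV1 => // u [Uu _]; exact: cont_area.
  apply: measurable_funB.
    apply: measurable_fun_continuous_rV1 => // u [Uu _]; apply: contM; first exact: cont_height.
    apply: (@contV _ _ (fun u => n.+1%:R * slope (F u))).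
      by rewrite mulf_neq0// gt_eqF// slope_gt0//; exact: (chart_S oO ch).
    by apply: contM; [exact: contC|exact: cont_slope].
  apply: measurable_funM => //.
  have mK : @measurable _ (borel_rV R n.+1) K1 by exact: measurable_closed_rV.
  have mF : @measurable_fun _ _ (borel_rV R n) (borel_rV R n.+1) U' F.
    by apply: measurable_fun_continuous_rV => // u [Uu _]; exact: cont_chart_F.
  have m1 : @measurable_fun _ _ (borel_rV R n.+1) _ setT (\1_K1 : V -> R) by exact: measurable_indic.
  exact: (measurableT_comp m1 mF).
have mTc : measurable_fun setT (fun x => T (@cons_rV R n x)) by exact: measurableT_comp mT (@measurable_cons_rV R n).
have d0 (u : 'rV[R]_n) : del 0 (cons_rV (0 : measurableTypeR R, u : borel_rV R n)) = u.
  by apply/rowP => i; rewrite mxE cons_rV_lift.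
have dc s (u : 'rV[R]_n) : del 0 (cons_rV (s : measurableTypeR R, u : borel_rV R n)) = u.
  by apply/rowP => i; rewrite mxE cons_rV_lift.
have sc s (u : 'rV[R]_n) : (cons_rV (s : measurableTypeR R, u : borel_rV R n) : V) 0 0 = s by rewrite cons_rV0.
apply: ge0_le_integral => //.
- by move=> u _; apply: integral_ge0.
- by have := measurable_fun_fubini_tonelli_G (m1 := @lebesgue_measure R) _ mTc; apply.
- exact/(measurable_restrictT _ _).1.
move=> u _; rewrite patchE; case: ifPn => [/set_mem[Uu Gu]|]; last first.
  move=> /negP nU; rewrite integral0_eq//= => s _; rewrite /T patchE memNset// => -[_ Uz Gz _]; apply: nU.
  by apply: mem_set; move: Uz Gz; rewrite dc.
have Su := chart_S oO ch Uu; have h0 := chart_height_gt0 o Uu.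
have -> : (\int[lebesgue_measure]_s T (cons_rV (s, u)))%E =
    (\int[lebesgue_measure]_(s in slice (F u)) ((area u)%:E * (height o nu (F u) * ramp s (F u))%:E))%E.
  rewrite [RHS]integral_mkcond; apply: eq_integral => s _; rewrite /T !patchE.
  have -> : (cons_rV (s, u) \in O') = (s \in slice (F u)).
    apply/idP/idP => /set_mem.
      by move=> [z0 _ _ nb]; apply: mem_set; move: z0 nb; rewrite /bad /= sc dc.
    by move=> [s0 nb]; apply: mem_set; split; rewrite /bad ?sc ?dc.
  by case: ifP => // _; rewrite /= -EFinM /theta sc dc; congr (_%:E); ring.
have mslice : measurable (slice (F u)).
  have -> : slice (F u) = `]0%R, +oo[%classic `\` (if `[< K1 (F u) >] then `[s1, s2]%classic else set0).
    apply/seteqP; split=> s; rewrite /slice /= in_itv /= andbT => -[s0 hs]; split=> //.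
      by case: asboolP => // Kp h; apply: hs; split=> //; move: h; rewrite /= in_itv.
    by move=> [h Kp]; apply: hs; rewrite asboolT//= in_itv.
  by apply: measurableD => //; case: ifP.
rewrite ge0_integralZl//; last 3 first.
- exact: measurable_rampM.
- by move=> s _; rewrite lee_fin mulr_ge0 ?(ltW h0)// exprn_ge0// le_max lexx.
- by rewrite lee_fin sqrtr_ge0.
rewrite EFinM muleC lee_wpmul2r// ?lee_fin ?sqrtr_ge0//.
exact: dens_bound.
Qed.

End cut.
End in_chart.
End local_bound.

Lemma near_forall (T : topologicalType) (I : finType) (x : T) (P : I -> T -> Prop) :
  (forall i, \forall y \near x, P i y) -> \forall y \near x, forall i, P i y.
Proof. by move=> h; exact: filter_forall h. Qed.

Section globalize.
Context {R : realType} {m : nat}.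

(* Bounds on open sets pass to half-open cubes by outer approximation, and half-open
   cubes subdivide disjointly. *)
Lemma globalize (nu : {measure set (borel_rV R m) -> \bar R}) d (T : measurableType d)
    (tau : {measure set T -> \bar R}) (rel : 'rV[R]_m -> set T) (a : 'rV[R]_m) (r : R) :
  (nu setT < +oo)%E -> 0 < r ->
  (forall x : 'rV[R]_m, exists N : set 'rV[R]_m, [/\ open N, N x &
     forall G, open G -> G `<=` N -> exists B, [/\ measurable B, forall y, G y -> rel y `<=` B & (tau B <= nu G)%E]]) ->
  exists B, [/\ measurable B, forall y, hcube a r y -> rel y `<=` B & (tau B <= nu (hcube a r))%E].
Proof.
move=> fin r0 hloc; apply: cover_hcube => // x _.
have mH (b : 'rV[R]_m) s : measurable (hcube b s : set (borel_rV R m)) by exact: measurable_hcube.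
have [N [oN Nx hN]] := hloc x.
have [d' d0 hd] := near_norm (open_nbhs_nbhs (conj oN Nx)).
exists d' => // b s sd _ hx.
have QN : hcube b s `<=` N by move=> y hy; apply: hd; exact: hcube_near hx hy.
pose G (j : nat) : set 'rV[R]_m := N `&` [set y : 'rV[R]_m | forall i, b 0 i - j.+1%:R^-1 < y 0 i < b 0 i + s].
have oG j : open (G j).
  apply: openI; first exact: oN.
  rewrite openE => y hy.
  suff : \forall w \near y, forall i : 'I_m, b 0 i - j.+1%:R^-1 < (w : 'rV[R]_m) 0 i < b 0 i + s by [].
  apply: near_forall => i; have /andP[h1 h2] := hy i.
  have cy : {for y, continuous (fun w : 'rV[R]_m => w 0 i)} by exact: coord_continuous.
  by apply: filterS (filterI (near_gt cy h1) (near_lt cy h2)) => w [? ?]; apply/andP.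
have mG j : measurable (G j : set (borel_rV R m)) by exact: measurable_open_rV.
have GQ : \bigcap_j G j = hcube b s.
  apply/seteqP; split=> y hy.
    move=> i; have [_ /(_ i)/andP[_ ->]] := hy 0%N I; rewrite andbT leNgt; apply/negP => yb.
    have e0 : 0 < b 0 i - y 0 i by rewrite subr_gt0.
    have [_ /(_ i)/andP[h _]] := hy (Num.truncn (b 0 i - y 0 i)^-1) I.
    have : (Num.truncn (b 0 i - y 0 i)^-1).+1%:R^-1 < b 0 i - y 0 i.
      by rewrite -[ltRHS]invrK ltf_pV2 ?posrE ?invr_gt0// truncnS_gt.
    move: (_.+1%:R^-1) h => w h h'; suff : b 0 i - w < b 0 i - w by rewrite ltxx.
    by apply: (lt_trans h); rewrite ltrBrDr addrC -ltrBrDr.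
  move=> j _; split; first exact: QN.
  move=> i; have /andP[h ->] := hy i; rewrite andbT (lt_le_trans _ h)// ltrBlDr ltrDl invr_gt0//.
have nG : nonincreasing_seq G.
  move=> i j ij; apply/subsetPset => y [Ny hy]; split=> // l; have /andP[h ->] := hy l.
  rewrite andbT (le_lt_trans _ h)// lerD2l lerN2 lef_pV2 ?posrE// ler_nat ltnS//.
have finG j : (nu (G j) < +oo)%E.
  by apply: le_lt_trans fin; apply: le_measure; rewrite ?inE.
have finQ : nu (hcube b s) \is a fin_num.
  rewrite ge0_fin_numE ?measure_ge0//; apply: le_lt_trans fin.
  by apply: le_measure; rewrite ?inE.
(* Continuity from above, where the finiteness of [nu] enters. *)
have cvg : nu \o G @ \oo --> nu (hcube b s).
  by rewrite -GQ; apply: nonincreasing_cvg_mu => //; rewrite GQ.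
have /choice[B hB] j : exists B : set T, [/\ measurable B, \bigcup_(y in hcube b s) rel y `<=` B &
     (tau B <= nu (G j))%E].
  have [|B [mB hB leB]] := hN (G j) (oG j); first by move=> y [].
  exists B; split => // w [y Qy hw]; apply: hB hw.
  by rewrite -GQ in Qy; exact: Qy.
pose e j := fine (nu (G j)) - fine (nu (hcube b s)).
have finGj j : nu (G j) \is a fin_num by rewrite ge0_fin_numE ?measure_ge0.
have [] := @cover_liminf R _ _ tau (fun=> \bigcup_(y in hcube b s) rel y) B (nu (hcube b s)) e.
- by move=> j; have [] := hB j.
- by move=> j; have [] := hB j.
- by move=> ? ? _; exact: subset_refl.
- by move=> j; have [_ _ h] := hB j; rewrite /e EFinB !fineK// [leRHS]addeC subeK.
- have cvg' : nu \o G @ \oo --> (fine (nu (hcube b s)))%:E by rewrite fineK.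
  have c1 : fine (nu (G j)) @[j --> \oo] --> fine (nu (hcube b s)) by exact: (fine_cvg cvg').
  rewrite -(subrr (fine (nu (hcube b s)))); apply: cvgB => //; exact: cvg_cst.
move=> A [mA hA leA]; exists A; split => // y Qy w hw; apply: hA; exists 0%N => //; by exists y.
Qed.

End globalize.

Section change.
Context {R : realType} {n : nat}.
Local Notation V := 'rV[R]_n.+1.
Local Notation ip := (inner hyp_metric).

Variable O : set V.
Hypothesis oO : open O.
Hypothesis sO : smooth_boundary O.
Variable mu : {measure set (borel_rV R n.+1) -> \bar R}.
Hypothesis hmu : area_measure (n := n) hyp_metric (boundary O) mu.

Lemma measurable_boundary : measurable (boundary O : set (borel_rV R n.+1)).
Proof. by apply: measurable_closed_rV; exact: closed_boundary. Qed.

Section in_chart.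
Variables (k : 'I_n.+1) (f : V -> R) (N : set V) (c : 'rV[R]_n) (r : R) (F : 'rV[R]_n -> V).
Hypothesis ch : chart O k f N c r F.
Local Notation U := [set u : 'rV[R]_n | `|u - c| < r].

Lemma chart_change (A : set V) (phi : V -> \bar R) : measurable (A : set (borel_rV R n.+1)) ->
  A `<=` N `&` boundary O -> @measurable_fun _ _ (borel_rV R n.+1) _ A phi -> (forall x, A x -> (0 <= phi x)%E) ->
  (\int[mu]_(x in A) phi x = \int[lebesgue_rV n]_(u in U `&` F @^-1` A) (phi (F u) * (area F u)%:E))%E.
Proof.
move=> mA AN mphi p0.
have oU : open U by exact: chart_U_open.
have mU : measurable (U : set (borel_rV R n)) by exact: measurable_open_rV.
(* Extension of [F] by 0 outside [U], since a pushforward needs a map that is measurable on the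
   whole space. *)
pose F' (u : 'rV[R]_n) : V := \row_j ((fun u => F u 0 j) \_ U) u.
have mF : @measurable_fun _ _ (borel_rV R n) (borel_rV R n.+1) setT F'.
  apply: measurable_rVP => j; rewrite (_ : (fun _ => _) = (fun u => F u 0 j) \_ U); last by apply/funext => u; rewrite mxE.
  apply/(measurable_restrictT _ _).1 => //.
  apply: measurable_fun_continuous_rV1 => // u Uu; apply: continuous_coordP; exact: cont_chart_F ch _ Uu.
have F'E u : U u -> F' u = F u.
  by move=> Uu; apply/rowP => j; rewrite mxE patchE mem_set.
pose p := (area F) \_ U.
have mp : @measurable_fun _ _ (borel_rV R n) _ setT (EFin \o p).
  apply/measurable_EFinP; apply/(measurable_restrictT _ _).1 => //.
  by apply: measurable_fun_continuous_rV1 => // u Uu; exact: cont_area ch _ Uu.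
have pp u : (0 <= (EFin \o p) u)%E by rewrite lee_fin /p patchE; case: ifP => // _; exact: sqrtr_ge0.
pose m1 := density (lebesgue_rV n) mp pp.
pose mFmix := isMeasurableFun.Build _ _ _ _ _ mF.
pose mFm : {mfun borel_rV R n >-> borel_rV R n.+1} := HB.pack F' mFmix.
have E1 B : measurable (B : set (borel_rV R n.+1)) -> B `<=` A -> mu B = pushforward m1 mFm B.
  move=> mB BA; have [_ h] := hmu.
  rewrite (h _ _ (chart_local_param oO ch))//; last first.
    by move=> x /BA/AN[Nx Sx]; have [Ux Fx] := chart_F oO ch Nx Sx; exists (del k x).
  rewrite /pushforward /m1 /density /=.
  rewrite [RHS]integral_mkcond [LHS]integral_mkcond; apply: eq_integral => u _.
  rewrite !patchE; have [Uu|nU] := pselect (U u).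
    have -> : (u \in U `&` F @^-1` B) = (u \in F' @^-1` B).
      by apply/idP/idP => /set_mem h'; apply: mem_set; [rewrite /= F'E//; exact: h'.2|split=> //; rewrite /= -F'E].
    by case: ifP => // _; rewrite /= /p patchE mem_set.
  rewrite memNset; last by case.
  by case: ifP => // _; rewrite /= /p patchE memNset.
have E2 : (\int[mu]_(x in A) phi x = \int[pushforward m1 mFm]_(x in A) phi x)%E.
  by apply: eq_measure_integral => B mB BA; exact: E1.
rewrite E2 (ge0_integral_pushforward mF)//; last by move=> x /set_mem; exact: p0.
have mA' : measurable (F' @^-1` A : set (borel_rV R n)).
  by have := mF measurableT _ mA; rewrite setTI.
have mphiF : @measurable_fun _ _ (borel_rV R n) _ (F' @^-1` A) (phi \o F').
  apply: (@measurable_comp _ _ _ (borel_rV R n) (borel_rV R n.+1) _ A phi (F' @^-1` A) F') => //.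
    by move=> x [y Ay <-].
  by apply: (measurable_funS _ _ mF).
rewrite integral_density//; last by move=> u Au; exact: p0.
rewrite [RHS]integral_mkcond [LHS]integral_mkcond; apply: eq_integral => u _.
rewrite !patchE; have [Uu|nU] := pselect (U u).
  have -> : (u \in U `&` F @^-1` A) = (u \in F' @^-1` A).
    by apply/idP/idP => /set_mem h'; apply: mem_set; [rewrite /= F'E//; exact: h'.2|split=> //; rewrite /= -F'E].
  by case: ifP => // _; rewrite /= /p patchE mem_set// F'E.
rewrite [in RHS]memNset; last by case.
by case: ifP => // _; rewrite /= /p patchE memNset// mule0.
Qed.

End in_chart.
End change.

Section volume.
Context {R : realType} {n : nat}.
Local Notation V := 'rV[R]_n.+1.
Local Notation ip := (inner hyp_metric).
Hypothesis n0 : (0 < n)%N.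

Variable O : set V.
Hypothesis oO : open O.
Hypothesis sO : smooth_boundary O.
Hypothesis bO : exists C, forall x y, O x -> O y -> riem_dist hyp_metric x y <= C.
Variable nu : V -> V.
Hypothesis hnu : outward_unit_normal (n := n) hyp_metric O nu.
Variable kappa : V -> 'I_n -> R.
Hypothesis hkappa : principal_curvatures hyp_metric (boundary O) nu kappa.
Hypothesis hH : forall p, boundary O p -> n%:R < mean_curvature kappa p.
Variable mu : {measure set (borel_rV R n.+1) -> \bar R}.
Hypothesis hmu : area_measure (n := n) hyp_metric (boundary O) mu.
Variable o : V.

Lemma boundary_height_gt0 q p : boundary O p -> 0 < height q nu p.
Proof. by move=> Sp; apply: height_gt0; exact: (normal_unit hnu). Qed.

Lemma measurable_dens K1 eps : closed K1 ->
  @measurable_fun _ _ (borel_rV R n.+1) _ (boundary O) (dens nu kappa o K1 eps).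
Proof.
move=> cK; apply: measurable_funB; last first.
  apply: measurable_funM => //; apply: (measurable_funS measurableT) => //.
  by apply: measurable_indic; exact: measurable_closed_rV.
apply: measurable_fun_lsc; first exact: measurable_boundary.
move=> x a Sx ax.
have [k [f [N [c [r [F [ch Nx]]]]]]] := boundary_chart oO sO Sx.
have [Ux Fx] := chart_F oO ch Nx Sx.
pose g u := height o nu (F u) / (n.+1%:R * slope kappa (F u)).
have cg : {for del k x, continuous g}.
  apply: contM; first exact: (cont_height oO hnu ch).
  apply: (@contV _ _ (fun u => n.+1%:R * slope kappa (F u))).
    by rewrite mulf_neq0// gt_eqF// (slope_gt0 n0 hH)//; exact: (chart_S oO ch).
  by apply: contM; [exact: contC|exact: (cont_slope n0 oO hnu hkappa ch)].
have := near_gt cg (c := a); rewrite /g Fx => /(_ ax) ng.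
have n2 : \forall y \near x, a < g (del k y) by exact: (hasD_cont (hasD_del k x)) ng.
have n3 : nbhs x ([set y | a < g (del k y)] `&` N).
  by apply: filterI => //; exact: open_nbhs_nbhs (conj (chart_open ch) Nx).
exists (([set y | a < g (del k y)] `&` N)°); split.
- exact: open_interior.
- exact: n3.
- move=> y /nbhs_singleton[ay Ny] Sy; have [_ Fy] := chart_F oO ch Ny Sy.
  by move: ay; rewrite /= /g Fy.
Qed.

Definition vol_dens (z : V) : R := coshd o z / wt z.

Lemma cont_vol_dens (y : V) : {for y, continuous vol_dens}.
Proof.
apply: contM; first exact: cont_coshd.
by apply: contV; [exact: wt_neq0|apply: cont_wt; exact: cvg_id].
Qed.

Lemma measurable_vol_dens : @measurable_fun _ _ (borel_rV R n.+1) _ setT (EFin \o vol_dens).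
Proof.
apply/measurable_EFinP; apply: measurable_fun_continuous_rV1; first exact: openT.
by move=> y _; exact: cont_vol_dens.
Qed.

Lemma vol_dens_ge0 y : (0 <= (EFin \o vol_dens) y)%E.
Proof. by rewrite lee_fin divr_ge0// ?(ltW (wt_gt0 _))// (le_trans _ (coshd_ge1 _ _)). Qed.

Section cut.
Variables (K1 : set V) (s1 s2 eps : R).
Hypothesis cK : closed K1.
Hypothesis s12 : 0 < s1 < s2.
Hypothesis eps0 : 0 <= eps.
Hypothesis hK : forall q, boundary O q -> K1 q -> forall s, s1 <= s <= s2 ->
  ~ contact O nu s q /\ eps <= (s2 - s1) * (height o nu q * ramp kappa s q).

Lemma dens_ge0 p : boundary O p -> 0 <= dens nu kappa o K1 eps p.
Proof.
move=> Sp; have h := dens_bound n0 hH s12 eps0 hK Sp (boundary_height_gt0 o Sp).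
rewrite -lee_fin; apply: le_trans h; apply: integral_ge0 => s _.
by rewrite lee_fin mulr_ge0// ?(ltW (boundary_height_gt0 o Sp))// exprn_ge0// le_max lexx.
Qed.

(** By [flow_surj] any set that contains the images of all contact pairs contains [O]; such a set is
    glued from the local ones by [globalize]. An infinite right side leaves nothing to prove, which
    supplies the finiteness that gluing requires. *)
Lemma volume_le : (\int[lebesgue_rV n.+1]_(z in O) (vol_dens z)%:E <=
  \int[mu]_(p in boundary O) (dens nu kappa o K1 eps p)%:E)%E.
Proof.
have mS := @measurable_boundary R n O.
pose dd := (dens nu kappa o K1 eps) \_ (boundary O).
have mdd : @measurable_fun _ _ (borel_rV R n.+1) _ setT (EFin \o dd).
  apply/measurable_EFinP; apply/(measurable_restrictT _ _).1 => //; exact: measurable_dens.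
have dd0 p : (0 <= (EFin \o dd) p)%E.
  by rewrite lee_fin /dd patchE; case: ifP => // /set_mem; exact: dens_ge0.
pose nu' : {measure set (borel_rV R n.+1) -> \bar R} := density mu mdd dd0.
have nu'E : nu' setT = (\int[mu]_(p in boundary O) (dens nu kappa o K1 eps p)%:E)%E.
  rewrite /nu' /density /= [RHS]integral_mkcond; apply: eq_integral => p _.
  by rewrite /dd /= !patchE; case: ifP.
rewrite -nu'E; have [fin|] := ltP (nu' setT) +oo%E; last by rewrite leye_eq => /eqP ->; exact: leey.
have [[z Oz]|nO] := pselect (exists z, O z); last first.
  have -> : O = set0 by apply/seteqP; split=> // z Oz; case: nO; exists z.
  by rewrite integral_set0 measure_ge0.
have [K hKb] := closure_bounded bO Oz.
pose tau : {measure set (borel_rV R n.+1) -> \bar R} := density (lebesgue_rV n.+1) measurable_vol_dens vol_dens_ge0.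
pose rel (p : V) : set V := [set z | exists s, [/\ boundary O p, 0 < s, contact O nu s p & flow o nu s p = z]].
pose r0 := `|K| + 1; have r00 : 0 < r0 by rewrite ltr_wpDl.
pose a : V := const_mx (- r0).
have local (x : V) : exists N : set V, [/\ open N, N x &
     forall G, open G -> G `<=` N -> exists B, [/\ @measurable _ (borel_rV R n.+1) B, forall y, G y -> rel y `<=` B & (tau B <= nu' G)%E]].
  have [Sx|nSx] := pselect (boundary O x); last first.
    have oc : open (~` boundary O) by apply: closed_openC; exact: closed_boundary.
    exists (~` boundary O); split => // G oG GN; exists set0.
    split; [exact: measurable0| |by rewrite measure0 measure_ge0].
    by move=> y /GN nSy w [s' [Sy _ _ _]].
  have [k [f [N [c [r [F [ch Nx]]]]]]] := boundary_chart oO sO Sx.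
  exists N; split => //; first exact: (chart_open ch).
  move=> G oG GN.
  have [B [mB hB leB]] := local_bound n0 oO hnu hkappa hH (o := o) ch cK s12 eps0 hK oG GN.
  have mG : measurable (G : set (borel_rV R n.+1)) by exact: measurable_open_rV.
  exists B; split => //.
    by move=> y Gy w [s' [Sy s'0 hc <-]]; exact: hB.
  apply: (le_trans leB); rewrite le_eqVlt; apply/orP; left; apply/eqP.
  have mA : measurable (G `&` boundary O : set (borel_rV R n.+1)) by exact: measurableI.
  have -> : nu' G = (\int[mu]_(x in G `&` boundary O) (dens nu kappa o K1 eps x)%:E)%E.
    rewrite /nu' /density /= [RHS]integral_mkcondr; apply: eq_integral => y _.
    by rewrite /dd /= !patchE; case: ifP.
  rewrite (chart_change oO hmu ch mA); last 3 first.
  - by move=> y [/GN Ny Sy].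
  - apply/measurable_EFinP; apply: (measurable_funS mS); first by move=> y [].
    exact: measurable_dens.
  - by move=> y [_ Sy]; rewrite lee_fin dens_ge0.
  congr (integral _ _ _).
  by apply/seteqP; split=> u [Uu Gu]; split => //; [split=> //; exact: (chart_S oO ch)|exact: Gu.1].
have r02 : 0 < r0 *+ 2 by rewrite mulrn_wgt0.
have [] := globalize a fin r02 local.
move=> B [mB hB leB].
have OB : O `<=` B.
  move=> w Ow; have [p [s [Sp s0 hc pw]]] := flow_surj oO sO bO hnu o Ow.
  apply: (hB p); last by exists s.
  move=> i; rewrite mxE; have [cp _] := Sp; have := le_trans (ler_coord_norm p i) (hKb _ cp).
  by rewrite ler_norml /r0 => /andP[h1 h2]; have := ler_norm K; rewrite mulr2n; lra.
have mO : measurable (O : set (borel_rV R n.+1)) by exact: measurable_open_rV.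
apply: (@le_trans _ _ (tau B)); first by rewrite -[leLHS]/(tau O); apply: le_measure; rewrite ?inE.
by apply: (le_trans leB); apply: le_measure; rewrite ?inE//; exact: measurable_hcube.
Qed.

End cut.
End volume.

(** * The equality case *)

Section equality.
Context {R : realType} {n : nat}.
Local Notation V := 'rV[R]_n.+1.
Local Notation ip := (inner hyp_metric).
Hypothesis n0 : (0 < n)%N.

Variable O : set V.
Hypothesis oO : open O.
Hypothesis sO : smooth_boundary O.
Hypothesis bO : exists C, forall x y, O x -> O y -> riem_dist hyp_metric x y <= C.
Variable nu : V -> V.
Hypothesis hnu : outward_unit_normal (n := n) hyp_metric O nu.
Variable kappa : V -> 'I_n -> R.
Hypothesis hkappa : principal_curvatures hyp_metric (boundary O) nu kappa.
Hypothesis hH : forall p, boundary O p -> n%:R < mean_curvature kappa p.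
Variable mu : {measure set (borel_rV R n.+1) -> \bar R}.
Hypothesis hmu : area_measure (n := n) hyp_metric (boundary O) mu.
Variable o : V.

Definition dens0 p : R := height o nu p / (n.+1%:R * slope kappa p).

Lemma dens_set0 p : dens nu kappa o set0 0 p = dens0 p.
Proof. by rewrite /dens mul0r subr0. Qed.

Lemma dens0_gt0 p : boundary O p -> 0 < dens0 p.
Proof.
move=> Sp; rewrite divr_gt0 ?(boundary_height_gt0 hnu)//.
by rewrite mulr_gt0// (slope_gt0 n0 hH).
Qed.

Lemma measurable_dens0 : @measurable_fun _ _ (borel_rV R n.+1) _ (boundary O) dens0.
Proof.
rewrite (_ : dens0 = dens nu kappa o set0 0); last by apply/funext => p; rewrite dens_set0.
by apply: (measurable_dens n0 oO sO hnu hkappa hH); exact: closed0.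
Qed.

Lemma volume_le0 : (\int[lebesgue_rV n.+1]_(z in O) (vol_dens o z)%:E <=
  \int[mu]_(p in boundary O) (dens0 p)%:E)%E.
Proof.
(* An empty cut: with [K1] empty and zero saving, any interval serves. *)
have := @volume_le R n n0 O oO sO bO nu hnu kappa hkappa hH mu hmu o set0 1 2 0 closed0.
have -> : dens nu kappa o set0 0 = dens0 by apply/funext => p; exact: dens_set0.
by apply => //; rewrite ltr01/=; lra.
Qed.

Lemma volume_fin : (\int[lebesgue_rV n.+1]_(z in O) (vol_dens o z)%:E < +oo)%E.
Proof.
have [[z Oz]|nO] := pselect (exists z, O z); last first.
  have -> : O = set0 by apply/seteqP; split=> // z Oz; case: nO; exists z.
  by rewrite integral_set0.
have [K hK] := closure_bounded bO Oz.
pose M := `|K| + 1; have M0 : 0 < M by rewrite ltr_wpDl.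
have OC : O `<=` hcube (const_mx (- M) : V) (M *+ 2).
  move=> x Ox i; rewrite mxE; have := le_trans (ler_coord_norm x i) (hK _ (subset_closure Ox)).
  by rewrite ler_norml /M => /andP[h1 h2]; have := ler_norm K; rewrite mulr2n; lra.
have hb : exists B : R, forall x, O x -> vol_dens o x <= B.
  have cb : compact (closure O).
    apply: bounded_closed_compact; last exact: closed_closure.
    by exists K; split; [exact: num_real|move=> M' KM x cx; exact: le_trans (hK _ cx) (ltW KM)].
  have n0' : closure O !=set0 by exists z; exact: subset_closure.
  have [|p _ hp] := @EVT_min_rV _ _ (fun x => - vol_dens o x) _ n0' cb.
    by apply: continuous_subspaceT => x; apply: contN; exact: cont_vol_dens.
  exists (vol_dens o p) => x Ox; rewrite -lerN2; apply: hp; apply: mem_set; exact: subset_closure.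
have [B hB] := hb.
have mO : measurable (O : set (borel_rV R n.+1)) by exact: measurable_open_rV.
have mC : measurable (hcube (const_mx (- M) : V) (M *+ 2) : set (borel_rV R n.+1)) by exact: measurable_hcube.
have M20 : 0 < M *+ 2 by rewrite mulrn_wgt0.
apply: (@le_lt_trans _ _ (\int[lebesgue_rV n.+1]_(z in O) (cst `|B|%:E) z)%E).
  apply: ge0_le_integral => //.
  - by move=> x _; exact: vol_dens_ge0.
  - by apply: (measurable_funS measurableT) => //; exact: measurable_vol_dens.
  - by move=> x Ox; rewrite lee_fin (le_trans (hB _ Ox))// ler_norm.
rewrite integral_cst//; apply: lte_mul_pinfty => //.
apply: (@le_lt_trans _ _ (lebesgue_rV n.+1 (hcube (const_mx (- M) : V) (M *+ 2)))).
  by apply: le_measure; rewrite ?inE.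
by rewrite lebesgue_hcube// ltry.
Qed.

Lemma boundary_ball_gt0 p (e : R) : boundary O p -> 0 < e ->
  (0 < mu (boundary O `&` [set x | (`|x - p| <= e)%R]))%E.
Proof.
move=> Sp e0.
have [k [f [N [c [r [F [ch Np]]]]]]] := boundary_chart oO sO Sp.
have [Up Fp] := chart_F oO ch Np Sp; set u := del k p in Up Fp.
have cF := cont_chart_F ch Up; have ca := cont_area ch Up.
have a0 : 0 < area F u by rewrite sqrtr_gt0 (det_first_form_gt0 oO hnu ch).
have n1 : \forall y \near u, `|F y - p| < e by apply: near_dist cF _; rewrite Fp subrr normr0.
have n2 : \forall y \near u, area F u / 2 < area F y by apply: near_gt ca _; lra.
have n3 : \forall y \near u, N (F y).
  by apply: cF; rewrite Fp; exact: open_nbhs_nbhs (conj (chart_open ch) Np).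
have [d d0 hd] := near_norm (filterI (filterI n1 n2) (filterI n3 (chart_nearU Up))).
pose Q := hcube u (d / 2).
have d20 : 0 < d / 2 by rewrite divr_gt0.
have QU y : Q y -> `|y - u| < d.
  move=> Qy; apply: (@hcube_near _ _ u u y (d / 2)) => //; first by rewrite d20; lra.
  by move=> i; rewrite lexx lerDl ltW.
set A := _ `&` _.
have cb : closed [set x : V | `|x - p| <= e].
  have := @closed_closed_ball_ R V p e.
  by rewrite (_ : closed_ball_ _ _ _ = [set x : V | `|x - p| <= e])//; apply/funext => x; rewrite /closed_ball_ /= distrC.
have mA : measurable (A : set (borel_rV R n.+1)).
  by apply: measurable_closed_rV; apply: closedI => //; exact: closed_boundary.
pose B := A `&` N.
have mN : measurable (N : set (borel_rV R n.+1)) by apply: measurable_open_rV; exact: (chart_open ch).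
have mB : measurable (B : set (borel_rV R n.+1)) by exact: measurableI.
have BA : (mu B <= mu A)%E by apply: le_measure; rewrite ?inE// => x [].
apply: lt_le_trans BA.
have [_ h] := hmu; rewrite (h _ _ (chart_local_param oO ch))//; last first.
  by move=> x [[Sx _] Nx]; have [Ux Fx] := chart_F oO ch Nx Sx; exists (del k x).
set D := _ `&` _.
have mQ : measurable (Q : set (borel_rV R n)) by exact: measurable_hcube.
have oU := @chart_U_open _ _ c r.
have mU : measurable ([set y : 'rV[R]_n | `|y - c| < r] : set (borel_rV R n)) by exact: measurable_open_rV.
have mF : @measurable_fun _ _ (borel_rV R n) (borel_rV R n.+1) [set y : 'rV[R]_n | `|y - c| < r] F.
  apply: measurable_fun_continuous_rV; first exact: oU.
  by move=> y Uy; exact: cont_chart_F ch _ Uy.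
have mD : measurable (D : set (borel_rV R n)) by exact: mF.
have marea : @measurable_fun _ _ (borel_rV R n) _ [set y : 'rV[R]_n | `|y - c| < r] (fun y => (area F y)%:E).
  apply/measurable_EFinP; apply: measurable_fun_continuous_rV1; first exact: oU.
  by move=> y Uy; exact: cont_area ch _ Uy.
have QD : Q `<=` D.
  move=> y /QU/hd[[y1 y2] [y3 y4]]; split=> //; split=> //; split; [exact: (chart_S oO ch)|exact: ltW].
apply: (@lt_le_trans _ _ (\int[lebesgue_rV n]_(y in Q) (cst (area F u / 2)%:E) y)%E).
  have := lebesgue_hcube u d20; rewrite -/Q => eQ.
  rewrite integral_cst//; apply: (@lt_le_trans _ _ ((area F u / 2)%:E * ((d / 2) ^+ n)%:E)%E).
    by rewrite -EFinM lte_fin mulr_gt0 ?divr_gt0// exprn_gt0.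
  by rewrite -eQ; exact: lexx.
apply: (@le_trans _ _ (\int[lebesgue_rV n]_(y in Q) (area F y)%:E)%E).
  apply: ge0_le_integral.
  - exact: mQ.
  - by move=> y _; rewrite lee_fin divr_ge0// ltW.
  - exact: measurable_cst.
  - by apply: (measurable_funS mU) marea => y /QD[].
  - by move=> y /QU/hd[[_ y2] _]; rewrite lee_fin ltW.
apply: ge0_subset_integral.
- exact: mQ.
- exact: mD.
- by apply: (measurable_funS mU) marea => y [].
- by move=> y _; rewrite lee_fin sqrtr_ge0.
- exact: QD.
Qed.

Hypothesis hE : (\int[mu]_(p in boundary O) (dens0 p)%:E = \int[lebesgue_rV n.+1]_(z in O) (vol_dens o z)%:E)%E.

(** Failure of contact persists for nearby pairs, and [slope * s < 1] keeps the ramp positive there.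
    Omitting a small product of a ball and an interval saves a positive amount, as balls about
    boundary points have positive area, and the total is finite, so equality would fail. *)
Lemma eq_contact p s : boundary O p -> 0 < s -> slope kappa p * s < 1 -> contact O nu s p.
Proof.
move=> Sp s0 sp; apply: contrapT => nc.
have [k [f [N [c [r [F [ch Np]]]]]]] := boundary_chart oO sO Sp.
have [Up Fp] := chart_F oO ch Np Sp; set u := del k p in Up Fp.
pose g (z : V) := height o nu (F (del 0 z)) * ramp kappa (z 0 0) (F (del 0 z)).
pose z0 : V := ins 0 u s.
have z00 : z0 0 0 = s by rewrite ins_k.
have z0d : del 0 z0 = u by rewrite del_ins.
have U0 : `|del 0 z0 - c| < r by rewrite z0d.
have cg : {for z0, continuous g}.
  apply: contM.
    by apply: (@cont_del0 _ _ z0 _ (fun u => height o nu (F u))); exact: (cont_height oO hnu ch).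
  apply: contX; apply: cont_maxr0; apply: contB; first exact: contC.
  apply: contM; last exact: cont_coord0.
  by apply: (@cont_del0 _ _ z0 _ (fun u => slope kappa (F u))); exact: (cont_slope n0 oO hnu hkappa ch).
have g0 : 0 < g z0.
  rewrite /g z00 z0d Fp mulr_gt0 ?(boundary_height_gt0 hnu)//.
  by rewrite exprn_gt0// lt_max subr_gt0 sp orbT.
have n1 : \forall z \near z0, g z0 / 2 < g z by apply: near_gt cg _; lra.
move: nc => /existsNP[q /not_implyP[Sq /negP]]; rewrite -ltNge => nc.
have ce : {for z0, continuous (fun z : V => flow_eta q nu (z 0 0) (F (del 0 z)) - (1 + z 0 0))}.
  apply: contB; last by apply: contD; [exact: contC|exact: cont_coord0].
  apply: contD.
    apply: (@cont_del0 _ _ z0 _ (fun u => coshd q (F u))).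
    by apply: continuous_comp; [exact: (cont_chart_F ch)|exact: cont_coshd].
  apply: contM; first exact: cont_coord0.
  by apply: (@cont_del0 _ _ z0 _ (fun u => height q nu (F u))); exact: (cont_height oO hnu ch).
have n2 : \forall z \near z0, flow_eta q nu ((z : V) 0 0) (F (del 0 (z : V))) - (1 + (z : V) 0 0) < 0.
  by apply: near_lt ce _; rewrite z00 z0d Fp subr_lt0.
have [d d0 hd] := near_norm (filterI n1 n2).
have [e e0 he] := near_norm (open_nbhs_nbhs (conj (chart_open ch) Np)).
pose w := Num.min (d / 4) (s / 2).
have w0 : 0 < w by rewrite lt_min !divr_gt0.
have wd : w <= d / 4 by rewrite ge_min lexx.
have ws : w <= s / 2 by rewrite ge_min lexx orbT.
pose rho := Num.min (d / 4) (e / 2).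
have rho0 : 0 < rho by rewrite lt_min !divr_gt0.
have rhod : rho <= d / 4 by rewrite ge_min lexx.
have rhoe : rho <= e / 2 by rewrite ge_min lexx orbT.
clearbody w rho.
pose K1 := [set x : V | `|x - p| <= rho].
have cK : closed K1.
  have := @closed_closed_ball_ R V p rho.
  by rewrite (_ : closed_ball_ _ _ _ = K1)//; apply/funext => x; rewrite /closed_ball_ /K1 /= distrC.
(* The interval has length [2 * w], and the integrand exceeds [g z0 / 2] on it. *)
pose eps := w * g z0.
have eps0 : 0 < eps by rewrite mulr_gt0.
have s12 : 0 < s - w < s + w by apply/andP; split; lra.
have hK x : boundary O x -> K1 x -> forall t, s - w <= t <= s + w ->
    ~ contact O nu t x /\ eps <= (s + w - (s - w)) * (height o nu x * ramp kappa t x).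
  move=> Sx /= Kx t /andP[t1 t2].
  have Nx : N x by apply: he; apply: (le_lt_trans Kx); lra.
  have [Ux Fx] := chart_F oO ch Nx Sx.
  have zz : `|ins 0 (del k x) t - z0| < d.
    rewrite /z0 -insB; apply: (le_lt_trans (ins_norm _ _ _)).
    have : `|del k x - u| <= rho by rewrite /u -delB; apply: le_trans (del_norm _ _) Kx.
    have : `|t - s| <= w by rewrite ler_norml; apply/andP; split; lra.
    lra.
  have [gz fz] := hd _ zz; rewrite /g ins_k del_ins Fx in gz fz.
  split; first by move=> /(_ q Sq); apply/negP; rewrite -ltNge -subr_lt0.
  have -> : s + w - (s - w) = w * 2 by ring.
  by rewrite /eps -mulrA ler_pM2l// -ler_pdivrMl// mulrC ltW.
have := volume_le n0 oO sO bO hnu hkappa hH hmu cK s12 (ltW eps0) hK.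
have mS := @measurable_boundary R n O.
have mK : measurable (K1 : set (borel_rV R n.+1)) by exact: measurable_closed_rV.
have mdens : @measurable_fun _ _ (borel_rV R n.+1) _ (boundary O) (fun p => (dens nu kappa o K1 eps p)%:E).
  by apply/measurable_EFinP; exact: (measurable_dens n0 oO sO hnu hkappa hH).
have E : (\int[mu]_(p in boundary O) (dens0 p)%:E =
   \int[mu]_(p in boundary O) (dens nu kappa o K1 eps p)%:E + eps%:E * mu (boundary O `&` K1))%E.
  have -> : (eps%:E * mu (boundary O `&` K1) = \int[mu]_(p in boundary O) (eps * \1_K1 p)%:E)%E.
    under eq_integral do rewrite EFinM.
    rewrite ge0_integralZl//.
    - by rewrite integral_indic// setIC.
    - by apply/measurable_EFinP; apply: (measurable_funS measurableT) => //; exact: measurable_indic.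
    - by rewrite lee_fin ltW.
  rewrite -ge0_integralD//.
  - by apply: eq_integral => x _; rewrite -EFinD /dens subrK.
  - by move=> x Sx; rewrite lee_fin; exact: (dens_ge0 n0 hnu hH s12 (ltW eps0) hK).
  - by move=> x _; rewrite lee_fin mulr_ge0 ?(ltW eps0).
  - apply/measurable_EFinP; apply: measurable_funM => //.
have muK := boundary_ball_gt0 Sp rho0.
have fin := volume_fin; rewrite -hE E in fin *.
have J0 : (0 <= \int[mu]_(p in boundary O) (dens nu kappa o K1 eps p)%:E)%E.
  apply: integral_ge0 => x Sx; rewrite lee_fin; exact: (dens_ge0 n0 hnu hH s12 (ltW eps0) hK).
have pos : (0 < eps%:E * mu (boundary O `&` K1))%E by rewrite mule_gt0// lte_fin.
move: fin J0 pos; move: (integral _ _ _) (eps%:E * _)%E => [a||] [b||]//=.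
by rewrite !lte_fin => _ _ b0; rewrite -EFinD lee_fin gerDl leNgt b0.
Qed.

Lemma eq_kappa p i : boundary O p -> kappa p i = mean_curvature kappa p / n%:R.
Proof.
move=> Sp; have [k [f [N [c [r [F [ch Np]]]]]]] := boundary_chart oO sO Sp.
have [Up Fp] := chart_F oO ch Np Sp; have c0 := slope_gt0 n0 hH Sp.
have le j : kappa p j <= slope kappa p + 1.
  rewrite leNgt; apply/negP => lt.
  (* [1 / s] is the mean of [kappa p j - 1] and the slope: [s] is below [1 / slope], so that contact
     holds, but above [1 / (kappa p j - 1)], which [contact_kappa] forbids. *)
  pose s := 2 / (kappa p j - 1 + slope kappa p).
  have den : 0 < kappa p j - 1 + slope kappa p by lra.
  have s0 : 0 < s by rewrite divr_gt0.
  have sE : s * (kappa p j - 1 + slope kappa p) = 2 by rewrite /s divfK// gt_eqF.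
  have d1 : 0 < kappa p j - 1 - slope kappa p by lra.
  have d2 := mulr_gt0 s0 d1.
  have sl : slope kappa p * s < 1 by nra.
  have := contact_kappa oO hnu ch hkappa j (ltW s0) Up.
  rewrite Fp => /(_ (eq_contact Sp s0 sl)); nra.
have sum0 : \sum_j (slope kappa p + 1 - kappa p j) = 0.
  rewrite sumrB sumr_const card_ord /slope subrK -[_ *+ n]mulr_natr divfK ?subrr//.
  by rewrite pnatr_eq0 -lt0n.
have ge j : true -> 0 <= slope kappa p + 1 - kappa p j by rewrite subr_ge0.
have /eqP := sum0; rewrite psumr_eq0// => /allP/(_ i).
rewrite mem_index_enum => /(_ isT) /=; rewrite subr_eq0 => /eqP <-; by rewrite /slope subrK.
Qed.

End equality.

(** * Symmetry of second derivatives and of the Weingarten map *)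

Section schwarz.
Context {R : realType} {m : nat}.
Local Notation P := 'rV[R]_m.

Lemma line_MVT (G H : P -> R) (u v : P) (t : R) : 0 < t ->
  (forall s : R, 0 <= s <= t -> differentiable G (u + s *: v) /\ 'D_v G (u + s *: v) = H (u + s *: v)) ->
  exists2 s : R, 0 < s < t & G (u + t *: v) - G u = t * H (u + s *: v).
Proof.
move=> t0 hG.
have hg s : 0 <= s <= t -> hasD (fun s : R => G (u + s *: v)) s (fun x : R => x * H (u + s *: v)).
  move=> /hG[dG GH]; apply: hasD_eq (hasD_comp (hasD_line u v s) (hasD_diff dG)) _ => x.
  by rewrite (deriveE _ dG) linearZ /= -(deriveE _ dG) GH.
have [x||s] := @MVT _ (fun s : R => G (u + s *: v)) (fun s : R => H (u + s *: v)) 0 t t0.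
- rewrite in_itv /= => /andP[x0 xt].
  have hx : 0 <= x <= t by rewrite !ltW.
  have [d e] := hasD_derive1 (hg x hx); apply: DeriveDef => //.
  by rewrite -derive1E e mul1r.
- by apply: continuous_in_subspaceT => x /set_mem /=; rewrite in_itv /= => /hg hx; exact: hasD_cont hx.
rewrite in_itv /= => st; rewrite subr0 scale0r addr0 mulrC => e; by exists s.
Qed.

(** The mean value theorem twice: along [b] for the difference of [G] over [t *: a], then along [a]
    for [Gb]. The second difference is symmetric in [a] and [b], so the same lemma with the roles
    exchanged gives [schwarz]. *)
Lemma second_difference (G Gb Gab : P -> R) (u a b : P) (e : R) : 0 < e ->
  (\forall y \near u, differentiable G y /\ 'D_b G y = Gb y) ->
  (\forall y \near u, differentiable Gb y /\ 'D_a Gb y = Gab y) ->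
  {for u, continuous Gab} ->
  exists2 d : R, 0 < d & forall t, 0 < t < d -> exists2 y : P, `|Gab y - Gab u| < e &
    G (u + t *: b + t *: a) - G (u + t *: b) - (G (u + t *: a) - G u) = t * (t * Gab y).
Proof.
move=> e0 h1 h2 h3.
have h4 : \forall y \near u, `|Gab y - Gab u| < e by apply: near_dist h3 _; rewrite subrr normr0.
have [d d0 hd] := near_norm (filterI (filterI h1 h2) h4).
pose M := `|a| + `|b| + 1.
have M0 : 0 < M by rewrite ltr_wpDl ?addr_ge0.
exists (d / M); first exact: divr_gt0.
move=> t /andP[t0]; rewrite ltr_pdivlMr// => td.
have hst s s' : 0 <= s <= t -> 0 <= s' <= t -> `|u + s *: b + s' *: a - u| < d.
  move=> /andP[s0 st] /andP[s0' st']; rewrite addrAC (addrAC u) subrr add0r.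
  apply: le_lt_trans (ler_normD _ _) _; rewrite !normrZ !ger0_norm//.
  have := normr_ge0 a; have := normr_ge0 b; rewrite /M in td *; nra.
have [|s /andP[s0 st]] := @line_MVT (fun y : P => G (y + t *: a) - G y) (fun y : P => Gb (y + t *: a) - Gb y) u b t t0.
  move=> s st; have tt : 0 <= t <= t by rewrite lexx ltW.
  have zt : 0 <= (0 : R) <= t by rewrite lexx ltW.
  have [[[g1 g2] _] _] := hd _ (hst _ _ st tt).
  have := hst _ _ st zt; rewrite scale0r addr0 => /hd[[[g3 g4] _] _].
  have hs : hasD (fun y : P => y + t *: a) (u + s *: b) (fun v : P => v + 0).
    by apply: hasD_D; [exact: hasD_id|exact: hasD_cst].
  have [d1 d2] := hasD_B (hasD_comp hs (hasD_diff g1)) (hasD_diff g3).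
  by split=> //; rewrite d2 addr0 g2 g4.
move=> ->.
have hs : 0 <= s <= t by rewrite !ltW.
have [|s' /andP[s0' st'] ->] := @line_MVT Gb Gab (u + s *: b) a t t0.
  by move=> s' st'; have [[_ g] _] := hd _ (hst _ _ hs st').
have hs' : 0 <= s' <= t by rewrite !ltW.
by exists (u + s *: b + s' *: a); first by have [_] := hd _ (hst _ _ hs hs').
Qed.

Lemma schwarz (G Ga Gb Gab Gba : P -> R) (u a b : P) :
  (\forall y \near u, differentiable G y /\ ('D_a G y = Ga y /\ 'D_b G y = Gb y)) ->
  (\forall y \near u, differentiable Ga y /\ 'D_b Ga y = Gba y) ->
  (\forall y \near u, differentiable Gb y /\ 'D_a Gb y = Gab y) ->
  {for u, continuous Gab} -> {for u, continuous Gba} -> Gab u = Gba u.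
Proof.
move=> h1 h2 h3 c1 c2; apply/eqP; rewrite -subr_eq0 -normr_eq0 eq_le normr_ge0 andbT.
apply/ler_addgt0Pl => e e0; rewrite addr0.
have e20 : 0 < e / 2 by rewrite divr_gt0.
have h1a : \forall y \near u, differentiable G y /\ 'D_a G y = Ga y by apply: filterS h1 => y [? []].
have h1b : \forall y \near u, differentiable G y /\ 'D_b G y = Gb y by apply: filterS h1 => y [? []].
have [d d0 hd] := second_difference e20 h1b h3 c1.
have [d' d0' hd'] := second_difference e20 h1a h2 c2.
pose t := Num.min (d / 2) (d' / 2).
have t0 : 0 < t by rewrite lt_min !divr_gt0.
have td : t < d by rewrite gt_min; apply/orP; left; lra.
have td' : t < d' by rewrite gt_min; apply/orP; right; lra.
have [|y hy E] := hd t; first by rewrite t0.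
have [|y' hy' E'] := hd' t; first by rewrite t0.
have : t * (t * Gab y) = t * (t * Gba y').
  by rewrite -E -E' (addrAC u (t *: b)); ring.
move=> /(mulfI (lt0r_neq0 t0))/(mulfI (lt0r_neq0 t0)) EE.
have -> : Gab u - Gba u = (Gba y' - Gba u) - (Gab y - Gab u) by rewrite EE; ring.
by apply: le_trans (ler_normB _ _) _; lra.
Qed.

End schwarz.
Section umbilic.
Context {R : realType} {n : nat}.
Local Notation V := 'rV[R]_n.+1.
Local Notation ip := (inner hyp_metric).
Variable O : set V.
Hypothesis oO : open O.
Variable nu : V -> V.
Hypothesis hnu : outward_unit_normal (n := n) hyp_metric O nu.

Section in_chart.
Variables (k : 'I_n.+1) (f : V -> R) (N : set V) (c : 'rV[R]_n) (r : R) (F : 'rV[R]_n -> V).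
Hypothesis ch : chart O k f N c r F.
Local Notation U := [set u : 'rV[R]_n | `|u - c| < r].

Lemma chart_D2_sym u (a b : 'rV[R]_n) : U u -> 'D_a ('D_b F) u = 'D_b ('D_a F) u.
Proof.
move=> Uu; have sF := chart_smooth_F ch; have nU := chart_nearU Uu.
apply/rowP => j.
have cD (G : 'rV[R]_n -> V) (v y : 'rV[R]_n) : smooth_on U G -> U y ->
    differentiable (fun x : 'rV[R]_n => G x 0 j) y /\ 'D_v (fun x : 'rV[R]_n => G x 0 j) y = 'D_v G y 0 j.
  move=> sG Uy; have [d e] := hasD_rV_coord j (hasD_diff (smooth_on_diff sG Uy)).
  by split=> //; rewrite e.
apply: (@schwarz _ _ (fun y => F y 0 j) (fun y => 'D_a F y 0 j) (fun y => 'D_b F y 0 j)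
  (fun y => 'D_a ('D_b F) y 0 j) (fun y => 'D_b ('D_a F) y 0 j) u a b).
- by apply: filterS nU => y Uy; have [d1 e1] := cD _ a _ sF Uy; have [_ e2] := cD _ b _ sF Uy.
- by apply: filterS nU => y Uy; exact: cD _ b _ (smooth_on_derive a sF) Uy.
- by apply: filterS nU => y Uy; exact: cD _ a _ (smooth_on_derive b sF) Uy.
- have [d _] := cD _ 0 _ (smooth_on_derive a (smooth_on_derive b sF)) Uu.
  exact: differentiable_continuous d.
- have [d _] := cD _ 0 _ (smooth_on_derive b (smooth_on_derive a sF)) Uu.
  exact: differentiable_continuous d.
Qed.

(** Differentiating the orthogonality of the normal and ['D_b F] along [a] gives minus the product
    of N with the second derivative of the lift of [F], which is symmetric in [a] and [b]. *)
Lemma D_normal_inner u (a b : 'rV[R]_n) : U u ->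
  ip (F u) ('D_a (nu \o F) u) (b *m 'J F u) =
  tcomp (F u) (nu (F u)) * ((dot ('D_a F u) ('D_b F u) + dot (F u) ('D_a ('D_b F) u)) / wt (F u)
     - dot (F u) ('D_b F u) * dot (F u) ('D_a F u) / wt (F u) ^+ 3) - dot (nu (F u)) ('D_a ('D_b F) u).
Proof.
move=> Uu; have sF := chart_smooth_F ch.
have hF := hasD_diff (chart_diff_F ch Uu); have hN := hasD_diff (chart_diff_nu oO hnu ch Uu).
have hFb := hasD_diff (smooth_on_diff (smooth_on_derive b sF) Uu).
have h := hasD_B (hasD_dot hN hFb) (hasD_M (tcomp_normal_D oO hnu ch a Uu) (hasD_tcomp hF hFb)).
have h0 : \forall y \near u, dot ((nu \o F) y) ('D_b F y) - tcomp (F y) (nu (F y)) * tcomp (F y) ('D_b F y) = 0.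
  apply: filterS (chart_nearU Uu) => y Uy; rewrite -innerE_tcomp (D_chart ch)//.
  exact: (normal_tan oO hnu ch).
have := hasD_const a h h0; rewrite innerE_tcomp -(D_chart ch)//= => e.
set A := dot _ _ in e *; set B := dot (nu (F u)) _ in e *; set T := tcomp _ ('D_a _ u) in e *.
set t := tcomp _ (nu _) in e *; set b' := tcomp _ _ in e *; set W := _ - _ / _ in e *.
by move: e; clearbody A B T t b' W => e; lra.
Qed.

Lemma gweing_sym u (a b : 'rV[R]_n) : U u ->
  ip (F u) (a *m gweing nu k F u *m 'J F u) (b *m 'J F u) =
  ip (F u) (b *m gweing nu k F u *m 'J F u) (a *m 'J F u).
Proof.
move=> Uu; have e1 := D_normal_inner a b Uu; have e2 := D_normal_inner b a Uu.
rewrite (D_normal oO hnu ch a Uu) in e1; rewrite (D_normal oO hnu ch b Uu) in e2.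
rewrite e1 e2; have e3 := chart_D2_sym a b Uu; move: ('D_a ('D_b F) u) ('D_b ('D_a F) u) e3 => A B ->.
move: ('D_a F u) ('D_b F u) => v w; rewrite (dotC v w); congr (_ * (_ - _) - _).
by rewrite (mulrC (dot (F u) v)).
Qed.

End in_chart.
End umbilic.

(** If the square of [A ^+ j] vanishes, so does [A ^+ j]: the square length of [v *m A ^+ j] is the
    product of [v *m A ^+ j *m A ^+ j] with [v], and the form [I] is anisotropic. This lowers the
    exponent step by step. *)
Lemma nilpotent_selfadjoint (R : realType) n (A I : 'M[R]_n.+1) (k : nat) :
  I^T = I -> A *m I = I *m A^T ->
  (forall v : 'rV[R]_n.+1, (v *m I *m v^T) 0 0 = 0 -> v = 0) ->
  A ^+ k = 0 -> A = 0.
Proof.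
move=> sI sA dI; have sX j : A ^+ j *m I = I *m (A ^+ j)^T.
  elim: j => [|j IH]; first by rewrite !expr0 trmx1 mul1mx mulmx1.
  by rewrite {1}exprSr exprS -[A ^+ j * A]/(A ^+ j *m A) -[A * A ^+ j]/(A *m A ^+ j) trmx_mul
    -mulmxA sA !mulmxA IH.
have half j : A ^+ j *m A ^+ j = 0 -> A ^+ j = 0.
  move=> h; apply/row_matrixP => i; rewrite row0; apply: dI.
  rewrite rowE trmx_mul mulmxA -(mulmxA _ I) -sX mulmxA -(mulmxA (delta_mx 0 i)) h mulmx0.
  by rewrite !mul0mx mxE.
elim: k => [|[|k] IH].
- by rewrite expr0 => h; rewrite -[A]mulr1 h mulr0.
- by rewrite expr1.
- move=> h; apply: IH; apply: half; rewrite -[_ *m _]/(_ * _) -exprD.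
  by rewrite addSnnS addnC exprD h mul0r.
Qed.

(** By Cayley-Hamilton [A - h%:M] is nilpotent, and it is self-adjoint for the form [I]; no
    diagonalization is involved. *)
Lemma scalar_of_char_poly (R : realType) n (A I : 'M[R]_n) (h : R) :
  I^T = I -> A *m I = I *m A^T ->
  (forall v : 'rV[R]_n, (v *m I *m v^T) 0 0 = 0 -> v = 0) ->
  char_poly A = \prod_(i < n) ('X - h%:P) -> A = h%:M.
Proof.
case: n A I => [|n] A I sI sA dI hA; first by apply/matrixP => -[].
suff : A - h%:M = 0 by move/eqP; rewrite subr_eq0 => /eqP.
apply: (@nilpotent_selfadjoint _ _ _ I n.+1) => //.
  by rewrite mulmxBl linearB /= mulmxBr sA tr_scalar_mx scalar_mxC.
have := Cayley_Hamilton A; rewrite hA prodr_const card_ord rmorphXn rmorphB /=.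
by rewrite horner_mx_X horner_mx_C.
Qed.

Section conformal.
Context {R : realType} {m : nat}.
Local Notation P := 'rV[R]_m.

Lemma ball_segment (c u v : P) (r s : R) : `|u - c| < r -> `|v - c| < r -> 0 <= s <= 1 ->
  `|u + s *: (v - u) - c| < r.
Proof.
move=> hu hv /andP[s0 s1].
have -> : u + s *: (v - u) - c = (1 - s) *: (u - c) + s *: (v - c).
  by apply/rowP => i; rewrite !mxE; ring.
apply: (le_lt_trans (ler_normD _ _)); rewrite !normrZ !ger0_norm ?subr_ge0//.
have [->|sn0] := eqVneq s 0; first by rewrite subr0 mul1r mul0r addr0.
have sp : 0 < s by rewrite lt_neqAle eq_sym sn0.
have p0 : 0 < r - `|v - c| by rewrite subr_gt0.
have q0 : 0 <= r - `|u - c| by rewrite subr_ge0 ltW.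
have t0 : 0 <= 1 - s by rewrite subr_ge0.
have := mulr_gt0 sp p0; have := mulr_ge0 t0 q0; lra.
Qed.

Lemma ball_cst (G : P -> R) (c u v : P) (r : R) : `|u - c| < r -> `|v - c| < r ->
  (forall y : P, `|y - c| < r -> differentiable G y /\ 'D_(v - u) G y = 0) -> G u = G v.
Proof.
move=> hu hv hG; have [|s _] := @line_MVT _ _ G (fun=> 0) u (v - u) 1 ltr01.
  by move=> s s01; apply: hG; exact: ball_segment.
by rewrite mulr0 scale1r subrKC => /eqP; rewrite subr_eq0 => /eqP.
Qed.

(* The i-th component of g depends on the i-th coordinate only, so h depends on the
   i-th coordinate only, for every i. *)
Lemma conformal_factor_cst (g : P -> P) (h : P -> R) (c : P) (r : R) : (1 < m)%N ->
  (forall y : P, `|y - c| < r -> hasD g y (fun v : P => h y *: v)) ->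
  forall u v, `|u - c| < r -> `|v - c| < r -> h u = h v.
Proof.
move=> m1 hg.
have comp (i : 'I_m) (u v : P) : `|u - c| < r -> `|v - c| < r -> u 0 i = v 0 i -> g u 0 i = g v 0 i.
  move=> hu hv e; apply: (@ball_cst (fun y => g y 0 i) c u v r) => // y /hg hy.
  have [d ->] := hasD_rV_coord i hy; split=> //.
  by rewrite !mxE e subrr mulr0.
have fac (i : 'I_m) (u v : P) : `|u - c| < r -> `|v - c| < r -> u 0 i = v 0 i -> h u = h v.
  move=> hu hv e; pose E : P := delta_mx 0 i.
  have hD (w : P) : `|w - c| < r -> hasD (fun t : R => g (w + t *: E) 0 i) 0 (fun t : R => h w * t).
    move=> hw; have hw0 : hasD g (w + 0 *: E) (fun v : P => h w *: v) by rewrite scale0r addr0; exact: hg.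
    apply: hasD_eq (hasD_rV_coord i (hasD_comp (hasD_line w E 0) hw0)) _ => t.
    by rewrite !mxE !eqxx mulr1.
  have nw (w : P) : `|w - c| < r -> \forall t \near (0 : R), `|w + t *: E - c| < r.
    move=> hw; apply: (@near_dist _ _ P (fun t : R => w + t *: E)); last by rewrite scale0r addr0.
    exact: hasD_cont (hasD_line w E 0).
  have h0 : \forall t \near (0 : R), g (u + t *: E) 0 i - g (v + t *: E) 0 i = 0.
    apply: filterS (filterI (nw u hu) (nw v hv)) => t [hut hvt].
    by apply/eqP; rewrite subr_eq0; apply/eqP; apply: comp => //; rewrite !mxE e.
  have hB := hasD_B (hD u hu) (hD v hv).
  have hc := fun t : R => hasD_const t hB h0; have := hc 1; rewrite !mulr1.
  by move/eqP; rewrite subr_eq0 => /eqP.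
move=> u v hu hv; pose i : 'I_m := Ordinal (ltnW m1); pose j : 'I_m := Ordinal m1.
(* [w] shares one coordinate with [u] and another one with [v], and it stays in the ball because the
   norm is the maximum norm. *)
pose w : P := \row_l (if l == i then u 0 l else v 0 l).
have hw : `|w - c| < r.
  have r0 : 0 < r by exact: le_lt_trans hu.
  apply/rV_norm_ltP => // l; rewrite !mxE; case: ifP => _.
    by have := ler_coord_norm (u - c) l; rewrite !mxE => /le_lt_trans; exact.
  by have := ler_coord_norm (v - c) l; rewrite !mxE => /le_lt_trans; exact.
rewrite (fac i u w)//; last by rewrite mxE eqxx.
by rewrite (fac j w v)// mxE.
Qed.

End conformal.

Section umbilic_charts.
Context {R : realType} {n : nat}.
Local Notation V := 'rV[R]_n.+1.
Local Notation ip := (inner hyp_metric).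
Hypothesis n0 : (0 < n)%N.
Variable O : set V.
Hypothesis oO : open O.
Hypothesis sO : smooth_boundary O.
Variable nu : V -> V.
Hypothesis hnu : outward_unit_normal (n := n) hyp_metric O nu.
Variable kappa : V -> 'I_n -> R.
Hypothesis hkappa : principal_curvatures hyp_metric (boundary O) nu kappa.

Definition hmean p := mean_curvature kappa p / n%:R.

Section in_chart.
Variables (k : 'I_n.+1) (f : V -> R) (N : set V) (c : 'rV[R]_n) (r : R) (F : 'rV[R]_n -> V).
Hypothesis ch : chart O k f N c r F.
Local Notation U := [set u : 'rV[R]_n | `|u - c| < r].

Lemma umbilic_gweing u h : U u -> (forall i, kappa (F u) i = h) -> gweing nu k F u = h%:M.
Proof.
move=> Uu hk; have e (a b : 'rV[R]_n) :
    (a *m (gweing nu k F u *m first_form hyp_metric F u) *m b^T) 0 0 =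
    (b *m (gweing nu k F u *m first_form hyp_metric F u) *m a^T) 0 0.
  have := gweing_sym oO hnu ch a b Uu; rewrite -!first_formE => g.
  by rewrite (mulmxA a) (mulmxA b).
have sI : (first_form hyp_metric F u)^T = first_form hyp_metric F u.
  apply/matrixP => i j; rewrite mxE.
  have ent (A : 'M[R]_n) i' j' : A i' j' = ((delta_mx 0 i' : 'rV[R]_n) *m A *m (delta_mx 0 j' : 'rV[R]_n)^T) 0 0.
    by rewrite trmx_delta -rowE -colE !mxE.
  by rewrite ent [RHS]ent !first_formE innerC.
apply: (@scalar_of_char_poly _ _ _ (first_form hyp_metric F u)) => //.
- rewrite -[X in _ = X *m _]sI -trmx_mul; apply/matrixP => i j; rewrite [RHS]mxE.
  have ent (A : 'M[R]_n) i' j' : A i' j' = ((delta_mx 0 i' : 'rV[R]_n) *m A *m (delta_mx 0 j' : 'rV[R]_n)^T) 0 0.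
    by rewrite trmx_delta -rowE -colE !mxE.
  by rewrite ent [RHS]ent e.
- move=> v; rewrite first_formE => /inner_eq0 h0.
  by rewrite -(chart_del_J ch v Uu) h0; apply/rowP => i; rewrite !mxE.
- by rewrite (char_gweing oO hnu ch hkappa)//; apply: eq_bigr => i _; rewrite hk.
Qed.

Lemma hmean_gweing u : U u -> hmean (F u) = n%:R^-1 * \sum_i ('D_(delta_mx 0 i) (nu \o F) u) 0 (lift k i).
Proof.
move=> Uu; rewrite /hmean -(tr_gweing oO hnu ch hkappa)// mulrC; congr (_ * _).
by apply: eq_bigr => i _; rewrite !mxE.
Qed.

Lemma hasD_hmean u : U u -> hasD (fun y => hmean (F y)) u
  (fun v => n%:R^-1 * \sum_i ('D_v ('D_(delta_mx 0 i) (nu \o F)) u) 0 (lift k i)).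
Proof.
move=> Uu; have sN := chart_smooth_nu oO ch hnu.
have h : hasD (fun y : 'rV[R]_n => n%:R^-1 * \sum_i ('D_(delta_mx 0 i) (nu \o F) y) 0 (lift k i)) u
  (fun v => 0 * (\sum_i ('D_(delta_mx 0 i) (nu \o F) u) 0 (lift k i)) +
     n%:R^-1 * \sum_i ('D_v ('D_(delta_mx 0 i) (nu \o F)) u) 0 (lift k i)).
  apply: hasD_M; first exact: hasD_cst.
  apply: hasD_sum => i _; apply: hasD_rV_coord; apply: hasD_diff.
  exact: smooth_on_diff (smooth_on_derive _ sN) Uu.
apply: hasD_eq (hasD_near _ h) _ => [|v]; last by rewrite mul0r add0r.
by apply: filterS (chart_nearU Uu) => y Uy; rewrite hmean_gweing.
Qed.

Lemma umbilic_D_normal u (v : 'rV[R]_n) : U u -> (forall i, kappa (F u) i = hmean (F u)) ->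
  'D_v (nu \o F) u = hmean (F u) *: 'D_v F u.
Proof.
move=> Uu hk; rewrite (D_normal oO hnu ch)// (umbilic_gweing Uu hk) (D_chart ch)//.
by rewrite mul_mx_scalar scalemxAl.
Qed.

(** The Codazzi argument in coordinates: deleting the [k]-th coordinate of the normal gives a map
    between spaces of dimension [n] whose differential is [hmean] times the identity. *)
Lemma umbilic_hmean_cst : (1 < n)%N -> (forall u, U u -> forall i, kappa (F u) i = hmean (F u)) ->
  forall u v, U u -> U v -> hmean (F u) = hmean (F v).
Proof.
move=> n1 hk; apply: (@conformal_factor_cst _ _ (fun y => del k (nu (F y))) (fun y => hmean (F y)) c r n1).
move=> y Uy; have hN := hasD_diff (chart_diff_nu oO hnu ch Uy).
apply: hasD_eq (hasD_comp hN (hasD_del k _)) _ => v.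
rewrite (umbilic_D_normal v Uy (hk y Uy)) (D_chart ch)//.
by rewrite scalemxAl (chart_del_J ch).
Qed.

Lemma umbilic_center_cst : (forall u, U u -> forall i, kappa (F u) i = hmean (F u)) ->
  (forall u v, U u -> U v -> hmean (F u) = hmean (F v)) ->
  forall u v, U u -> U v -> hmean (F u) *: F u - nu (F u) = hmean (F v) *: F v - nu (F v).
Proof.
move=> hk hc u v Uu Uv; rewrite (hc v u)//; apply/rowP => j.
apply: (@ball_cst _ _ (fun y => (hmean (F u) *: F y - nu (F y)) 0 j) c u v r Uu Uv) => y Uy.
have hF := hasD_diff (chart_diff_F ch Uy); have hN := hasD_diff (chart_diff_nu oO hnu ch Uy).
have [d ->] := hasD_rV_coord j (hasD_B (hasD_Z (hasD_cst (hmean (F u)) y) hF) hN).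
by split=> //; rewrite (umbilic_D_normal _ Uy (hk y Uy)) (hc u y)// scale0r add0r subrr mxE.
Qed.

(** With X, N, Q the lifts of [F y], its normal and [q], and h the mean of the curvatures at [F y],
    this is [- <h X - N, Q - X>]. It is the limit of the contact inequality as [s] tends to
    [1 / (h - 1)], scaled by [h - 1]: nonnegative when [q] is not inside the tangent sphere of
    curvature h. *)
Definition support q y := hmean (F y) * (coshd q (F y) - 1) -
  (wt q * tcomp (F y) (nu (F y)) - dot q (nu (F y))).

Lemma support_self y : support (F y) y = 0.
Proof.
by rewrite /support coshdxx subrr mulr0 /tcomp mulrC divfK ?wt_neq0// subrr subr0.
Qed.

Lemma support_D q u (v : 'rV[R]_n) : U u -> (forall i, kappa (F u) i = hmean (F u)) ->
  differentiable (support q) u /\ 'D_v (support q) u = 'D_v (fun y => hmean (F y)) u * (coshd q (F u) - 1).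
Proof.
move=> Uu hk; have hF := hasD_diff (chart_diff_F ch Uu); have hN := hasD_diff (chart_diff_nu oO hnu ch Uu).
have hh := hasD_diff (hasD_hmean Uu).1.
have [d ->] := hasD_B (hasD_M hh (hasD_B (hasD_coshd q hF) (hasD_cst (1 : R) u)))
  (hasD_B (hasD_M (hasD_cst (wt q) u) (tcomp_normal_D oO hnu ch 0 Uu)) (hasD_dot (hasD_cst q u) hN)).
split=> //; rewrite (umbilic_D_normal v Uu hk) tcompZ dotZr dot0l /tcomp.
move: (dot (F u) _ / _) (dot q ('D_v F u)) (coshd _ _) ('D_v _ u) => a b e g; ring.
Qed.

Lemma contact_support p q : boundary O p -> boundary O q -> 0 < slope kappa p ->
  (forall s, 0 < s -> slope kappa p * s < 1 -> contact O nu s p) ->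
  0 <= hmean p * (coshd q p - 1) - (wt q * tcomp p (nu p) - dot q (nu p)).
Proof.
move=> Sp Sq; rewrite /slope -/(hmean p); set l := hmean p - 1 => l0 hc; rewrite leNgt; apply/negP.
set Vn := _ - dot q _ => neg.
have h s : 0 < s -> l * s < 1 -> 1 + s <= coshd q p + s * (coshd q p - Vn) by move=> s0 sl; exact: hc.
have V1 := coshd_ge1 q p; move: neg h V1; move: (coshd q p) => v neg h V1.
have hm : hmean p = l + 1 by rewrite /l subrK.
rewrite hm in neg; clear hm; clearbody l Vn.
pose a := v - 1; pose b := v - Vn - 1.
have nb : l * a + b < 0 by rewrite /a /b; lra.
have h' s : 0 < s -> l * s < 1 -> 0 <= a + s * b by move=> s0 sl; have := h s s0 sl; rewrite /a /b; lra.
have a0 : 0 <= a by rewrite /a subr_ge0.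
have la : 0 <= l * a by rewrite mulr_ge0// ltW.
have b0 : b < 0 by lra.
(* The midpoint between the zero [a / (- b)] of [a + s * b] and the end [1 / l] of the admissible
   range; it is admissible and the affine function is negative there. *)
pose s := (1 + l * a / (- b)) / 2 / l.
have nb0 : 0 < - b by lra.
have lab : l * a / (- b) < 1 by rewrite ltr_pdivrMr//; lra.
have lab0 : 0 <= l * a / (- b) by rewrite divr_ge0// ltW.
have ls : l * s = (1 + l * a / (- b)) / 2 by rewrite /s mulrC divfK// gt_eqF.
have s0 : 0 < s by rewrite /s !divr_gt0//; lra.
have := h' s s0; rewrite ls => h2; have {}h2 := h2 ltac:(lra); have : 0 <= l * a + l * s * b by rewrite -mulrA -mulrDr mulr_ge0// ltW.
have : l * a / (- b) * (- b) = l * a by rewrite divfK// gt_eqF.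
move: (l * a / - b) lab ls => w lab ls e; rewrite ls; nra.
Qed.

(* By contact, support q is nonnegative; it vanishes at the parameter of q, and its
   derivative is that of the mean curvature times coshd q - 1 > 0. *)
Lemma contact_hmean_D u (v : 'rV[R]_n) : U u ->
  (forall y, U y -> forall i, kappa (F y) i = hmean (F y)) ->
  (forall p, boundary O p -> 0 < slope kappa p) ->
  (forall p s, boundary O p -> 0 < s -> slope kappa p * s < 1 -> contact O nu s p) ->
  0 <= 'D_v (fun y => hmean (F y)) u.
Proof.
move=> Uu hk hs hc; rewrite leNgt; apply/negP => neg.
have v0 : v != 0.
  by apply/eqP => v0; move: neg; rewrite v0 (deriveE _ (hasD_hmean Uu).1) linear0 ltxx.
have cD : {for u, continuous (fun y : 'rV[R]_n => 'D_v (fun y => hmean (F y)) y)}.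
  have sN := chart_smooth_nu oO ch hnu.
  have h : hasD (fun y : 'rV[R]_n => n%:R^-1 * \sum_i ('D_v ('D_(delta_mx 0 i) (nu \o F)) y) 0 (lift k i)) u
    (fun w => 0 * (\sum_i ('D_v ('D_(delta_mx 0 i) (nu \o F)) u) 0 (lift k i)) +
     n%:R^-1 * \sum_i ('D_w ('D_v ('D_(delta_mx 0 i) (nu \o F))) u) 0 (lift k i)).
    apply: hasD_M; first exact: hasD_cst.
    apply: hasD_sum => i _; apply: hasD_rV_coord; apply: hasD_diff.
    exact: smooth_on_diff (smooth_on_derive _ (smooth_on_derive _ sN)) Uu.
  refine (cont_near _ (hasD_cont h)).
  by apply: filterS (chart_nearU Uu) => y Uy; rewrite (hasD_hmean Uy).2.
have n1 : \forall y \near u, 'D_v (fun y => hmean (F y)) y < 0 by exact: near_lt cD neg.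
have [d d0 hd] := near_norm (filterI n1 (chart_nearU Uu)).
pose t := d / 2 / `|v|.
have nv : 0 < `|v| by rewrite normr_gt0.
have t0 : 0 < t by rewrite !divr_gt0.
have near s : 0 <= s <= t -> `|u + s *: v - u| < d.
  move=> /andP[s0 st]; rewrite addrAC subrr add0r normrZ ger0_norm//.
  have : s * `|v| <= d / 2 by rewrite -ler_pdivlMr.
  by lra.
have [|s /andP[s0 st] E] := @line_MVT _ _ (support (F u)) (fun y => 'D_v (fun y => hmean (F y)) y * (coshd (F u) (F y) - 1)) u v t t0.
  by move=> s /near/hd[_ Us]; exact: support_D (hk _ Us).
have ss : 0 <= s <= t by rewrite !ltW.
have tt : 0 <= t <= t by rewrite lexx ltW.
have [neg' Us] := hd _ (near s ss); have [_ Ut] := hd _ (near t tt).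
have Sut := chart_S oO ch Ut.
have := @contact_support (F (u + t *: v)) (F u) Sut (chart_S oO ch Uu) (hs _ Sut) (fun s => hc _ s Sut).
rewrite -/(support (F u) (u + t *: v)); apply/negP; rewrite -ltNge.
rewrite support_self subr0 in E; rewrite E pmulr_rlt0// nmulr_rlt0//.
rewrite subr_gt0 lt_neqAle coshd_ge1 andbT eq_sym; apply/eqP => /coshd_eq1 /(congr1 (del k)).
rewrite !(chart_del ch)// => /eqP; rewrite addrC -subr_eq subrr eq_sym scaler_eq0 (negbTE v0) orbF.
by rewrite gt_eqF.
Qed.

End in_chart.
End umbilic_charts.

(** * Geodesic spheres *)

Section spheres.
Context {R : realType} {n : nat}.
Local Notation V := 'rV[R]_n.+1.
Local Notation ip := (inner hyp_metric).

(* The point whose lift to the hyperboloid is parallel to h X - N, where X and N are the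
   lifts of p and of the unit normal v: the centre of the sphere through p with normal v
   and curvature h > 1. *)
Definition center (h : R) (p v : V) : V := (Num.sqrt (h ^+ 2 - 1))^-1 *: (h *: p - v).

Section center.
Variables (h : R) (p v : V).
Hypothesis h1 : 1 < h.
Hypothesis pv : ip p v v = 1.
Local Notation g := (Num.sqrt (h ^+ 2 - 1)).
Local Notation c := (center h p v).

Lemma curv_gt0 : 0 < h ^+ 2 - 1.
Proof. by move: h1 => h1'; nra. Qed.

Lemma curv_sqr : g ^+ 2 = h ^+ 2 - 1.
Proof. by rewrite sqr_sqrtr// ltW// curv_gt0. Qed.

Lemma curv_sqrt_gt0 : 0 < g.
Proof. by rewrite sqrtr_gt0 curv_gt0. Qed.

Lemma wt_center : wt c = g^-1 * (h * wt p - tcomp p v).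
Proof.
have w0 := wt_gt0 p; have g0 := curv_sqrt_gt0.
set t := tcomp p v; have dt : dot p v = t * wt p by rewrite /t /tcomp divfK// gt_eqF.
have vv : dot v v = 1 + t ^+ 2 by move: pv; rewrite innerE_tcomp -/t => <-; ring.
have tw : t < wt p.
  rewrite ltNge; apply/negP => wt_t.
  have := dot_cauchy p v; rewrite dt vv dotxx; have := wt_ge1 p; nra.
have pos : 0 <= g^-1 * (h * wt p - t).
  by rewrite mulr_ge0 ?invr_ge0 ?ltW//; move: h1 => h1'; nra.
have gg : g^-1 * g^-1 * (h ^+ 2 - 1) = 1 by rewrite -invfM -expr2 curv_sqr mulVf// gt_eqF// curv_gt0.
rewrite [LHS]/wt (_ : 1 + _ = (g^-1 * (h * wt p - t)) ^+ 2) ?sqrtr_sqr ?ger0_norm//.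
rewrite /center !dotrw (dotC v p) dt vv dotxx -[X in X + _]gg.
by clearbody t; move: g^-1 (wt p) => a w; ring.
Qed.

Lemma coshd_center : coshd c p = h / g.
Proof.
have w0 := wt_neq0 p; rewrite /coshd wt_center /center !dotrw dotxx (dotC v p) /tcomp.
by field; rewrite w0 gt_eqF// curv_sqrt_gt0.
Qed.

Lemma center_D (a : V) : wt c * tcomp p a - dot c a = g^-1 * ip p v a.
Proof.
have w0 := wt_neq0 p; rewrite wt_center innerE_tcomp /center !dotrw /tcomp.
by field; rewrite w0 gt_eqF// curv_sqrt_gt0.
Qed.

Lemma radius_gt1 : 1 < h / g.
Proof.
rewrite ltr_pdivlMr ?curv_sqrt_gt0// mul1r; have := curv_sqr; have := curv_sqrt_gt0.
by move: h1 => h1'; nra.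
Qed.

Lemma radius_sqr : (h / g) ^+ 2 - 1 = g ^- 2.
Proof.
rewrite exprMn exprVn curv_sqr; have := curv_gt0; move: (h ^+ 2) => w w0.
by field; rewrite gt_eqF.
Qed.

Lemma normal_center : v = h *: p - g *: c.
Proof. by rewrite /center scalerA divff ?gt_eqF ?curv_sqrt_gt0// scale1r subKr. Qed.

End center.

(** First-order Taylor formula in the chart with exact remainder. The remainder is nonnegative, so
    [coshd c] lies above its tangents, and it vanishes only for [y = x]. *)
Lemma coshd_tangent (c x y : V) :
  coshd c y - coshd c x = wt c * tcomp x (y - x) - dot c (y - x) + wt c / wt x * (coshd x y - 1).
Proof.
have w0 := wt_neq0 x; rewrite /coshd /tcomp !dotrw dotxx; field; exact: w0.
Qed.

Lemma coshd_seg (c x y : V) (t : R) : 0 <= t <= 1 ->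
  coshd c (x + t *: (y - x)) <= coshd c x + t * (coshd c y - coshd c x).
Proof.
move=> /(wt_seg x y); have w0 := wt_gt0 c; rewrite /coshd !dotrw -(ler_pM2l w0).
move: (wt c) => w; lra.
Qed.

(* Polar coordinates about c: the point in the direction v on the sphere coshd c = m. *)
Definition polar (c : V) (m : R) (v : V) : V := m *: c + (Num.sqrt (m ^+ 2 - 1) / Num.sqrt (ip c v v)) *: v.

Lemma inner_gt0 (c v : V) : v != 0 -> 0 < ip c v v.
Proof.
by move=> v0; rewrite lt_neqAle inner_ge0 andbT eq_sym; apply: contra v0 => /eqP /inner_eq0 ->.
Qed.

Lemma coshd_polar (c v : V) m : 1 < m -> v != 0 -> coshd c (polar c m v) = m.
Proof.
move=> m1 v0; rewrite /polar; have q0 := inner_gt0 c v0.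
set s := _ / _; have m0 : 0 < m ^+ 2 - 1 by nra.
have s2 : s ^+ 2 * ip c v v = m ^+ 2 - 1.
  by rewrite /s exprMn exprVn !sqr_sqrtr ?divfK ?gt_eqF// ltW.
set t := tcomp c v; have w0 := wt_gt0 c.
have dt : dot c v = t * wt c by rewrite /t /tcomp divfK// gt_eqF.
have vv : dot v v = ip c v v + t ^+ 2 by rewrite innerE_tcomp -/t; ring.
have st : (s * t) ^+ 2 <= (m ^+ 2 - 1) * (wt c ^+ 2 - 1).
  have := dot_cauchy c v; rewrite dt vv dotxx -s2 => h.
  have : 0 <= s ^+ 2 * ((wt c ^+ 2 - 1) * (ip c v v + t ^+ 2) - (t * wt c) ^+ 2).
    by rewrite mulr_ge0 ?sqr_ge0 ?subr_ge0.
  by nra.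
have pos : 0 <= m * wt c + s * t.
  rewrite leNgt; apply/negP => neg; have w1 := wt_ge1 c; move: st neg w1 w0; move: (s * t) (wt c) => a w st neg w1 w0.
  have mw : 0 < m * w by rewrite mulr_gt0//; lra.
  have P1 : 0 < (- a - m * w) * (m * w - a) by rewrite mulr_gt0//; lra.
  by nra.
rewrite /coshd; have -> : wt (m *: c + s *: v) = m * wt c + s * t.
  rewrite [LHS]/wt (_ : 1 + _ = (m * wt c + s * t) ^+ 2) ?sqrtr_sqr ?ger0_norm//.
  rewrite !dotrw (dotC v c) dt vv dotxx; clearbody s t.
  transitivity (1 + m ^+ 2 * (wt c ^+ 2 - 1) + 2 * m * s * t * wt c + (s ^+ 2 * ip c v v + s ^+ 2 * t ^+ 2)).
    by ring.
  by rewrite s2; ring.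
by rewrite !dotrw dt dotxx; clearbody s t; ring.
Qed.

Lemma polarK (c x : V) m : 1 < m -> coshd c x = m -> x - m *: c != 0 /\ polar c m (x - m *: c) = x.
Proof.
move=> m1 hx; have m0 : 0 < m ^+ 2 - 1 by nra.
have E : ip c (x - m *: c) (x - m *: c) = m ^+ 2 - 1.
  have w0 := wt_neq0 c; rewrite innerE !dotrw (dotC x c) !dotxx.
  have -> : dot c x = wt c * wt x - m by rewrite -hx /coshd; ring.
  by field.
split; first by apply/eqP => h; move: E; rewrite h /inner mul0mx mul0mx mxE => e; rewrite -e ltxx in m0.
by rewrite /polar E divff ?scale1r ?subrKC// gt_eqF// sqrtr_gt0.
Qed.

Lemma cont_polar (c v : V) m : v != 0 -> {for v, continuous (polar c m)}.
Proof.
move=> v0; have cI : {for v, continuous (fun x : V => x)} by exact: cvg_id.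
have h : {for v, continuous (fun v : V => ip c v v)} by apply: cont_inner => //; exact: contC.
have q0 : Num.sqrt (ip c v v) != 0 by rewrite gt_eqF// sqrtr_gt0 inner_gt0.
apply: contD; first exact: contC.
apply: contZ; last exact: cI.
apply: contM; first exact: contC.
apply: contV => //; apply: (@continuous_comp _ _ _ (fun v : V => ip c v v) Num.sqrt) => //.
exact: sqrt_continuous.
Qed.

(** Connectedness of the space without the origin, which has dimension at least two. If the segment
    from [v0] to [v] meets the origin, a detour through a shifted point avoids it. *)
Lemma punctured_path (T : set V) (v0 v : V) : (0 < n)%N -> open T ->
  (forall x, boundary T x -> x = 0) -> T v0 -> v0 != 0 -> v != 0 -> T v.
Proof.
move=> n0 oT bT Tv v00 vn0.
have seg (a b : V) : T a -> (forall t : R, 0 <= t <= 1 -> a + t *: (b - a) != 0) -> T b.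
  move=> Ta hab; have := @path_in _ _ T (fun t => a + t *: (b - a)) 0 1 oT (@cont_line _ _ a (b - a)) ler01.
  rewrite scale0r addr0 scale1r subrKC; apply=> // t /hab ht /bT h; by rewrite h eqxx in ht.
have [h|] := pselect (forall t : R, 0 <= t <= 1 -> v0 + t *: (v - v0) != 0); first exact: seg h.
move=> /existsNP[t /not_implyP[/andP[t0 t1] /negP]]; rewrite negbK => /eqP e.
have [i vi] : exists i, v0 0 i != 0 by apply/rV0Pn.
(* Shifting [v0] in a coordinate [j] other than one where [v0] is nonzero leaves the line through
   [v0] and the origin, on which [v] lies. *)
have [j ji] : exists j : 'I_n.+1, j != i.
  case: n n0 i {vi} => // n' _ i; exists (if i == 0 then lift 0 0 else 0).
  by case: ifPn => [/eqP ->|]; rewrite eq_sym.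
pose w : V := v0 + delta_mx 0 j.
have Tw : T w.
  apply: seg Tv _ => s _; apply/eqP => /rowP/(_ i); rewrite !mxE eqxx (eq_sym i) (negbTE ji) /= addr0 subrr mulr0 addr0 => h.
  by rewrite h eqxx in vi.
apply: seg Tw _ => s /andP[s0 s1]; apply/eqP => h.
have hi := congr1 (fun M : V => M 0 i) h; have hj := congr1 (fun M : V => M 0 j) h.
have ei := congr1 (fun M : V => M 0 i) e; have ej := congr1 (fun M : V => M 0 j) e.
have tn0 : t != 0.
  by apply: contra v00 => /eqP tz; rewrite -e tz scale0r addr0.
have t1n : t != 1.
  by apply: contra vn0 => /eqP tz; rewrite -e tz scale1r subrKC.
move: hi hj ei ej; rewrite !mxE !eqxx (eq_sym i) (negbTE ji) /= => hi hj ei ej.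
have E1 : v 0 i * t = - (1 - t) * v0 0 i by lra.
have E2 : v 0 j * t = - (1 - t) * v0 0 j by lra.
have H1 : ((1 - s) * t - s * (1 - t)) * v0 0 i = 0.
  transitivity ((1 - s) * v0 0 i * t + s * (v 0 i * t)); first by rewrite E1; ring.
  by rewrite -[RHS](mul0r t) -[X in _ = X * t]hi; ring.
have H2 : ((1 - s) * t - s * (1 - t)) * v0 0 j + (1 - s) * t = 0.
  transitivity ((1 - s) * (v0 0 j + 1) * t + s * (v 0 j * t)); first by rewrite E2; ring.
  by rewrite -[RHS](mul0r t) -[X in _ = X * t]hj; ring.
move/eqP: H1; rewrite mulf_eq0 (negbTE vi) orbF => /eqP H1; rewrite H1 mul0r add0r in H2.
move/eqP: H2; rewrite mulf_eq0 (negbTE tn0) orbF => /eqP s1'.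
have := H1; rewrite s1' mul0r sub0r => /eqP; rewrite oppr_eq0 mulf_eq0.
have -> : s = 1 by lra.
by rewrite oner_eq0 /= subr_eq0 eq_sym (negbTE t1n).
Qed.

End spheres.

Section umbilic_sphere.
Context {R : realType} {n : nat}.
Local Notation V := 'rV[R]_n.+1.
Local Notation ip := (inner hyp_metric).
Hypothesis n0 : (0 < n)%N.
Variable O : set V.
Hypothesis oO : open O.
Hypothesis sO : smooth_boundary O.
Hypothesis cO : connected O.
Hypothesis bO : exists C, forall x y, O x -> O y -> riem_dist hyp_metric x y <= C.
Variable nu : V -> V.
Hypothesis hnu : outward_unit_normal (n := n) hyp_metric O nu.
Variable H : V -> R.
Hypothesis H1 : forall p, boundary O p -> 1 < H p.
Hypothesis Hcst : forall k f N c r F, chart (n := n) O k f N c r F -> forall u v : 'rV[R]_n, `|u - c| < r -> `|v - c| < r ->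
  H (F u) = H (F v) /\ H (F u) *: F u - nu (F u) = H (F v) *: F v - nu (F v).

Local Notation cen p := (center (H p) p (nu p)).
Local Notation rad p := (H p / Num.sqrt (H p ^+ 2 - 1)).

Lemma center_near p : boundary O p -> \forall q \near p, boundary O q -> H q = H p /\ cen q = cen p.
Proof.
move=> Sp; have [k [f [N [c [r [F [ch Np]]]]]]] := boundary_chart oO sO Sp.
have [Up Fp] := chart_F oO ch Np Sp.
have nN : \forall q \near p, N q by exact: open_nbhs_nbhs (conj (chart_open ch) Np).
apply: filterS nN => q Nq Sq; have [Uq Fq] := chart_F oO ch Nq Sq.
have := Hcst ch Uq Up; rewrite Fp Fq /center => -[-> e]; by rewrite e.
Qed.

Lemma center_slope p : boundary O p -> forall a : V,
  wt (cen p) * tcomp p a - dot (cen p) a = (Num.sqrt (H p ^+ 2 - 1))^-1 * ip p (nu p) a.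
Proof. by move=> Sp a; rewrite (center_D (H1 Sp) (normal_unit hnu Sp)). Qed.

Lemma coshd_cen p : boundary O p -> coshd (cen p) p = rad p.
Proof. by move=> Sp; rewrite (coshd_center (H1 Sp) (normal_unit hnu Sp)). Qed.

(** The [k]-th direction is transversal to the sphere at [p], and the boundary, a graph in that
    direction, consists near [p] of points of the sphere. A nearby point [x] of the sphere is
    compared with the boundary point [y] on the same line. *)
Lemma sphere_near p : boundary O p -> \forall x \near p, coshd (cen p) x = rad p -> boundary O x.
Proof.
move=> Sp; have [k [f [N [c [r [F [ch Np]]]]]]] := boundary_chart oO sO Sp.
have [Up Fp] := chart_F oO ch Np Sp.
pose E : V := delta_mx 0 k.
pose D (x : V) := wt (cen p) * tcomp x E - dot (cen p) E.
have D0 : D p != 0.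
  rewrite /D center_slope// mulf_neq0 ?invr_eq0//; first by rewrite gt_eqF// curv_sqrt_gt0// H1.
  apply/eqP => h; have := @tan_span _ _ _ oO _ hnu _ _ _ _ _ _ ch (del k p) E Up.
  rewrite Fp => /(_ h); rewrite (_ : del k E = 0) ?mul0mx; last first.
    by apply/rowP => i; rewrite !mxE eqxx /= eq_sym (negbTE (neq_lift _ _)).
  by move/rowP/(_ k); rewrite !mxE !eqxx => /eqP; rewrite oner_eq0.
have cD (x : V) : {for x, continuous D}.
  apply: contB; last exact: contC.
  apply: contM; first exact: contC.
  apply: contM; first by apply: cont_dot; [exact: cvg_id|exact: contC].
  apply: contV; [exact: wt_neq0|apply: cont_wt; exact: cvg_id].
have DD : 0 < D p * D p by rewrite -expr2 exprn_even_gt0.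
have n1 : \forall x \near p, 0 < D x * D p.
  by apply: (@near_gt _ _ (fun x : V => D x * D p)) => //; apply: contM; [exact: cD|exact: contC].
have cdel : {for p, continuous (del k : V -> 'rV[R]_n)} by exact: hasD_cont (hasD_del k p).
have n2 : \forall x \near p, `|del k x - c| < r by exact: near_dist cdel Up.
have n3 : \forall x \near p, 0 < D (F (del k x)) * D p.
  apply: (@near_gt _ _ (fun x : V => D (F (del k x)) * D p)); last by rewrite Fp.
  apply: contM; last exact: contC.
  apply: (@continuous_comp _ _ _ (fun x : V => F (del k x)) D); last exact: cD.
  by apply: continuous_comp => //; exact: cont_chart_F ch _ Up.
apply: filterS (filterI n1 (filterI n2 n3)) => x [d1 [Ux d2]] hx.
set y := F (del k x) in d2.
have Sy : boundary O y := chart_S oO ch Ux.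
have hy : coshd (cen p) y = rad p.
  have := Hcst ch Ux Up; rewrite Fp -/y => -[e1 e2].
  by have := coshd_cen Sy; rewrite /center e2 e1.
suff -> : x = y by [].
have exy : x - y = (x 0 k - y 0 k) *: E.
  apply/rowP => j; rewrite !mxE eqxx /=.
  have dy : del k y = del k x := chart_del ch Ux.
  case: (unliftP k j) => [i|] ->; rewrite ?eqxx ?mulr1//.
  rewrite eq_sym (negbTE (neq_lift _ _)) mulr0.
  by have := congr1 (fun M : 'rV[R]_n => M 0 i) dy; rewrite !mxE => ->; rewrite subrr.
set t := x 0 k - y 0 k in exy.
(* A function above its tangents with equal values at [x] and [y] cannot have slopes of the same
   sign at both, unless the points coincide. *)
have t1 := coshd_tangent (cen p) x y; have t2 := coshd_tangent (cen p) y x.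
rewrite hx hy subrr in t1 t2.
have eyx : y - x = (- t) *: E by rewrite -opprB exy scaleNr.
have P1 : 0 <= wt (cen p) / wt x * (coshd x y - 1).
  by rewrite mulr_ge0 ?subr_ge0 ?coshd_ge1// divr_ge0// ltW// wt_gt0.
have P2 : 0 <= wt (cen p) / wt y * (coshd y x - 1).
  by rewrite mulr_ge0 ?subr_ge0 ?coshd_ge1// divr_ge0// ltW// wt_gt0.
rewrite eyx tcompZ dotZr in t1; rewrite exy tcompZ dotZr in t2.
have Q1 : 0 <= t * D x by rewrite /D; lra.
have Q2 : t * D y <= 0 by rewrite /D; lra.
have t0 : t = 0.
  apply/eqP; rewrite eq_le; move: d1 d2 Q1 Q2; move: (D p) (D x) (D y) => e a b d1 d2 Q1 Q2.
  have [e0|e0|e0] := ltgtP e 0; last by move: d1; rewrite e0 mulr0 ltxx.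
    move: d1 d2; rewrite !(nmulr_lgt0 _ e0) => a0 b0.
    by move: Q1 Q2; rewrite (nmulr_lge0 _ a0) (nmulr_lle0 _ b0) => -> ->.
  move: d1 d2; rewrite !(pmulr_lgt0 _ e0) => a0 b0.
  by move: Q1 Q2; rewrite (pmulr_lge0 _ a0) (pmulr_lle0 _ b0) => -> ->.
by apply/eqP; rewrite -subr_eq0 exy t0 scale0r.
Qed.

(** An open and closed argument in the direction variable of [polar]: the directions whose point
    lies in the boundary with the curvature and centre of [p] form an open set with boundary in the
    origin. [punctured_path] then reaches every direction. *)
Lemma sphere_subset p : boundary O p ->
  forall x, coshd (cen p) x = rad p -> [/\ boundary O x, H x = H p & cen x = cen p].
Proof.
move=> Sp; set c := cen p; set m := rad p => x hx.
have m1 : 1 < m by exact: radius_gt1 (H1 Sp).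
pose S0 := [set q | [/\ boundary O q, H q = H p & cen q = c]].
pose T := [set v : V | v != 0 /\ S0 (polar c m v)].
have oT : open T.
  rewrite openE => v [v0 [Sq Hq Cq]]; set q := polar c m v in Sq Hq Cq.
  have n1 := sphere_near Sq; have n2 := center_near Sq.
  have cp := @cont_polar _ _ c v m v0.
  have n3 : \forall w \near v, w != 0.
    have v1 : `|v| != 0 by rewrite normr_eq0.
    have nv : 0 < `|v| by rewrite normr_gt0.
    apply: filterS (norm_near v nv) => w hw; apply/eqP => w0; move: hw.
    by rewrite w0 sub0r normrN ltxx.
  have n4 : \forall w \near v, (coshd (cen q) (polar c m w) = rad q -> boundary O (polar c m w)) /\
      (boundary O (polar c m w) -> H (polar c m w) = H q /\ cen (polar c m w) = cen q).
    exact: (cp _ (filterI n1 n2)).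
  apply: filterS (filterI n3 n4) => w [w0 [h1 h2]].
  have Sw : boundary O (polar c m w) by apply: h1; rewrite Cq Hq coshd_polar.
  have [e1 e2] := h2 Sw; split; first exact: w0.
  by split; [exact: Sw|rewrite e1; exact: Hq|rewrite e2; exact: Cq].
have bT v : boundary T v -> v = 0.
  move=> [clT]; rewrite (interior_id T).1// => nT.
  apply: contrapT => /eqP v0; apply: nT; split=> //.
  have cp := @cont_polar _ _ c v m v0.
  have Sq : boundary O (polar c m v).
    apply: closed_boundary => B nB.
    have nb : \forall w \near v, B (polar c m w) by apply: cp.
    by have [w [[w0 [Sw _ _]] Bw]] := clT _ nb; exists (polar c m w).
  have nb : \forall w \near v, boundary O (polar c m w) -> H (polar c m w) = H (polar c m v) /\ cen (polar c m w) = cen (polar c m v).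
    exact: (cp _ (center_near Sq)).
  have [w [[w0 [Sw e1 e2]] Bw]] := clT _ nb.
  by have [e3 e4] := Bw Sw; split; [exact: Sq|rewrite -e3; exact: e1|rewrite -e4; exact: e2].
have [v00 pv0] := polarK m1 (coshd_cen Sp); have [vn0 pv] := polarK m1 hx.
have T0 : T (p - m *: c) by split=> //; rewrite pv0.
by have [_] := punctured_path n0 oT bT T0 v00 vn0; rewrite pv.
Qed.

Lemma inner_side p : boundary O p -> exists2 x, O x & coshd (cen p) x < rad p.
Proof.
move=> Sp; have [k [f [N [c [r [F [ch Np]]]]]]] := boundary_chart oO sO Sp.
have dk := chart_diff ch Np.
have u1 := normal_unit hnu Sp.
have D1 : 'D_(- nu p) f p < 0.
  rewrite (normal_derive oO ch hnu)// innerNr u1 mulrN1 oppr_lt0 sqrtr_gt0.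
  exact: steep_gt0 ch _ Np.
have hc := hasD_coshd (cen p) (hasD_id p).
have D2 : 'D_(- nu p) (coshd (cen p)) p < 0.
  rewrite (hc.2 (- nu p)) -/(tcomp p (- nu p)) center_slope// innerNr u1 mulrN1 oppr_lt0.
  by rewrite invr_gt0 curv_sqrt_gt0// H1.
have [d d0 hd] := derive_neg (diff_derivable dk) D1.
have [d' d0' hd'] := derive_neg (diff_derivable hc.1) D2.
have cl := @cont_line _ _ p (- nu p).
have n1 : \forall t \near (0 : R), N (p + t *: - nu p).
  by apply: cl; rewrite scale0r addr0; exact: open_nbhs_nbhs (conj (chart_open ch) Np).
have [e e0 he] := near_norm n1.
pose t := Num.min (d / 2) (Num.min (d' / 2) (e / 2)).
have t0 : 0 < t by rewrite !lt_min !divr_gt0.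
have td : t < d by rewrite gt_min; apply/orP; left; lra.
have td' : t < d' by rewrite !gt_min; apply/orP; right; apply/orP; left; lra.
have te : t < e by rewrite !gt_min; apply/orP; right; apply/orP; right; lra.
exists (p + t *: - nu p).
  have Nt : N (p + t *: - nu p) by apply: he; rewrite subr0 gtr0_norm.
  apply: (chart_dom ch Nt).2; rewrite -(chart_f0 oO ch Np Sp); apply: hd.
  by rewrite t0.
by rewrite -(coshd_cen Sp); apply: hd'; rewrite t0.
Qed.

(** The sphere is contained in the boundary, so the connected set [O] misses it and stays on the
    side where [inner_side] finds a point. *)
Lemma sphere_encloses p : boundary O p -> forall x, O x -> coshd (cen p) x < rad p.
Proof.
move=> Sp; set c := cen p; set m := rad p.
have nS x : O x -> coshd c x != m.
  move=> Ox; apply/eqP => hx; have [Sx _ _] := sphere_subset Sp hx.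
  by have [_] := boundaryP oO Sx.
have [z Oz hz] := inner_side Sp.
have e : O `&` [set x | coshd c x < m] = O.
  apply: cO; first by exists z.
  - exists [set x | coshd c x < m] => //.
    by apply: (@open_comp _ _ (coshd c) [set y | y < m]); [move=> x _; exact: cont_coshd|exact: open_lt].
  - exists [set x | coshd c x <= m].
      by apply: (@closed_comp _ _ (coshd c) [set y | y <= m]); [move=> x _; exact: cont_coshd|exact: closed_le].
    apply/seteqP; split=> x [Ox /= hx]; split=> //=; first exact: ltW.
    by rewrite lt_neqAle nS.
by move=> x; rewrite -{1}e => -[].
Qed.

Lemma boundary_sublevel (c x : V) m : boundary [set y | coshd c y < m] x -> coshd c x = m.
Proof.
move=> [cl]; have oB : open [set y | coshd c y < m].
  by apply: (@open_comp _ _ (coshd c) [set y | y < m]); [move=> y _; exact: cont_coshd|exact: open_lt].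
rewrite (interior_id _).1// => /negP; rewrite -leNgt => h; apply/eqP; rewrite eq_le h andbT.
have cB : closed [set y | coshd c y <= m].
  by apply: (@closed_comp _ _ (coshd c) [set y | y <= m]); [move=> y _; exact: cont_coshd|exact: closed_le].
by apply: cB; apply: closure_subset cl => y /ltW.
Qed.

Lemma ray_exit (c z v : V) m : coshd c z < m -> v != 0 -> exists2 t, 0 < t & coshd c (z + t *: v) = m.
Proof.
move=> hz v0; have [K hK] := coshd_bounded c m.
pose b := (`|K| + `|z| + 1) / `|v|.
have nv : 0 < `|v| by rewrite normr_gt0.
have b0 : 0 <= b by rewrite divr_ge0// !addr_ge0.
have oB : open [set y | coshd c y < m].
  by apply: (@open_comp _ _ (coshd c) [set y | y < m]); [move=> y _; exact: cont_coshd|exact: open_lt].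
apply: contrapT => nt.
have := @path_in _ _ [set y | coshd c y < m] (fun t => z + t *: v) 0 b oB (@cont_line _ _ z v) b0.
rewrite scale0r addr0 => /(_ hz) h.
have {}h : coshd c (z + b *: v) < m.
  apply: h => t /andP[t0 _] /boundary_sublevel e; apply: nt; exists t => //.
  rewrite lt_neqAle t0 andbT; apply/eqP => t00; move: hz; rewrite -e -t00 scale0r addr0.
  by rewrite ltxx.
have := hK _ (ltW h); apply/negP; rewrite -ltNge.
have E : `|b *: v| = `|K| + `|z| + 1.
  by rewrite normrZ ger0_norm// /b divfK// gt_eqF.
have := ler_normB (z + b *: v) z; rewrite addrAC subrr add0r E => h1.
by have := ler_norm K; lra.
Qed.

(* If q were strictly inside the sphere of p, a ray tangent at q to the sphere of q
   would leave the sphere of p at a boundary point outside the sphere of q. *)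
Lemma boundary_on_sphere p q : boundary O p -> boundary O q -> coshd (cen p) q = rad p.
Proof.
move=> Sp Sq; set c := cen p; set m := rad p.
have le p' x : boundary O p' -> closure O x -> coshd (cen p') x <= rad p'.
  move=> Sp' cx.
  have cB : closed [set y | coshd (cen p') y <= rad p'].
    by apply: (@closed_comp _ _ (coshd (cen p')) [set y | y <= rad p']); [move=> y _; exact: cont_coshd|exact: closed_le].
  by apply: cB; apply: closure_subset cx => y /(sphere_encloses Sp') /ltW.
apply/eqP; rewrite eq_le le//=; last by case: Sq.
rewrite leNgt; apply/negP => lt.
pose E : V := delta_mx 0 0.
have [v v0 hv] : exists2 v : V, v != 0 & 0 <= wt (cen q) * tcomp q v - dot (cen q) v.
  have E0 : E != 0 by apply/eqP => /rowP/(_ 0); rewrite !mxE !eqxx => /eqP; rewrite oner_eq0.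
  have [h|h] := leP 0 (wt (cen q) * tcomp q E - dot (cen q) E); first by exists E.
  exists (- E); rewrite ?oppr_eq0// -scaleN1r tcompZ dotZr; lra.
have [t t0 ht] := ray_exit lt v0.
have [Sx _ _] := sphere_subset Sp ht.
have := le q _ Sq Sx.1; have := coshd_tangent (cen q) q (q + t *: v).
rewrite coshd_cen// (addrC q) addrK tcompZ dotZr (addrC _ q).
have P : 0 < wt (cen q) / wt q * (coshd q (q + t *: v) - 1).
  rewrite mulr_gt0 ?divr_gt0 ?wt_gt0// subr_gt0 lt_neqAle coshd_ge1 andbT eq_sym.
  apply/eqP => /coshd_eq1 /eqP; rewrite addrC -subr_eq subrr eq_sym scaler_eq0 (negbTE v0) orbF.
  by rewrite gt_eqF.
have := mulr_ge0 (ltW t0) hv; move: P; move: (_ / _ * _) => w P; lra.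
Qed.

Lemma umbilic_ball : exists c h, [/\ 1 < h,
  O = [set x | coshd c x < h / Num.sqrt (h ^+ 2 - 1)],
  forall p, boundary O p <-> coshd c p = h / Num.sqrt (h ^+ 2 - 1),
  forall p, boundary O p -> H p = h &
  forall p, boundary O p -> nu p = h *: p - Num.sqrt (h ^+ 2 - 1) *: c] \/ O = set0.
Proof.
have [[z Oz]|nO] := pselect (exists z, O z); last first.
  by exists 0, 0; right; apply/seteqP; split=> // z Oz; case: nO; exists z.
have [p Sp] := boundary_nonempty oO bO Oz.
exists (cen p), (H p); left; split; first exact: H1.
- apply/seteqP; split=> x; first exact: sphere_encloses.
  move=> /= hx; have := @path_in _ _ O (fun t => z + t *: (x - z)) 0 1 oO (@cont_line _ _ z (x - z)) ler01.
  rewrite scale0r addr0 scale1r subrKC => /(_ Oz); apply=> t t01 /(boundary_on_sphere Sp) e.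
  have := coshd_seg (cen p) z x t01; rewrite e leNgt => /negP; apply.
  have hz := sphere_encloses Sp Oz; move: hx hz t01.
  move: (coshd _ x) (coshd _ z) (rad p) => a b m hx hz /andP[t0 t1].
  have [->|tn0] := eqVneq t 0; first by rewrite mul0r addr0.
  have tp : 0 < t by rewrite lt_neqAle eq_sym tn0.
  have A1 : 0 < m - a by rewrite subr_gt0.
  have A2 : 0 <= m - b by rewrite subr_ge0 ltW.
  have t10 : 0 <= 1 - t by rewrite subr_ge0.
  by have := mulr_gt0 tp A1; have := mulr_ge0 t10 A2; lra.
- by move=> q; split=> [/(boundary_on_sphere Sp)//|/(sphere_subset Sp)[]].
- by move=> q Sq; have [_ -> _] := sphere_subset Sp (boundary_on_sphere Sp Sq).
- move=> q Sq; have [_ e1 e2] := sphere_subset Sp (boundary_on_sphere Sp Sq).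
  by rewrite {1}(normal_center q (nu q) (H1 Sq)) e2 e1.
Qed.

End umbilic_sphere.

(** * The flow of a geodesic ball and its inverse *)

Section ball_flow.
Context {R : realType} {n : nat}.
Local Notation V := 'rV[R]_n.+1.
Variables (nu : V -> V) (c : V) (h : R).
Hypothesis h1 : 1 < h.
Local Notation g := (Num.sqrt (h ^+ 2 - 1)).
Local Notation m := (h / g).

Lemma curv_div : g = (h ^+ 2 - 1) / g.
Proof.
have g0 := curv_sqrt_gt0 h1; rewrite -[X in _ = X / _](curv_sqr h1) expr2 mulfK// gt_eqF//.
Qed.

(* The ray from c through z meets the sphere coshd c = m at ball_proj z, and in
   Minkowski space z = ball_scale z *: ball_proj z modulo c. *)
Definition ball_scale (z : V) : R := g * Num.sqrt (coshd c z ^+ 2 - 1).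
Definition ball_proj (z : V) : V := m *: c + (ball_scale z)^-1 *: (z - coshd c z *: c).
(** Inverts the relation [ball_scale = 1 - s * (h - 1)], which holds along the flow
    ([ball_scale_flow]). *)
Definition ball_time (z : V) : R := (1 - ball_scale z) / (h - 1).

Lemma coshd_gt1 z : z != c -> 1 < coshd c z.
Proof.
move=> zc; rewrite lt_neqAle coshd_ge1 andbT eq_sym; apply: contra zc => /eqP/coshd_eq1 ->.
exact: eqxx.
Qed.

Lemma ball_disc_gt0 z : z != c -> 0 < coshd c z ^+ 2 - 1.
Proof. by move=> /coshd_gt1; move: (coshd c z) => y y1; nra. Qed.

Lemma ball_scale_gt0 z : z != c -> 0 < ball_scale z.
Proof. by move=> zc; rewrite mulr_gt0 ?(curv_sqrt_gt0 h1)// sqrtr_gt0 ball_disc_gt0. Qed.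

Lemma ball_scale_lt1 z : coshd c z < m -> ball_scale z < 1.
Proof.
move=> zm; have g0 := curv_sqrt_gt0 h1; have y1 := coshd_ge1 c z.
rewrite /ball_scale mulrC -ltr_pdivlMr// div1r.
rewrite -[ltRHS]ger0_norm ?invr_ge0 ?ltW// -sqrtr_sqr exprVn -(radius_sqr h1).
rewrite ltr_sqrt; move: zm y1; move: (coshd c z) m => y M zm y1; nra.
Qed.

Lemma inner_axis (z : V) : inner hyp_metric c (z - coshd c z *: c) (z - coshd c z *: c) = coshd c z ^+ 2 - 1.
Proof.
have w0 := wt_neq0 c; rewrite innerE !dotrw (dotC z c) !dotxx.
have -> : dot c z = wt c * wt z - coshd c z by rewrite /coshd; ring.
by move: w0; move: (wt c) => w w0; field.
Qed.

Lemma axis_neq0 z : z != c -> z - coshd c z *: c != 0.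
Proof.
move=> /ball_disc_gt0; rewrite -inner_axis => h0; apply/eqP => e; move: h0.
by rewrite e /inner mul0mx mul0mx mxE ltxx.
Qed.

Lemma ball_projE z : ball_proj z = polar c m (z - coshd c z *: c).
Proof.
have g0 := curv_sqrt_gt0 h1; rewrite /ball_proj /polar; congr (_ + _ *: _).
rewrite inner_axis (radius_sqr h1) -exprVn sqrtr_sqr ger0_norm ?invr_ge0 ?ltW//.
by rewrite /ball_scale invfM.
Qed.

Lemma coshd_ball_proj z : z != c -> coshd c (ball_proj z) = m.
Proof.
by move=> zc; rewrite ball_projE; apply: coshd_polar; [exact: radius_gt1|exact: axis_neq0].
Qed.

Section at_point.
Variables (p : V) (s : R).
Hypothesis hp : coshd c p = m.
Hypothesis hnu : nu p = h *: p - g *: c.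
Hypothesis s0 : 0 <= s.
Hypothesis u1 : inner hyp_metric p (nu p) (nu p) = 1.
Local Notation l := (1 - s * (h - 1)).

Lemma ball_height : height c nu p = (h - 1) / g.
Proof.
have g0 := curv_sqrt_gt0 h1; have w0 := wt_neq0 p.
have e : dot c p = wt c * wt p - m by rewrite -hp /coshd; ring.
rewrite /height hnu /tcomp !dotrw hp !dotxx (dotC p c) e.
have -> : h / g - (wt c * ((h * (wt p ^+ 2 - 1) - g * (wt c * wt p - h / g)) / wt p) - (h * (wt c * wt p - h / g) - g * (wt c ^+ 2 - 1)))
   = h / g - h ^+ 2 / g + g.
  field. by rewrite w0 gt_eqF.
by move: curv_div; move: (g^-1) => w; move: (g) => G ->; ring.
Qed.

Lemma ball_flow_disc : flow_eta c nu s p ^+ 2 - 2 * s = 1 + (l / g) ^+ 2.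
Proof.
have g0 := curv_sqrt_gt0 h1.
rewrite /flow_eta ball_height hp.
have gg : g ^+ 2 = h ^+ 2 - 1 by exact: curv_sqr.
have -> : 1 + (l / g) ^+ 2 = (g ^+ 2 + l ^+ 2) / g ^+ 2 by field; rewrite gt_eqF.
have -> : (h / g + s * ((h - 1) / g)) ^+ 2 - 2 * s = ((h + s * (h - 1)) ^+ 2 - 2 * s * g ^+ 2) / g ^+ 2 by field; rewrite gt_eqF.
by congr (_ / _); rewrite gg; ring.
Qed.

Lemma coshd_ball_flow : coshd c (flow c nu s p) = Num.sqrt (1 + (l / g) ^+ 2).
Proof. by rewrite coshd_flow// ball_flow_disc. Qed.

Lemma ball_flowE : flow c nu s p = l *: p + (Num.sqrt (1 + (l / g) ^+ 2) - l * m) *: c.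
Proof.
have g0 := curv_sqrt_gt0 h1.
rewrite /flow /flow_t ball_flow_disc /flow_eta ball_height hp hnu.
move: (Num.sqrt (1 + _)) => y; apply/rowP => j; rewrite !mxE.
move: curv_div; move: (g^-1) => w; move: (g) => G ->; ring.
Qed.

Lemma ball_scale_flow : 0 < l -> ball_scale (flow c nu s p) = l.
Proof.
move=> l0; have g0 := curv_sqrt_gt0 h1.
rewrite /ball_scale coshd_ball_flow sqr_sqrtr ?addr_ge0 ?sqr_ge0//.
rewrite (addrC 1) addrK sqrtr_sqr ger0_norm ?divr_ge0 ?(ltW l0) ?(ltW g0)//.
by rewrite mulrC divfK// gt_eqF.
Qed.

Lemma ball_proj_flow : 0 < l -> ball_proj (flow c nu s p) = p.
Proof.
move=> l0; rewrite /ball_proj ball_scale_flow// coshd_ball_flow ball_flowE.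
move: (Num.sqrt (1 + _)) m => y M; apply/rowP => j; rewrite !mxE; move: l l0 => a a0; field.
by rewrite gt_eqF.
Qed.

Lemma ball_time_flow : 0 < l -> ball_time (flow c nu s p) = s.
Proof. by move=> l0; rewrite /ball_time ball_scale_flow// subKr mulfK// subr_eq0 gt_eqF. Qed.

Lemma ball_flow_neq : 0 < l -> flow c nu s p != c.
Proof.
move=> l0; apply/eqP => e; have := coshd_ball_flow; rewrite e coshdxx => /esym/eqP.
have g0 := curv_sqrt_gt0 h1; have lg : 0 < (l / g) ^+ 2 by rewrite exprn_gt0// divr_gt0.
by rewrite -[X in _ == X]sqrtr1 eqr_sqrt ?addr_ge0 ?sqr_ge0// -subr_eq0 addrAC subrr add0r gt_eqF.
Qed.

Lemma coshd_flow_lt : 0 < s -> 0 < l -> coshd c (flow c nu s p) < m.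
Proof.
move=> s0' l0; have g0 := curv_sqrt_gt0 h1; rewrite coshd_ball_flow.
have m0 : 0 <= m by rewrite divr_ge0 ?(ltW g0)//; move: h1; lra.
rewrite -[ltRHS](ger0_norm m0) -sqrtr_sqr ltr_sqrt; last by rewrite exprn_gt0// divr_gt0//; move: h1; lra.
rewrite -[ltRHS](subrK 1) (radius_sqr h1) addrC ltrD2r exprMn exprVn.
rewrite gtr_pMl ?invr_gt0 ?exprn_gt0//.
have : 0 < s * (h - 1) by rewrite mulr_gt0// subr_gt0.
by move: l0; move: (s * (h - 1)) => a; nra.
Qed.

End at_point.

Lemma ball_flow_proj z : z != c -> coshd c z < m ->
  nu (ball_proj z) = h *: ball_proj z - g *: c ->
  inner hyp_metric (ball_proj z) (nu (ball_proj z)) (nu (ball_proj z)) = 1 ->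
  flow c nu (ball_time z) (ball_proj z) = z.
Proof.
move=> zc zm hnu u1; have g0 := curv_sqrt_gt0 h1; have l0 := ball_scale_gt0 zc.
have s0 : 0 <= ball_time z.
  by rewrite divr_ge0 ?subr_ge0 ?(ltW h1)// ltW// ball_scale_lt1.
rewrite (ball_flowE (ball_time z) (coshd_ball_proj zc) hnu).
have -> : 1 - ball_time z * (h - 1) = ball_scale z.
  by rewrite /ball_time divfK ?subKr// subr_eq0 gt_eqF.
have -> : Num.sqrt (1 + (ball_scale z / g) ^+ 2) = coshd c z.
  have -> : ball_scale z / g = Num.sqrt (coshd c z ^+ 2 - 1) by rewrite /ball_scale mulrC mulKf// gt_eqF.
  rewrite sqr_sqrtr ?ltW ?ball_disc_gt0// subrKC sqrtr_sqr ger0_norm//.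
  exact: le_trans (coshd_ge1 _ _).
rewrite /ball_proj; move: (ball_scale z) l0 (coshd c z) m => l l0 y M.
apply/rowP => j; rewrite !mxE; field; by rewrite gt_eqF.
Qed.

Lemma hasD_ball_scale z : z != c -> exists L, hasD ball_scale z L.
Proof.
move=> zc; have hy := hasD_coshd c (hasD_id z).
eexists; apply: hasD_M; first exact: hasD_cst.
apply: (@hasD_sqrt _ _ (fun z : V => coshd c z ^+ 2 - 1)); first exact: ball_disc_gt0.
by apply: hasD_B; [exact: (hasD_M hy hy)|exact: hasD_cst].
Qed.

Lemma hasD_ball_proj z : z != c -> exists L, hasD ball_proj z L.
Proof.
move=> zc; have [L hL] := hasD_ball_scale zc; have l0 := ball_scale_gt0 zc.
have hy := hasD_coshd c (hasD_id z).
eexists; apply: hasD_D; first exact: hasD_cst.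
apply: hasD_Z; first by apply: (@hasD_V _ _ ball_scale) hL; rewrite gt_eqF.
by apply: hasD_B; [exact: hasD_id|exact: hasD_Z hy (hasD_cst c z)].
Qed.

Lemma hasD_ball_time z : z != c -> exists L, hasD ball_time z L.
Proof.
move=> zc; have [L hL] := hasD_ball_scale zc.
by eexists; apply: hasD_M; [exact: hasD_B (hasD_cst (1 : R) z) hL|exact: hasD_cst].
Qed.

End ball_flow.

Section ball_measure.
Context {R : realType} {n : nat}.
Local Notation V := 'rV[R]_n.+1.
Local Notation ip := (inner hyp_metric).
Hypothesis n0 : (0 < n)%N.
Variable O : set V.
Hypothesis oO : open O.
Hypothesis sO : smooth_boundary O.
Hypothesis bO : exists C, forall x y, O x -> O y -> riem_dist hyp_metric x y <= C.
Variable nu : V -> V.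
Hypothesis hnu : outward_unit_normal (n := n) hyp_metric O nu.
Variable kappa : V -> 'I_n -> R.
Hypothesis hkappa : principal_curvatures hyp_metric (boundary O) nu kappa.
Hypothesis hH : forall p, boundary O p -> n%:R < mean_curvature kappa p.
Variable mu : {measure set (borel_rV R n.+1) -> \bar R}.
Hypothesis hmu : area_measure (n := n) hyp_metric (boundary O) mu.
Variables (c : V) (h : R).
Hypothesis h1 : 1 < h.
Local Notation g := (Num.sqrt (h ^+ 2 - 1)).
Local Notation m := (h / g).
Hypothesis ballO : O = [set x | coshd c x < m].
Hypothesis ballS : forall p, boundary O p <-> coshd c p = m.
Hypothesis kh : forall p i, boundary O p -> kappa p i = h.
Hypothesis nuh : forall p, boundary O p -> nu p = h *: p - g *: c.

Lemma ball_slope p : boundary O p -> slope kappa p = h - 1.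
Proof.
move=> Sp; rewrite /slope /mean_curvature (eq_bigr (fun=> h)) => [|i _]; last exact: kh.
by rewrite sumr_const card_ord -[h *+ n]mulr_natr mulfK// pnatr_eq0 -lt0n.
Qed.

Lemma ball_dens0 p : boundary O p -> dens0 nu kappa c p = (n.+1%:R * g)^-1.
Proof.
move=> Sp; rewrite /dens0 (ball_height h1 ((ballS p).1 Sp) (nuh Sp)) ball_slope//.
have g0 := curv_sqrt_gt0 h1; have l0 : h - 1 != 0 by rewrite subr_eq0 gt_eqF.
move: (g) g0 => G G0; have : n.+1%:R != 0 :> R by rewrite pnatr_eq0.
move: (n.+1%:R : R) => N N0; field.
by rewrite gt_eqF// N0 l0.
Qed.

(** The centre is left out: [ball_scale] vanishes there, and the direction towards the sphere is
    undefined. *)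
Let O' := [set z | O z /\ z != c].

Lemma open_punctured : open O'.
Proof.
have -> : O' = O `&` [set x | 1 < coshd c x].
  apply/seteqP; split=> z [Oz zc]; split=> //; first exact: coshd_gt1.
  by apply/eqP => e; move: zc; rewrite /= e coshdxx ltxx.
apply: openI => //; apply: (@open_comp _ _ (coshd c) [set y | 1 < y]); last exact: open_gt.
by move=> x _; exact: cont_coshd.
Qed.

(** The reciprocal of the constant value of the density on the sphere ([ball_dens0]). *)
Let M : R := n.+1%:R * g.

Let M0 : 0 < M.
Proof. by rewrite mulr_gt0// (curv_sqrt_gt0 h1). Qed.

Lemma ball_proj_S z : z != c -> boundary O (ball_proj c h z).
Proof. by move=> zc; apply/ballS; exact: coshd_ball_proj. Qed.

(** [area_le] for the inverse [Phi] of the flow, with the flow density as weight: the two Jacobians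
    cancel, and for equal curvatures the ramp equals the determinant exactly. Integrating the weight
    over [s] by [integral_ramp] leaves the area element, since the height and [M] cancel. *)
Lemma ball_area_local k f N c0 r F (ch : chart O k f N c0 r F) (G : set V) : open G -> G `<=` N ->
  (mu G <= \int[lebesgue_rV n.+1]_(z in O' `&` ball_proj c h @^-1` G) (M * vol_dens c z)%:E)%E.
Proof.
move=> oG GN; pose U := [set u : 'rV[R]_n | `|u - c0| < r].
pose W := O' `&` ball_proj c h @^-1` G.
have cproj z : O' z -> {for z, continuous (ball_proj c h)}.
  by move=> [_ zc]; have [L hL] := hasD_ball_proj h1 zc; exact: hasD_cont hL.
have oW : open W by apply: continuous_open_preimage => //; exact: open_punctured.
pose D := [set z : V | U (del 0 z)].
have oD : open D.
  rewrite openE => z Uz; exact: (hasD_cont (hasD_del 0 z)) (chart_nearU Uz).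
pose th := theta nu kappa c F.
have cth z : D z -> {for z, continuous (fun z => M * th z)}.
  by move=> Dz; apply: contM; [exact: contC|exact: (cont_theta n0 oO hnu hkappa ch)].
have th0 z : D z -> 0 <= M * th z by move=> Dz; rewrite mulr_ge0 ?(ltW M0)// (theta_ge0 oO hnu kappa c ch).
(* Extended by zero outside [D], as [area_le] asks for a weight on the whole space. *)
pose w := (fun z => M * th z) \_ D.
have wE z : D z -> w z = M * th z by move=> Dz; rewrite /w patchE mem_set.
have mD : measurable (D : set (borel_rV R n.+1)) by exact: measurable_open_rV.
have mw : @measurable_fun _ _ (borel_rV R n.+1) _ setT (EFin \o w).
  apply/measurable_EFinP; apply/(measurable_restrictT _ _).1; first exact: mD.
  by apply: measurable_fun_continuous_rV1; first exact: oD.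
have w0 z : 0 <= w z by rewrite /w patchE; case: ifPn => // /set_mem; exact: th0.
pose Phi (z : V) : V := ins 0 (del k (ball_proj c h z)) (ball_time c h z).
have dens_ge0 z : 0 <= M * vol_dens c z by rewrite mulr_ge0 ?(ltW M0)// -lee_fin; exact: vol_dens_ge0.
have cdens z : {for z, continuous (fun z => M * vol_dens c z)}.
  by apply: contM; [exact: contC|exact: cont_vol_dens].
have PhiD z : W z -> D (Phi z) /\ F (del 0 (Phi z)) = ball_proj c h z.
  move=> [[Oz zc] Gz]; rewrite /D /= /Phi del_ins.
  have [Uz Fz] := chart_F oO ch (GN _ Gz) (ball_proj_S zc); by split.
have PhiK z : W z -> flow_map nu F c (Phi z) = z.
  move=> Wz; have [_ e] := PhiD z Wz; have [[Oz zc] Gz] := Wz.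
  have Sz := ball_proj_S zc.
  rewrite /flow_map e /Phi ins_k; apply: ball_flow_proj => //; [|exact: nuh|exact: (normal_unit hnu Sz)].
  by move: Oz; rewrite ballO.
have Phit z : W z -> 0 < Phi z 0 0.
  move=> [[Oz zc] Gz]; rewrite /Phi ins_k divr_gt0 ?subr_gt0// ball_scale_lt1//.
  by move: Oz; rewrite ballO.
have hPhi z : W z -> exists L, hasD Phi z L.
  move=> [[Oz zc] Gz]; have [L1 hL1] := hasD_ball_proj h1 zc; have [L2 hL2] := hasD_ball_time h zc.
  by eexists; exact: hasD_ins (hasD_comp hL1 (hasD_del k _)) hL2.
have [] := @area_le _ _ W setT Phi w (fun z => M * vol_dens c z) oW.
- by move=> z _ [].
- exact: mw.
- exact: w0.
- move=> z Wz _; have [L hL] := hPhi z Wz; have [Dz Fz] := PhiD z Wz; split; first exact: hL.1.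
    apply: cont_near (cth _ Dz); have nD := open_nbhs_nbhs (conj oD Dz).
    by apply: filterS nD => y Dy; rewrite wE.
  have JJ : 'J Phi z *m 'J (flow_map nu F c) (Phi z) = 1%:M.
    have hflow := hasD_diff (flow_map_diff oO hnu ch c (Phit _ Wz) Dz).
    have hc := hasD_comp (hasD_diff hL.1) hflow.
    have nid : \forall y \near z, flow_map nu F c (Phi y) = y.
      by apply: filterS (open_nbhs_nbhs (conj oW Wz)) => y; exact: PhiK.
    have hid := hasD_near nid hc.
    apply/row_matrixP => i; rewrite !rowE mulmx1 mulmxA.
    have E1 : 'D_(delta_mx 0 i) Phi z = delta_mx 0 i *m 'J Phi z := deriveEjacobian (delta_mx 0 i) hL.1.
    have E2 := deriveEjacobian (delta_mx 0 i *m 'J Phi z) hflow.1.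
    have E3 := hid.2 (delta_mx 0 i); rewrite (hasD_id z).2 E1 in E3.
    by rewrite -E2 -E3.
  have dd : `|\det ('J Phi z)| * `|\det ('J (flow_map nu F c) (Phi z))| = 1.
    by rewrite -normrM -det_mulmx JJ det1 normr1.
  have FD := flow_map_det oO hnu ch c (Phit _ Wz) Dz n0.
  rewrite PhiK// in FD.
  rewrite wE// -mulrA ler_pM2l//.
  have -> : th (Phi z) = `|\det ('J (flow_map nu F c) (Phi z))| * vol_dens c z.
    rewrite /vol_dens FD /th /theta /area mulrC; congr (_ * _).
    rewrite (det_gweing oO hnu ch hkappa)// Fz.
    have Sz := ball_proj_S Wz.1.2.
    have l0 : 0 <= 1 - (h - 1) * Phi z 0 0.
      have := ball_scale_gt0 h1 Wz.1.2; rewrite /Phi ins_k /ball_time mulrC divfK ?subKr; first exact: ltW.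
      by rewrite subr_eq0 gt_eqF.
    rewrite /ramp ball_slope// max_r//.
    rewrite (eq_bigr (fun=> 1 - (h - 1) * Phi z 0 0)) => [|i _]; last by rewrite kh//; ring.
    by rewrite prodr_const card_ord ger0_norm// exprn_ge0.
  by rewrite mulrAC (mulrC `|_|) dd mul1r.
- by move=> z _; split; [exact: dens_ge0|exact: cdens].
move=> B [mB hB leB]; apply: le_trans leB.
pose D' := [set z : V | [/\ 0 < z 0 0, U (del 0 z) & G (F (del 0 z))]].
have cFd (z : V) : U (del 0 z) -> {for z, continuous (fun z : V => F (del 0 z))}.
  by move=> Uz; apply: (@cont_del0 _ _ z _ F); exact: cont_chart_F ch _ Uz.
have oD' : open D'.
  rewrite openE => z [z0 Uz Gz].
  have n1 : \forall y \near z, 0 < (y : V) 0 0 by apply: near_gt z0; exact: cont_coord0.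
  have n2 : \forall y \near z, D y by exact: open_nbhs_nbhs (conj oD Uz).
  have n3 : \forall y \near z, G (F (del 0 y)) by exact: cFd _ Uz _ (open_nbhs_nbhs (conj oG Gz)).
  by apply: filterS (filterI n1 (filterI n2 n3)) => y [? [? ?]]; split.
have mD' : measurable (D' : set (borel_rV R n.+1)) by exact: measurable_open_rV.
pose T : V -> \bar R := (EFin \o (fun z => M * th z)) \_ D'.
have mT : @measurable_fun _ _ (borel_rV R n.+1) _ setT T.
  apply/(measurable_restrictT _ _).1; first exact: mD'.
  apply/measurable_EFinP; apply: measurable_fun_continuous_rV1; first exact: oD'.
  by move=> z [_ Uz _]; exact: cth.
have T0 z : (0 <= T z)%E.
  by rewrite /T patchE; case: ifPn => // /set_mem[_ Uz _]; rewrite lee_fin th0.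
have leT : (\int[lebesgue_rV n.+1]_z T z <= \int[lebesgue_rV n.+1]_(z in B) (w z)%:E)%E.
  rewrite [leRHS]integral_mkcond; apply: ge0_le_integral.
  - exact: measurableT.
  - by move=> z _; exact: T0.
  - exact: mT.
  - apply/(measurable_restrictT _ _).1; first exact: mB.
    by apply: (measurable_funS measurableT) mw.
  move=> z _; rewrite /T !patchE; case: ifPn => [/set_mem[z0 Uz Gz]|_]; last first.
    by case: ifP => // _; rewrite lee_fin.
  have Sp := chart_S oO ch Uz; set p := F (del 0 z) in Gz Sp.
  have u1 := normal_unit hnu Sp.
  have hp := (ballS p).1 Sp; have hn := nuh Sp.
  (* Parameters with [s * (h - 1) >= 1] are not reached by [Phi], but the ramp vanishes there. *)
  have [l0|l0] := ltP 0 (1 - z 0 0 * (h - 1)); last first.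
    have tz : th z = 0.
      rewrite /th /theta /ramp ball_slope// max_l; first by rewrite expr0n eqn0Ngt n0 mulr0.
      by rewrite mulrC.
    by rewrite /= tz mulr0; case: ifP => // _; rewrite lee_fin.
  have Bz : z \in B.
    apply: mem_set; set q := flow c nu (z 0 0) p.
    have Wq : W q.
      split; last by rewrite /= (ball_proj_flow h1 hp hn (ltW z0) u1 l0).
      split; last exact: (ball_flow_neq h1 hp hn (ltW z0) u1 l0).
      by rewrite ballO; exact: (coshd_flow_lt h1 hp hn (ltW z0) u1 z0 l0).
    have := hB q Wq I; rewrite /Phi /q (ball_proj_flow h1 hp hn (ltW z0) u1 l0).
    rewrite (ball_time_flow h1 hp hn (ltW z0) u1 l0).
    by rewrite /p (chart_del ch Uz) ins_del.
  by rewrite Bz wE// lexx.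
apply: le_trans leT; rewrite (integral_cons mT T0).
have muG : mu G = mu (G `&` boundary O).
  have mG : measurable (G : set (borel_rV R n.+1)) by exact: measurable_open_rV.
  have mS := @measurable_boundary R n O.
  rewrite -[in LHS](setIT G) -(setUv (boundary O)) setIUr measureU//.
  - apply: etrans (adde0 _); congr (_ + _)%E.
    apply/eqP; rewrite eq_le measure_ge0 andbT -hmu.1.
    by apply: le_measure; rewrite ?inE//; [apply: measurableI => //|]; exact: measurableC.
  - exact: measurableI.
  - by apply: measurableI => //; exact: measurableC.
  - by rewrite setIACA setICr setI0.
have mGS : measurable (G `&` boundary O : set (borel_rV R n.+1)).
  by apply: measurableI; [exact: measurable_open_rV|exact: measurable_boundary].
rewrite muG (hmu.2 _ _ (chart_local_param oO ch))//; last first.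
  by move=> x [/GN Nx Sx]; have [Ux Fx] := chart_F oO ch Nx Sx; exists (del k x).
have mU : measurable (U : set (borel_rV R n)) by apply: measurable_open_rV; exact: chart_U_open.
have oUG : open (U `&` F @^-1` G).
  by apply: continuous_open_preimage => //; [exact: chart_U_open|exact: cont_chart_F ch].
have -> : U `&` F @^-1` (G `&` boundary O) = U `&` F @^-1` G.
  by apply/seteqP; split=> u [Uu]; [case|move=> Gu; split=> //; split=> //; exact: (chart_S oO ch)].
have mTc : measurable_fun setT (fun x => T (@cons_rV R n x)) by exact: measurableT_comp mT (@measurable_cons_rV R n).
have dc s (u : 'rV[R]_n) : del 0 (cons_rV (s : measurableTypeR R, u : borel_rV R n)) = u.
  by apply/rowP => i; rewrite mxE cons_rV_lift.
have sc s (u : 'rV[R]_n) : (cons_rV (s : measurableTypeR R, u : borel_rV R n) : V) 0 0 = s by rewrite cons_rV0.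
rewrite [leLHS]integral_mkcond; apply: ge0_le_integral.
- exact: measurableT.
- by move=> u _; rewrite patchE; case: ifP => // _; rewrite lee_fin sqrtr_ge0.
- apply/(measurable_restrictT _ _).1; first exact: measurable_open_rV.
  apply/measurable_EFinP; apply: measurable_fun_continuous_rV1; first exact: oUG.
  by move=> u [Uu _]; exact: (cont_area ch).
- by have := measurable_fun_fubini_tonelli_G (m1 := @lebesgue_measure R) _ mTc; apply.
move=> u _; rewrite patchE; case: ifPn => [/set_mem[Uu Gu]|_]; last by apply: integral_ge0.
have Su := chart_S oO ch Uu; have g0 := curv_sqrt_gt0 h1; have l0 : 0 < h - 1 by rewrite subr_gt0.
have -> : (\int[lebesgue_measure]_s T (cons_rV (s, u)))%E =
    (\int[lebesgue_measure]_(s in `]0%R, +oo[) ((M * (height c nu (F u) * area F u))%:E * (ramp kappa s (F u))%:E))%E.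
  rewrite [RHS]integral_mkcond; apply: eq_integral => s _; rewrite /T !patchE.
  have -> : (cons_rV (s, u) \in D') = (s \in `]0%R, +oo[%classic).
    apply/idP/idP => /set_mem.
      by move=> [z0 _ _]; apply: mem_set; move: z0; rewrite sc /= in_itv /= andbT.
    by rewrite /= in_itv /= andbT => s0; apply: mem_set; split; rewrite ?sc ?dc.
  by case: ifP => // _; rewrite /= -EFinM /th /theta sc dc mulrA.
rewrite ge0_integralZl//; last 3 first.
- exact: measurable_ramp.
- by move=> s _; rewrite lee_fin exprn_ge0// le_max lexx.
- by rewrite lee_fin !mulr_ge0 ?(ltW M0)// ?sqrtr_ge0// ltW// (chart_height_gt0 oO hnu ch c Uu).
rewrite /ramp integral_ramp ?(slope_gt0 n0 hH)// -EFinM lee_fin ball_slope//.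
rewrite (ball_height h1 ((ballS _).1 Su) (nuh Su)) /M -/(area F u).
have -> : n.+1%:R * g * ((h - 1) / g * area F u) / (n.+1%:R * (h - 1)) = area F u; last exact: lexx.
have : n.+1%:R != 0 :> R by rewrite pnatr_eq0.
move: (n.+1%:R : R) (area F u) (g) g0 => N1 a G1 g0 N0; move: h1 => h1'; field.
by rewrite N0 (gt_eqF g0) subr_eq0 (gt_eqF h1').
Qed.

(** The local bounds compare [mu] with [nu'], the pushforward of [M] times V dvol under [ball_proj].
    Gluing them with the identity relation bounds the total area, and on the sphere [dens0] is the
    constant [M^-1]. *)
Lemma ball_area_le : (\int[mu]_(p in boundary O) (dens0 nu kappa c p)%:E <=
  \int[lebesgue_rV n.+1]_(z in O) (vol_dens c z)%:E)%E.
Proof.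
have g0 := curv_sqrt_gt0 h1.
have oP := open_punctured.
have mO : measurable (O : set (borel_rV R n.+1)) by exact: measurable_open_rV.
have mO' : measurable (O' : set (borel_rV R n.+1)) by exact: measurable_open_rV.
have mvd : @measurable_fun _ _ (borel_rV R n.+1) _ setT (vol_dens c).
  by apply: measurable_fun_continuous_rV1; [exact: openT|move=> y _; exact: cont_vol_dens].
pose proj (z : V) : V := \row_j ((fun z => ball_proj c h z 0 j) \_ O') z.
have mproj : @measurable_fun _ _ (borel_rV R n.+1) (borel_rV R n.+1) setT proj.
  apply: measurable_rVP => j; rewrite (_ : (fun _ => _) = (fun z => ball_proj c h z 0 j) \_ O'); last by apply/funext => u; rewrite mxE.
  apply/(measurable_restrictT _ _).1; first exact: mO'.
  apply: measurable_fun_continuous_rV1; first exact: oP.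
  move=> z [_ zc]; apply: continuous_coordP; have [L hL] := hasD_ball_proj h1 zc; exact: hasD_cont hL.
have projE z : O' z -> proj z = ball_proj c h z.
  by move=> Oz; apply/rowP => j; rewrite mxE patchE mem_set.
pose p := (fun z => M * vol_dens c z) \_ O'.
have mp : @measurable_fun _ _ (borel_rV R n.+1) _ setT (EFin \o p).
  apply/measurable_EFinP; apply/(measurable_restrictT _ _).1; first exact: mO'.
  by apply: measurable_funM; [exact: measurable_cst|exact: (measurable_funS measurableT)].
have p0 z : (0 <= (EFin \o p) z)%E.
  by rewrite lee_fin /p patchE; case: ifP => // _; rewrite mulr_ge0 ?(ltW M0)// -lee_fin; exact: vol_dens_ge0.
pose m1 := density (lebesgue_rV n.+1) mp p0.
pose nuf : {measure set (borel_rV R n.+1) -> \bar R} := pushforward m1 (proj : borel_rV R n.+1 -> borel_rV R n.+1).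
pose nu' := nuf mproj.
have nuE (G : set V) : nu' G = (\int[lebesgue_rV n.+1]_(z in O' `&` ball_proj c h @^-1` G) (M * vol_dens c z)%:E)%E.
  rewrite /nu' /= /pushforward /m1 /density [LHS]integral_mkcond [RHS]integral_mkcond.
  apply: eq_integral => z _; rewrite !patchE; have [Oz|nO] := pselect (O' z).
    have -> : (z \in O' `&` ball_proj c h @^-1` G) = (z \in proj @^-1` G).
      by apply/idP/idP => /set_mem h'; apply: mem_set; [rewrite /= projE//; exact: h'.2|split=> //; rewrite /= -projE].
    by case: ifP => // _; rewrite /= /p patchE mem_set.
  rewrite [in RHS]memNset; last by case.
  by case: ifP => // _; rewrite /= /p patchE memNset.
have nuT : (nu' setT <= M%:E * \int[lebesgue_rV n.+1]_(z in O) (vol_dens c z)%:E)%E.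
  rewrite nuE preimage_setT setIT -ge0_integralZl; first last.
  - by rewrite lee_fin ltW.
  - by move=> z _; exact: vol_dens_ge0.
  - by apply/measurable_EFinP; exact: (measurable_funS measurableT).
  - exact: mO.
  apply: ge0_subset_integral.
  - exact: mO'.
  - exact: mO.
  - by apply/measurable_EFinP; apply: measurable_funM; [exact: measurable_cst|exact: (measurable_funS measurableT)].
  - by move=> z _; rewrite lee_fin mulr_ge0 ?(ltW M0)// -lee_fin; exact: vol_dens_ge0.
  - by move=> z [].
have fin := volume_fin oO bO c.
have nufin : (nu' setT < +oo)%E.
  by apply: le_lt_trans nuT _; apply: lte_mul_pinfty => //; rewrite lee_fin ltW.
have loc (x : V) : exists N : set V, [/\ open N, N x &
    forall G, open G -> G `<=` N -> exists B, [/\ @measurable _ (borel_rV R n.+1) B, forall y, G y -> [set y] `<=` B & (mu B <= nu' G)%E]].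
  have [Sx|nS] := pselect (boundary O x); last first.
    exists (~` boundary O); split => //; first by apply: closed_openC; exact: closed_boundary.
    move=> G oG GS; exists G; split.
    - exact: measurable_open_rV.
    - by move=> y Gy _ ->.
    - have -> : mu G = 0%E; last exact: measure_ge0.
      apply/eqP; rewrite eq_le measure_ge0 andbT -hmu.1.
      apply: le_measure; rewrite ?inE//; first exact: measurable_open_rV.
      by apply: measurableC; exact: measurable_boundary.
  have [k [f [N [c0 [r [F [ch Nx]]]]]]] := boundary_chart oO sO Sx.
  exists N; split; [exact: (chart_open ch)|exact: Nx|].
  move=> G oG GN; exists G; split.
  - exact: measurable_open_rV.
  - by move=> y Gy _ ->.
  - by rewrite nuE; exact: ball_area_local ch G oG GN.
have muS : (mu (boundary O) <= M%:E * \int[lebesgue_rV n.+1]_(z in O) (vol_dens c z)%:E)%E.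
  have Oc : O c by rewrite ballO /= coshdxx; exact: radius_gt1.
  have [K hK] := closure_bounded bO Oc.
  pose L := `|K| + 1; have L0 : 0 < L by rewrite ltr_wpDl.
  have L20 : 0 < L *+ 2 by rewrite mulrn_wgt0.
  have SQ : boundary O `<=` hcube (const_mx (- L) : V) (L *+ 2).
    move=> x [cx _] i; rewrite mxE; have := le_trans (ler_coord_norm x i) (hK _ cx).
    by rewrite ler_norml /L => /andP[b1 b2]; have := ler_norm K; rewrite mulr2n; lra.
  have [B [mB hB leB]] := globalize (const_mx (- L) : V) nufin L20 loc.
  apply: (@le_trans _ _ (mu B)).
    apply: le_measure; rewrite ?inE//; first exact: measurable_boundary.
    by move=> x /SQ Qx; exact: hB Qx _ erefl.
  apply: (le_trans leB); apply: le_trans nuT; apply: le_measure; rewrite ?inE//.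
  exact: measurable_hcube.
have -> : (\int[mu]_(p in boundary O) (dens0 nu kappa c p)%:E = (M^-1)%:E * mu (boundary O))%E.
  rewrite -integral_cst; last exact: measurable_boundary.
  by apply: eq_integral => q /set_mem Sq; rewrite ball_dens0.
rewrite -(@lee_pmul2l _ M%:E)// ?lte_fin// muleA -EFinM divff ?gt_eqF// mul1e.
exact: muS.
Qed.

End ball_measure.

(** * Moving the base point by reflection *)

Section ball_equality.
Context {R : realType} {n : nat}.
Local Notation V := 'rV[R]_n.+1.
Local Notation ip := (inner hyp_metric).

(* The geodesic reflection of o through c: the lifts satisfy O + O' = 2 coshd(c, o) C. *)
Definition reflect_pt (c o : V) : V := (2 * coshd c o) *: c - o.

Lemma wt_reflect (c o : V) : wt (reflect_pt c o) = 2 * coshd c o * wt c - wt o.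
Proof.
set k := coshd c o; have e : dot c o = wt c * wt o - k by rewrite /k /coshd; ring.
have w1 := wt_ge1 c; have w0 := wt_gt0 o.
have pos : 0 <= 2 * k * wt c - wt o.
  rewrite leNgt; apply/negP => neg; have := dot_cauchy c o; rewrite !dotxx.
  move: e neg w1 w0; move: (dot c o) (wt c) (wt o) => a w v e neg w1 v0.
  have A1 : v * (2 * w ^+ 2 - 1) < 2 * w * a by rewrite e; nra.
  have A0 : 0 < v * (2 * w ^+ 2 - 1) by rewrite mulr_gt0//; nra.
  have A2 : (v * (2 * w ^+ 2 - 1)) ^+ 2 < (2 * w * a) ^+ 2.
    by rewrite ltr_pXn2r ?nnegrE ?(ltW A0)// ltW// (lt_trans A0).
  move=> cs; have A3 : (2 * w * a) ^+ 2 <= 4 * w ^+ 2 * ((w ^+ 2 - 1) * (v ^+ 2 - 1)).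
    have -> : (2 * w * a) ^+ 2 = 4 * w ^+ 2 * a ^+ 2 by ring.
    by rewrite ler_wpM2l// mulr_ge0// sqr_ge0.
  have A4 : 0 <= w ^+ 2 * (w ^+ 2 - 1) by rewrite mulr_ge0 ?sqr_ge0//; nra.
  have := sqr_ge0 v; nra.
rewrite /wt (_ : 1 + _ = (2 * k * wt c - wt o) ^+ 2) ?sqrtr_sqr ?ger0_norm//.
by rewrite /reflect_pt -/k !dotrw (dotC o c) e !dotxx; ring.
Qed.

Lemma coshd_reflect (c o z : V) : coshd o z + coshd (reflect_pt c o) z = 2 * coshd c o * coshd c z.
Proof. by rewrite {1 2}/coshd wt_reflect /reflect_pt !dotrw /coshd; ring. Qed.

Lemma height_reflect (nu : V -> V) (c o p : V) :
  height o nu p + height (reflect_pt c o) nu p = 2 * coshd c o * height c nu p.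
Proof.
rewrite /height (_ : _ + _ = (coshd o p + coshd (reflect_pt c o) p) -
  ((wt o + wt (reflect_pt c o)) * tcomp p (nu p) - (dot o (nu p) + dot (reflect_pt c o) (nu p)))); last by ring.
by rewrite coshd_reflect wt_reflect /reflect_pt !dotrw; ring.
Qed.

Hypothesis n0 : (0 < n)%N.
Variable O : set V.
Hypothesis oO : open O.
Hypothesis sO : smooth_boundary O.
Hypothesis bO : exists C, forall x y, O x -> O y -> riem_dist hyp_metric x y <= C.
Variable nu : V -> V.
Hypothesis hnu : outward_unit_normal (n := n) hyp_metric O nu.
Variable kappa : V -> 'I_n -> R.
Hypothesis hkappa : principal_curvatures hyp_metric (boundary O) nu kappa.
Hypothesis hH : forall p, boundary O p -> n%:R < mean_curvature kappa p.
Variable mu : {measure set (borel_rV R n.+1) -> \bar R}.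
Hypothesis hmu : area_measure (n := n) hyp_metric (boundary O) mu.

Local Notation area_int o := (\int[mu]_(p in boundary O) (dens0 nu kappa o p)%:E)%E.
Local Notation vol_int o := (\int[lebesgue_rV n.+1]_(z in O) (vol_dens o z)%:E)%E.

(* The inequalities for o and its reflection add up to a multiple of the equality for c. *)
Lemma equality_center (c o : V) : (area_int c <= vol_int c)%E -> area_int o = vol_int o.
Proof.
move=> hc; set o' := reflect_pt c o; set k := 2 * coshd c o.
have k0 : 0 <= k by rewrite mulr_ge0// (le_trans _ (coshd_ge1 _ _)).
have mO : measurable (O : set (borel_rV R n.+1)) by exact: measurable_open_rV.
have mS := @measurable_boundary R n O.
have mv q : @measurable_fun _ _ (borel_rV R n.+1) _ O (fun z => (vol_dens q z)%:E).
  apply/measurable_EFinP; apply: measurable_fun_continuous_rV1; first exact: oO.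
  by move=> y _; exact: cont_vol_dens.
have md q : @measurable_fun _ _ (borel_rV R n.+1) _ (boundary O) (fun z => (dens0 nu kappa q z)%:E).
  by apply/measurable_EFinP; exact: measurable_dens0.
have d0 q p : boundary O p -> (0 <= (dens0 nu kappa q p)%:E)%E.
  by move=> Sp; rewrite lee_fin ltW// (dens0_gt0 n0 hnu hH).
have v0 (q p : V) : (0 <= (vol_dens q p)%:E)%E by exact: vol_dens_ge0.
have E1 : (vol_int o + vol_int o' = k%:E * vol_int c)%E.
  rewrite -ge0_integralD; try first [exact: mO|exact: mv|by move=> ? _; exact: v0].
  rewrite -ge0_integralZl; try first [exact: mO|exact: mv|by move=> ? _; exact: v0|by rewrite lee_fin].
  apply: eq_integral => z _; rewrite -EFinD -EFinM; congr (_%:E).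
  by rewrite /vol_dens -mulrDl coshd_reflect mulrA.
have E2 : (area_int o + area_int o' = k%:E * area_int c)%E.
  rewrite -ge0_integralD; try first [exact: mS|exact: md|by move=> ?; exact: d0].
  rewrite -ge0_integralZl; try first [exact: mS|exact: md|by move=> ?; exact: d0|by rewrite lee_fin].
  apply: eq_integral => z _; rewrite -EFinD -EFinM; congr (_%:E).
  by rewrite /dens0 -mulrDl height_reflect mulrA.
have L1 := volume_le0 n0 oO sO bO hnu hkappa hH hmu o.
have L2 := volume_le0 n0 oO sO bO hnu hkappa hH hmu o'.
have L3 : (area_int o + area_int o' <= vol_int o + vol_int o')%E.
  by rewrite E1 E2 lee_wpmul2l// lee_fin.
have F1 := volume_fin oO bO o; have F2 := volume_fin oO bO o'.
have P1 : (0 <= vol_int o)%E by apply: integral_ge0.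
have P2 : (0 <= vol_int o')%E by apply: integral_ge0.
move: L1 L2 L3 F1 F2 P1 P2; move: (vol_int o) (vol_int o') (area_int o) (area_int o').
move=> [a||] [b||] [x||] [y||]//=; rewrite -?EFinD ?lee_fin// => ax by' xy _ _ _ _.
by congr (_%:E); lra.
Qed.

End ball_equality.

(** * Equality and umbilicity *)

Section umbilic_equality.
Context {R : realType} {n : nat}.
Local Notation V := 'rV[R]_n.+1.
Hypothesis n0 : (0 < n)%N.
Variable O : set V.
Hypothesis hO : bounded_domain hyp_metric O.
Hypothesis sO : smooth_boundary O.
Variable nu : V -> V.
Hypothesis hnu : outward_unit_normal (n := n) hyp_metric O nu.
Variable kappa : V -> 'I_n -> R.
Hypothesis hkappa : principal_curvatures hyp_metric (boundary O) nu kappa.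
Hypothesis hH : forall p, boundary O p -> n%:R < mean_curvature kappa p.
Variable mu : {measure set (borel_rV R n.+1) -> \bar R}.
Hypothesis hmu : area_measure (n := n) hyp_metric (boundary O) mu.

Lemma hmean_gt1 p : boundary O p -> 1 < hmean kappa p.
Proof. by move=> /hH h; rewrite ltr_pdivlMr ?ltr0n// mul1r. Qed.

Lemma umbilic_const_ball :
  (forall p, boundary O p -> forall i, kappa p i = hmean kappa p) ->
  (forall k f N c r F, chart (n := n) O k f N c r F -> forall u v : 'rV[R]_n, `|u - c| < r -> `|v - c| < r ->
    hmean kappa (F u) = hmean kappa (F v)) ->
  exists c h, [/\ 1 < h,
    O = [set x | coshd c x < h / Num.sqrt (h ^+ 2 - 1)],
    forall p, boundary O p <-> coshd c p = h / Num.sqrt (h ^+ 2 - 1),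
    forall p, boundary O p -> hmean kappa p = h &
    forall p, boundary O p -> nu p = h *: p - Num.sqrt (h ^+ 2 - 1) *: c].
Proof.
have [[z Oz] oO cO bO] := hO => hk hc.
have [] := @umbilic_ball _ _ n0 O oO sO cO bO nu hnu (hmean kappa) hmean_gt1.
  move=> k f N c r F ch u v Uu Uv; split; first exact: hc ch _ _ Uu Uv.
  have hk' (y : 'rV[R]_n) : `|y - c| < r -> forall i, kappa (F y) i = hmean kappa (F y).
    by move=> Uy; apply: hk; exact: (chart_S oO ch).
  exact: (umbilic_center_cst oO hnu hkappa ch hk' (hc _ _ _ _ _ _ ch) Uu Uv).
move=> c [h [|O0]]; first by exists c, h.
by move: Oz; rewrite O0.
Qed.

(** Constancy of the curvature is drawn from contact and not from the Codazzi argument of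
    [umbilic_hmean_cst], which is confined to [n >= 2]; this treats curves as well. *)
Lemma equality_umbilic o :
  (\int[mu]_(p in boundary O) (dens0 nu kappa o p)%:E = \int[lebesgue_rV n.+1]_(z in O) (vol_dens o z)%:E)%E ->
  umbilic (boundary O) kappa.
Proof.
have [Oz oO cO bO] := hO => hE.
have hk p : boundary O p -> forall i, kappa p i = hmean kappa p.
  by move=> Sp i; exact: (eq_kappa n0 oO sO bO hnu hkappa hH hmu hE).
have [||c [h [h1 _ _ hh _]]] := umbilic_const_ball.
- exact: hk.
- move=> k f N c r F ch u v Uu Uv.
  have hk' (y : 'rV[R]_n) : `|y - c| < r -> forall i, kappa (F y) i = hmean kappa (F y).
    by move=> Uy; apply: hk; exact: (chart_S oO ch).
  apply: (@ball_cst _ _ (fun y => hmean kappa (F y)) c u v r) => // y Uy.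
  have [dh _] := hasD_hmean n0 oO hnu hkappa ch Uy; split=> //.
  (* The derivative of the curvature is nonnegative in every direction and in its opposite, hence
     zero. *)
  have D0 w := contact_hmean_D n0 oO hnu hkappa ch w Uy hk' (fun p Sp => slope_gt0 n0 hH Sp)
    (fun p s Sp s0 sl => eq_contact n0 oO sO bO hnu hkappa hH hmu hE Sp s0 sl).
  apply/eqP; rewrite eq_le D0 andbT -oppr_ge0; have := D0 (- (v - u)).
  by rewrite !(deriveE _ dh) linearN.
split; first by move=> p Sp i j; rewrite !hk.
by move=> _ p q Sp Sq i; rewrite !hk// !hh.
Qed.

(** Local constancy of the curvature is part of the hypothesis for curves and comes from
    [umbilic_hmean_cst] otherwise. Once the domain is a ball about [c], equality is transferred from
    base point [c] to [o]. *)
Lemma umbilic_equality o : umbilic (boundary O) kappa ->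
  (\int[mu]_(p in boundary O) (dens0 nu kappa o p)%:E = \int[lebesgue_rV n.+1]_(z in O) (vol_dens o z)%:E)%E.
Proof.
have [Oz oO cO bO] := hO => -[u1 u2].
have hk p : boundary O p -> forall i, kappa p i = hmean kappa p.
  move=> Sp i; rewrite /hmean /mean_curvature (eq_bigr (fun=> kappa p i)) => [|j _]; last exact: u1.
  by rewrite sumr_const card_ord -[_ *+ n]mulr_natr mulfK// pnatr_eq0 -lt0n.
have [||c [h [h1 hB hS hh hn]]] := umbilic_const_ball.
- exact: hk.
- move=> k f N c r F ch u v Uu Uv; have Su := chart_S oO ch Uu; have Sv := chart_S oO ch Uv.
  have [n1|n1] := leqP n 1.
    have e1 : n = 1%N by apply/eqP; rewrite eqn_leq n1.
    by rewrite -(hk _ Su (Ordinal n0)) -(hk _ Sv (Ordinal n0)); exact: u2.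
  have hk' (y : 'rV[R]_n) : `|y - c| < r -> forall i, kappa (F y) i = hmean kappa (F y).
    by move=> Uy; apply: hk; exact: (chart_S oO ch).
  exact: (umbilic_hmean_cst oO hnu hkappa ch n1 hk' Uu Uv).
apply: (equality_center n0 oO sO bO hnu hkappa hH hmu (c := c)).
apply: (ball_area_le n0 oO sO bO hnu hkappa hH hmu h1 hB hS) => //.
by move=> p i Sp; rewrite hk// hh.
Qed.

End umbilic_equality.

Theorem theorem1p1 (R : realType) (n : nat) (hn : (1 <= n)%N)
    (Omega : set 'rV[R]_n.+1)
    (hOmega : bounded_domain hyp_metric Omega)
    (hsmooth : smooth_boundary Omega)
    (nu : 'rV[R]_n.+1 -> 'rV[R]_n.+1)
    (hnu : outward_unit_normal (n := n) hyp_metric Omega nu)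
    (kappa : 'rV[R]_n.+1 -> 'I_n -> R)
    (hkappa : principal_curvatures hyp_metric (boundary Omega) nu kappa)
    (mu : {measure set (borel_rV R n.+1) -> \bar R})
    (hmu : area_measure (n := n) hyp_metric (boundary Omega) mu)
    (o : 'rV[R]_n.+1)
    (hH : forall p, boundary Omega p ->
       n%:R < mean_curvature kappa p) :
  let Sigma := boundary Omega in
  let V := cosh_dist o in
  let V_nu p := inner hyp_metric p (gradient hyp_metric V p) (nu p) in
  let lhs := (\int[mu]_(p in Sigma)
     ((V p - V_nu p) / (mean_curvature kappa p - n%:R))%:E)%E in
  let rhs := ((n.+1%:R / n%:R)%:E *
     \int[lebesgue_rV n.+1]_(x in Omega)
       (V x * vol_density hyp_metric x)%:E)%E in
  (rhs <= lhs)%E /\ (lhs = rhs <-> umbilic Sigma kappa).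
Proof.
have [Oz oO cO bO] := hOmega.
move=> Sigma V V_nu lhs rhs.
pose I := (\int[lebesgue_rV n.+1]_(z in Omega) (vol_dens o z)%:E)%E.
pose J := (\int[mu]_(p in Sigma) (dens0 nu kappa o p)%:E)%E.
pose K : R := n.+1%:R / n%:R.
have nn : n%:R != 0 :> R by rewrite pnatr_eq0 -lt0n.
have K0 : 0 < K by rewrite divr_gt0 ?ltr0n.
have rhsE : rhs = (K%:E * I)%E.
  congr (_ * _)%E; apply: eq_integral => x _.
  by rewrite /V cosh_distE vol_density_hyp.
have lhsE : lhs = (K%:E * J)%E.
  rewrite /J -ge0_integralZl; last 4 first.
  - exact: measurable_boundary.
  - by apply/measurable_EFinP; exact: measurable_dens0.
  - by move=> p Sp; rewrite lee_fin ltW// (dens0_gt0 hn hnu hH).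
  - by rewrite lee_fin ltW.
  apply: eq_integral => p /set_mem Sp; rewrite -EFinM; congr (_%:E).
  rewrite /V_nu /V normal_derivative_coshd cosh_distE -/(tcomp p (nu p)) -/(height o nu p).
  have := hH p Sp; rewrite /dens0 /slope /K -subr_gt0 => d0.
  have N1 : n.+1%:R != 0 :> R by rewrite pnatr_eq0.
  have -> : mean_curvature kappa p / n%:R - 1 = (mean_curvature kappa p - n%:R) / n%:R by field.
  move: d0 nn N1; move: (mean_curvature kappa p) (height o nu p) (n.+1%:R : R) (n%:R : R).
  by move=> d a N m d0 m0 N1; field; rewrite N1 m0 gt_eqF.
have IJ : (I <= J)%E by exact: volume_le0.
have K0E : (0 < K%:E)%E by rewrite lte_fin.
rewrite lhsE rhsE; split; first by rewrite lee_pmul2l.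
have eqE : (K%:E * J = K%:E * I)%E <-> J = I.
  split=> [e|->//]; apply/eqP; rewrite eq_le IJ andbT.
  by rewrite -(@lee_pmul2l _ K%:E)// e lexx.
rewrite eqE; split; first exact: equality_umbilic.
by move=> hu; exact: umbilic_equality.
Qed.
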